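(* There exists an embedding $A$ of the trefoil arc in $\mathbb{R}^3_+$ that admits a semi-pearl necklace satisfying all the requirements of the definition of a pearl-necklace, i.e. giving rise to a pearl-necklace $Spin(T)$ subordinate to $Spin(A)$.
   Context: A trefoil arc is an arc in $\mathbb{R}^3_+$ such that joining its end-points by an unknotted segment yields the trefoil knot. Spinning. Let $\mathbb{R}^3_+=\{(x_1,x_2,x_3,0):x_3\ge 0\}\subset\mathbb{R}^4$, $\mathbb{R}^2=\{(x_1,x_2,0,0)\}$ and $\mathbb{S}^4=\mathbb{R}^4\cup\{\infty\}$. $R_\theta$ denotes the rotation of $\mathbb{R}^4$ by angle $\theta$ in the $(x_3,x_4)$-coordinates, fixing $\mathbb{R}^2$ pointwise. For $X\subset\mathbb{R}^3_+$, $Spin(X)=\{R_\theta(x):x\in X,\ 0\le\theta\le 2\pi\}$. Arcs $A\subset\mathbb{R}^3_+$ are embedded arcs with two distinct end-points in $\mathbb{R}^2$ and interior in $\mathbb{R}^3_+\setminus\mathbb{R}^2$. $A$ is spinnable if it is smooth at every point and has contact of infinite order with the normal direction (to $\mathbb{R}^2$) at its end-points. Then $Spin(A)$ is a $2$-sphere in $\mathbb{S}^4$; its poles are the two end-points of $A$. $A$ is knotted if the knot obtained by joining its end-points by an unknotted segment is non-trivial. Semi-pearl necklaces. Two round spheres are orthogonal if the square of the distance between their centers is the sum of the squares of their radii; two round balls are orthogonal if their boundary spheres are. A semi-pearl solid necklace subordinate to $A$ is a collection of consecutive closed round $4$-balls $B^1,\ldots,B^n$ such that: the end-points of $A$ are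 the centers of $B^1$ and $B^n$ respectively; $A\subset\bigcup_i B^i$; two consecutive balls are orthogonal, and non-consecutive balls are disjoint; the segment of $A$ in the interior of each ball is unknotted. The boundary $3$-spheres are called pearls, and their collection is a semi-pearl necklace subordinate to $A$. Pearl-necklaces. Let $A$ be a spinnable knotted arc. A pearl-necklace $Spin(T)$ subordinate to $Spin(A)$ is a finite collection of round $3$-spheres (pearls) consisting of the $\Sigma^k_i$, $\Sigma_m$ and $P^k_i$ below: (1) There is a semi-pearl necklace $\overline T$ subordinate to $A$ consisting of pearls $\Sigma^0,\Sigma^1,\ldots,\Sigma^{l+1}$; put $T=\{\Sigma^1,\ldots,\Sigma^l\}$. For $i=1,\ldots,6$ put $A_i=R_{2\pi i/6}(A)$, $T_i=R_{2\pi i/6}(T)$, $\Sigma^k_i=R_{2\pi i/6}(\Sigma^k)$ (index $i$ modulo $6$). It is required that $\Sigma^k_i$ is orthogonal to $\Sigma^k_{i+1}$ for all $k,i$. (2) At each pole of $Spin(A)$ there is a pearl $\Sigma_m$, $m=1,2$, with $\Sigma_1$ orthogonal to $\Sigma^1_i$ and $\Sigma_2$ orthogonal to $\Sigma^l_i$ for $i=1,\ldots,6$, such that $\Sigma_1\cap\Sigma^1_i\cap\Sigma^1_{i+1}\ne\emptyset$ and $\Sigma_2\cap\Sigma^l_i\cap\Sigma^l_{i+1}\neq\emptyset$ for all $i\in\mathbb{Z}/6\mathbb{Z}$. (3) At each intersection point of the four pearls $\Sigma^k_i,\Sigma^{k+1}_i,\Sigma^k_{i+1},\Sigma^{k+1}_{i+1}$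 (their intersection is a single point) there is a pearl $P^k_i$ orthogonal to these four pearls and not intersecting any other pearl, i.e. disjoint from the other $\Sigma^r_s$ and from $\Sigma_1,\Sigma_2$. (4) If $B^k_i$ is the closed round $4$-ball bounded by $\Sigma^k_i$, then $B^k_i\cap Spin(A)$ is an unknotted disk. *)

(* Defs.v *)
From HB Require Import structures.
From mathcomp Require Import all_boot all_order all_algebra.
From mathcomp Require Import all_classical all_reals all_analysis.
From mathcomp Require Import ring.

Set Implicit Arguments.
Unset Strict Implicit.
Unset Printing Implicit Defensive.

Import Order.TTheory GRing.Theory Num.Theory numFieldNormedType.Exports.

Local Open Scope classical_set_scope.
Local Open Scope ring_scope.

(* R^n is 'rV[R]_n; the coordinates x_1, ..., x_4 are x 0 0, ..., x 0 3.
   The library norm on 'rV[R]_n is the sup norm, which has the right topology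
   but the wrong round spheres, so the Euclidean distance is defined here. *)

Section Euclidean.
Variables (R : realType) (n : nat).
Implicit Types x y : 'rV[R]_n.

Definition sqdist x y : R := \sum_(i < n) (x 0 i - y 0 i) ^+ 2.

Definition edist x y : R := Num.sqrt (sqdist x y).

Definition unit_ball : set 'rV[R]_n := [set x | sqdist x 0 <= 1].

Definition flat_disk (k : nat) : set 'rV[R]_n :=
  [set x | unit_ball x /\ forall i : 'I_n, (k <= i)%N -> x 0 i = 0].

End Euclidean.

Definition pair_homeo (U V : topologicalType)
    (X A : set U) (Y B : set V) : Prop :=
  exists (f : U -> V) (g : V -> U),
    [/\ {within X, continuous f}, {within Y, continuous g},
        f @` X = Y, forall x, X x -> g (f x) = x & f @` A = B].

(* (X, D) is a trivial ball pair, homeomorphic to (D^n, D^k). *)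
Definition unknotted_in (R : realType) (U : topologicalType) (n k : nat)
    (X D : set U) : Prop :=
  pair_homeo X D (@unit_ball R n) (@flat_disk R n k).

Section Spinning.
Variable R : realType.
Local Notation E4 := 'rV[R]_4.
Implicit Types (A X K : set E4) (a b p x : E4) (t : R).

Definition space3 : set E4 := [set x | x 0 3 = 0].
Definition half_space3 : set E4 := [set x | 0 <= x 0 2 /\ x 0 3 = 0].
Definition plane2 : set E4 := [set x | x 0 2 = 0 /\ x 0 3 = 0].

Definition rot t x : E4 :=
  \row_(j < 4) [:: x 0 0; x 0 1;
                   cos t * x 0 2 - sin t * x 0 3;
                   sin t * x 0 2 + cos t * x 0 3]`_j.

Definition spin X : set E4 :=
  [set y | exists t x, [/\ 0 <= t <= 2 * pi, X x & y = rot t x]].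

Definition half_space_arc A a b : Prop :=
  (exists g : R -> E4,
     [/\ {within `[0, 1], continuous g}, {in `[0, 1] &, injective g},
         g @` `[0, 1] = A, g 0 = a & g 1 = b]) /\
  [/\ plane2 a, plane2 b, a <> b, A `<=` half_space3 &
      A `&` plane2 = [set a; b]].

(* Smoothness up to the end-points is expressed by asking that the
   parametrization be the restriction of a smooth curve defined on R. *)
Definition smooth_arc A a b : Prop :=
  exists g : R -> E4,
    [/\ forall n t, derivable (derive1n n g) t 1,
        forall t, t \in `[0, 1] -> derive1 g t != 0,
        {in `[0, 1] &, injective g},
        g @` `[0, 1] = A & g 0 = a /\ g 1 = b].

Definition normal_line p : set E4 :=
  [set p + s *: delta_mx 0 2 | s in [set: R]].

Definition infinite_contact A p : Prop :=
  forall n : nat, \forall x \near within A (nbhs p),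
    exists2 y, normal_line p y & edist x y <= edist x p ^+ n.

Definition spinnable A a b : Prop :=
  [/\ smooth_arc A a b, infinite_contact A a & infinite_contact A b].

Definition segment a b : set E4 := [set a + t *: (b - a) | t in `[0, 1]].

(* The interior of the arc lies off plane2, so the straight segment of plane2
   meets the arc only at its end-points, and it is unknotted. *)
Definition closed_up A a b : set E4 := A `|` segment a b.

Definition round_circle : set 'rV[R]_3 :=
  [set \row_(j < 3) [:: cos t; sin t; 0]`_j | t in `[0, 2 * pi]].

Definition standard_trefoil : set 'rV[R]_3 :=
  [set \row_(j < 3) [:: (2 + cos (3 * t)) * cos (2 * t);
                        (2 + cos (3 * t)) * sin (2 * t);
                        sin (3 * t)]`_j | t in `[0, 2 * pi]].

(* Knots are taken up to homeomorphism of R^3; in particular the left-handed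
   and the right-handed trefoils are not distinguished. *)
Definition has_knot_type K (K0 : set 'rV[R]_3) : Prop :=
  pair_homeo space3 K [set: 'rV[R]_3] K0.

Definition knotted A a b : Prop :=
  ~ has_knot_type (closed_up A a b) round_circle.

Definition trefoil_arc A a b : Prop :=
  half_space_arc A a b /\ has_knot_type (closed_up A a b) standard_trefoil.

(* The same datum describes a closed round 4-ball and its boundary sphere. *)
Record round := Round {
  center : E4;
  radius : R;
  radius_gt0 : 0 < radius }.

Definition rball (B : round) : set E4 :=
  [set x | sqdist x (center B) <= radius B ^+ 2].

Definition rsphere (B : round) : set E4 :=
  [set x | sqdist x (center B) = radius B ^+ 2].

Definition orthogonal (B C : round) : Prop :=
  sqdist (center B) (center C) = radius B ^+ 2 + radius C ^+ 2.

Definition rot_round t (B : round) : round :=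
  Round (rot t (center B)) (radius_gt0 B).

(* The balls are B 0, ..., B n; the values of B beyond n are irrelevant.
   Every smooth arc is unknotted in a 4-ball, so unknottedness is understood in
   R^3_+, where A lives.  The convex set rball (B i) `&` half_space3 is a half
   ball for the two extreme balls, and the segment then joins its centre to
   its round part. *)
Record semi_pearl_necklace A a b (n : nat) (B : nat -> round) : Prop := {
  spn_first : center (B 0%N) = a;
  spn_last : center (B n) = b;
  spn_cover : A `<=` \bigcup_(i in [set i | (i <= n)%N]) rball (B i);
  spn_orthogonal : forall i, (i < n)%N -> orthogonal (B i) (B i.+1);
  spn_disjoint : forall i j, (i.+1 < j)%N -> (j <= n)%N ->
    rball (B i) `&` rball (B j) = set0;
  spn_unknotted : forall i, (i <= n)%N ->
    unknotted_in R 3 1 (rball (B i) `&` half_space3)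
                       (closure (A `&` interior (rball (B i)))) }.

Definition angle6 (i : 'Z_6) : R := 2 * pi * (i : nat)%:R / 6%:R.

(* S 0, ..., S l.+1 are the pearls of the semi-pearl necklace, S1 and S2 the
   pearls at the two poles a and b, and P k i the pearl at the intersection
   point of the four pearls of indices k, k+1 and i, i+1.  An element i of
   'Z_6 has representative 0, ..., 5, and i + 1 is taken modulo 6.
   S1 and S2 are centred at the poles, whereas P k i passes through its
   intersection point p: a sphere centred at p is orthogonal to no sphere
   containing p. *)
Record pearl_necklace A a b (l : nat) (S : nat -> round) (S1 S2 : round)
    (P : nat -> 'Z_6 -> round) : Prop := {
  pn_arc : half_space_arc A a b;
  pn_spinnable : spinnable A a b;
  pn_knotted : knotted A a b;
  pn_l_gt0 : (0 < l)%N;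
  pn_semi : semi_pearl_necklace A a b l.+1 S;
  pn_orthogonal : forall k (i : 'Z_6), (1 <= k <= l)%N ->
    orthogonal (rot_round (angle6 i) (S k)) (rot_round (angle6 (i + 1)) (S k));
  pn_pole1 : center S1 = a;
  pn_pole2 : center S2 = b;
  pn_pole1_orthogonal : forall i : 'Z_6,
    orthogonal S1 (rot_round (angle6 i) (S 1%N));
  pn_pole2_orthogonal : forall i : 'Z_6,
    orthogonal S2 (rot_round (angle6 i) (S l));
  pn_pole1_meet : forall i : 'Z_6,
    rsphere S1 `&` rsphere (rot_round (angle6 i) (S 1%N))
      `&` rsphere (rot_round (angle6 (i + 1)) (S 1%N)) !=set0;
  pn_pole2_meet : forall i : 'Z_6,
    rsphere S2 `&` rsphere (rot_round (angle6 i) (S l))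
      `&` rsphere (rot_round (angle6 (i + 1)) (S l)) !=set0;
  pn_corner : forall k (i : 'Z_6), (1 <= k < l)%N ->
    exists2 p,
      rsphere (rot_round (angle6 i) (S k))
        `&` rsphere (rot_round (angle6 i) (S k.+1))
        `&` rsphere (rot_round (angle6 (i + 1)) (S k))
        `&` rsphere (rot_round (angle6 (i + 1)) (S k.+1)) = [set p]
      & rsphere (P k i) p;
  pn_corner_orthogonal : forall k (i : 'Z_6), (1 <= k < l)%N ->
    forall r (s : 'Z_6), r = k \/ r = k.+1 -> s = i \/ s = i + 1 ->
    orthogonal (P k i) (rot_round (angle6 s) (S r));
  pn_corner_disjoint : forall k (i : 'Z_6), (1 <= k < l)%N ->
    forall r (s : 'Z_6), (1 <= r <= l)%N ->
    ~ ((r = k \/ r = k.+1) /\ (s = i \/ s = i + 1)) ->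
    rsphere (P k i) `&` rsphere (rot_round (angle6 s) (S r)) = set0;
  pn_corner_disjoint_poles : forall k (i : 'Z_6), (1 <= k < l)%N ->
    rsphere (P k i) `&` rsphere S1 = set0 /\
    rsphere (P k i) `&` rsphere S2 = set0;
  pn_unknotted : forall k (i : 'Z_6), (1 <= k <= l)%N ->
    unknotted_in R 4 2 (rball (rot_round (angle6 i) (S k)))
                       (rball (rot_round (angle6 i) (S k)) `&` spin A) }.

Lemma sqdist_rot t x y : sqdist (rot t x) (rot t y) = sqdist x y.
Proof.
rewrite /sqdist !big_ord_recl !big_ord0 !mxE /=.
have -> : lift ord0 ord0 = 1 :> 'I_4 by apply/val_inj.
have -> : lift ord0 (lift ord0 ord0) = 2 :> 'I_4 by apply/val_inj.
have -> : lift ord0 (lift ord0 (lift ord0 ord0)) = 3 :> 'I_4 by apply/val_inj.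
have -> : ord0 = 0 :> 'I_4 by apply/val_inj.
have h : cos t ^+ 2 = 1 - sin t ^+ 2 by rewrite -(cos2Dsin2 t) addrK.
congr (_ + (_ + _)); rewrite !addr0; ring: h.
Qed.

Lemma rotK t : cancel (rot t) (rot (- t)).
Proof.
have h : cos t ^+ 2 = 1 - sin t ^+ 2 by rewrite -(cos2Dsin2 t) addrK.
move=> x; apply/rowP => j; rewrite mxE cosN sinN.
have -> : rot t x 0 0 = x 0 0 by rewrite mxE.
have -> : rot t x 0 1 = x 0 1 by rewrite mxE.
have -> : rot t x 0 2 = cos t * x 0 2 - sin t * x 0 3 by rewrite mxE.
have -> : rot t x 0 3 = sin t * x 0 2 + cos t * x 0 3 by rewrite mxE.
have u2 u v : cos t * (cos t * u - sin t * v) -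
    - sin t * (sin t * u + cos t * v) = u by ring: h.
have u3 u v : - sin t * (cos t * u - sin t * v) +
    cos t * (sin t * u + cos t * v) = v by ring: h.
rewrite u2 u3; case: j => -[|[|[|[|//]]]] ? /=; congr (x _ _); exact/val_inj.
Qed.

Lemma rsphere_rot t B : rsphere (rot_round t B) = rot t @` rsphere B.
Proof.
apply/seteqP; split => [x /= xB|_ [x xB <-]]; last first.
  by rewrite /rsphere /= sqdist_rot.
have xE : rot t (rot (- t) x) = x by rewrite -{1}[t]opprK rotK.
by exists (rot (- t) x); rewrite // /rsphere /= -(sqdist_rot t) xE.
Qed.

Lemma rball_rot t B : rball (rot_round t B) = rot t @` rball B.
Proof.
apply/seteqP; split => [x /= xB|_ [x xB <-]]; last first.
  by rewrite /rball /= sqdist_rot.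
have xE : rot t (rot (- t) x) = x by rewrite -{1}[t]opprK rotK.
by exists (rot (- t) x); rewrite // /rball /= -(sqdist_rot t) xE.
Qed.

End Spinning.

(* Main.v *)
From Pilot Require Import Defs.
From Stdlib Require Import ZArith.
From HB Require Import structures.
From mathcomp Require Import all_boot all_order all_algebra.
From mathcomp Require Import all_classical all_reals all_analysis.
From mathcomp Require Import ring lra complex ssrZ.
Import Pilot.Defs.

(** The bead centres form an explicit chain (x_k, y_k, h_k, 0) of integer points
    and the bead around the k-th one has radius h_k / sqrt 2, which is what makes
    it orthogonal to its image under a rotation by pi/3; its foot-points are the
    vertical projections of the extreme centres.  The arc is the polygon through
    the centres with its corners smoothed by a flat ramp, and a homeomorphism
    moving points only near the centres straightens it, so in each bead it
    becomes a pair of radii.  A ball homeomorphism preserving distances to the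
    centre turns these radii into a diameter; rotating, the 4-ball fibres in
    segments over the 3-ball, which trivializes the disk.  The half-space at
    angle pi/6 between two rotated copies cuts consecutive beads in externally
    tangent balls of radii h_k / 2 and h_(k+1) / 2: their point of contact is the
    corner, and a small sphere through it with horizontal tangent diameter is the
    pearl P.

    The closed polygon consists of two strands, each meeting every half-plane
    bounded by an axis once, as do two strands of the standard trefoil with the
    same crossings; interpolating half-plane by half-plane gives a homeomorphism.
    The trefoil is knotted because a continuous family of cubics
    X^3 - 3 Z X + 2 W has distinct roots exactly off it and non-abelian
    monodromy, whereas over the complement of a round circle every such family
    has a continuous root or a continuous square root of its discriminant. *)

Set Implicit Arguments.
Unset Strict Implicit.
Unset Printing Implicit Defensive.

Import Order.TTheory GRing.Theory Num.Theory numFieldNormedType.Exports.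

Local Open Scope classical_set_scope.
Local Open Scope ring_scope.
Delimit Scope Z_scope with Zb.

(** * Limits *)

(** A centre at height h is at distance h from its image under a turn by pi/3, so orthogonality
    forces 2 r^2 = h^2: a bead is as large as it is high, and a strand that bridges another one must
    climb. For consecutive beads at distance d, orthogonality reads 2 d^2 = h^2 + h'^2. It has
    integer solutions: horizontal steps of length 55 between heights 55 and 55, of length 65 between
    55 and 135, of length 135 between 135 and 405; oblique steps split these lengths by the 3-4-5
    triangle. A bead of height 405 stays above height 118, one of height 55 below 94. Two crossings
    are such bridges; at the third the closing segment, in the bounding plane, runs under the arc.
    As the data are integral, the metric conditions and the crossing pattern are decided by
    computation. Smoothness forces the corners to be rounded; this is done within distance 2 of the
    centres, deep inside the beads, so that no incidence between arc and beads changes. The family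
    of cubics stands for the homomorphism of the trefoil group onto the symmetric group on three
    letters, made explicit through root functions. *)

Section Basics.
Variable R : realType.

Lemma cvg_row (T : Type) (F : set_system T) {FF : Filter F} n
    (f : T -> 'rV[R]_n) (l : 'rV[R]_n) :
  (forall i, (fun t => f t 0 i) @ F --> l 0 i) -> f @ F --> l.
Proof.
move=> fl A [P nP PA].
have h i : \forall t \near F, P 0 i (f t 0 i) by apply: fl; exact: nP.
have {}h := filter_forall _ h.
rewrite /nbhs /=; apply: (filterS _ (h FF)) => t Pt; apply: PA => i j.
by rewrite (ord1 i); exact: Pt.
Qed.

Lemma ctsI (T U : topologicalType) (f : T -> U) :
  (forall p : T, f @ nbhs p --> f p) -> continuous f.
Proof. by []. Qed.

Lemma ctsI_at (T U : topologicalType) (f : T -> U) (p : T) :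
  (f @ nbhs p --> f p) -> {for p, continuous f}.
Proof. by []. Qed.

Lemma tends_id n (p : 'rV[R]_n) (i : 'I_n) :
  (fun q : 'rV[R]_n => q 0 i) @ nbhs p --> p 0 i.
Proof. exact: coord_continuous. Qed.

Section LimitRules.
Context (T : Type) (F : set_system T) {FF : Filter F}.
Implicit Types (f g : T -> R) (a b : R).

Lemma tendsD f g a b : f @ F --> a -> g @ F --> b ->
  (fun t => f t + g t) @ F --> a + b.
Proof. exact: cvgD. Qed.

Lemma tendsN f a : f @ F --> a -> (fun t => - f t) @ F --> - a.
Proof. exact: cvgN. Qed.

Lemma tendsB f g a b : f @ F --> a -> g @ F --> b ->
  (fun t => f t - g t) @ F --> a - b.
Proof. exact: cvgB. Qed.

Lemma tendsM f g a b : f @ F --> a -> g @ F --> b ->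
  (fun t => f t * g t) @ F --> a * b.
Proof. exact: cvgM. Qed.

Lemma tendsX f a n : f @ F --> a -> (fun t => f t ^+ n) @ F --> a ^+ n.
Proof.
move=> fa; elim: n => [|n IH].
  by rewrite (_ : (fun _ => _) = cst 1); [exact: cvg_cst|apply/funext].
under eq_fun do rewrite exprS.
by rewrite exprS; exact: tendsM.
Qed.

Lemma tendsV f a : a != 0 -> f @ F --> a -> (fun t => (f t)^-1) @ F --> a^-1.
Proof. by move=> a0 fa; apply: cvgV. Qed.

Lemma tendsdiv f g a b : b != 0 -> f @ F --> a -> g @ F --> b ->
  (fun t => f t / g t) @ F --> a / b.
Proof. by move=> b0 fa gb; apply: tendsM => //; exact: tendsV. Qed.

Lemma tendsnorm f a : f @ F --> a -> (fun t => `|f t|) @ F --> `|a|.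
Proof. exact: cvg_norm. Qed.

Lemma tends_comp (h : R -> R) f a : {for a, continuous h} ->
  f @ F --> a -> (fun t => h (f t)) @ F --> h a.
Proof. by move=> hc fa; exact: (cvg_comp _ _ fa hc). Qed.

Lemma tendssqrt f a : f @ F --> a -> (fun t => Num.sqrt (f t)) @ F --> Num.sqrt a.
Proof. exact/tends_comp/sqrt_continuous. Qed.

Lemma tendscos f a : f @ F --> a -> (fun t => cos (f t)) @ F --> cos a.
Proof. exact/tends_comp/continuous_cos. Qed.

Lemma tendssin f a : f @ F --> a -> (fun t => sin (f t)) @ F --> sin a.
Proof. exact/tends_comp/continuous_sin. Qed.

Lemma maxE_norm (x y : R) : Num.max x y = (x + y + `|x - y|) / 2.
Proof.
by case: (lerP x y) => xy; lra.
Qed.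

Lemma minE_norm (x y : R) : Num.min x y = (x + y - `|x - y|) / 2.
Proof.
by case: (lerP x y) => xy; lra.
Qed.

Lemma tendsmax f g a b : f @ F --> a -> g @ F --> b ->
  (fun t => Num.max (f t) (g t)) @ F --> Num.max a b.
Proof.
move=> fa gb; under eq_fun do rewrite maxE_norm.
rewrite maxE_norm; apply: tendsM; last exact: cvg_cst.
by apply: tendsD; [exact: tendsD|apply: tendsnorm; exact: tendsB].
Qed.

Lemma tendsmin f g a b : f @ F --> a -> g @ F --> b ->
  (fun t => Num.min (f t) (g t)) @ F --> Num.min a b.
Proof.
move=> fa gb; under eq_fun do rewrite minE_norm.
rewrite minE_norm; apply: tendsM; last exact: cvg_cst.
by apply: tendsB; [exact: tendsD|apply: tendsnorm; exact: tendsB].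
Qed.

Lemma tendssum (I : Type) (r : seq I) (P : pred I) (f : I -> T -> R) (a : I -> R) :
  (forall i, f i @ F --> a i) ->
  (fun t => \sum_(i <- r | P i) f i t) @ F --> \sum_(i <- r | P i) a i.
Proof.
move=> fa; elim: r => [|i r IH].
  under eq_fun do rewrite big_nil.
  by rewrite big_nil; exact: cvg_cst.
under eq_fun do rewrite big_cons.
by rewrite big_cons; case: (P i) => //; exact: tendsD.
Qed.

Lemma tendscoord n (f : T -> 'rV[R]_n) (a : 'rV[R]_n) i : f @ F --> a ->
  (fun t => f t 0 i) @ F --> a 0 i.
Proof. by move=> fa; exact: (cvg_comp _ _ fa (@coord_continuous _ _ _ 0 i a)). Qed.

End LimitRules.

(** A property that is locally stable on [A], and whose negation is too, cuts out a relatively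
    clopen part of [A]. *)
Lemma connected_ind (T : topologicalType) (A B : set T) : connected A ->
  (exists2 p, A p & B p) ->
  (forall p, A p -> B p -> \forall q \near p, A q -> B q) ->
  (forall p, A p -> ~ B p -> \forall q \near p, A q -> ~ B q) ->
  A `<=` B.
Proof.
move=> Aco [p0 Ap0 Bp0] oB cB.
suff -> : A = A `&` B by move=> ? [].
apply/esym/Aco; first by exists p0.
- exists (interior [set q | A q -> B q]); first exact: open_interior.
  apply/seteqP; split => [q [Aq Bq]|q [Aq /interior_subset]]; last first.
    by move=> Bq; split => //; exact: Bq.
  by split => //; exact: oB.
- exists (~` interior [set q | A q -> ~ B q]).
    exact/open_closedC/open_interior.
  apply/seteqP; split => [q [Aq Bq]|q [Aq nBq]].
    by split => // /interior_subset /(_ Aq).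
  by split => //; apply: contrapT => Bq; apply: nBq; exact: cB.
Qed.

End Basics.

(** Limit goals are decomposed along the syntax of the function. The last patterns catch eta-reduced
    functions such as [GRing.mul c]. An inverse leaves the goal that its limit is non-zero, closed
    by [assumption]. *)
Ltac tends_step :=
  first [ assumption |
  lazymatch goal with
  | |- cvg_to (nbhs (fmap (fun _ => ?c) _)) _ => exact: cvg_cst
  | |- cvg_to (nbhs (fmap (fun t => (@?f t + @?g t)%R) _)) _ => apply: tendsD
  | |- cvg_to (nbhs (fmap (fun t => (- @?f t)%R) _)) _ => apply: tendsN
  | |- cvg_to (nbhs (fmap (fun t => (@?f t * @?g t)%R) _)) _ => apply: tendsM
  | |- cvg_to (nbhs (fmap (fun t => (@?f t ^+ _)%R) _)) _ => apply: tendsX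
  | |- cvg_to (nbhs (fmap (fun t => ((@?f t)^-1)%R) _)) _ => apply: tendsV
  | |- cvg_to (nbhs (fmap (fun t => `|@?f t|%R) _)) _ => apply: tendsnorm
  | |- cvg_to (nbhs (fmap (fun t => Num.max (@?f t) (@?g t)) _)) _ => apply: tendsmax
  | |- cvg_to (nbhs (fmap (fun t => Num.min (@?f t) (@?g t)) _)) _ => apply: tendsmin
  | |- cvg_to (nbhs (fmap (fun t => Num.sqrt (@?f t)) _)) _ => apply: tendssqrt
  | |- cvg_to (nbhs (fmap (fun t => cos (@?f t)) _)) _ => apply: tendscos
  | |- cvg_to (nbhs (fmap (fun t => sin (@?f t)) _)) _ => apply: tendssin
  | |- cvg_to (nbhs (fmap (fun t => fun_of_matrix t _ _) _)) _ => apply: tends_id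
  | |- cvg_to (nbhs (fmap (fun t => fun_of_matrix (@?f t) _ _) _)) _ => apply: tendscoord
  | |- cvg_to (nbhs (fmap (fun t => t) _)) _ => exact: cvg_id
  | |- cvg_to (nbhs (fmap (GRing.mul ?c) _)) _ => apply: (@tendsM _ _ _ _ (fun=> c) (fun t => t))
  | |- cvg_to (nbhs (fmap (GRing.add ?c) _)) _ => apply: (@tendsD _ _ _ _ (fun=> c) (fun t => t))
  | |- cvg_to (nbhs (fmap cos _)) _ => exact: continuous_cos
  | |- cvg_to (nbhs (fmap sin _)) _ => exact: continuous_sin
  end ].
Ltac tends := repeat tends_step.

(** * The trefoil is knotted *)

Section Cubic.
Variable R : realType.
Local Notation C := R[i].
Local Notation Re := complex.Re.
Local Notation Im := complex.Im.

(** Squared modulus, kept real valued so that all estimates take place in [R]. *)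
Definition sqn (z : C) : R := Re z ^+ 2 + Im z ^+ 2.

Lemma ReM (x y : C) : Re (x * y) = Re x * Re y - Im x * Im y.
Proof. by case: x => a b; case: y. Qed.

Lemma ImM (x y : C) : Im (x * y) = Re x * Im y + Im x * Re y.
Proof. by case: x => a b; case: y. Qed.

Lemma ReD (x y : C) : Re (x + y) = Re x + Re y.
Proof. by case: x => a b; case: y. Qed.

Lemma ImD (x y : C) : Im (x + y) = Im x + Im y.
Proof. by case: x => a b; case: y. Qed.

Lemma ReN (x : C) : Re (- x) = - Re x.
Proof. by case: x. Qed.

Lemma ImN (x : C) : Im (- x) = - Im x.
Proof. by case: x. Qed.

Lemma complex_ext (x y : C) : Re x = Re y -> Im x = Im y -> x = y.
Proof. by case: x => a b; case: y => c d /= -> ->. Qed.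

Lemma sqn_ge0 z : 0 <= sqn z.
Proof. by rewrite addr_ge0 ?sqr_ge0. Qed.

Lemma sqn_eq0 z : (sqn z == 0) = (z == 0).
Proof.
rewrite /sqn paddr_eq0 ?sqr_ge0// !sqrf_eq0.
by case: z => a b; rewrite eq_complex.
Qed.

Lemma sqn_gt0 z : (0 < sqn z) = (z != 0).
Proof. by rewrite lt_def sqn_ge0 andbT sqn_eq0. Qed.

Lemma sqnM x y : sqn (x * y) = sqn x * sqn y.
Proof. by rewrite /sqn ReM ImM; ring. Qed.

Lemma sqnN x : sqn (- x) = sqn x.
Proof. by rewrite /sqn ReN ImN; ring. Qed.

(** A triangle inequality for squared distances: the defect is the squared modulus of x - 2 y +
    z. *)
Lemma sqnB_le x y z : sqn (x - z) <= 2 * sqn (x - y) + 2 * sqn (y - z).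
Proof.
rewrite /sqn !ReD !ImD !ReN !ImN.
have := sqr_ge0 (Re x - 2 * Re y + Re z).
have := sqr_ge0 (Im x - 2 * Im y + Im z).
nra.
Qed.

(** Complex limits are taken coordinatewise, so that only the topology of [R] enters. *)
Definition climit (T : Type) (f : T -> C) (F : set_system T) (a : C) :=
  (fun t => Re (f t)) @ F --> Re a /\ (fun t => Im (f t)) @ F --> Im a.

Section ClimitRules.
Context (T : Type) (F : set_system T) {FF : Filter F}.
Implicit Types (f g : T -> C) (a b : C).

Lemma climit_cst a : climit (fun=> a) F a.
Proof. by split; exact: cvg_cst. Qed.

Lemma climitD f g a b : climit f F a -> climit g F b ->
  climit (fun t => f t + g t) F (a + b).
Proof.
move=> [fr fi] [gr gi]; split.
  by rewrite ReD (funext (fun t => ReD (f t) (g t))); exact: tendsD.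
by rewrite ImD (funext (fun t => ImD (f t) (g t))); exact: tendsD.
Qed.

Lemma climitN f a : climit f F a -> climit (fun t => - f t) F (- a).
Proof.
move=> [fr fi]; split.
  by rewrite ReN (funext (fun t => ReN (f t))); exact: tendsN.
by rewrite ImN (funext (fun t => ImN (f t))); exact: tendsN.
Qed.

Lemma climitB f g a b : climit f F a -> climit g F b ->
  climit (fun t => f t - g t) F (a - b).
Proof. by move=> fa gb; apply: climitD => //; exact: climitN. Qed.

Lemma climitM f g a b : climit f F a -> climit g F b ->
  climit (fun t => f t * g t) F (a * b).
Proof.
move=> [fr fi] [gr gi]; split.
  by rewrite ReM (funext (fun t => ReM (f t) (g t))); apply: tendsB; exact: tendsM.
by rewrite ImM (funext (fun t => ImM (f t) (g t))); apply: tendsD; exact: tendsM.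
Qed.

Lemma climitX f a n : climit f F a -> climit (fun t => f t ^+ n) F (a ^+ n).
Proof.
move=> fa; elim: n => [|n IH].
  by rewrite (_ : (fun _ => _) = cst 1); [exact: climit_cst|apply/funext].
by rewrite exprS (funext (fun t => exprS (f t) n)); exact: climitM.
Qed.

Lemma climit_sqn f a : climit f F a -> (fun t => sqn (f t)) @ F --> sqn a.
Proof. by move=> [fr fi]; apply: tendsD; apply: tendsX. Qed.

Lemma climit_neq f a b : climit f F a -> a != b -> \forall t \near F, f t != b.
Proof.
move=> fa ab; have /climit_sqn h := climitB fa (climit_cst b).
have : 0 < sqn (a - b) by rewrite sqn_gt0 subr_eq0.
move/(cvgr_gt _ h); apply: filterS => t.
by rewrite sqn_gt0 subr_eq0.
Qed.

Lemma climit_near f g a : (\forall t \near F, f t = g t) -> climit f F a ->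
  climit g F a.
Proof.
move=> fg [fr fi]; split; [apply: cvg_trans fr|apply: cvg_trans fi];
  apply: near_eq_cvg; apply: filterS fg => t ->; done.
Qed.

Lemma climitP f a : (forall e, 0 < e -> \forall t \near F, sqn (f t - a) < e) ->
  climit f F a.
Proof.
move=> h; split; apply/cvgrPdist_lt => e e0.
  apply: filterS (h (e ^+ 2) (exprn_gt0 _ e0)) => t.
  rewrite /sqn ReD ReN => lt; rewrite distrC -sqrtr_sqr.
  rewrite -[ltRHS](@ger0_norm _ e) ?ltW// -sqrtr_sqr ltr_sqrt ?exprn_gt0//.
  by apply: le_lt_trans lt; rewrite lerDl sqr_ge0.
apply: filterS (h (e ^+ 2) (exprn_gt0 _ e0)) => t.
rewrite /sqn ImD ImN => lt; rewrite distrC -sqrtr_sqr.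
rewrite -[ltRHS](@ger0_norm _ e) ?ltW// -sqrtr_sqr ltr_sqrt ?exprn_gt0//.
by apply: le_lt_trans lt; rewrite lerDr sqr_ge0.
Qed.

End ClimitRules.

(** Normalized so that the discriminant is 108 (z^3 - w^2). Multiple roots then occur exactly on z^3
    = w^2, which meets the torus of unimodular z and w in a trefoil. *)
Definition cubic (z w x : C) : C := x ^+ 3 - 3%:R * z * x + 2%:R * w.

Lemma cubic_factor z w : exists f : 'I_3 -> C,
  forall x, cubic z w x = (x - f 0) * (x - f 1) * (x - f 2).
Proof.
pose P : {poly C} := 'X^3 - (3%:R * z) *: 'X + (2%:R * w)%:P.
have sP : size P = 4.
  rewrite /P -addrA size_polyDl size_polyXn//.
  apply: leq_ltn_trans (size_polyD _ _) _; rewrite gtn_max size_polyN.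
  rewrite (leq_ltn_trans (size_scale_leq _ _)) ?size_polyX//=.
  by rewrite (leq_ltn_trans (size_polyC_leq1 _)).
have Pm : lead_coef P = 1.
  by rewrite lead_coefE sP /P !(coefD, coefN, coefZ, coefXn, coefX, coefC)/= mulr0 subr0 addr0.
have [r] := closed_field_poly_normal P; rewrite Pm scale1r => Pr.
have : size r = 3.
  by move: sP; rewrite Pr size_prod_XsubC => -[].
case: r Pr => [//|a [//|b [//|c [|//]]]] Pr _.
exists (fun j => nth 0 [:: a; b; c] j) => x /=.
have -> : cubic z w x = P.[x] by rewrite /cubic /P !hornerE.
by rewrite Pr !big_cons big_nil mulr1 !hornerM !hornerXsubC mulrA.
Qed.

(** Vieta's relations are extracted from the values at 0, 1 and -1. The sum of the roots vanishes,
    so everything can be expressed through [a] and [b]. *)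
Lemma cubic_vieta z w a b c :
  (forall x, cubic z w x = (x - a) * (x - b) * (x - c)) ->
  (((a - b) * (b - c) * (c - a)) ^+ 2 = 108%:R * (z ^+ 3 - w ^+ 2)) *
  (3%:R * a ^+ 2 - 3%:R * z = (a - b) * (a - c)).
Proof.
move=> h; have h0 := h 0; have h1 := h 1; have h2 := h (-1).
rewrite /cubic in h0 h1 h2.
have n2 : (2%:R : C) != 0 by rewrite pnatr_eq0.
have n3 : (3%:R : C) != 0 by rewrite pnatr_eq0.
have wE : 2%:R * w = - (a * b * c).
  by transitivity ((0 - a) * (0 - b) * (0 - c)); [rewrite -h0|]; ring.
have zE : 6%:R * z = - 2%:R * (a * b + b * c + c * a) .
  transitivity (2%:R - ((1 - a) * (1 - b) * (1 - c) - (-1 - a) * (-1 - b) * (-1 - c))).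
    by rewrite -h1 -h2; ring.
  by ring.
have cE : c = - a - b.
  apply: (mulfI n2); transitivity (- 2%:R * (a + b) - 2%:R * (a * b * c) -
    ((1 - a) * (1 - b) * (1 - c) + (-1 - a) * (-1 - b) * (-1 - c))); first by ring.
  rewrite -h1 -h2 (_ : 1 ^+ 3 - _ * z * 1 + _ * w + _ = 2%:R * (2%:R * w)); last by ring.
  by rewrite wE; ring.
have {}zE : 3%:R * z = a ^+ 2 + a * b + b ^+ 2.
  by apply: (mulfI n2); rewrite mulrA (_ : 2%:R * 3%:R = 6%:R :> C) -?natrM// zE cE; ring.
have {}wE : 2%:R * w = a * b * (a + b) by rewrite wE cE; ring.
split; last by rewrite zE cE; ring.
rewrite (_ : 108%:R * (z ^+ 3 - w ^+ 2) = 4%:R * (3%:R * z) ^+ 3 - 27%:R * (2%:R * w) ^+ 2); last by ring.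
by rewrite zE wE cE; ring.
Qed.

(** * Continuous roots of a family of cubics *)

Section Sheets.
Variables (X : topologicalType) (Z W : X -> C).

Definition regular_at p :=
  [/\ climit Z (nbhs p) (Z p), climit W (nbhs p) (W p) &
      Z p ^+ 3 != W p ^+ 2].

Definition within_climit (U : set X) (f : X -> C) p :=
  climit f (within U (nbhs p)) (f p).

(** The difference of the two sides is the divided difference of the cubic at [x] and [y]. *)
Lemma cubic_diff z w x y : x != y -> cubic z w x = 0 -> cubic z w y = 0 ->
  x ^+ 2 + x * y + y ^+ 2 = 3%:R * z.
Proof.
rewrite -subr_eq0 => xy hx hy; apply/eqP; rewrite -subr_eq0 -(mulrI_eq0 _ (mulfI xy)).
have <- : cubic z w x - cubic z w y = 0 by rewrite hx hy subr0.
by apply/eqP; rewrite /cubic; ring.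
Qed.

(** A root with x^2 = z would give w = x^3, hence z^3 = w^2. *)
Lemma cubic_simple z w x : z ^+ 3 != w ^+ 2 -> cubic z w x = 0 ->
  3%:R * x ^+ 2 != 3%:R * z.
Proof.
have n2 : (2%:R : C) != 0 by rewrite pnatr_eq0.
have n3 : (3%:R : C) != 0 by rewrite pnatr_eq0.
move=> zw; rewrite /cubic => h; apply: contra zw => /eqP /(mulfI n3) zE.
have : w = x ^+ 3.
  apply: (mulfI n2).
  transitivity (3%:R * z * x - x ^+ 3 + (x ^+ 3 - 3%:R * z * x + 2%:R * w)); first by ring.
  by rewrite h -zE; ring.
by move=> ->; rewrite -zE; apply/eqP; ring.
Qed.

(** The set where the two roots agree is clopen. Where they differ, the divided difference x^2 + x y
    + y^2 - 3 Z vanishes; near a point of agreement it tends to the derivative of the cubic, which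
    is non-zero at a simple root. *)
Lemma root_unique (U : set X) (x y : X -> C) :
  connected U -> (forall p, U p -> regular_at p) ->
  (forall p, U p -> cubic (Z p) (W p) (x p) = 0) ->
  (forall p, U p -> cubic (Z p) (W p) (y p) = 0) ->
  (forall p, U p -> within_climit U x p) ->
  (forall p, U p -> within_climit U y p) ->
  (exists2 p, U p & x p = y p) -> forall p, U p -> x p = y p.
Proof.
move=> Uco Ureg x0 y0 xc yc ex.
apply: (@connected_ind _ _ (fun p => x p = y p) Uco ex) => p Up.
  move=> xyp; have [Zc Wc ZW] := Ureg _ Up.
  have := cubic_simple ZW (x0 _ Up).
  set F := within U (nbhs p).
  have ZcF : climit Z F (Z p).
    by case: Zc => zr zi; split; apply: cvg_within_filter; [exact: zr|exact: zi].
  rewrite -subr_eq0.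
  have lim : climit (fun q => x q ^+ 2 + x q * y q + y q ^+ 2 - 3%:R * Z q) F
                (3%:R * x p ^+ 2 - 3%:R * Z p).
    rewrite [_ * x p ^+ 2](_ : _ = x p ^+ 2 + x p * y p + y p ^+ 2); last first.
      by rewrite -xyp; ring.
    apply: climitB; last exact/climitM/ZcF/climit_cst.
    apply: climitD; first apply: climitD.
    - exact/climitX/xc.
    - by apply: climitM; [exact: xc|exact: yc].
    - exact/climitX/yc.
  move=> /(climit_neq lim); rewrite /F near_withinE.
  apply: filterS => q h Uq; apply/eqP; apply: contraT => xyq.
  have := h Uq; rewrite (cubic_diff xyq (x0 _ Uq) (y0 _ Uq)).
  by rewrite subrr eqxx.
move=> xyp.
have lim : climit (fun t => x t - y t) (within U (nbhs p)) (x p - y p).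
  by apply: climitB; [exact: xc|exact: yc].
have /(climit_neq lim) : x p - y p != 0 by rewrite subr_eq0; exact/eqP.
rewrite near_withinE; apply: filterS => q h Uq xyq.
by have := h Uq; rewrite xyq subrr eqxx.
Qed.

(** A continuous numbering of all three roots over [U], that is, a trivialization of the triple
    covering they form. *)
Definition sheet (f : 'I_3 -> X -> C) (U : set X) :=
  forall p, U p -> [/\ forall j, cubic (Z p) (W p) (f j p) = 0,
    forall x, cubic (Z p) (W p) x = 0 -> exists j, x = f j p,
    injective (f ^~ p) & forall j, within_climit U (f j) p].

Lemma sheet_sub f U V : V `<=` U -> sheet f U -> sheet f V.
Proof.
move=> VU sf p /VU Up; have [h1 h2 h3 h4] := sf _ Up; split=> // j.
have [hr hi] := h4 j; split => Q; [move=> /hr|move=> /hi];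
  by rewrite /nbhs /= /within /=; apply: filterS => q h /VU /h.
Qed.

(** The squared modulus of the cubic at [a] is the product of the squared distances from [a] to the
    three roots. It tends to 0, so one of the factors is small. *)
Lemma near_root (rt : X -> 'I_3 -> C) p a :
  (forall q x, cubic (Z q) (W q) x = (x - rt q 0) * (x - rt q 1) * (x - rt q 2)) ->
  climit Z (nbhs p) (Z p) -> climit W (nbhs p) (W p) ->
  cubic (Z p) (W p) a = 0 -> forall e, 0 < e ->
  \forall q \near p, exists k, sqn (a - rt q k) < e.
Proof.
move=> rtE Zc Wc a0 e e0.
have lim : climit (fun q => cubic (Z q) (W q) a) (nbhs p) 0.
  rewrite -a0; apply: climitD; last exact/climitM/Wc/climit_cst.
  apply: climitB; first exact: climit_cst.
  apply: climitM; last exact: climit_cst.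
  exact/climitM/Zc/climit_cst.
have s0 : sqn 0 = 0 by apply/eqP; rewrite sqn_eq0.
have lim0 : (fun q => sqn (cubic (Z q) (W q) a)) @ nbhs p --> (0 : R).
  by rewrite -s0; exact: climit_sqn.
have e3 : 0 < e ^+ 3 by rewrite exprn_gt0.
have nh : \forall q \near p, sqn (cubic (Z q) (W q) a) < e ^+ 3.
  by have /cvgr_lt := lim0; apply.
apply: filterS nh => q.
rewrite rtE !sqnM => h; apply: contrapT => nk.
have ge k : e <= sqn (a - rt q k).
  by rewrite leNgt; apply/negP => lt; apply: nk; exists k.
move: h; rewrite ltNge => /negP; apply.
have e0' := ltW e0; rewrite exprSr expr2.
by apply: ler_pM => //; [exact: mulr_ge0|exact: ler_pM].
Qed.

Lemma cubic_roots_inj z w (f : 'I_3 -> C) : z ^+ 3 != w ^+ 2 ->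
  (forall x, cubic z w x = (x - f 0) * (x - f 1) * (x - f 2)) -> injective f.
Proof.
move=> zw h; have [disc _] := cubic_vieta h.
have n0 : ((f 0 - f 1) * (f 1 - f 2) * (f 2 - f 0)) ^+ 2 != 0.
  by rewrite disc mulf_eq0 pnatr_eq0 subr_eq0.
have {n0} : [&& f 0 != f 1, f 1 != f 2 & f 2 != f 0].
  by move: n0; rewrite expf_eq0/= !mulf_eq0 !subr_eq0 !negb_or -andbA.
case/and3P => n01 n12 n20.
have K (i : 'I_3) : [\/ i = 0, i = 1 | i = 2].
  by case: i => -[|[|[|//]]] ?; [constructor 1|constructor 2|constructor 3]; exact/val_inj.
move=> i j; case: (K i) => ->; case: (K j) => -> // e;
  by move: n01 n12 n20; rewrite e ?eqxx.
Qed.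

(** Comparing two divided differences shows that three distinct roots have sum zero, which restores
    the factorization. *)
Lemma cubic_disc z w (f : 'I_3 -> C) :
  (forall j, cubic z w (f j) = 0) ->
  (forall x, cubic z w x = 0 -> exists j, x = f j) -> injective f ->
  ((f 0 - f 1) * (f 1 - f 2) * (f 2 - f 0)) ^+ 2 =
  108%:R * (z ^+ 3 - w ^+ 2).
Proof.
move=> f0 fsurj fi; have [rt rtE] := cubic_factor z w.
suff E x : cubic z w x = (x - f 0) * (x - f 1) * (x - f 2).
  by have [-> _] := cubic_vieta E.
have n01 : f 1 - f 0 != 0 by rewrite subr_eq0; apply/eqP => /fi.
have n02 : f 2 - f 0 != 0 by rewrite subr_eq0; apply/eqP => /fi.
have n12 : f 2 - f 1 != 0 by rewrite subr_eq0; apply/eqP => /fi.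
have d01 : f 1 ^+ 2 + f 1 * f 0 + f 0 ^+ 2 = 3%:R * z.
  by apply: (cubic_diff _ (f0 1) (f0 0)); rewrite -subr_eq0.
have d02 : f 2 ^+ 2 + f 2 * f 0 + f 0 ^+ 2 = 3%:R * z.
  by apply: (cubic_diff _ (f0 2) (f0 0)); rewrite -subr_eq0.
have s0 : f 2 = - f 0 - f 1.
  apply: (mulfI n12); transitivity (f 2 ^+ 2 + f 2 * f 0 + f 0 ^+ 2 -
    (f 1 ^+ 2 + f 1 * f 0 + f 0 ^+ 2) - (f 2 - f 1) * (f 0 + f 1)); first by ring.
  by rewrite d01 d02; ring.
have w0 : 2%:R * w = 3%:R * z * f 0 - f 0 ^+ 3.
  transitivity (cubic z w (f 0) + 3%:R * z * f 0 - f 0 ^+ 3).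
    by rewrite /cubic; ring.
  by rewrite f0 add0r.
by rewrite /cubic w0 -d01 s0; ring.
Qed.

(** Roots are chosen pointwise without any regularity; over a small neighbourhood each is then
    labelled by the root at [p] to which it is close. *)
Lemma local_sheet p : regular_at p -> (\forall q \near p, regular_at q) ->
  exists2 V, nbhs p V & exists f, sheet f V.
Proof.
move=> [Zc Wc ZW] nreg.
have /choice [rt rtE] : forall q, exists f : 'I_3 -> C, forall x,
    cubic (Z q) (W q) x = (x - f 0) * (x - f 1) * (x - f 2).
  by move=> q; exact: cubic_factor.
have rt0 q k : cubic (Z q) (W q) (rt q k) = 0.
  rewrite rtE; case: k => -[|[|[|//]]] k3; apply/eqP; rewrite !mulf_eq0.
  - by rewrite (_ : Ordinal k3 = 0) ?subrr ?eqxx//; exact/val_inj.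
  - by rewrite (_ : Ordinal k3 = 1) ?subrr ?eqxx ?orbT//; exact/val_inj.
  - by rewrite (_ : Ordinal k3 = 2) ?subrr ?eqxx ?orbT//; exact/val_inj.
have rtex q x : cubic (Z q) (W q) x = 0 -> exists k, x = rt q k.
  rewrite rtE => /eqP; rewrite !mulf_eq0 !subr_eq0 => /orP[/orP[]|] /eqP ->.
  - by exists 0.
  - by exists 1.
  - by exists 2.
have rinj : injective (rt p) := cubic_roots_inj ZW (rtE p).
pose a := rt p.
(* The factor 10 is 2 + 2 (2 + 2): two successive uses of [sqnB_le] with squared distances below [e]
   contradict the separation. *)
have [e e0 sep] : exists2 e, 0 < e & forall i j, i != j -> 10 * e <= sqn (a i - a j).
  pose m := \big[Num.min/1]_(ij : 'I_3 * 'I_3 | ij.1 != ij.2) sqn (a ij.1 - a ij.2).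
  exists (m / 10).
    rewrite divr_gt0// /m; elim/big_ind: _ => // [x y x0 y0|[i j] /= ij].
      by rewrite lt_min x0.
    by rewrite sqn_gt0 subr_eq0; apply: contra ij => /eqP/rinj ->.
  move=> i j ij; rewrite mulrC divfK//.
  by rewrite /m (bigD1 (i, j))//= ge_min lexx.
have near_all : \forall q \near p, forall j, exists k, sqn (a j - rt q k) < e.
  apply: filter_forall => j; apply: near_root => //; exact: rt0.
pose V := [set q | regular_at q /\ forall j, exists k, sqn (a j - rt q k) < e].
exists V; first by apply: filterS2 nreg near_all.
have /choice [kk kkP] : forall q, exists k : 'I_3 -> 'I_3, V q ->
    forall j, sqn (a j - rt q (k j)) < e.
  move=> q; have [[_ /choice[k kP]]|nV] := pselect (V q); first by exists k.
  by exists id.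
exists (fun j q => rt q (kk q j)) => q Vq.
have kinj r : V r -> injective (kk r).
  move=> Vr i j kij; apply/eqP; apply: contraT => ij.
  have := sep _ _ ij; have := sqnB_le (a i) (rt r (kk r i)) (a j).
  have := kkP _ Vr i; have := kkP _ Vr j; rewrite -kij.
  by rewrite -(sqnN (a j - _)) opprB; lra.
have ksurj r x : V r -> cubic (Z r) (W r) x = 0 -> exists j, x = rt r (kk r j).
  move=> Vr /rtex [k ->]; have [h hk kh] := injF_bij (kinj _ Vr).
  by exists (h k); rewrite kh.
split => //.
- by move=> x; exact: ksurj.
- move=> i j; have [[_ _ ZWq] _] := Vq.
  by move/(cubic_roots_inj ZWq (rtE q)); exact: kinj.
move=> j; apply: climitP => e1 e10.
have [[Zq Wq _] _] := Vq.
have m0 : 0 < Num.min e e1 by rewrite lt_min e0.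
have := near_root rtE Zq Wq (rt0 q (kk q j)) m0.
rewrite near_withinE; apply: filterS => r [k]; rewrite lt_min => /andP[k1 k2] Vr.
have [i ki] := ksurj _ _ Vr (rt0 r k).
have [ij|ij] := eqVneq i j.
  by rewrite -ij -ki -sqnN opprB ij.
have := sep _ _ ij; have := sqnB_le (a i) (rt r k) (a j).
have := sqnB_le (rt r k) (rt q (kk q j)) (a j).
have := kkP _ Vr i; have := kkP _ Vq j; rewrite -ki.
have fl x y : sqn (x - y) = sqn (y - x) by rewrite -sqnN opprB.
rewrite (fl (rt q _) (a j)) (fl (rt r k) (a j)) (fl (rt r k) (rt q _)).
lra.
Qed.

Lemma sheet_reorder f U (s : 'I_3 -> 'I_3) : injective s -> sheet f U ->
  sheet (fun j => f (s j)) U.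
Proof.
move=> si sf p Up; have [h1 h2 h3 h4] := sf _ Up; split => //.
- move=> x /h2 [j ->]; have [t _ st] := injF_bij si.
  by exists (t j); rewrite st.
- by move=> i j /h3 /si.
Qed.

(** Comparing the numberings at [p] defines a permutation, and uniqueness of continuous roots
    propagates it over [U]. *)
Lemma sheet_match f g U p : (forall p, U p -> regular_at p) -> connected U ->
  U p -> sheet f U -> sheet g U ->
  exists2 s : 'I_3 -> 'I_3, injective s & forall j q, U q -> f j q = g (s j) q.
Proof.
move=> Ureg Uco Up sf sg.
have [f1 f2 f3 f4] := sf _ Up; have [g1 g2 g3 g4] := sg _ Up.
have /choice [s sP] : forall j, exists k, f j p = g k p by move=> j; exact/g2/f1.
exists s; first by move=> i j sij; apply: f3; rewrite /= !sP sij.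
move=> j q Uq; apply: (@root_unique U (f j) (g (s j))) => //; last by exists p.
- by move=> r /sf [].
- by move=> r /sg [].
- by move=> r /sf [].
- by move=> r /sg [].
Qed.

Lemma within_climit_union (A B : set X) f p :
  within_climit A f p -> within_climit B f p -> within_climit (A `|` B) f p.
Proof.
have h (u : X -> R) (l : R) : u @ within A (nbhs p) --> l ->
    u @ within B (nbhs p) --> l -> u @ within (A `|` B) (nbhs p) --> l.
  move=> ha hb V /[dup] /ha + /hb.
  rewrite /nbhs /= /within /= => a b; near=> q => -[]; near: q; [exact: a|exact: b].
by move=> [ar ai] [br bi]; split; exact: h.
Unshelve. all: by end_near. Qed.

(** The second sheet is renumbered by the permutation found on the intersection; connectedness makes
    one permutation sufficient. *)
Lemma sheet_glue A B f g p : (forall p, (A `|` B) p -> regular_at p) ->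
  closed A -> closed B -> connected (A `&` B) -> (A `&` B) p ->
  sheet f A -> sheet g B -> exists h, sheet h (A `|` B).
Proof.
move=> reg Acl Bcl ABco ABp sf sg.
have [s si sP] := @sheet_match f g (A `&` B) p (fun q h => reg _ (or_introl h.1))
  ABco ABp (sheet_sub (@subIsetl _ _ _) sf) (sheet_sub (@subIsetr _ _ _) sg).
pose h j q := if pselect (A q) then f j q else g (s j) q.
have hA q j : A q -> h j q = f j q by rewrite /h; case: pselect.
have hB q j : B q -> h j q = g (s j) q.
  by rewrite /h; case: pselect => // Aq Bq; exact: sP.
have wl (U : set X) u v q : U q -> (forall r, U r -> u r = v r) ->
    within_climit U u q -> within_climit U v q.
  move=> Uq uv [ur ui]; rewrite /within_climit -(uv _ Uq).
  split; [apply: cvg_trans ur|apply: cvg_trans ui]; apply: near_eq_cvg;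
    by rewrite near_withinE; near=> r => Ur; rewrite uv.
have away (U : set X) u q : closed U -> ~ U q -> within_climit U u q.
  move=> Ucl nU; have : \forall r \near q, ~ U r.
    by have := closed_openC Ucl; rewrite openE => /(_ q nU).
  move=> nr; split => V _; rewrite /nbhs /= /within /=;
    by apply: filterS nr => r nUr Ur.
exists h => q [Aq|Bq].
- have [h1 h2 h3 h4] := sf _ Aq; split.
  + by move=> j; rewrite hA.
  + by move=> x /h2 [j ->]; exists j; rewrite hA.
  + by move=> i j; rewrite /= !hA//; exact: h3.
  + move=> j; apply: within_climit_union.
      by apply: (wl _ (f j)) => // r Ar; rewrite hA.
    have [Bq|/away] := pselect (B q); last exact.
    apply: (wl _ (g (s j))) => // [r Br|]; first by rewrite hB.
    by have [_ _ _] := sg _ Bq; apply.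
- have [h1 h2 h3 h4] := sheet_reorder si sg Bq; split.
  + by move=> j; rewrite hB.
  + by move=> x /h2 [j ->]; exists j; rewrite hB.
  + by move=> i j; rewrite /= !hB//; exact: h3.
  + move=> j; apply: within_climit_union; last first.
      by apply: (wl _ (g (s j))) => // r Br; rewrite hB.
    have [Aq|/away] := pselect (A q); last exact.
    apply: (wl _ (f j)) => // [r Ar|]; first by rewrite hA.
    by have [_ _ _] := sf _ Aq; apply.
Unshelve. all: by end_near. Qed.

End Sheets.
End Cubic.

(** * Boxes, polar angles and subdivision *)

Section Space3.
Variable R : realType.
Local Notation V3 := 'rV[R]_3.

Definition vec3 (a b c : R) : V3 := \row_(j < 3) [:: a; b; c]`_j.

Lemma vec3E a b c : ((vec3 a b c) 0 0 = a) * ((vec3 a b c) 0 1 = b) *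
  ((vec3 a b c) 0 2 = c).
Proof. by rewrite !mxE. Qed.

Lemma ord3 (i : 'I_3) : [\/ i = 0, i = 1 | i = 2].
Proof.
by case: i => -[|[|[|//]]] ?; [constructor 1|constructor 2|constructor 3];
  exact/val_inj.
Qed.

Lemma vec3_ext (p q : V3) : p 0 0 = q 0 0 -> p 0 1 = q 0 1 -> p 0 2 = q 0 2 ->
  p = q.
Proof.
by move=> h0 h1 h2; apply/rowP => i; case: (ord3 i) => ->.
Qed.

Lemma vec3_eta (p : V3) : vec3 (p 0 0) (p 0 1) (p 0 2) = p.
Proof. by apply: vec3_ext; rewrite !vec3E. Qed.

Lemma tends_vec3 (T : Type) (F : set_system T) {FF : Filter F}
    (f g h : T -> R) a b c :
  f @ F --> a -> g @ F --> b -> h @ F --> c ->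
  (fun t => vec3 (f t) (g t) (h t)) @ F --> vec3 a b c.
Proof.
move=> fa gb hc; apply: cvg_row => i; case: (ord3 i) => ->; rewrite vec3E.
- by rewrite (_ : (fun _ => _) = f) //; apply/funext => t; rewrite vec3E.
- by rewrite (_ : (fun _ => _) = g) //; apply/funext => t; rewrite vec3E.
- by rewrite (_ : (fun _ => _) = h) //; apply/funext => t; rewrite vec3E.
Qed.

Lemma polar (c s : R) : c ^+ 2 + s ^+ 2 = 1 ->
  exists t, [/\ 0 <= t <= 2 * pi, c = cos t & s = sin t].
Proof.
move=> cs1.
have c1 : -1 <= c <= 1.
  by have s2 := sqr_ge0 s; apply/andP; split; nra.
have [/andP[a0 api] ca] := acos_def c1.
have sa : sin (acos c) = `|s|.
  by rewrite sin_acos// -cs1 addrAC subrr add0r sqrtr_sqr.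
have [s0|s0] := leP 0 s.
  exists (acos c); split => //; last by rewrite sa ger0_norm.
  by rewrite a0/=; have := @pi_ge0 R; lra.
exists (2 * pi - acos c); split.
- by have := @pi_ge0 R; lra.
- by rewrite mulr_natl cosB cos2pi sin2pi ca mul1r mul0r addr0.
- by rewrite mulr_natl sinB cos2pi sin2pi sa ltr0_norm// mul0r mul1r sub0r opprK.
Qed.

Lemma convex_connected n (A : set 'rV[R]_n) :
  (forall p q t, A p -> A q -> 0 <= t <= 1 -> A (p + t *: (q - p))) ->
  connected A.
Proof.
move=> Acx; have [[p Ap]|] := pselect (A !=set0); last first.
  by move/nonemptyPn => ->; exact: connected0.
pose seg q := [set p + t *: (q - p) | t in `[0, 1]].
have -> : A = \bigcup_(q in A) seg q.
  apply/seteqP; split => [q Aq|_ [q Aq [t /= t01 <-]]].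
    by exists q => //; exists 1; rewrite /= ?in_itv/= ?ler01 ?lexx// scale1r subrKC.
  by apply: Acx; rewrite // -in_itv.
apply: bigcup_connected.
  by exists p => q Aq; exists 0; rewrite /= ?in_itv/= ?ler01 ?lexx// scale0r addr0.
move=> q Aq; apply: connected_continuous_connected; first exact: segment_connected.
apply: continuous_subspaceT => t; apply: cvg_row => i.
rewrite !mxE (_ : (fun _ => _) = (fun t => p 0 i + t * (q 0 i - p 0 i))).
  by apply: tendsD; [exact: cvg_cst|apply: tendsM; [exact: cvg_id|exact: cvg_cst]].
by apply/funext => s; rewrite !mxE.
Qed.

(** Cousin's lemma: the supremum of the points reached from [a] is itself reached and cannot stay
    below [b]. It serves as the compactness argument for cutting boxes into small pieces. *)
Lemma cousin (Q : R -> R -> Prop) :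
  (forall a b c, a <= c -> c <= b -> Q a c -> Q c b -> Q a b) ->
  (forall x, exists2 d, 0 < d & forall a b, a <= x <= b -> b - a < d -> Q a b) ->
  forall a b, a <= b -> Q a b.
Proof.
move=> Qadd Qloc a b ab.
pose S := [set t | a <= t <= b /\ Q a t].
have Sa : S a.
  split; first by rewrite lexx.
  by have [d d0 h] := Qloc a; apply: h; rewrite ?lexx// subrr.
have Sub : has_ubound S by exists b => t [/andP[]].
have Ssup : has_sup S by split; [exists a|].
pose s := sup S.
have as_ : a <= s := ub_le_sup Sub Sa.
have sb : s <= b by apply: ge_sup; [exists a|move=> t [/andP[]]].
have [d d0 h] := Qloc s.
have d20 : 0 < d / 2 by rewrite divr_gt0.
have [t [/andP[at_ tb] Qat] ts] := sup_adherent d20 Ssup.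
have ts' : t <= s by apply: (ub_le_sup Sub); split => //; exact/andP.
pose u := Num.min b (s + d / 4).
have su : s <= u by rewrite le_min sb/=; lra.
have Qau : Q a u.
  apply: (Qadd a u t) => //; first exact: le_trans su.
  apply: h; first by rewrite ts' su.
  have : u <= s + d / 4 by rewrite ge_min lexx orbT.
  move: ts; rewrite -/s; lra.
have Su : S u by split => //; rewrite (le_trans as_ su)/= ge_min lexx.
have us : u <= s := ub_le_sup Sub Su.
suff <- : u = b by [].
apply/eqP; rewrite eq_le ge_min lexx/= leNgt; apply/negP => ub.
by move: us; rewrite /u ge_min => /orP[]; lra.
Qed.

Definition box (a b c d e f : R) : set V3 :=
  [set p | [/\ a <= p 0 0 <= b, c <= p 0 1 <= d & e <= p 0 2 <= f]].

Lemma box_connected a b c d e f : connected (box a b c d e f).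
Proof.
apply: convex_connected => p q t [/andP[p1 p2] /andP[p3 p4] /andP[p5 p6]].
move=> [/andP[q1 q2] /andP[q3 q4] /andP[q5 q6]] /andP[t0 t1].
by split; rewrite !mxE; apply/andP; split; nra.
Qed.

Lemma closed_coord_ge (a : R) (i : 'I_3) : closed [set p : V3 | a <= p 0 i].
Proof.
apply: (@preimage_closed _ _ (fun p : V3 => p 0 i) [set t | a <= t]).
  by move=> p _; exact: coord_continuous.
exact: closed_ge.
Qed.

Lemma closed_coord_le (a : R) (i : 'I_3) : closed [set p : V3 | p 0 i <= a].
Proof.
apply: (@preimage_closed _ _ (fun p : V3 => p 0 i) [set t | t <= a]).
  by move=> p _; exact: coord_continuous.
exact: closed_le.
Qed.

Lemma box_closed a b c d e f : closed (box a b c d e f).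
Proof.
have -> : box a b c d e f =
    ([set p | a <= p 0 0] `&` [set p | p 0 0 <= b]) `&`
    (([set p | c <= p 0 1] `&` [set p | p 0 1 <= d]) `&`
     ([set p | e <= p 0 2] `&` [set p | p 0 2 <= f])).
  apply/seteqP; split => p /=.
    by move=> [/andP[? ?] /andP[? ?] /andP[? ?]].
  by move=> [[? ?] [[? ?] [? ?]]]; split; exact/andP.
by apply: closedI; [|apply: closedI]; apply: closedI;
  (exact: closed_coord_ge || exact: closed_coord_le).
Qed.

Lemma nbhs_box (p : V3) V : nbhs p V -> exists2 d, 0 < d &
  forall a b c e f g, box a b c e f g p -> b - a < d -> e - c < d -> g - f < d ->
  box a b c e f g `<=` V.
Proof.
move=> /nbhs_ballP [d /= d0 dV]; exists d => // a b c e f g.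
move=> [/andP[p1 p2] /andP[p3 p4] /andP[p5 p6]] ba ec gf q.
move=> [/andP[q1 q2] /andP[q3 q4] /andP[q5 q6]]; apply: dV.
split => // i j; rewrite (ord1 i) /ball /= ltr_norml.
by case: (ord3 j) => ->; apply/andP; split; lra.
Qed.

Lemma box_nbhs (p : V3) a b c d e f : a < p 0 0 < b -> c < p 0 1 < d ->
  e < p 0 2 < f -> nbhs p (box a b c d e f).
Proof.
move=> /andP[p1 p2] /andP[p3 p4] /andP[p5 p6].
have h (i : 'I_3) x y : x < p 0 i -> p 0 i < y ->
    \forall q \near p, x <= (q : V3) 0 i <= y.
  move=> xp py; have c0 := @coord_continuous R 1 3 0 i p.
  have hx : \forall q \near p, x < (q : V3) 0 i by have /cvgr_gt := c0; apply.
  have hy : \forall q \near p, (q : V3) 0 i < y by have /cvgr_lt := c0; apply.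
  by near=> q; apply/andP; split; apply: ltW; near: q.
by near=> q; split; near: q; exact: h.
Unshelve. all: by end_near. Qed.

End Space3.

(** * Roots over the whole space *)

Section GlobalSheets.
Variable R : realType.
Local Notation V3 := 'rV[R]_3.
Local Notation C := R[i].
Variables (Z W : V3 -> C).

(** [cousin] is applied to one coordinate at a time. The property given to it includes an admissible
    width [d] for the coordinates not yet extended; the smaller of two widths survives
    concatenation. *)
Lemma box_sheet : (forall p, regular_at Z W p) -> forall a b c d e f,
  a <= b -> c <= d -> e <= f -> exists s, sheet Z W s (box a b c d e f).
Proof.
move=> reg.
have split3 (A B : set V3) p : closed A -> closed B -> connected (A `&` B) ->
    (A `&` B) p -> (exists s, sheet Z W s A) -> (exists s, sheet Z W s B) ->
    exists s, sheet Z W s (A `|` B).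
  move=> Acl Bcl ABco ABp [s ss] [t st].
  by apply: (sheet_glue _ Acl Bcl ABco ABp ss st) => q _; exact: reg.
have loc (p : V3) : exists2 d, 0 < d & forall a b c e f g, box a b c e f g p ->
    b - a < d -> e - c < d -> g - f < d -> exists s, sheet Z W s (box a b c e f g).
  have [|V nV [s sV]] := local_sheet (reg p); first by near=> q; exact: reg.
  have [d d0 dV] := nbhs_box nV; exists d => // a b c e f g bp h1 h2 h3.
  by exists s; apply: sheet_sub sV; exact: dV.
have step1 x y e f : e <= f -> exists2 d, 0 < d & forall a b c g,
    a <= x <= b -> c <= y <= g -> b - a < d -> g - c < d ->
    exists s, sheet Z W s (box a b c g e f).
  apply: (@cousin _ (fun e f => exists2 d, 0 < d & forall a b c g,
    a <= x <= b -> c <= y <= g -> b - a < d -> g - c < d ->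
    exists s, sheet Z W s (box a b c g e f))) => {e f}.
    move=> e f z ez zf [d d0 hd] [d' d'0 hd'].
    exists (Num.min d d'); first by rewrite lt_min d0.
    move=> a b c g xab ycg; rewrite !lt_min => /andP[h1 h2] /andP[h3 h4].
    have -> : box a b c g e f = box a b c g e z `|` box a b c g z f.
      apply/seteqP; split => q.
        move=> [q1 q2 /andP[q3 q4]].
        by have [qz|/ltW qz] := leP (q 0 2) z; [left|right]; split => //; apply/andP.
      move=> [] [q1 q2 /andP[q3 q4]]; split => //; apply/andP; split=> //.
        exact: le_trans zf.
      exact: le_trans q3.
    have I : box a b c g e z `&` box a b c g z f = box a b c g z z.
      apply/seteqP; split => q.
        by move=> [[q1 q2 /andP[q3 q4]] [_ _ /andP[q5 q6]]]; split => //; apply/andP.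
      move=> [q1 q2 /andP[q3 q4]]; split; split => //; apply/andP; split => //.
        exact: le_trans q3.
      exact: le_trans zf.
    apply: (split3 _ _ (vec3 x y z)).
    - exact: box_closed.
    - exact: box_closed.
    - by rewrite I; exact: box_connected.
    - by rewrite I; split; rewrite !vec3E// lexx.
    - exact: hd.
    - exact: hd'.
  move=> z; have [d d0 hd] := loc (vec3 x y z); exists d => // e f zef fe.
  by exists d => // a b c g xab ycg ba gc; apply: hd => //; split; rewrite !vec3E.
have step2 x c g e f : c <= g -> e <= f -> exists2 d, 0 < d & forall a b,
    a <= x <= b -> b - a < d -> exists s, sheet Z W s (box a b c g e f).
  move=> cg ef; move: c g cg.
  apply: (@cousin _ (fun c g => exists2 d, 0 < d & forall a b,
    a <= x <= b -> b - a < d -> exists s, sheet Z W s (box a b c g e f))).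
    move=> c g y cy yg [d d0 hd] [d' d'0 hd'].
    exists (Num.min d d'); first by rewrite lt_min d0.
    move=> a b xab; rewrite !lt_min => /andP[h1 h2].
    have -> : box a b c g e f = box a b c y e f `|` box a b y g e f.
      apply/seteqP; split => q.
        move=> [q1 /andP[q3 q4] q2].
        by have [qz|/ltW qz] := leP (q 0 1) y; [left|right]; split => //; apply/andP.
      move=> [] [q1 /andP[q3 q4] q2]; split => //; apply/andP; split=> //.
        exact: le_trans yg.
      exact: le_trans q3.
    have I : box a b c y e f `&` box a b y g e f = box a b y y e f.
      apply/seteqP; split => q.
        by move=> [[q1 /andP[q3 q4] q2] [_ /andP[q5 q6] _]]; split => //; apply/andP.
      move=> [q1 /andP[q3 q4] q2]; split; split => //; apply/andP; split => //.
        exact: le_trans q3.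
      exact: le_trans yg.
    apply: (split3 _ _ (vec3 x y e)).
    - exact: box_closed.
    - exact: box_closed.
    - by rewrite I; exact: box_connected.
    - by rewrite I; split; rewrite !vec3E// lexx.
    - exact: hd.
    - exact: hd'.
  move=> y; have [d d0 hd] := step1 x y e f ef; exists d => // c g ycg gc.
  by exists d => // a b xab ba; apply: hd.
move=> a b c d e f ab cd ef; move: a b ab.
apply: (@cousin _ (fun a b => exists s, sheet Z W s (box a b c d e f))).
  move=> a b x ax xb hd hd'.
  have -> : box a b c d e f = box a x c d e f `|` box x b c d e f.
    apply/seteqP; split => q.
      move=> [/andP[q3 q4] q1 q2].
      by have [qz|/ltW qz] := leP (q 0 0) x; [left|right]; split => //; apply/andP.
    move=> [] [/andP[q3 q4] q1 q2]; split => //; apply/andP; split=> //.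
      exact: le_trans xb.
    exact: le_trans q3.
  have I : box a x c d e f `&` box x b c d e f = box x x c d e f.
    apply/seteqP; split => q.
      by move=> [[/andP[q3 q4] q1 q2] [/andP[q5 q6] _ _]]; split => //; apply/andP.
    move=> [/andP[q3 q4] q1 q2]; split; split => //; apply/andP; split => //.
      exact: le_trans q3.
    exact: le_trans xb.
  apply: (split3 _ _ (vec3 x c e)) => //.
  - exact: box_closed.
  - exact: box_closed.
  - by rewrite I; exact: box_connected.
  - by rewrite I; split; rewrite !vec3E ?lexx.
move=> x; have [dd dd0 hd] := step2 x c d e f cd ef; exists dd.
Unshelve. all: by end_near. Qed.

(** The sheets over an exhausting sequence of cubes are renumbered to agree at the origin. By
    uniqueness they are then compatible, and a point may be read in any cube that contains it. *)
Lemma global_sheet : (forall p, regular_at Z W p) ->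
  exists s, sheet Z W s setT.
Proof.
move=> reg.
pose cube (n : nat) : set V3 := box (- n%:R) n%:R (- n%:R) n%:R (- n%:R) n%:R.
have /choice [f fP] : forall n : nat, exists s, sheet Z W s (cube n).
  by move=> n; apply: box_sheet => //; rewrite ge0_cp.
have cube_le m n : (m <= n)%N -> cube m `<=` cube n.
  move=> mn p [/andP[? ?] /andP[? ?] /andP[? ?]].
  have mnR : m%:R <= n%:R :> R by rewrite ler_nat.
  by split; apply/andP; split; lra.
have cube0 n : cube n 0.
  by have n0 : 0 <= n%:R :> R by []; split; rewrite mxE; lra.
have /choice [g gP] : forall n, exists s, sheet Z W s (cube n) /\
    forall j, s j 0 = f 0 j 0.
  move=> n; have [|||||s si sP] := @sheet_match _ _ Z W (f 0) (f n) (cube 0) 0.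
  - by move=> *; exact: reg.
  - exact: box_connected.
  - exact: cube0.
  - exact: fP.
  - exact: sheet_sub (cube_le _ _ (leq0n n)) (fP n).
  - exists (fun j => f n (s j)); split; first exact: sheet_reorder.
    by move=> j; rewrite sP.
have gm m n : (m <= n)%N -> forall j p, cube m p -> g m j p = g n j p.
  move=> mn j; have [gs g0] := gP m; have [hs h0] := gP n.
  have hs' := sheet_sub (cube_le _ _ mn) hs.
  apply: (@root_unique _ _ Z W (cube m)) => //.
  - exact: box_connected.
  - by move=> r /gs [].
  - by move=> r /hs' [].
  - by move=> r /gs [].
  - by move=> r /hs' [].
  - by exists 0 => //; rewrite g0 h0.
pose N (p : V3) := Num.bound (`|p 0 0| + `|p 0 1| + `|p 0 2|).
have NP (p : V3) : `|p 0 0| + `|p 0 1| + `|p 0 2| < (N p)%:R by rewrite archi_boundP// !addr_ge0.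
have Nc p : cube (N p) p.
  have := NP p; have := normr_ge0 (p 0 0); have := normr_ge0 (p 0 1).
  have := normr_ge0 (p 0 2) => *.
  by split; rewrite -ler_norml; lra.
have Nn p : nbhs p (cube (N p)).
  have := NP p; have := normr_ge0 (p 0 0); have := normr_ge0 (p 0 1).
  have := normr_ge0 (p 0 2) => *.
  by apply: box_nbhs; rewrite -ltr_norml; lra.
exists (fun j p => g (N p) j p) => p _.
have [gs g0] := gP (N p); have [h1 h2 h3 h4] := gs _ (Nc p).
split => // j; have [hr hi] := h4 j.
have near_g : \forall q \near p, g (N p) j q = g (N q) j q.
  apply: filterS (Nn p) => q cq.
  have [le|/ltnW le] := leqP (N p) (N q); first exact: gm.
  by rewrite (gm _ _ le).
have wl (u v : V3 -> R) : u @ within (cube (N p)) (nbhs p) --> v p ->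
    (\forall q \near p, u q = v q) -> v @ within setT (nbhs p) --> v p.
  move=> h e V /h; rewrite /nbhs /= /within /= => h'.
  near=> q => _.
  have <- : u q = v q by near: q.
  by apply: (near h' q) => //; near: q; exact: Nn.
by split; [apply: wl hr _|apply: wl hi _]; apply: filterS near_g => q ->.
Unshelve. all: by end_near. Qed.

End GlobalSheets.

(** * Roots over open copies of the space *)

Section Transport.
Variable R : realType.
Local Notation V3 := 'rV[R]_3.
Local Notation C := R[i].

Definition osheet (Z W : V3 -> C) (f : 'I_3 -> V3 -> C) (U : set V3) :=
  forall p, U p -> [/\ forall j, cubic (Z p) (W p) (f j p) = 0,
    forall x, cubic (Z p) (W p) x = 0 -> exists j, x = f j p,
    injective (f ^~ p) & forall j, climit (f j) (nbhs p) (f j p)].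

Lemma osheet_sheet Z W f U V : V `<=` U -> osheet Z W f U -> sheet Z W f V.
Proof.
move=> VU of_ p /VU /of_ [h1 h2 h3 h4]; split => // j; have [hr hi] := h4 j.
by split; apply: cvg_within_filter; [exact: hr|exact: hi].
Qed.

Lemma climit_comp (f : V3 -> C) (T : Type) (F : set_system T) (l : T -> V3) p :
  Filter F -> l @ F --> p -> climit f (nbhs p) (f p) ->
  climit (fun q => f (l q)) F (f p).
Proof.
by move=> FF lp [fr fi]; split; [apply: cvg_comp lp fr|apply: cvg_comp lp fi].
Qed.

(** The family is pulled back along [k] to the whole space, where a sheet exists, and the roots are
    brought back to [U] by the right inverse [l]. *)
Lemma sheet_transport Z W (U : set V3) (k l : V3 -> V3) :
  continuous k -> (forall p, U (k p)) ->
  (forall p, U p -> {for p, continuous l}) -> (forall p, U p -> k (l p) = p) ->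
  (forall p, U p -> regular_at Z W p) -> exists f, osheet Z W f U.
Proof.
move=> kc kU lc kl reg.
have [|s sP] := @global_sheet R (Z \o k) (W \o k).
  move=> p; have [Zc Wc ZW] := reg _ (kU p); split => //.
    exact: (climit_comp _ (kc p) Zc).
  exact: (climit_comp _ (kc p) Wc).
exists (fun j q => s j (l q)) => p Up.
have [h1 h2 h3 h4] := sP (l p) I; split.
- by move=> j; have := h1 j; rewrite /= kl.
- by move=> x xr; apply: h2; rewrite /= kl.
- exact: h3.
- move=> j; have := h4 j; rewrite /within_climit => -[hr hi].
  apply: climit_comp; first exact: lc.
  by split => V; [move=> /hr|move=> /hi]; rewrite /nbhs /= /within /=;
    apply: filterS => q; exact.
Qed.

Lemma osheet_glue Z W (A B : set V3) f g p : open A -> open B ->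
  (forall p, (A `|` B) p -> regular_at Z W p) -> connected (A `&` B) ->
  (A `&` B) p -> osheet Z W f A -> osheet Z W g B ->
  exists h, osheet Z W h (A `|` B).
Proof.
move=> Aop Bop reg ABco ABp sf sg.
have [s si sP] := @sheet_match _ _ Z W f g (A `&` B) p
  (fun q h => reg _ (or_introl h.1)) ABco ABp
  (osheet_sheet (@subIsetl _ _ _) sf) (osheet_sheet (@subIsetr _ _ _) sg).
pose h j q := if pselect (A q) then f j q else g (s j) q.
have hA q j : A q -> h j q = f j q by rewrite /h; case: pselect.
have hB q j : B q -> h j q = g (s j) q.
  by rewrite /h; case: pselect => // Aq Bq; exact: sP.
have nA q : A q -> \forall r \near q, A r by move: Aop; rewrite openE; apply.
have nB q : B q -> \forall r \near q, B r by move: Bop; rewrite openE; apply.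
exists h => q [Aq|Bq].
- have [h1 h2 h3 h4] := sf _ Aq; split.
  + by move=> j; rewrite hA.
  + by move=> x /h2 [j ->]; exists j; rewrite hA.
  + by move=> i j; rewrite /= !hA//; exact: h3.
  + move=> j; rewrite hA//; apply: climit_near (h4 j).
    by apply: filterS (nA _ Aq) => r Ar; rewrite hA.
- have [h1 h2 h3 h4] := sg _ Bq.
  have [t _ st] := injF_bij si; split.
  + by move=> j; rewrite hB.
  + by move=> x /h2 [j ->]; exists (t j); rewrite hB// st.
  + by move=> i j; rewrite /= !hB// => /h3 /si.
  + move=> j; rewrite hB//; apply: climit_near (h4 (s j)).
    by apply: filterS (nB _ Bq) => r Br; rewrite hB.
Qed.

End Transport.

(** * Families of cubics over the complement of a circle *)

Section Unknot.
Variable R : realType.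
Local Notation V3 := 'rV[R]_3.
Local Notation C := R[i].

Let rad (p : V3) : R := Num.sqrt (p 0 0 ^+ 2 + p 0 1 ^+ 2).
Let over (p : V3) : R := Num.max 0 (rad p - 1).

Let rad_ge0 p : 0 <= rad p. Proof. exact: sqrtr_ge0. Qed.

Let rad_cts : continuous rad.
Proof.
by apply: ctsI => p; rewrite /rad; tends.
Qed.

Let over_cts : continuous over.
Proof.
by apply: ctsI => p; apply: tendsmax; [exact: cvg_cst|apply: tendsB; [exact: rad_cts|exact: cvg_cst]].
Qed.

Let over_vec3 a b c d : over (vec3 a b c) = over (vec3 a b d).
Proof. by rewrite /over /rad !vec3E. Qed.

(** [Up] lies above the graph of - [over], [Um] below the graph of [over], and [Vc] is the open
    solid cylinder over the disk. They cover the complement of the circle and each is a copy of R^3.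
    [Up] and [Um] have connected intersection, whereas [Vc] meets their union in two pieces, above
    and below the disk. *)
Let Up : set V3 := [set p : V3 | 0 < p 0 2 + over p].
Let Um : set V3 := [set p : V3 | 0 < over p - p 0 2].
Let Vc : set V3 := [set p : V3 | rad p < 1].

Let open_gt0 (f : V3 -> R) : continuous f -> open [set p | 0 < f p].
Proof.
move=> fc; apply: (@open_comp _ _ f [set t | 0 < t]) => [p _|]; first exact: fc.
exact: open_gt.
Qed.

Let c02 : continuous (fun p : V3 => p 0 2).
Proof. exact: coord_continuous. Qed.

Let open_Up : open Up.
Proof.
by apply: open_gt0; apply: ctsI => p; apply: tendsD; [exact: c02|exact: over_cts].
Qed.

Let open_Um : open Um.
Proof.
by apply: open_gt0; apply: ctsI => p; apply: tendsB; [exact: over_cts|exact: c02].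
Qed.

Let open_Vc : open Vc.
Proof.
have -> : Vc = [set p | 0 < 1 - rad p] by apply/seteqP; split => p; rewrite /Vc /= subr_gt0.
by apply: open_gt0; apply: ctsI => p; apply: tendsB; [exact: cvg_cst|exact: rad_cts].
Qed.

Let circle_compl p : ~ round_circle p <-> (Up `|` Um `|` Vc) p.
Proof.
split => [nC|].
  rewrite /Up /Um /Vc /=; apply: contrapT => /not_orP [/not_orP [/negP h1 /negP h2] /negP h3].
  move: h1 h2 h3; rewrite -!leNgt => h1 h2 h3; apply: nC.
  have oE : over p = rad p - 1 by rewrite /over; case: leP => //; lra.
  have r1 : rad p = 1 by move: h1 h2; rewrite oE; lra.
  have z0 : p 0 2 = 0 by move: h1 h2; rewrite oE r1; lra.
  have := @polar R (p 0 0) (p 0 1) _.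
  rewrite -[X in X = 1 -> _]sqr_sqrtr ?addr_ge0 ?sqr_ge0// -/(rad p) r1 expr1n.
  case=> // t [t02 ct st]; exists t; first by rewrite /= in_itv.
  by apply: vec3_ext; rewrite !mxE//= z0.
move=> U [t _ tp]; move: U; rewrite -tp /Up /Um /Vc /= /over /rad !mxE /= cos2Dsin2 sqrtr1.
by rewrite subrr maxxx add0r subr0 !ltxx => -[[]|].
Qed.

(** The sheet over [Vc] is matched with the outer one by a permutation [s] above the disk and [t]
    below it; their discrepancy is the monodromy around the circle. If [s] and [t] agree at some
    index, that root is continuous everywhere. Otherwise the monodromy is a derangement of three
    letters, hence a 3-cycle and even, and the product of the differences of the roots is a
    continuous square root of the discriminant. *)
Lemma unknot_alternative (Z W : V3 -> C) :
  (forall p, ~ round_circle p -> regular_at Z W p) ->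
  (exists x : V3 -> C, forall p, ~ round_circle p ->
     cubic (Z p) (W p) (x p) = 0 /\ climit x (nbhs p) (x p)) \/
  (exists d : V3 -> C, forall p, ~ round_circle p ->
     d p ^+ 2 = 108%:R * (Z p ^+ 3 - W p ^+ 2) /\ climit d (nbhs p) (d p)).
Proof.
move=> reg0.
have reg p : (Up `|` Um `|` Vc) p -> regular_at Z W p by move/circle_compl/reg0.
have [fp fpP] : exists f, osheet Z W f Up.
  apply: (@sheet_transport _ Z W Up
    (fun p => vec3 (p 0 0) (p 0 1) (expR (p 0 2) - over p))
    (fun p => vec3 (p 0 0) (p 0 1) (ln (p 0 2 + over p)))).
  - apply: ctsI => p; apply: tends_vec3; [exact: coord_continuous|exact: coord_continuous|].
    apply: tendsB; last exact: over_cts.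
    by apply: tends_comp; [exact: continuous_expR|exact: c02].
  - move=> p; rewrite /Up /= vec3E (over_vec3 _ _ _ (p 0 2)) vec3_eta subrK.
    exact: expR_gt0.
  - move=> p Upp; apply: ctsI_at; apply: tends_vec3; [exact: coord_continuous|exact: coord_continuous|].
    apply: tends_comp; first exact: continuous_ln.
    by apply: tendsD; [exact: c02|exact: over_cts].
  - move=> p Upp; apply: vec3_ext; rewrite !vec3E//.
    by rewrite (over_vec3 _ _ _ (p 0 2)) vec3_eta lnK ?posrE// addrK.
  - by move=> p Upp; apply: reg; left; left.
have [fm fmP] : exists f, osheet Z W f Um.
  apply: (@sheet_transport _ Z W Um
    (fun p => vec3 (p 0 0) (p 0 1) (over p - expR (p 0 2)))
    (fun p => vec3 (p 0 0) (p 0 1) (ln (over p - p 0 2)))).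
  - apply: ctsI => p; apply: tends_vec3; [exact: coord_continuous|exact: coord_continuous|].
    apply: tendsB; first exact: over_cts.
    by apply: tends_comp; [exact: continuous_expR|exact: c02].
  - move=> p; rewrite /Um /= vec3E (over_vec3 _ _ _ (p 0 2)) vec3_eta subKr.
    exact: expR_gt0.
  - move=> p Ump; apply: ctsI_at; apply: tends_vec3; [exact: coord_continuous|exact: coord_continuous|].
    apply: tends_comp; first exact: continuous_ln.
    by apply: tendsB; [exact: over_cts|exact: c02].
  - move=> p Ump; apply: vec3_ext; rewrite !vec3E//.
    by rewrite (over_vec3 _ _ _ (p 0 2)) vec3_eta lnK ?posrE// subKr.
  - by move=> p Ump; apply: reg; left; right.
have [g gP] : exists f, osheet Z W f Vc.
  have c00 (p : V3) : (fun p : V3 => p 0 0) @ nbhs p --> p 0 0 by exact: coord_continuous.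
  have c01 (p : V3) : (fun p : V3 => p 0 1) @ nbhs p --> p 0 1 by exact: coord_continuous.
  have rd a b c d : 0 <= d -> rad (vec3 (a * d) (b * d) c) = rad (vec3 a b c) * d.
    move=> d0; rewrite /rad !vec3E !exprMn -mulrDl sqrtrM ?addr_ge0 ?sqr_ge0//.
    by rewrite sqrtr_sqr ger0_norm.
  apply: (@sheet_transport _ Z W Vc
    (fun p => vec3 (p 0 0 * (1 + rad p)^-1) (p 0 1 * (1 + rad p)^-1) (p 0 2))
    (fun p => vec3 (p 0 0 * (1 - rad p)^-1) (p 0 1 * (1 - rad p)^-1) (p 0 2))).
  - apply: ctsI => p; have n0 : 1 + rad p != 0 by rewrite gt_eqF// ltr_pwDl.
    have ri : (fun p => (1 + rad p)^-1) @ nbhs p --> (1 + rad p)^-1.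
      by apply: tendsV => //; apply: tendsD; [exact: cvg_cst|exact: rad_cts].
    by apply: tends_vec3; [exact: tendsM|exact: tendsM|exact: c02].
  - move=> p; have p0 : 0 < 1 + rad p by rewrite ltr_pwDl.
    rewrite /Vc /= rd ?invr_ge0 ?ltW// -/(vec3 _ _ _) vec3_eta.
    by rewrite ltr_pdivrMr// mul1r ltrDr.
  - move=> p Vp; have n0 : 1 - rad p != 0 by rewrite gt_eqF// subr_gt0.
    have ri : (fun p => (1 - rad p)^-1) @ nbhs p --> (1 - rad p)^-1.
      by apply: tendsV => //; apply: tendsB; [exact: cvg_cst|exact: rad_cts].
    by apply: ctsI_at; apply: tends_vec3; [exact: tendsM|exact: tendsM|exact: c02].
  - move=> p Vp; have p0 : 0 < 1 - rad p by rewrite subr_gt0.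
    have -> : 1 + rad (vec3 (p 0 0 / (1 - rad p)) (p 0 1 / (1 - rad p)) (p 0 2)) =
        (1 - rad p)^-1.
      rewrite rd ?invr_ge0 ?ltW// vec3_eta -[X in X + _](divff (lt0r_neq0 p0)).
      by rewrite -mulrDl subrK mul1r.
    by rewrite invrK; apply: vec3_ext; rewrite !vec3E// divfK ?lt0r_neq0.
  - by move=> p Vp; apply: reg; right.
have Vcx p q t : Vc p -> Vc q -> 0 <= t <= 1 -> Vc (p + t *: (q - p)).
  rewrite /Vc /= => Vp Vq /andP[t0 t1].
  have sq (r : V3) : rad r < 1 -> r 0 0 ^+ 2 + r 0 1 ^+ 2 < 1.
    by rewrite -{1}(@sqrtr1 R) ltr_sqrt.
  rewrite -(@sqrtr1 R) ltr_sqrt//; move: (sq _ Vp) (sq _ Vq); rewrite !mxE.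
  move: (p 0 0) (p 0 1) (q 0 0) (q 0 1) => a b c d h1 h2.
  have -> : (a + t * (c - a)) ^+ 2 + (b + t * (d - b)) ^+ 2 =
    (1 - t) * (a ^+ 2 + b ^+ 2) + t * (c ^+ 2 + d ^+ 2) -
    t * (1 - t) * ((a - c) ^+ 2 + (b - d) ^+ 2) by ring.
  have := sqr_ge0 (a - c); have := sqr_ge0 (b - d) => s1 s2.
  have tt : 0 <= t * (1 - t) by rewrite mulr_ge0// subr_ge0.
  have [->|tn1] := eqVneq t 1; first by nra.
  have : t < 1 by rewrite lt_neqAle tn1.
  by nra.
(* In polar coordinates the set is the image of a convex one: the angle is free, the radius minus 1
   is positive, and the height is a fraction of it between -1 and 1. *)
have UUco : connected (Up `&` Um).
  pose D : set V3 := [set p | 0 < p 0 1 /\ -1 < p 0 2 < 1].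
  pose k (p : V3) := vec3 ((1 + p 0 1) * cos (p 0 0)) ((1 + p 0 1) * sin (p 0 0))
    (p 0 2 * p 0 1).
  have -> : Up `&` Um = k @` D.
    apply/seteqP; split => [p [Upp Ump]|_ [q [q1 /andP[q2 q3]] <-]].
      have o0 : 0 < over p by move: Upp Ump; rewrite /Up /Um /=; lra.
      have oE : over p = rad p - 1.
        by move: o0; rewrite /over; case: (leP 0 (rad p - 1)) => //; rewrite ltxx.
      have r0 : 0 < rad p by move: o0; rewrite oE; lra.
      have [|t [_ ct st]] := @polar R (p 0 0 / rad p) (p 0 1 / rad p).
        rewrite !exprMn -mulrDl -[X in X * _](@sqr_sqrtr R) ?addr_ge0 ?sqr_ge0//.
        by rewrite -/(rad p) -exprMn divff ?expr1n// gt_eqF.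
      exists (vec3 t (over p) (p 0 2 / over p)).
        rewrite /D /= !vec3E; split => //.
        rewrite ltr_pdivlMr// ltr_pdivrMr// mulN1r mul1r.
        by move: Upp Ump; rewrite /Up /Um /=; lra.
      apply: vec3_ext; rewrite !vec3E ?divfK ?gt_eqF// -?ct -?st oE addrC subrK.
        by rewrite mulrC divfK// gt_eqF.
      by rewrite mulrC divfK// gt_eqF.
    have rk : rad (k q) = 1 + q 0 1.
      rewrite /rad /k !vec3E !exprMn -mulrDr cos2Dsin2 mulr1 sqrtr_sqr ger0_norm//.
      by lra.
    have ok : over (k q) = q 0 1 by rewrite /over rk addrC addKr; case: leP => //; lra.
    by rewrite /Up /Um /= ok /k !vec3E; split; nra.
  apply: connected_continuous_connected.
    apply: convex_connected => p q t [p1 /andP[p2 p3]] [q1 /andP[q2 q3]] /andP[t0 t1].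
    rewrite /D /= !mxE; have [->|tn1] := eqVneq t 1; first by lra.
    have : t < 1 by rewrite lt_neqAle tn1.
    by split; [nra|apply/andP; split; nra].
  apply: continuous_subspaceT; apply: ctsI => p.
  have c (i : 'I_3) : (fun p : V3 => p 0 i) @ nbhs p --> p 0 i by exact: coord_continuous.
  apply: tends_vec3; apply: tendsM => //; first apply: tendsD => //.
  - exact: cvg_cst.
  - exact: tendscos.
  - by apply: tendsD => //; exact: cvg_cst.
  - exact: tendssin.
have [f fP] : exists h, osheet Z W h (Up `|` Um).
  apply: (@osheet_glue _ Z W Up Um fp fm (vec3 2 0 0)) => //.
    by move=> p h; apply: reg; left.
  have o2 : over (vec3 2 0 0) = 1.
    rewrite /over /rad !vec3E expr0n/= addr0 sqrtr_sqr ger0_norm//.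
    by case: leP => //; lra.
  by rewrite /Up /Um /= o2 vec3E; split; lra.
have oV p : Vc p -> over p = 0.
  by rewrite /Vc /= /over => Vp; case: leP => //; lra.
pose Vu := Vc `&` [set p | 0 < p 0 2]; pose Vd := Vc `&` [set p | p 0 2 < 0].
have VuU : Vu `<=` Up `|` Um by move=> p [Vp /= z]; left; rewrite /Up /= oV// addr0.
have VdU : Vd `<=` Up `|` Um by move=> p [Vp /= z]; right; rewrite /Um /= oV// sub0r oppr_gt0.
have r0 c : rad (vec3 0 0 c) = 0 by rewrite /rad !vec3E expr0n/= addr0 sqrtr0.
have [|||||s si sP] := @sheet_match _ _ Z W g f Vu (vec3 0 0 1).
- by move=> p [Vp _]; apply: reg; right.
- apply: convex_connected => p q t [Vp /= p2] [Vq /= q2] t01; split; first exact: Vcx.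
  move: t01 => /andP[t0 t1]; rewrite /= !mxE; have [->|tn1] := eqVneq t 1; first by lra.
  have : t < 1 by rewrite lt_neqAle tn1.
  by nra.
- by split; rewrite /Vc /= ?r0 ?vec3E.
- by apply: osheet_sheet gP => p [].
- exact: osheet_sheet fP.
have [|||||t ti tP] := @sheet_match _ _ Z W g f Vd (vec3 0 0 (-1)).
- by move=> p [Vp _]; apply: reg; right.
- apply: convex_connected => p q u [Vp /= p2] [Vq /= q2] t01; split; first exact: Vcx.
  move: t01 => /andP[t0 t1]; rewrite /= !mxE; have [->|tn1] := eqVneq u 1; first by lra.
  have : u < 1 by rewrite lt_neqAle tn1.
  by nra.
- by split; rewrite /Vc /= ?r0 ?vec3E// oppr_lt0.
- by apply: osheet_sheet gP => p [].
- exact: osheet_sheet fP.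
have UV p : (Up `|` Um) p -> Vc p -> Vu p \/ Vd p.
  rewrite /Up /Um /= => h Vp; move: h; rewrite oV// addr0 sub0r oppr_gt0.
  by case; [left|right].
have glue (u v : V3 -> C) : (forall p, (Up `|` Um) p -> climit u (nbhs p) (u p)) ->
    (forall p, Vc p -> climit v (nbhs p) (v p)) ->
    (forall p, Vu p -> v p = u p) -> (forall p, Vd p -> v p = u p) ->
    exists x : V3 -> C, [/\ forall p, (Up `|` Um) p -> x p = u p,
      forall p, Vc p -> x p = v p &
      forall p, ~ round_circle p -> climit x (nbhs p) (x p)].
  move=> uc vc vu vd; pose x p := if pselect (Vc p) then v p else u p.
  have xU p : (Up `|` Um) p -> x p = u p.
    by rewrite /x; case: pselect => // Vp UUp; case: (UV _ UUp Vp) => [/vu|/vd].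
  have xV p : Vc p -> x p = v p by rewrite /x; case: pselect.
  exists x; split => // p /circle_compl [UUp|Vp].
    rewrite xU//; apply: climit_near (uc _ UUp).
    have nU : \forall q \near p, (Up `|` Um) q.
      by have := openU open_Up open_Um; rewrite openE; apply.
    by apply: filterS nU => q Uq; rewrite xU.
  rewrite xV//; apply: climit_near (vc _ Vp).
  have nV : \forall q \near p, Vc q by move: open_Vc; rewrite openE; apply.
  by apply: filterS nV => q Vq; rewrite xV.
have [[j stj]|nfix] := pselect (exists j, s j = t j).
  left; have [||||x [xU xV xc]] := glue (f (s j)) (g j).
  - by move=> p /fP [].
  - by move=> p /gP [].
  - by move=> p Vup; rewrite sP.
  - by move=> p Vdp; rewrite tP// stj.
  exists x => p nC; split; last exact: xc.
  have /circle_compl [UUp|Vp] := nC; first by rewrite xU//; have [] := fP _ UUp.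
  by rewrite xV//; have [] := gP _ Vp.
right.
pose disc (h : 'I_3 -> V3 -> C) p := (h 0 p - h 1 p) * (h 1 p - h 2 p) * (h 2 p - h 0 p).
have disc_cts (h : 'I_3 -> V3 -> C) (p : V3) : (forall j, climit (h j) (nbhs p) (h j p)) ->
    climit (disc h) (nbhs p) (disc h p).
  by move=> hc; apply: climitM; [apply: climitM|]; apply: climitB.
have disc_sq (U : set V3) (h : 'I_3 -> V3 -> C) (p : V3) : osheet Z W h U -> U p ->
    disc h p ^+ 2 = 108%:R * (Z p ^+ 3 - W p ^+ 2).
  by move=> oh Upp; have [h1 h2 h3 _] := oh _ Upp; exact: (@cubic_disc _ (Z p) (W p) (h ^~ p)).
have disc_cycle (h : 'I_3 -> V3 -> C) (u v : 'I_3 -> 'I_3) p : injective u ->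
    injective v -> (forall j, u j <> v j) ->
    disc (fun j => h (u j)) p = disc (fun j => h (v j)) p.
  move=> ui vi uv.
  have u01 : u 0 <> u 1 by move/ui. have u12 : u 1 <> u 2 by move/ui.
  have u02 : u 0 <> u 2 by move/ui.
  have v01 : v 0 <> v 1 by move/vi. have v12 : v 1 <> v 2 by move/vi.
  have v02 : v 0 <> v 2 by move/vi.
  move: (uv 0) (uv 1) (uv 2) u01 u12 u02 v01 v12 v02; rewrite /disc {uv ui vi}.
  by case: (ord3 (u 0)) => ->; case: (ord3 (u 1)) => ->; case: (ord3 (u 2)) => -> //;
    case: (ord3 (v 0)) => ->; case: (ord3 (v 1)) => ->; case: (ord3 (v 2)) => -> //;
    move=> *; ring.
have [||||d [dU dV dc]] := glue (disc (fun j => f (s j))) (disc g).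
- by move=> p /fP [_ _ _ h]; apply: disc_cts => j; exact: h.
- by move=> p /gP [_ _ _ h]; apply: disc_cts => j; exact: h.
- by move=> p Vup; rewrite /disc !sP.
- move=> p Vdp; rewrite (disc_cycle f s t) //; last first.
    by move=> j e; apply: nfix; exists j.
  by rewrite /disc !tP.
exists d => p nC; split; last exact: dc.
have /circle_compl [UUp|Vp] := nC; last by rewrite dV// (disc_sq _ _ _ gP).
rewrite dU// (disc_sq (Up `|` Um))// => q /fP [h1 h2 h3 h4].
have [r _ rK] := injF_bij si; split => //.
- by move=> x /h2 [j ->]; exists (r j); rewrite rK.
- by move=> i j /h3 /si.
Qed.

End Unknot.

(** * The trefoil as a discriminant locus *)

Section Trefoil.
Variable R : realType.
Local Notation V3 := 'rV[R]_3.
Local Notation C := R[i].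
Local Notation Re := complex.Re.
Local Notation Im := complex.Im.

Definition cis (t : R) : C := Complex (cos t) (sin t).

Lemma cisD s t : cis (s + t) = cis s * cis t.
Proof. by apply: complex_ext; rewrite ?ReM ?ImM /= ?cosD ?sinD; ring. Qed.

Lemma cisX t n : cis (n%:R * t) = cis t ^+ n.
Proof.
elim: n => [|n IH]; first by rewrite mul0r /cis cos0 sin0.
by rewrite -natr1 mulrDl mul1r cisD IH exprSr.
Qed.

Lemma sqn_cis t : sqn (cis t) = 1.
Proof. by rewrite /sqn /= cos2Dsin2. Qed.

Lemma cis_neq0 t : cis t != 0.
Proof. by rewrite -sqn_gt0 sqn_cis. Qed.

Lemma cis_cts (T : Type) (F : set_system T) {FF : Filter F} (f : T -> R) a :
  f @ F --> a -> climit (fun t => cis (f t)) F (cis a).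
Proof. by move=> fa; split; [exact: tendscos|exact: tendssin]. Qed.

Let rad (p : V3) : R := Num.sqrt (p 0 0 ^+ 2 + p 0 1 ^+ 2).
Let dist (p : V3) : R := Num.sqrt ((rad p - 2) ^+ 2 + p 0 2 ^+ 2).
(** A cut-off, 1 where [dist] is at most 1 and 0 where it is at least 3/2. *)
Let bump (p : V3) : R := Num.max 0 (Num.min 1 (3 - 2 * dist p)).
(** The guard 1/2 avoids a division by zero on the axis; wherever [bump] is non-zero, [rad] is at
    least 1/2. *)
Let scale (p : V3) : R := bump p * (Num.max (rad p) 2^-1)^-1.

(* The closed tube [dist p <= 3/2] around the core circle [rad p = 2] avoids
   the axis.  In it the cubic X^3 - 3 Z X + 2 W is, up to the cut-off, the
   cubic with Z = e^(i phi) and W the complex coordinate of the meridian disk;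
   its discriminant vanishes exactly on W^2 = Z^3, which is the trefoil. *)
Definition Zt (p : V3) : C := Complex (scale p * p 0 0) (scale p * p 0 1).
Definition Wt (p : V3) : C := Complex (rad p - 2) (p 0 2).

Let rad_ge0 p : 0 <= rad p. Proof. exact: sqrtr_ge0. Qed.
Let dist_ge0 p : 0 <= dist p. Proof. exact: sqrtr_ge0. Qed.

Let rad_cts (p : V3) : rad @ nbhs p --> rad p.
Proof. by rewrite /rad; tends. Qed.

Let dist_cts (p : V3) : dist @ nbhs p --> dist p.
Proof. by have := @rad_cts p; rewrite /dist => ?; tends. Qed.

Let max_gt0 (p : V3) : 0 < Num.max (rad p) 2^-1.
Proof. by rewrite lt_max invr_gt0 ltr0n orbT. Qed.

Let scale_cts (p : V3) : scale @ nbhs p --> scale p.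
Proof.
have h1 := @rad_cts p; have h2 := @dist_cts p; have h3 := lt0r_neq0 (@max_gt0 p).
by rewrite /scale /bump; tends.
Qed.

Lemma Zt_cts (p : V3) : climit Zt (nbhs p) (Zt p).
Proof. by have := @scale_cts p => ?; split => /=; tends. Qed.

Lemma Wt_cts (p : V3) : climit Wt (nbhs p) (Wt p).
Proof. by have := @rad_cts p => ?; split => /=; tends. Qed.

Let sqn_Wt p : sqn (Wt p) = dist p ^+ 2.
Proof. by rewrite /sqn /dist sqr_sqrtr ?addr_ge0 ?sqr_ge0. Qed.

Let rad2 p : rad p ^+ 2 = p 0 0 ^+ 2 + p 0 1 ^+ 2.
Proof. by rewrite sqr_sqrtr ?addr_ge0 ?sqr_ge0. Qed.

Let sqn_Zt p : sqn (Zt p) = (scale p * rad p) ^+ 2.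
Proof. by rewrite /sqn /= !exprMn rad2; ring. Qed.

Let dist2 p : dist p ^+ 2 = (rad p - 2) ^+ 2 + p 0 2 ^+ 2.
Proof. by rewrite sqr_sqrtr ?addr_ge0 ?sqr_ge0. Qed.

Let rad_tube p : dist p <= 3 / 2 -> 2^-1 <= rad p.
Proof.
move=> d; rewrite leNgt; apply/negP => r; have := dist_ge0 p; have := dist2 p.
by have := sqr_ge0 (p 0 2); have := rad_ge0 p; nra.
Qed.

Let scale_tube p : dist p <= 3 / 2 -> scale p * rad p = bump p.
Proof.
move=> d; have r := rad_tube d; rewrite /scale (max_idPl r) divfK//.
by rewrite gt_eqF// (lt_le_trans _ r)// invr_gt0.
Qed.

(** Comparing moduli gives bump^6 = dist^4. Since [bump] is at most 1, and equal to 1 when [dist] is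
    less than 1, this forces [dist] to be 1. There z and w are unimodular, and w / z has square z
    and cube w, so its argument is the parameter on the trefoil. *)
Lemma Zt_Wt_trefoil p : Zt p ^+ 3 = Wt p ^+ 2 -> standard_trefoil p.
Proof.
move=> ZW.
have d32 : dist p <= 3 / 2.
  rewrite leNgt; apply/negP => d; have b0 : bump p = 0.
    by rewrite /bump; apply/max_idPl; rewrite ge_min; apply/orP; right; lra.
  have Z0 : Zt p = 0 by rewrite /Zt /scale b0 !mul0r.
  move: ZW; rewrite Z0 expr0n/= => /esym/eqP; rewrite sqrf_eq0 -sqn_eq0 sqn_Wt.
  by rewrite sqrf_eq0; lra.
have S3 : bump p ^+ 6 = dist p ^+ 4.
  have : sqn (Zt p ^+ 3) = sqn (Wt p ^+ 2) by rewrite ZW.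
  rewrite !exprS !expr0 !mulr1 !sqnM sqn_Zt sqn_Wt scale_tube// => e.
  by transitivity (bump p ^+ 2 * (bump p ^+ 2 * bump p ^+ 2)); [ring|rewrite e; ring].
have d0 := dist_ge0 p.
have d1 : dist p = 1.
  apply/eqP; rewrite eq_le; apply/andP; split; rewrite leNgt; apply/negP => d.
    have b1 : 0 <= bump p <= 1.
      by rewrite /bump le_max lexx/= ge_max ler01/= ge_min lexx.
    have : bump p ^+ 6 <= 1 by case/andP: b1 => ? ?; exact: exprn_ile1.
    by rewrite S3 leNgt exprn_egt1.
  have b1 : bump p = 1.
    rewrite /bump (_ : Num.min 1 _ = 1); first by apply/max_idPr.
    by apply/min_idPl; lra.
  by move: S3; rewrite b1 expr1n => /esym/eqP; rewrite lt_eqF// exprn_ilt1.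
have b1 : bump p = 1 by rewrite /bump d1 (_ : 3 - 2 * 1 = 1) ?minxx; [apply/max_idPr|lra].
have t32 : dist p <= 3 / 2 by [].
have r0 : 0 < rad p by apply: lt_le_trans (rad_tube t32); rewrite invr_gt0.
have sc : scale p = (rad p)^-1.
  by apply: (mulIf (lt0r_neq0 r0)); rewrite scale_tube// b1 mulVf// gt_eqF.
pose z := Zt p; pose w := Wt p.
have z1 : sqn z = 1 by rewrite sqn_Zt scale_tube// b1 expr1n.
have w1 : sqn w = 1 by rewrite sqn_Wt d1 expr1n.
pose zc : C := Complex (Re z) (- Im z).
have zz : z * zc = 1.
  by apply: complex_ext; rewrite ?ReM ?ImM /= ?mulrN ?opprK -?expr2 -/(sqn z) ?z1//; ring.
pose tau := w * zc.
have tau2 : tau ^+ 2 = z.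
  transitivity (w ^+ 2 * zc ^+ 2); first by rewrite /tau exprMn.
  rewrite -ZW -/z; transitivity (z * (z * zc) ^+ 2); first by ring.
  by rewrite zz expr1n mulr1.
have tau3 : tau ^+ 3 = w.
  rewrite exprSr tau2 /tau mulrCA zz mulr1//.
have [|t [t0 ct st]] := @polar R (Re tau) (Im tau).
  rewrite -/(sqn tau) /tau sqnM w1 mul1r -z1 /zc /sqn /=; ring.
have tauE : tau = cis t by apply: complex_ext.
exists t; first by rewrite /= in_itv.
have c3 : cis (3 * t) = w by rewrite cisX -tauE.
have c2 : cis (2 * t) = z by rewrite cisX -tauE.
have [e1 e2] : cos (3 * t) = rad p - 2 /\ sin (3 * t) = p 0 2.
  by have := c3; rewrite /cis /w /Wt => -[].
have [e3 e4] : rad p * cos (2 * t) = p 0 0 /\ rad p * sin (2 * t) = p 0 1.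
  have := c2; rewrite /cis /z /Zt sc => -[-> ->].
  by rewrite !mulVKf// gt_eqF.
by apply: vec3_ext; rewrite !mxE /= ?e1 ?e2 // addrC subrK.
Qed.

Let trefoil_dist p : standard_trefoil p -> dist p = 1.
Proof.
move=> [t _ <-].
have r : rad (\row_j [:: (2 + cos (3 * t)) * cos (2 * t);
    (2 + cos (3 * t)) * sin (2 * t); sin (3 * t)]`_j) = 2 + cos (3 * t).
  rewrite /rad !mxE /= !exprMn -mulrDr cos2Dsin2 mulr1 sqrtr_sqr ger0_norm//.
rewrite /dist r !mxE /= (_ : 2 + cos (3 * t) - 2 = cos (3 * t)); last by ring.
by rewrite cos2Dsin2 sqrtr1.
Qed.

Lemma trefoil_regular p : ~ standard_trefoil p -> regular_at Zt Wt p.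
Proof.
move=> nT; split; [exact: Zt_cts|exact: Wt_cts|].
by apply/eqP => /Zt_Wt_trefoil.
Qed.

(** [L1] is a meridian of the tube of radius 3/2 and [L2] the core of the tube. Along [L1] the cubic
    is X^3 + 3 e^(it), whose roots are permuted cyclically; along [L2] it is X^3 - 3 e^(it) X, where
    two roots are exchanged. *)
Let L1 (t : R) : V3 := vec3 (2 + 3 / 2 * cos t) 0 (3 / 2 * sin t).
Let L2 (t : R) : V3 := vec3 (2 * cos t) (2 * sin t) 0.

Let L1_cts (t : R) : L1 @ nbhs t --> L1 t.
Proof. by rewrite /L1; apply: tends_vec3; tends. Qed.

Let L2_cts (t : R) : L2 @ nbhs t --> L2 t.
Proof. by rewrite /L2; apply: tends_vec3; tends. Qed.

Let L1_rad t : rad (L1 t) = 2 + 3 / 2 * cos t.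
Proof.
rewrite /rad !vec3E expr0n addr0 sqrtr_sqr ger0_norm//.
by have := cos_geN1 t; lra.
Qed.

Let L1_dist t : dist (L1 t) = 3 / 2.
Proof.
rewrite /dist L1_rad vec3E.
rewrite (_ : _ + _ = (3 / 2) ^+ 2 * (cos t ^+ 2 + sin t ^+ 2)); last by ring.
by rewrite cos2Dsin2 mulr1 sqrtr_sqr ger0_norm.
Qed.

Let L2_rad t : rad (L2 t) = 2.
Proof. by rewrite /rad !vec3E !exprMn -mulrDr cos2Dsin2 mulr1 sqrtr_sqr ger0_norm. Qed.

Let L2_dist t : dist (L2 t) = 0.
Proof. by rewrite /dist L2_rad vec3E subrr expr0n addr0 sqrtr0. Qed.

Let L1_Z t : Zt (L1 t) = 0.
Proof.
have b0 : bump (L1 t) = 0.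
  by rewrite /bump L1_dist; apply/max_idPl; rewrite ge_min; apply/orP; right; lra.
by rewrite /Zt /scale b0 !mul0r.
Qed.

Let L2_Z t : Zt (L2 t) = cis t.
Proof.
have b1 : bump (L2 t) = 1.
  by rewrite /bump L2_dist mulr0 subr0 (_ : Num.min 1 3 = 1) ?(max_idPr _)//; apply/min_idPl; lra.
rewrite /Zt /scale b1 L2_rad (_ : Num.max _ _ = 2); last by apply/max_idPl; lra.
by rewrite !vec3E mul1r !mulKf.
Qed.

Let L1_off t : ~ standard_trefoil (L1 t).
Proof. by move/trefoil_dist; rewrite L1_dist; lra. Qed.

Let L2_off t : ~ standard_trefoil (L2 t).
Proof. by move/trefoil_dist; rewrite L2_dist; lra. Qed.

Let line_unique (Z W : R -> C) (x y : R -> C) :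
  (forall t, regular_at Z W t) ->
  (forall t, cubic (Z t) (W t) (x t) = 0) ->
  (forall t, cubic (Z t) (W t) (y t) = 0) ->
  (forall t : R, climit x (nbhs t) (x t)) ->
  (forall t : R, climit y (nbhs t) (y t)) -> x 0 = y 0 -> forall t, x t = y t.
Proof.
move=> reg x0 y0 xc yc xy0 t.
have wl (f : R -> C) (s : R) : climit f (nbhs s) (f s) -> within_climit setT f s.
  by move=> [fr fi]; split; apply: cvg_within_filter; [exact: fr|exact: fi].
apply: (@root_unique _ _ Z W setT) => //.
- apply/connected_intervalP => a b _ _ c _; done.
- by move=> s _; exact: wl.
- by move=> s _; exact: wl.
- by exists 0.
Qed.

(** The homeomorphism would transport [unknot_alternative] to the complement of the trefoil. A
    continuous root is refuted along [L1] and a continuous square root of the discriminant along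
    [L2]. *)
Lemma trefoil_nontrivial (f g : V3 -> V3) : continuous f -> continuous g ->
  cancel f g -> cancel g f -> f @` (@standard_trefoil R) <> @round_circle R.
Proof.
move=> fc gc fK gK fT.
have pi2 : 2 * pi = pi *+ 2 :> R by rewrite mulr_natl.
have offf p : ~ standard_trefoil p -> ~ @round_circle R (f p).
  by rewrite -fT => nT [q Tq /(can_inj fK) qp]; apply: nT; rewrite -qp.
have offg p : ~ @round_circle R p -> ~ standard_trefoil (g p).
  by move=> nC Tg; apply: nC; rewrite -fT; exists (g p).
have [|[x xP]|[d dP]] := @unknot_alternative R (Zt \o g) (Wt \o g).
- move=> p /offg /trefoil_regular [h1 h2 h3]; split => //.
    by apply: (climit_comp _ (gc p) h1).
  by apply: (climit_comp _ (gc p) h2).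
- pose y t := x (f (L1 t)).
  have yP t : y t ^+ 3 = - 3%:R * cis t.
    have [h _] := xP _ (offf _ (@L1_off t)).
    move: h; rewrite /cubic /= fK L1_Z mulr0 mul0r subr0 -/(y t) => /eqP.
    rewrite addr_eq0 => /eqP ->.
    by apply: complex_ext; rewrite ?ReN ?ImN ?ReM ?ImM ?ReN ?ImN /= ?L1_rad ?vec3E; field.
  have yc (t : R) : climit y (nbhs t) (y t).
    have [_ h] := xP _ (offf _ (@L1_off t)).
    apply: (climit_comp _ _ h); apply: (cvg_comp _ _ (L1_cts (t := t))); exact: fc.
  pose k := y 0.
  have k3 : k ^+ 3 = - 3%:R by rewrite /k yP /cis cos0 sin0 mulr1.
  have w3 t : (k * cis (t / 3)) ^+ 3 = - 3%:R * cis t.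
    by rewrite exprMn k3 -cisX (_ : 3%:R * (t / 3) = t)//; field.
  (* Lifted to the line, the root must be k e^(it/3), which has not returned to k at t = 2 pi. *)
  have E := @line_unique (fun=> 0) (fun t => (3%:R / 2%:R) * cis t) y (fun t => k * cis (t / 3)).
  have {E} : y (2 * pi) = k * cis (2 * pi / 3).
    apply: E => //.
    + move=> t; split; first exact: climit_cst.
        by apply: climitM; [exact: climit_cst|apply: cis_cts; exact: cvg_id].
      by rewrite expr0n/= eq_sym sqrf_eq0 !mulf_neq0 ?cis_neq0 ?invr_eq0 ?pnatr_eq0.
    + move=> t; rewrite /cubic yP; have : (2%:R : C) != 0 by rewrite pnatr_eq0.
      by move=> n2; field.
    + move=> t; rewrite /cubic w3; have : (2%:R : C) != 0 by rewrite pnatr_eq0.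
      by move=> n2; field.
    + move=> t; apply: climitM; first exact: climit_cst.
      by apply: cis_cts; tends.
    + by rewrite mul0r /cis cos0 sin0 mulr1.
  have -> : y (2 * pi) = k by rewrite /k /y /L1 pi2 cos2pi sin2pi cos0 sin0.
  have k0 : k != 0.
    apply/eqP => k0; move: k3; rewrite k0 expr0n/= => /eqP.
    by rewrite eq_sym oppr_eq0 pnatr_eq0.
  rewrite -[LHS]mulr1 => /(mulfI k0) /(congr1 (@complex.Re R)) /= c1.
  have p0 := @pi_gt0 R.
  have := @cos_inj R 0 (2 * pi / 3); rewrite !in_itv /= => inj.
  suff : 0 = 2 * pi / 3 :> R by lra.
  by apply: inj; [lra|lra|rewrite cos0].
- pose y t := d (f (L2 t)).
  have yP t : y t ^+ 2 = 108%:R * cis (3 * t).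
    have [h _] := dP _ (offf _ (@L2_off t)).
    rewrite /y h /= fK L2_Z cisX.
    have -> : Wt (L2 t) = 0 by rewrite /Wt L2_rad vec3E subrr.
    by rewrite expr0n/= subr0.
  have yc (t : R) : climit y (nbhs t) (y t).
    have [_ h] := dP _ (offf _ (@L2_off t)).
    apply: (climit_comp _ _ h); apply: (cvg_comp _ _ (L2_cts (t := t))); exact: fc.
  pose k := y 0.
  have k2 : k ^+ 2 = 108%:R by rewrite /k yP mulr0 /cis cos0 sin0 mulr1.
  have w2 t : (k * cis (3 / 2 * t)) ^+ 2 = 108%:R * cis (3 * t).
    by rewrite exprMn k2 -cisX (_ : 2%:R * (3 / 2 * t) = 3 * t)//; field.
  (* A square root of 108 e^(3it) is a non-zero root of X^3 - 3 Z X for Z = 36 e^(3it), so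
     uniqueness of continuous roots applies to it too. It changes sign after one turn. *)
  have E := @line_unique (fun t => 36%:R * cis (3 * t)) (fun=> 0) y (fun t => k * cis (3 / 2 * t)).
  have {E} : y (2 * pi) = k * cis (3 / 2 * (2 * pi)).
    apply: E => //.
    + move=> t; split.
      * apply: (@climitM _ _ _ _ (fun=> _) _ (36%:R)); first exact: climit_cst.
        apply: cis_cts; tends.
      * exact: climit_cst.
      * by rewrite expr0n/= expf_eq0/= mulf_neq0 ?cis_neq0 ?pnatr_eq0.
    + move=> t; rewrite /cubic mulr0 addr0 exprSr yP; ring.
    + move=> t; rewrite /cubic mulr0 addr0 exprSr w2; ring.
    + move=> t; apply: climitM; first exact: climit_cst.
      by apply: cis_cts; tends.
    + by rewrite mulr0 /cis cos0 sin0 mulr1.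
  have -> : y (2 * pi) = k by rewrite /k /y /L2 pi2 cos2pi sin2pi cos0 sin0.
  have k0 : k != 0.
    apply/eqP => k0; move: k2; rewrite k0 expr0n/= => /eqP.
    by rewrite eq_sym pnatr_eq0.
  rewrite -[LHS]mulr1 => /(mulfI k0) /(congr1 (@complex.Re R)) /=.
  have -> : 3 / 2 * (2 * pi) = pi + pi *+ 2 :> R by rewrite -mulr_natl; field.
  by rewrite cosD cospi sin2pi cos2pi mulr0 subr0; lra.
Qed.

End Trefoil.

(** * Homeomorphisms of pairs *)

Section Topology.
Implicit Types (U V W : topologicalType).

(** The local form of the fact that a proper surjection is a quotient map: near [y] all preimages
    can be taken in the compact [K], where a point either maps to [y], so that [F] is under control,
    or is separated from [y]. The filter [N] is left free to allow neighbourhoods within a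
    subset. *)
Lemma quotient_tends U V W (X K : set U) (N : set_system V) {FN : Filter N} (q : U -> V) (F : U -> W)
    (G : V -> W) (y : V) : N --> y -> hausdorff_space V -> compact K -> K `<=` X ->
  (forall x, X x -> q @ within X (nbhs x) --> q x) ->
  (forall x, X x -> F @ within X (nbhs x) --> F x) ->
  (forall x, X x -> G (q x) = F x) ->
  (\forall y' \near N, exists2 x, K x & q x = y') ->
  G @ N --> G y.
Proof.
move=> Ny hV Kc KX qc Fc GqF Kq A Ay.
have /compact_near_coveringP cov := Kc.
have [P PE] : exists P : V -> U -> Prop, P = (fun y' x => K x -> q x = y' -> A (G y')).
  by eexists.
have : \forall y' \near N, K `<=` P y'.
  apply: cov => x Kx; rewrite PE; have Xx := KX _ Kx.
  have [qxy|qxy] := eqVneq (q x) y.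
    have AF : nbhs (F x) A by rewrite -GqF// qxy.
    have /= := Fc x Xx _ AF; rewrite /nbhs /= => h.
    exists ([set x' | X x' -> A (F x')], setT) => /=; first by split => //; exact: filterT.
    by move=> [x' y'] [/= AFx _ Kx' <-]; rewrite GqF; [exact/AFx/KX|exact: KX].
  have := hV; rewrite open_hausdorff => /(_ _ _ qxy) [[B C] /= [xB yC] [oB oC BC]].
  have nB : nbhs (q x) B by apply: open_nbhs_nbhs; split => //; rewrite inE in xB.
  have nC : nbhs y C by apply: open_nbhs_nbhs; split => //; rewrite inE in yC.
  have /= := qc x Xx _ nB; rewrite /nbhs /= => h.
  exists ([set x' | X x' -> B (q x')], C) => /=.
    by split => //; exact: Ny.
  move=> [x' y'] [/= Bq Cy' Kx' qE]; exfalso.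
  suff : (B `&` C) y' by move/eqP: BC => ->.
  by split => //; rewrite -qE; exact/Bq/KX.
move=> near1; apply: filterS2 near1 Kq => y' KP [x Kx qx].
by have := KP x Kx; rewrite PE; apply.
Qed.

Lemma pair_homeo_sym U V (X A : set U) (Y B : set V) : A `<=` X ->
  pair_homeo X A Y B -> pair_homeo Y B X A.
Proof.
move=> AX [f [g [fc gc fX gf fA]]]; exists g, f; split => //.
- rewrite -fX; apply/seteqP; split => [_ [_ [x Xx <-] <-]|x Xx]; first by rewrite gf.
  by exists (f x); [exists x|exact: gf].
- by move=> y; rewrite -fX => -[x Xx <-]; rewrite gf.
- rewrite -fA; apply/seteqP; split => [_ [_ [x Ax <-] <-]|x Ax].
    by rewrite gf //; exact: AX.
  by exists (f x); [exists x|apply/gf/AX].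
Qed.

Lemma within_comp U V W (X : set U) (Y : set V) (f : U -> V) (g : V -> W) :
  {within X, continuous f} -> {within Y, continuous g} ->
  (forall x, X x -> Y (f x)) -> {within X, continuous (g \o f)}.
Proof.
move=> /subspace_continuousP fc /subspace_continuousP gc fXY.
apply/subspace_continuousP => x Xx; apply: (cvg_comp _ _ _ (gc _ (fXY _ Xx))).
move=> A; rewrite /within /= => /(fc x Xx).
by rewrite /within /= /nbhs /=; apply: filterS => z AYz Xz; apply: AYz => //; exact: fXY.
Qed.

Lemma pair_homeo_trans U V W (X A : set U) (Y B : set V) (Z C : set W) :
  pair_homeo X A Y B -> pair_homeo Y B Z C -> pair_homeo X A Z C.
Proof.
move=> [f [g [fc gc fX gf fA]]] [h [k [hc kc hY kh hB]]].
exists (h \o f), (g \o k); split.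
- by apply: within_comp fc hc _ => x Xx; rewrite -fX; exists x.
- apply: within_comp kc gc _ => z; rewrite -hY => -[y Yy <-]; rewrite kh//.
- by rewrite -hY -fX image_comp.
- by move=> x Xx /=; rewrite kh ?gf//; rewrite -fX; exists x.
- by rewrite -hB -fA image_comp.
Qed.

End Topology.

Section Rows.
Variable R : realType.

Lemma hausdorff_row n : hausdorff_space 'rV[R]_n.
Proof. exact: norm_hausdorff. Qed.

(** The inverse is continuous because, near each point of [Y], the map is already onto from a
    compact set. *)
Lemma pair_homeo_bij n m (X A : set 'rV[R]_n) (Y B : set 'rV[R]_m)
    (f : 'rV[R]_n -> 'rV[R]_m) :
  (forall x, X x -> f @ within X (nbhs x) --> f x) ->
  {in X &, injective f} -> f @` X = Y -> f @` A = B ->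
  (forall y, Y y -> exists2 K, compact K /\ K `<=` X &
    \forall y' \near within Y (nbhs y), exists2 x, K x & f x = y') ->
  pair_homeo X A Y B.
Proof.
move=> fc fI fX fA loc.
have /choice [g gP] : forall y, exists x, Y y -> X x /\ f x = y.
  move=> y; have [Yy|nY] := pselect (Y y); last by exists 0.
  by move: (Yy); rewrite -fX => -[x Xx <-]; exists x.
have gf x : X x -> g (f x) = x.
  move=> Xx; have [|? fgf] := gP (f x); first by rewrite -fX; exists x.
  by apply: fI => //; rewrite inE.
exists f, g; split => //; first exact/subspace_continuousP.
apply/subspace_continuousP => y Yy; have [K [Kc KX] near] := loc y Yy.
have id_c (x : 'rV[R]_n) : X x -> id @ within X (nbhs x) --> x.
  by move=> _; exact: cvg_within.
exact: (quotient_tends (@cvg_within _ _ _ _) (@hausdorff_row _) Kc KX fc id_c gf near).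
Qed.

Lemma pair_homeo_compact n m (X A : set 'rV[R]_n) (Y B : set 'rV[R]_m)
    (f : 'rV[R]_n -> 'rV[R]_m) : compact X ->
  (forall x, X x -> f @ within X (nbhs x) --> f x) ->
  {in X &, injective f} -> f @` X = Y -> f @` A = B -> pair_homeo X A Y B.
Proof.
move=> Xc fc fI fX fA; apply: (pair_homeo_bij fc) => // y Yy.
have sub y' : Y y' -> exists2 x, X x & f x = y'.
  by rewrite -fX => -[x Xx <-]; exists x.
exists X; [by split|exact: (filterS sub (near_withinT Y (nbhs_filter y)))].
Qed.

Lemma unknotted_compact n k m (X A : set 'rV[R]_n) (f : 'rV[R]_n -> 'rV[R]_k) :
  compact X -> (forall x, X x -> f @ within X (nbhs x) --> f x) ->
  {in X &, injective f} ->
  (forall x, X x -> unit_ball (f x)) ->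
  (forall y, unit_ball y -> exists2 x, X x & f x = y) ->
  A `<=` X ->
  (forall x, X x -> (A x <-> flat_disk m (f x))) -> unknotted_in R k m X A.
Proof.
move=> Xc fc fI fX fY AX fA; apply: (pair_homeo_compact Xc fc fI).
  apply/seteqP; split => [_ [x Xx <-]|y /fY [x Xx <-]]; first exact: fX.
  by exists x.
apply/seteqP; split => [_ [x Ax <-]|y yD]; first exact/fA/Ax/AX/Ax.
have [x Xx xy] := fY y (proj1 yD).
by exists x => //; apply/(fA x Xx); rewrite xy.
Qed.

Lemma compact_of_bounded n (X : set 'rV[R]_n) (M : R) : closed X ->
  (forall x, X x -> forall i, `|x 0 i| <= M) -> compact X.
Proof.
move=> Xc XM; apply: bounded_closed_compact => //.
exists (Num.max 0 M); split; first exact: num_real.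
move=> N; rewrite gt_max => /andP[N0 MN] x /XM xM /=.
have [x0|/mx_norm_neq0 [[i j] /= xE]] := eqVneq (mx_norm x) 0.
  by rewrite [leLHS]x0 ltW.
by rewrite [leLHS]xE (ord1 i) (le_trans (xM j)) // ltW.
Qed.

End Rows.

(** * Two strands over a circle *)

Section Fans.
Variable R : realType.
Local Notation V3 := 'rV[R]_3.

Lemma tends_null_bounded (T : Type) (F : set_system T) {FF : Filter F}
    (u l : T -> R) : (fun t => u t) @ F --> 0 -> (forall t, `|l t| <= 1) ->
  (fun t => u t * l t) @ F --> 0.
Proof.
move=> u0 l1; apply: norm_cvg0.
apply: (@squeeze_cvgr _ _ _ _ (cst 0) (fun t => `|u t|)).
- apply: nearW => t /=; rewrite normr_ge0 normrM /=.
  by rewrite -[leRHS]mulr1 ler_wpM2l.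
- exact: cvg_cst.
- by rewrite -(normr0 R); exact: tendsnorm.
Qed.

Definition ramp01 (t : R) : R := Num.max 0 (Num.min 1 t).

Lemma ramp01_itv t : 0 <= ramp01 t <= 1.
Proof.
rewrite /ramp01; have [h|h] := lerP 1 t.
  by rewrite (max_idPr ler01) ler01 lexx.
by have [h0|h0] := lerP 0 t; rewrite ?lexx ?ler01 ?h0 ?ltW.
Qed.

Lemma ramp01_0 t : t <= 0 -> ramp01 t = 0.
Proof.
by move=> t0; apply/max_idPl; rewrite ge_min t0 orbT.
Qed.

Lemma ramp01_1 t : 1 <= t -> ramp01 t = 1.
Proof. by move=> t1; rewrite /ramp01 (min_idPl t1); apply/max_idPr. Qed.

Lemma ramp01_id t : 0 <= t <= 1 -> ramp01 t = t.
Proof. by move=> /andP[t0 t1]; rewrite /ramp01 (min_idPr t1); apply/max_idPr. Qed.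

Lemma ramp01_le t u : t <= u -> ramp01 t <= ramp01 u.
Proof. by move=> tu; rewrite /ramp01 ge_max le_max lexx /= le_max orbC le_min !ge_min lexx tu !orbT. Qed.

(** Constant beyond [a] and [b], which may come in either order. If a = b the quotient is 0 and the
    value is [A]; this is why several lemmas ask for A = B in that case. *)
Definition interp (a b A B r : R) : R := A + (B - A) * ramp01 ((r - a) / (b - a)).

Lemma interp_l a b A B : interp a b A B a = A.
Proof. by rewrite /interp subrr mul0r ramp01_0// mulr0 addr0. Qed.

Lemma interp_r a b A B : (a = b -> A = B) -> interp a b A B b = B.
Proof.
move=> h; rewrite /interp; have [ab|ab] := eqVneq a b.
  by rewrite (h ab) subrr mul0r addr0.
by rewrite divff ?subr_eq0 1?eq_sym// ramp01_1// mulr1 addrCA subrr addr0.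
Qed.

Lemma interp_sym a b A B r : (a = b -> A = B) -> interp a b A B r = interp b a B A r.
Proof.
move=> h; rewrite /interp; have [ab|ab] := eqVneq a b.
  by rewrite (h ab) subrr !mul0r.
have ba : b - a != 0 by rewrite subr_eq0 eq_sym.
have -> : (r - b) / (a - b) = 1 - (r - a) / (b - a).
  by field; rewrite ba subr_eq0 ab.
set t := (r - a) / (b - a).
have -> : ramp01 (1 - t) = 1 - ramp01 t.
  have [t0|t0] := lerP t 0; first by rewrite ramp01_1 ?ramp01_0// ?subr0//; lra.
  have [t1|t1] := lerP 1 t; first by rewrite ramp01_0 ?ramp01_1// ?subrr//; lra.
  by rewrite !ramp01_id//; lra.
ring.
Qed.

Lemma interp_itv a b A B r : A <= B -> A <= interp a b A B r <= B.
Proof.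
by move=> AB; rewrite /interp; have := ramp01_itv ((r - a) / (b - a)); nra.
Qed.

Lemma interp_abs a b A B r : `|interp a b A B r| <= `|A| + `|B|.
Proof.
rewrite /interp; have := ramp01_itv ((r - a) / (b - a)); set t := ramp01 _ => /andP[t0 t1].
have -> : A + (B - A) * t = (1 - t) * A + t * B by ring.
rewrite (le_trans (ler_normD _ _))// !normrM (ger0_norm t0) ger0_norm ?subr_ge0//.
by have := normr_ge0 A; have := normr_ge0 B; nra.
Qed.

Lemma tends_ramp01 (T : Type) (F : set_system T) {FF : Filter F} (t : T -> R) a :
  t @ F --> a -> (fun x => ramp01 (t x)) @ F --> ramp01 a.
Proof. by move=> ta; rewrite /ramp01; tends. Qed.

(** Where a0 = b0 the quotient may have no limit, but its [ramp01] is bounded and is multiplied by B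
    - A, which tends to 0. *)
Lemma tends_interp (T : Type) (F : set_system T) {FF : Filter F}
    (a b A B r : T -> R) a0 b0 A0 B0 r0 : (a0 = b0 -> A0 = B0) ->
  a @ F --> a0 -> b @ F --> b0 -> A @ F --> A0 -> B @ F --> B0 -> r @ F --> r0 ->
  (fun t => interp (a t) (b t) (A t) (B t) (r t)) @ F --> interp a0 b0 A0 B0 r0.
Proof.
move=> h aF bF AF BF rF; apply: tendsD => //.
have [ab|ab] := eqVneq a0 b0; last first.
  apply: tendsM; first exact: tendsB.
  apply: tends_ramp01; apply: tendsdiv; first by rewrite subr_eq0 eq_sym.
    exact: tendsB.
  exact: tendsB.
rewrite (h ab) subrr mul0r; apply: tends_null_bounded.
  have z : 0 = B0 - A0 by rewrite (h ab) subrr.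
  by rewrite [X in _ --> X]z; exact: tendsB.
move=> t; have /andP[t0 t1] := ramp01_itv ((r t - a t) / (b t - a t)).
by rewrite ger0_norm.
Qed.

Section TwoStrands.
Variable L : R.
Hypothesis L0 : 0 < L.

(** A closed curve with parameter in [0, L], met exactly once by every ray from the origin. The
    pairs (r, s) are then generalized polar coordinates of the plane. *)
Definition fan (e0 e1 : R -> R) : Prop :=
  [/\ forall s : R, e0 @ nbhs s --> e0 s, forall s : R, e1 @ nbhs s --> e1 s,
      e0 L = e0 0 /\ e1 L = e1 0,
      forall s s' r r', 0 <= s <= L -> 0 <= s' <= L -> 0 < r -> 0 < r' ->
        r * e0 s = r' * e0 s' -> r * e1 s = r' * e1 s' ->
        r = r' /\ (s = s' \/ (s = 0 /\ s' = L) \/ (s = L /\ s' = 0)) &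
      (exists2 m, 0 < m & forall s, 0 <= s <= L -> m <= e0 s ^+ 2 + e1 s ^+ 2) /\
      forall u v, exists r s, [/\ 0 <= r, 0 <= s <= L, u = r * e0 s & v = r * e1 s]].

(** The coordinates of [p] are the radial factor, the parameter on the curve and the height. *)
Definition fan_pt (e0 e1 : R -> R) (p : V3) : V3 :=
  vec3 (p 0 0 * e0 (p 0 1)) (p 0 0 * e1 (p 0 1)) (p 0 2).

Definition fan_dom : set V3 := [set p : V3 | 0 <= p 0 0 /\ 0 <= p 0 1 <= L].

(** The identifications common to all fans: the axis r = 0, and the seam s = 0 with s = L. *)
Definition fan_eq (p p' : V3) : Prop :=
  [/\ p 0 0 = p' 0 0, p 0 2 = p' 0 2 & p 0 0 = 0 \/
    (p 0 1 = p' 0 1 \/ (p 0 1 = 0 /\ p' 0 1 = L) \/ (p 0 1 = L /\ p' 0 1 = 0))].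

Lemma fan_eqP f0 f1 p p' : fan f0 f1 -> fan_dom p -> fan_dom p' ->
  fan_pt f0 f1 p = fan_pt f0 f1 p' <-> fan_eq p p'.
Proof.
move=> [_ _ [eL0 eL1] inj [[m m0 mP] _]] [r0 sL] [r'0 s'L]; split => [E|[rE zE sE]].
  have E0 : p 0 0 * f0 (p 0 1) = p' 0 0 * f0 (p' 0 1).
    by move/rowP: E => /(_ 0); rewrite !vec3E.
  have E1 : p 0 0 * f1 (p 0 1) = p' 0 0 * f1 (p' 0 1).
    by move/rowP: E => /(_ 1); rewrite !vec3E.
  have E2 : p 0 2 = p' 0 2 by move/rowP: E => /(_ 2); rewrite !vec3E.
  have zero r s : 0 <= r -> 0 <= s <= L -> r * f0 s = 0 -> r * f1 s = 0 -> r = 0.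
    move=> rp sp a0 a1; apply/eqP; apply: contraT => rn.
    have := mP _ sp; have /eqP := a0; have /eqP := a1.
    by rewrite !mulf_eq0 (negPf rn) /= => /eqP -> /eqP ->; rewrite !expr0n/=; lra.
  have [a0|a0] := eqVneq (p 0 0) 0.
    have a0' : p' 0 0 = 0 by apply: (zero _ (p' 0 1)) => //; rewrite -?E0 -?E1 a0 mul0r.
    by split; [rewrite a0 a0'| |left].
  have [a0'|a0'] := eqVneq (p' 0 0) 0.
    have := zero _ _ r0 sL; rewrite E0 E1 a0' !mul0r => /(_ erefl erefl) a.
    by rewrite a eqxx in a0.
  have [||rE sE] := inj _ _ _ _ sL s'L _ _ E0 E1; first by rewrite lt_def a0.
    by rewrite lt_def a0'.
  by split => //; right.
by apply: vec3_ext; rewrite !vec3E // -rE; case: sE => [->|[->|[[-> ->]|[-> ->]]]];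
   rewrite ?mul0r // ?eL0 ?eL1.
Qed.

Lemma fan_cts f0 f1 p : fan f0 f1 -> fan_pt f0 f1 @ nbhs p --> fan_pt f0 f1 p.
Proof.
move=> [f0c f1c _ _ _]; apply: tends_vec3; last exact: tends_id.
  apply: tendsM; first exact: tends_id.
  by apply: tends_comp; [exact: f0c|exact: tends_id].
apply: tendsM; first exact: tends_id.
by apply: tends_comp; [exact: f1c|exact: tends_id].
Qed.

(** Two proper quotient maps of the same space with the same fibres have canonically homeomorphic
    images. *)
Lemma pair_homeo_quot (X K0 : set V3) (q Q : V3 -> V3) :
  (forall x, X x -> q @ within X (nbhs x) --> q x) ->
  (forall x, X x -> Q @ within X (nbhs x) --> Q x) ->
  (forall x x', X x -> X x' -> q x = q x' <-> Q x = Q x') ->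
  (forall y, exists2 x, X x & q x = y) -> (forall y, exists2 x, X x & Q x = y) ->
  (forall y : V3, exists2 K, compact K /\ K `<=` X &
    \forall y' \near y, forall x, X x -> q x = y' -> K x) ->
  (forall y : V3, exists2 K, compact K /\ K `<=` X &
    \forall y' \near y, forall x, X x -> Q x = y' -> K x) ->
  K0 `<=` X -> pair_homeo [set: V3] (q @` K0) [set: V3] (Q @` K0).
Proof.
move=> qc Qc qQ qs Qs qp Qp K0X.
have /choice [g gP] : forall y, exists x, X x /\ q x = y.
  by move=> y; have [x] := qs y; exists x.
have /choice [h hP] : forall y, exists x, X x /\ Q x = y.
  by move=> y; have [x] := Qs y; exists x.
have Gq x : X x -> Q (g (q x)) = Q x.
  by move=> Xx; have [Xg qg] := gP (q x); apply/qQ.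
have HQ x : X x -> q (h (Q x)) = q x.
  by move=> Xx; have [Xg qg] := hP (Q x); apply/qQ.
exists (Q \o g), (q \o h); split.
- apply: continuous_subspaceT => y; have [K [Kc KX] Kn] := qp y.
  apply: (quotient_tends (N := nbhs y) (@cvg_id _ _) (@hausdorff_row _ _) Kc KX qc Qc Gq).
  apply: filterS Kn => y' KP.
  by have [x Xx qx] := qs y'; exists x => //; exact: KP.
- apply: continuous_subspaceT => y; have [K [Kc KX] Kn] := Qp y.
  apply: (quotient_tends (N := nbhs y) (@cvg_id _ _) (@hausdorff_row _ _) Kc KX Qc qc HQ).
  apply: filterS Kn => y' KP.
  by have [x Xx qx] := Qs y'; exists x => //; exact: KP.
- apply/seteqP; split => // y _; have [x Xx <-] := Qs y.
  by exists (q x) => //=; rewrite Gq.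
- move=> y _ /=; have [Xg qg] := gP y.
  by rewrite HQ.
- apply/seteqP; split => [_ [_ [x Kx <-] <-]|_ [x Kx <-]] /=.
    by exists x => //; rewrite Gq//; exact: K0X.
  by exists (q x); [exists x|rewrite /= Gq//; exact: K0X].
Qed.

Lemma fan_box_compact (M : R) :
  compact [set p : V3 | fan_dom p /\ `|p 0 0| <= M /\ `|p 0 2| <= M].
Proof.
apply: (@compact_of_bounded _ _ _ (`|M| + L)); last first.
  move=> p [[r0 sL] [rM zM]] i; have := ler_norm M; have := normr_ge0 M.
  by case: (ord3 i) => ->; rewrite ?(ger0_norm (proj1 (andP sL))); lra.
have c i : continuous (fun p : V3 => p 0 i) by move=> p; exact: coord_continuous.
have cn i : continuous (fun p : V3 => `|p 0 i|).
  by apply: ctsI => p; apply: tendsnorm; exact: tends_id.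
rewrite (_ : mkset _ = ((fun p : V3 => p 0 0) @^-1` [set x | 0 <= x] `&`
   (fun p : V3 => p 0 1) @^-1` [set x | 0 <= x] `&`
   (fun p : V3 => p 0 1) @^-1` [set x | x <= L] `&`
   (fun p : V3 => `|p 0 0|) @^-1` [set x | x <= M] `&`
   (fun p : V3 => `|p 0 2|) @^-1` [set x | x <= M])).
  do ! apply: closedI; apply: preimage_closed; rewrite ?closed_le ?closed_ge//;
  by [exact: closed_le|exact: closed_ge|move=> ? _; exact: c|move=> ? _; exact: cn].
apply/seteqP; split => p /=.
  by move=> [[? /andP[? ?]] [? ?]].
by move=> [[[[? ?] ?] ?] ?]; split; split => //; apply/andP.
Qed.

Lemma bounded_proper (Q : V3 -> V3) y :
  (forall B, exists M, forall x, fan_dom x -> (forall i, `|Q x 0 i| <= B) ->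
     `|x 0 0| <= M /\ `|x 0 2| <= M) ->
  exists2 K, compact K /\ K `<=` fan_dom &
    \forall y' \near (y : V3), forall x, fan_dom x -> Q x = y' -> K x.
Proof.
pose B := `|y 0 0| + `|y 0 1| + `|y 0 2| + 1; move=> /(_ B) [M MP].
exists [set p : V3 | fan_dom p /\ `|p 0 0| <= M /\ `|p 0 2| <= M].
  by split; [exact: fan_box_compact|move=> p []].
have near_lt (i : 'I_3) : \forall y' \near nbhs y, `|(y' : V3) 0 i| < B.
  apply: (@cvgr_norm_lt R R^o _ (nbhs y) _ (fun q : V3 => q 0 i) (y 0 i)); first exact: tends_id.
  have := normr_ge0 (y 0 0); have := normr_ge0 (y 0 1); have := normr_ge0 (y 0 2).
  by rewrite /B; case: (ord3 i) => ->; lra.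
apply: filterS3 (near_lt 0) (near_lt 1) (near_lt 2) => y' h0 h1 h2 x Xx Qx.
split => //; apply: MP => // i; rewrite Qx; apply: ltW.
by case: (ord3 i) => ->.
Qed.

Lemma fan_proper f0 f1 y : fan f0 f1 ->
  exists2 K, compact K /\ K `<=` fan_dom &
    \forall y' \near (y : V3), forall x, fan_dom x -> fan_pt f0 f1 x = y' -> K x.
Proof.
move=> [_ _ _ _ [[m m0 mP] _]]; apply: bounded_proper => B.
exists (2 * B ^+ 2 / m + 1 + B) => x [r0 sL] xB; have zB := xB 2; rewrite vec3E in zB.
have aB := xB 0; have bB := xB 1; rewrite !vec3E in aB bB.
have B0 : 0 <= B by rewrite (le_trans _ zB).
have rm : (x 0 0) ^+ 2 * m <= 2 * B ^+ 2.
  have := mP _ sL; have := real_normK (num_real (x 0 0 * f0 (x 0 1))).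
  have := real_normK (num_real (x 0 0 * f1 (x 0 1))).
  have := normr_ge0 (x 0 0 * f1 (x 0 1)); have := normr_ge0 (x 0 0 * f0 (x 0 1)).
  move: (`|_|) (`|_|) aB bB => u v; rewrite !exprMn; nra.
have q0 : 0 <= 2 * B ^+ 2 / m by rewrite divr_ge0 ?mulr_ge0 ?sqr_ge0// ltW.
split; last by apply: (le_trans zB); lra.
rewrite ger0_norm//.
have : x 0 0 ^+ 2 <= 2 * B ^+ 2 / m by rewrite ler_pdivlMr.
by move: q0; move: (2 * B ^+ 2 / m) => q; nra.
Qed.

Variables (e0 e1 d0 d1 : R -> R).
Hypotheses (eF : fan e0 e1) (dF : fan d0 d1).

Variables (r1 r2 h1 h2 r1' r2' h1' h2' : R -> R).
Hypothesis r1c : continuous r1.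
Hypothesis r2c : continuous r2.
Hypothesis h1c : continuous h1.
Hypothesis h2c : continuous h2.
Hypothesis r1c' : continuous r1'.
Hypothesis r2c' : continuous r2'.
Hypothesis h1c' : continuous h1'.
Hypothesis h2c' : continuous h2'.
Hypothesis r_gt0 : forall s, 0 < r1 s /\ 0 < r2 s.
Hypothesis r_gt0' : forall s, 0 < r1' s /\ 0 < r2' s.
(** Each strand is continued by the other one across the seam, so that together they form one closed
    curve going twice round the axis. *)
Hypothesis swap : [/\ r1 L = r2 0, r2 L = r1 0, h1 L = h2 0 & h2 L = h1 0].
Hypothesis swap' : [/\ r1' L = r2' 0, r2' L = r1' 0, h1' L = h2' 0 & h2' L = h1' 0].
Hypothesis r_lt : forall s, (r1 s < r2 s) = (r1' s < r2' s).
Hypothesis r_gt : forall s, (r2 s < r1 s) = (r2' s < r1' s).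
Hypothesis crossing : forall s, r1 s = r2 s -> 0 < (h1 s - h2 s) * (h1' s - h2' s).

(** At a crossing this is the ratio (h1' - h2') / (h1 - h2), positive by [crossing]; the squared
    difference of the radii keeps it defined and positive elsewhere. Once heights are multiplied by
    it, the offsets [c1] and [c2] still to be added agree at crossings, where a single vertical line
    carries both points. *)
Let scale s := (`|(h1 s - h2 s) * (h1' s - h2' s)| + (r1 s - r2 s) ^+ 2) /
  ((h1 s - h2 s) ^+ 2 + (r1 s - r2 s) ^+ 2).

Let den_gt0 s : 0 < (h1 s - h2 s) ^+ 2 + (r1 s - r2 s) ^+ 2.
Proof.
have [/crossing c|] := eqVneq (r1 s) (r2 s).
  rewrite ltr_wpDr ?sqr_ge0// lt_def sqr_ge0 andbT sqrf_eq0.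
  by apply/eqP => z; rewrite z mul0r ltxx in c.
by move=> n; rewrite ltr_wpDl ?sqr_ge0// lt_def sqr_ge0 andbT sqrf_eq0 subr_eq0.
Qed.

Let scale_gt0 s : 0 < scale s.
Proof.
rewrite divr_gt0//.
have [/crossing c|] := eqVneq (r1 s) (r2 s).
  by rewrite ltr_wpDr ?sqr_ge0// normr_gt0 lt0r_neq0.
by move=> n; rewrite ltr_wpDl ?sqr_ge0// lt_def sqr_ge0 andbT sqrf_eq0 subr_eq0.
Qed.

Let c1 s := h1' s - scale s * h1 s.
Let c2 s := h2' s - scale s * h2 s.

Let c_eq s : r1 s = r2 s -> c1 s = c2 s.
Proof.
move=> e; have h := crossing e; have := den_gt0 s; rewrite /c1 /c2 /scale e subrr expr0n !addr0 => d0'.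
have n0 : h1 s - h2 s != 0 by move: d0'; rewrite lt_def sqrf_eq0 => /andP[].
rewrite gtr0_norm//; apply/eqP; rewrite -subr_eq0; apply/eqP; by field.
Qed.

Let lo s := Num.min (r1 s) (r2 s).
Let hi s := Num.max (r1 s) (r2 s).
Let lo' s := Num.min (r1' s) (r2' s).
Let hi' s := Num.max (r1' s) (r2' s).

Let ordered s : [/\ 0 < lo s, lo s <= hi s, 0 < lo' s, lo' s <= hi' s &
  (lo s < hi s) = (lo' s < hi' s)].
Proof.
have [a b] := r_gt0 s; have [a' b'] := r_gt0' s; have := r_lt s; have := r_gt s.
rewrite /lo /hi /lo' /hi'.
case: (ltrgtP (r1 s) (r2 s)) => [rr|rr|rr]; case: (ltrgtP (r1' s) (r2' s)) => rr' //;
 by split; lra.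
Qed.

(* The piecewise linear map of the half-line through (0,0), (lo,lo') and
   (hi,hi'), of slope 1 beyond. *)
Let radial s r := lo' s / lo s * Num.min r (lo s) +
  (interp (lo s) (hi s) 0 (hi' s - lo' s) r + Num.max 0 (r - hi s)).

(** Fades the vertical correction out towards the axis, where the map must not depend on [s]; it is
    1 from the inner strand on. *)
Let blend s r := Num.min 1 (r / lo s).
Let shift s r := interp (r1 s) (r2 s) (c1 s) (c2 s) r.
Let factor s r := 1 - blend s r + blend s r * scale s.

Let straighten (p : V3) : V3 := vec3 (radial (p 0 1) (p 0 0)) (p 0 1)
  (factor (p 0 1) (p 0 0) * p 0 2 + blend (p 0 1) (p 0 0) * shift (p 0 1) (p 0 0)).

Let target (p : V3) := fan_pt d0 d1 (straighten p).

Let c_comp (f : R -> R) : continuous f -> forall (T : Type) (F : set_system T),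
  Filter F -> forall (u : T -> R) a, u @ F --> a -> (fun t => f (u t)) @ F --> f a.
Proof. by move=> fc T F FF u a; apply: tends_comp; exact: fc. Qed.

Let scale_cts : continuous scale.
Proof.
apply: ctsI => s; apply: tendsdiv; first exact: lt0r_neq0.
  apply: tendsD; first apply: tendsnorm; last first.
    by apply: tendsX; apply: tendsB; [exact: r1c|exact: r2c].
  by apply: tendsM; apply: tendsB; [exact: h1c|exact: h2c|exact: h1c'|exact: h2c'].
by apply: tendsD; apply: tendsX; apply: tendsB; [exact: h1c|exact: h2c|exact: r1c|exact: r2c].
Qed.

Let c1_cts : continuous c1.
Proof.
by apply: ctsI => s; apply: tendsB; [exact: h1c'|apply: tendsM; [exact: scale_cts|exact: h1c]].
Qed.

Let c2_cts : continuous c2.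
Proof.
by apply: ctsI => s; apply: tendsB; [exact: h2c'|apply: tendsM; [exact: scale_cts|exact: h2c]].
Qed.

Let lo_cts : continuous lo.
Proof. by apply: ctsI => s; apply: tendsmin; [exact: r1c|exact: r2c]. Qed.
Let hi_cts : continuous hi.
Proof. by apply: ctsI => s; apply: tendsmax; [exact: r1c|exact: r2c]. Qed.
Let lo_cts' : continuous lo'.
Proof. by apply: ctsI => s; apply: tendsmin; [exact: r1c'|exact: r2c']. Qed.
Let hi_cts' : continuous hi'.
Proof. by apply: ctsI => s; apply: tendsmax; [exact: r1c'|exact: r2c']. Qed.

Let lo_neq0 s : lo s != 0.
Proof. by have [/lt0r_neq0] := ordered s. Qed.

Let gap_eq0 s : lo s = hi s -> 0 = hi' s - lo' s.
Proof. by have [_ _ _ a] := ordered s => b e; move: b a; rewrite e ltxx; case: ltgtP => //; lra. Qed.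

Section Continuity.
Context (T : Type) (F : set_system T) {FF : Filter F} (s r : T -> R) (s0 r0 : R).
Hypotheses (sF : s @ F --> s0) (rF : r @ F --> r0).

Let tends_radial : (fun t => radial (s t) (r t)) @ F --> radial s0 r0.
Proof.
apply: tendsD.
  apply: tendsM; last by apply: tendsmin => //; exact: c_comp.
  by apply: tendsdiv => //; [exact: c_comp|exact: c_comp].
apply: tendsD.
  apply: tends_interp => //; [exact: gap_eq0|exact: c_comp|exact: c_comp|exact: cvg_cst|].
  by apply: tendsB; exact: c_comp.
by apply: tendsmax; [exact: cvg_cst|apply: tendsB => //; exact: c_comp].
Qed.

Let tends_blend : (fun t => blend (s t) (r t)) @ F --> blend s0 r0.
Proof.
by apply: tendsmin; [exact: cvg_cst|apply: tendsdiv => //; exact: c_comp].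
Qed.

Let tends_shift : (fun t => shift (s t) (r t)) @ F --> shift s0 r0.
Proof.
by apply: tends_interp => //; [exact: c_eq|exact: c_comp..].
Qed.

Let tends_factor : (fun t => factor (s t) (r t)) @ F --> factor s0 r0.
Proof.
apply: tendsD; first by apply: tendsB => //; exact: cvg_cst.
by apply: tendsM => //; exact: c_comp.
Qed.

Lemma tends_straighten (z : T -> R) (z0 : R) : z @ F --> z0 ->
  (fun t => straighten (vec3 (r t) (s t) (z t))) @ F --> straighten (vec3 r0 s0 z0).
Proof.
move=> zF; under eq_fun do rewrite /straighten !vec3E.
rewrite /straighten !vec3E; apply: tends_vec3 => //.
by apply: tendsD; apply: tendsM.
Qed.

End Continuity.

Let target_cts p : target @ nbhs p --> target p.
Proof.
apply: (cvg_comp _ _ _ (fan_cts (p := straighten p) dF)).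
have E : straighten = fun q => straighten (vec3 (q 0 0) (q 0 1) (q 0 2)).
  by apply/funext => q; rewrite vec3_eta.
by rewrite E; apply: tends_straighten; exact: tends_id.
Qed.

Let radial0 s : radial s 0 = 0.
Proof.
have [l0 lh _ _ _] := ordered s; have h0 := lt_le_trans l0 lh.
rewrite /radial (min_idPl (ltW l0)) mulr0 add0r (max_idPl _) ?sub0r ?oppr_le0 ?ltW// addr0.
rewrite /interp add0r ramp01_0 ?mulr0// mulr_le0_ge0 ?invr_ge0 ?subr_ge0//; lra.
Qed.

Let radial_lo s : radial s (lo s) = lo' s.
Proof.
have [l0 lh _ _ _] := ordered s.
by rewrite /radial minxx divfK// interp_l add0r (max_idPl _) ?addr0 ?subr_le0.
Qed.

Let radial_hi s : radial s (hi s) = hi' s.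
Proof.
have [l0 lh _ _ _] := ordered s.
rewrite /radial (min_idPr lh) divfK// interp_r; last exact: gap_eq0.
by rewrite subrr maxxx addr0 addrCA subrr addr0.
Qed.

Let radial_lt s r r' : r < r' -> radial s r < radial s r'.
Proof.
have [l0 lh l0' lh' lt] := ordered s; move=> rr; rewrite /radial.
have k0 : 0 < lo' s / lo s by rewrite divr_gt0.
have gi : interp (lo s) (hi s) 0 (hi' s - lo' s) r <=
    interp (lo s) (hi s) 0 (hi' s - lo' s) r'.
  rewrite /interp !add0r ler_wpM2l ?subr_ge0// ramp01_le// ler_wpM2r ?invr_ge0 ?subr_ge0//.
  by rewrite lerD2r ltW.
have [rl|rl] := ltrP r (lo s).
  rewrite ltr_leD//; last by apply: lerD => //; rewrite ge_max le_max lexx /= le_max lerD2r (ltW rr) orbT.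
  by rewrite ltr_pM2l// lt_min rr /= (lt_le_trans _ (lexx _))// gt_min rl.
apply: ler_ltD; first by apply: ler_wpM2l; [exact: ltW|rewrite le_min lexx andbT (le_trans rl)// ltW].
have [rh|rh] := ltrP r (hi s); last first.
  by apply: ler_ltD => //; rewrite (max_idPr _) ?subr_ge0// lt_max ltrD2r rr orbT.
apply: ltr_leD; last by rewrite ge_max le_max lexx /= le_max lerD2r (ltW rr) orbT.
have gap0 : 0 < hi s - lo s by lra.
have gap0' : 0 < hi' s - lo' s by rewrite subr_gt0 -lt; lra.
rewrite /interp !add0r !subr0 ltr_pM2l// [ramp01 ((r - _) / _)]ramp01_id; last first.
  by rewrite ler_pdivrMr// mul1r lerD2r (ltW rh) divr_ge0 ?(ltW gap0)// subr_ge0.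
rewrite /ramp01 lt_max lt_min; apply/orP; right; apply/andP; split.
  by rewrite ltr_pdivrMr// mul1r ltrD2r.
by rewrite ltr_pM2r ?invr_gt0// ltrD2r.
Qed.

Let radial_ge s r : 0 <= r -> r - hi s <= radial s r.
Proof.
have [l0 lh l0' lh' lt] := ordered s; move=> r0.
rewrite /radial -[leLHS]add0r lerD//; first by apply: mulr_ge0; [exact: divr_ge0 (ltW _) (ltW _)|rewrite le_min r0 ltW].
rewrite -[leLHS]add0r lerD ?le_max ?lexx ?orbT//.
suff /andP[] : 0 <= interp (lo s) (hi s) 0 (hi' s - lo' s) r <= hi' s - lo' s by [].
by apply: interp_itv; rewrite subr_ge0.
Qed.

Let radial_inj s r r' : radial s r = radial s r' -> r = r'.
Proof.
by move=> e; case: (ltrgtP r r') => // /(radial_lt s); rewrite e ltxx.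
Qed.

Let blend_itv s r : 0 <= r -> 0 <= blend s r <= 1.
Proof.
move=> r0; have [l0 _ _ _ _] := ordered s.
by apply/andP; split; [rewrite le_min ler01 divr_ge0// ltW|rewrite ge_min lexx].
Qed.

Let blend0 s : blend s 0 = 0.
Proof. by rewrite /blend mul0r; apply/min_idPr. Qed.

Let blend1 s r : lo s <= r -> blend s r = 1.
Proof.
by move=> lr; have [l0 _ _ _ _] := ordered s; apply/min_idPl; rewrite ler_pdivlMr// mul1r.
Qed.

Let factor_gt0 s r : 0 <= r -> 0 < factor s r.
Proof.
move=> r0; have /andP[b0 b1] := blend_itv s r0; have := scale_gt0 s.
rewrite /factor; have [->|b] := eqVneq (blend s r) 0; first by rewrite mul0r; lra.
move=> k; apply: ltr_wpDl; first by rewrite subr_ge0.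
by rewrite mulr_gt0// lt_def b.
Qed.

Let ends : [/\ scale L = scale 0, lo L = lo 0, hi L = hi 0, lo' L = lo' 0 & hi' L = hi' 0].
Proof.
have [a b c d] := swap; have [a' b' c' d'] := swap'.
rewrite /scale /lo /hi /lo' /hi' a b c d a' b' c' d'; split; [|exact: minC|exact: maxC|exact: minC|exact: maxC].
congr ((`|_| + _) / (_ + _)); ring.
Qed.

Let ends_radial r : radial L r = radial 0 r.
Proof. by have [_ a b c d] := ends; rewrite /radial a b c d. Qed.
Let ends_blend r : blend L r = blend 0 r.
Proof. by have [_ a b c d] := ends; rewrite /blend a. Qed.
Let ends_factor r : factor L r = factor 0 r.
Proof. by have [a _ _ _ _] := ends; rewrite /factor ends_blend a. Qed.
(** Across the seam the strands change roles, and interpolation is symmetric in its two nodes. *)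
Let ends_shift r : shift L r = shift 0 r.
Proof.
have [k _ _ _ _] := ends; have [a b c d] := swap; have [a' b' c' d'] := swap'.
have k1 : c1 L = c2 0 by rewrite /c1 /c2 k c c'.
have k2 : c2 L = c1 0 by rewrite /c1 /c2 k d d'.
by rewrite /shift a b k1 k2; apply: interp_sym => /esym /c_eq.
Qed.

Let straighten_dom p : fan_dom p -> fan_dom (straighten p).
Proof.
move=> [r0 sL]; split; rewrite vec3E//.
move: r0; rewrite le_eqVlt => /predU1P[<-|/(radial_lt (p 0 1))]; first by rewrite radial0.
by rewrite radial0 => /ltW.
Qed.

Let radial_eq0 s r : 0 <= r -> radial s r = 0 -> r = 0.
Proof.
rewrite le_eqVlt => /predU1P[<-//|/(radial_lt s)]; rewrite radial0 => + e.
by rewrite e ltxx.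
Qed.

Let straighten_eq p p' : fan_dom p -> fan_dom p' ->
  fan_eq (straighten p) (straighten p') <-> fan_eq p p'.
Proof.
move=> [r0 sL] [r0' sL']; rewrite /fan_eq !vec3E; split => [[rE zE sE]|[rE zE sE]].
  have [z|nz] := eqVneq (p 0 0) 0.
    have z' : p' 0 0 = 0 by apply: (@radial_eq0 (p' 0 1)); rewrite // -rE z radial0.
    move: zE; rewrite z z' /factor !blend0 !mul0r !subr0 !addr0 !mul1r => zE.
    by split => //; left.
  have {}sE : p 0 1 = p' 0 1 \/ p 0 1 = 0 /\ p' 0 1 = L \/ p 0 1 = L /\ p' 0 1 = 0.
    by case: sE => // /(radial_eq0 r0) z; rewrite z eqxx in nz.
  have [eR eF' eB eS] : [/\ radial (p 0 1) =1 radial (p' 0 1), factor (p 0 1) =1 factor (p' 0 1),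
      blend (p 0 1) =1 blend (p' 0 1) & shift (p 0 1) =1 shift (p' 0 1)].
    by case: sE => [->|[[-> ->]|[-> ->]]]; split => r.
  rewrite eR in rE; have {}rE := radial_inj rE.
  split => //; last by right.
  move: zE; rewrite eF' eB eS rE => /addIr /mulfI; apply.
  by rewrite lt0r_neq0// factor_gt0.
split.
- case: sE => [z|[->|[[-> ->]|[-> ->]]]]; rewrite -?rE ?ends_radial//.
  by rewrite z !radial0.
- case: sE => [z|[->|[[-> ->]|[-> ->]]]]; rewrite -?rE ?zE ?ends_factor ?ends_blend ?ends_shift//.
  by rewrite z /factor !blend0 !mul0r !subr0.
- by case: sE => [->|?]; [left; rewrite radial0|right].
Qed.

Let straighten_surj q : fan_dom q -> exists2 p, fan_dom p & straighten p = q.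
Proof.
move=> [r0 sL]; set s := q 0 1.
have [hi0 _] : 0 < hi s /\ 0 < lo s by have [a b _ _ _] := ordered s; split => //; exact: lt_le_trans b.
have rc : continuous (radial s).
  apply: ctsI => r; have := @tends_straighten _ (nbhs r) _ (fun=> s) (fun t => t) s r.
  move=> /(_ (nbhs_filter r) (cvg_cst _) cvg_id (fun=> 0) 0 (cvg_cst _)) /(tendscoord (i := 0)).
  by under eq_fun do rewrite !vec3E; rewrite !vec3E.
have [|||r rI rE] := @IVT R (radial s) 0 (q 0 0 + hi s) (q 0 0).
- by rewrite addr_ge0// ltW.
- exact: continuous_subspaceT.
- rewrite radial0 ge_min r0 le_max; have := @radial_ge s (q 0 0 + hi s).
  by rewrite addrK => -> //; [rewrite orbT|rewrite addr_ge0// ltW].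
have r_ge0 : 0 <= r by move: rI; rewrite in_itv => /andP[].
exists (vec3 r s ((q 0 2 - blend s r * shift s r) / factor s r)).
  by split; rewrite vec3E.
apply: vec3_ext; rewrite !vec3E//.
by rewrite mulrC divfK ?subrK// lt0r_neq0// factor_gt0.
Qed.

(** The radius is controlled through [radial_ge], then the height because [factor] is bounded below,
    uniformly in [s] by compactness of [0, L]. *)
Let target_bound B : exists M, forall x, fan_dom x -> (forall i, `|target x 0 i| <= B) ->
     `|x 0 0| <= M /\ `|x 0 2| <= M.
Proof.
have [_ _ _ _ [[m m0 mP] _]] := dF.
have [||sM _ sP] := @EVT_max R (fun s => hi s + (`|c1 s| + `|c2 s|) + (scale s)^-1) 0 L.
- exact: ltW.
- apply: continuous_subspaceT; apply: ctsI => s; apply: tendsD; last first.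
    by apply: tendsV; [exact: lt0r_neq0|exact: scale_cts].
  by apply: tendsD; [exact: hi_cts|apply: tendsD; apply: tendsnorm; [exact: c1_cts|exact: c2_cts]].
set N := (_ + _ + _) in sP.
exists ((2 * B ^+ 2 / m + 1 + N) + (B + N) * (N + 1)) => x [r0 sL] xB.
have zB := xB 2; have aB := xB 0; have bB := xB 1; rewrite !vec3E in zB aB bB.
have := sP (x 0 1); rewrite in_itv => /(_ sL).
set s := x 0 1 in sL zB aB bB *; set r := x 0 0 in r0 zB aB bB *.
have hi0 : 0 < hi s by have [a b _ _ _] := ordered s; exact: lt_le_trans b.
have iv0 : 0 < (scale s)^-1 by rewrite invr_gt0.
have c1n := normr_ge0 (c1 s); have c2n := normr_ge0 (c2 s).
move=> sN.
have hN : hi s <= N by lra.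
have cN : `|c1 s| + `|c2 s| <= N by lra.
have iN : (scale s)^-1 <= N by lra.
have N0 : 0 < N by lra.
have B0 : 0 <= B by rewrite (le_trans _ zB).
have q0 : 0 <= 2 * B ^+ 2 / m by rewrite divr_ge0 ?mulr_ge0 ?sqr_ge0// ltW.
have gB : radial s r <= 2 * B ^+ 2 / m + 1.
  have : (radial s r) ^+ 2 <= 2 * B ^+ 2 / m.
    rewrite ler_pdivlMr//.
    have := mP _ sL; have := real_normK (num_real (radial s r * d0 s)).
    have := real_normK (num_real (radial s r * d1 s)).
    have := normr_ge0 (radial s r * d1 s); have := normr_ge0 (radial s r * d0 s).
    move: (`|_|) (`|_|) aB bB => u v; rewrite !exprMn; nra.
  by move: (2 * B ^+ 2 / m) q0 => q q0; nra.
have rN : r <= 2 * B ^+ 2 / m + 1 + N by have := radial_ge s r0; lra.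
have BN0 : 0 <= (B + N) * (N + 1) by rewrite mulr_ge0//; lra.
split; first by rewrite ger0_norm//; lra.
have /andP[b0 b1] := blend_itv s r0.
have fN : (factor s r)^-1 <= N + 1.
  rewrite -[leRHS]invrK lef_pV2 ?posrE ?factor_gt0 ?invr_gt0//; last by lra.
  have k : N^-1 <= scale s by rewrite -[leRHS]invrK lef_pV2.
  have k2 : (N + 1)^-1 <= N^-1 by rewrite lef_pV2 ?posrE//; lra.
  have k3 : (N + 1)^-1 <= 1 by rewrite invf_le1; lra.
  by rewrite /factor; nra.
have zz : `|factor s r * x 0 2| <= B + N.
  have : `|blend s r * shift s r| <= N.
    rewrite normrM ger0_norm//.
    have := interp_abs (r1 s) (r2 s) (c1 s) (c2 s) r; rewrite -/(shift s r).
    by have := normr_ge0 (shift s r); nra.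
  move=> h; rewrite -[X in `|X|](addrK (blend s r * shift s r)).
  by rewrite (le_trans (ler_normB _ _))// lerD.
have f0 := factor_gt0 s r0.
suff : `|x 0 2| <= (B + N) * (N + 1) by lra.
have -> : `|x 0 2| = `|factor s r * x 0 2| * (factor s r)^-1.
  by rewrite normrM gtr0_norm// mulrAC divff ?mul1r// lt0r_neq0.
by apply: ler_pM => //; rewrite ltW// invr_gt0.
Qed.

Definition strands (r1 r2 h1 h2 : R -> R) : set V3 :=
  [set p : V3 | 0 <= p 0 1 <= L /\ (p = vec3 (r1 (p 0 1)) (p 0 1) (h1 (p 0 1)) \/
                               p = vec3 (r2 (p 0 1)) (p 0 1) (h2 (p 0 1)))].

Let straighten_strand1 s : straighten (vec3 (r1 s) s (h1 s)) = vec3 (r1' s) s (h1' s).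
Proof.
have rE : radial s (r1 s) = r1' s.
  have := r_lt s; have := r_gt s; have := radial_lo s; have := radial_hi s.
  rewrite /lo /hi /lo' /hi'.
  by case: (ltrgtP (r1 s) (r2 s)) => [||->]; case: (ltrgtP (r1' s) (r2' s)) => // -> .
have b1 : blend s (r1 s) = 1 by rewrite blend1// /lo ge_min lexx.
rewrite /straighten !vec3E rE; congr (vec3 _ _ _).
by rewrite /factor b1 subrr add0r !mul1r /shift interp_l /c1 addrC subrK.
Qed.

Let straighten_strand2 s : straighten (vec3 (r2 s) s (h2 s)) = vec3 (r2' s) s (h2' s).
Proof.
have rE : radial s (r2 s) = r2' s.
  have := r_lt s; have := r_gt s; have := radial_lo s; have := radial_hi s.
  rewrite /lo /hi /lo' /hi'.
  by case: (ltrgtP (r1 s) (r2 s)) => [||->]; case: (ltrgtP (r1' s) (r2' s)) => // -> .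
have b1 : blend s (r2 s) = 1 by rewrite blend1// /lo ge_min lexx orbT.
rewrite /straighten !vec3E rE; congr (vec3 _ _ _).
rewrite /factor b1 subrr add0r !mul1r /shift interp_r; last exact: c_eq.
by rewrite /c2 addrC subrK.
Qed.

(** [fan_pt e0 e1] and [target] are proper quotient maps of the same strip, and they have the same
    fibres because [straighten] preserves and reflects [fan_eq]. *)
Theorem two_strand_homeo :
  pair_homeo [set: V3] (fan_pt e0 e1 @` strands r1 r2 h1 h2)
             [set: V3] (fan_pt d0 d1 @` strands r1' r2' h1' h2').
Proof.
have -> : fan_pt d0 d1 @` strands r1' r2' h1' h2' = target @` strands r1 r2 h1 h2.
  apply/seteqP; split => [_ [p [pL pE] <-]|_ [p [pL pE] <-]].
    case: pE => pE; [exists (vec3 (r1 (p 0 1)) (p 0 1) (h1 (p 0 1)))|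
                     exists (vec3 (r2 (p 0 1)) (p 0 1) (h2 (p 0 1)))].
    - by split; rewrite !vec3E//; left.
    - by rewrite /target straighten_strand1; congr (fan_pt d0 d1 _); exact/esym/pE.
    - by split; rewrite !vec3E//; right.
    - by rewrite /target straighten_strand2; congr (fan_pt d0 d1 _); exact/esym/pE.
  exists (straighten p) => //; split; first by rewrite vec3E.
  case: pE => pE; [left|right]; rewrite {1}pE ?straighten_strand1 ?straighten_strand2;
    by rewrite /straighten !vec3E.
apply: (@pair_homeo_quot fan_dom) => [x _|x _|x x' Xx Xx'|y|y|y|y|p [pL pE]].
- by apply: cvg_within_filter; exact: fan_cts.
- by apply: cvg_within_filter; exact: target_cts.
- rewrite (fan_eqP eF Xx Xx') /target.
  by rewrite (fan_eqP dF (straighten_dom Xx) (straighten_dom Xx')) straighten_eq.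
- have [_ _ _ _ [_ /(_ (y 0 0) (y 0 1)) [r [s [r0 sL E0 E1]]]]] := eF.
  exists (vec3 r s (y 0 2)); first by split; rewrite vec3E.
  by apply: vec3_ext; rewrite !vec3E.
- have [_ _ _ _ [_ /(_ (y 0 0) (y 0 1)) [r [s [r0 sL E0 E1]]]]] := dF.
  have [|p pX pE] := @straighten_surj (vec3 r s (y 0 2)); first by split; rewrite vec3E.
  exists p => //; rewrite /target pE.
  by apply: vec3_ext; rewrite !vec3E.
- exact: fan_proper eF.
- by apply: bounded_proper => B; exact: target_bound.
- split => //; have [a b] := r_gt0 (p 0 1).
  by case: pE => ->; rewrite vec3E ltW.
Qed.

End TwoStrands.
End Fans.

(** * The standard trefoil as two strands *)

Section CircleFan.
Variable R : realType.
Local Notation V3 := 'rV[R]_3.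

Definition ramp (a b s : R) : R := ramp01 ((s - a) / (b - a)).

Lemma ramp_itv a b s : 0 <= ramp a b s <= 1.
Proof. exact: ramp01_itv. Qed.

Lemma ramp_l a b s : a < b -> s <= a -> ramp a b s = 0.
Proof.
by move=> ab sa; apply: ramp01_0; rewrite ler_pdivrMr ?subr_gt0// mul0r subr_le0.
Qed.

Lemma ramp_r a b s : a < b -> b <= s -> ramp a b s = 1.
Proof.
by move=> ab sb; apply: ramp01_1; rewrite ler_pdivlMr ?subr_gt0// mul1r lerD2r.
Qed.

Lemma ramp_le a b s s' : a < b -> s <= s' -> ramp a b s <= ramp a b s'.
Proof.
by move=> ab ss; apply: ramp01_le; rewrite ler_pM2r ?invr_gt0 ?subr_gt0// lerD2r.
Qed.

Lemma ramp_lt a b s s' : a < b -> a < s' -> s < b -> s < s' -> ramp a b s < ramp a b s'.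
Proof.
move=> ab as' sb ss.
have d0 : 0 < b - a by lra.
have i0 : 0 < (b - a)^-1 by rewrite invr_gt0.
have sE : (s - a) / (b - a) < 1 by rewrite ltr_pdivrMr// mul1r; lra.
have s'E : 0 < (s' - a) / (b - a) by rewrite mulr_gt0//; lra.
have ssE : (s - a) / (b - a) < (s' - a) / (b - a) by rewrite ltr_pM2r//; lra.
rewrite /ramp /ramp01 (_ : Num.min 1 ((s - a) / (b - a)) = (s - a) / (b - a)); last exact/min_idPr/ltW.
rewrite gt_max; apply/andP; split; rewrite lt_max lt_min; apply/orP; right; apply/andP; split => //.
Qed.

Lemma ramp_cts a b : continuous (ramp a b).
Proof. by apply: ctsI => s; apply: tends_ramp01; tends. Qed.

Lemma cos_eq1 (x : R) : 0 <= x <= 2 * pi -> cos x = 1 -> x = 0 \/ x = 2 * pi.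
Proof.
move=> /andP[x0 x2] cx; have p0 := @pi_gt0 R.
have [xp|xp] := lerP x pi.
  left; apply: cos_inj; [by rewrite in_itv /= x0|by rewrite in_itv /= lexx ltW|by rewrite cx cos0].
right; suff : 2 * pi - x = 0 by lra.
apply: cos_inj; rewrite ?in_itv /=; [lra|lra|].
by rewrite mulr_natl cosB cos2pi sin2pi mul0r addr0 mul1r cx cos0.
Qed.

Variables (L s1 s2 s3 : R).
Hypotheses (s10 : 0 < s1) (s12 : s1 < s2) (s23 : s2 < s3) (s3L : s3 < L).

Let ord : [/\ 0 < s1, s1 < s2, s2 < s3 & s3 < L].
Proof. by []. Qed.

(** Sends [s1], [s2], [s3] to pi/3, pi and 5 pi/3, the angles at which the two strands of the
    standard trefoil have equal radius; hence increments of 1, 2, 2 and 1 sixths of a turn. *)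
Definition angle (s : R) : R := 2 * pi / 6 * (ramp 0 s1 s + 2 * ramp s1 s2 s +
  2 * ramp s2 s3 s + ramp s3 L s).

Lemma angle_cts : continuous angle.
Proof.
apply: ctsI => s; rewrite /angle; apply: tendsM; first exact: cvg_cst.
do ! apply: tendsD; try exact: ramp_cts.
  by apply: tendsM; [exact: cvg_cst|exact: ramp_cts].
by apply: tendsM; [exact: cvg_cst|exact: ramp_cts].
Qed.

Lemma angle0 : angle 0 = 0.
Proof. by have [q1 q2 q3 q4] := ord; rewrite /angle !ramp_l//; lra. Qed.

Lemma angleL : angle L = 2 * pi.
Proof. by have [q1 q2 q3 q4] := ord; rewrite /angle !ramp_r//; lra. Qed.

Lemma angle_itv s : 0 <= angle s <= 2 * pi.
Proof.
have := ramp_itv 0 s1 s; have := ramp_itv s1 s2 s; have := ramp_itv s2 s3 s.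
have := ramp_itv s3 L s; have p0 := @pi_gt0 R; rewrite /angle.
move: (ramp _ _ _) (ramp _ _ _) (ramp _ _ _) (ramp _ _ _) => a b c d.
by nra.
Qed.

Lemma angle_lt s s' : 0 <= s -> s' <= L -> s < s' -> angle s < angle s'.
Proof.
have [q1 q2 q3 q4] := ord; move=> s0 s'L ss; have p0 := @pi_gt0 R.
rewrite /angle ltr_pM2l; last by lra.
have ss' := ltW ss.
have := @ramp_le 0 s1 s s' s10 ss'; have := @ramp_le s1 s2 s s' s12 ss'.
have := @ramp_le s2 s3 s s' s23 ss'; have := @ramp_le s3 L s s' s3L ss'.
have [a|a] := ltrP s s1; first by have := @ramp_lt 0 s1 s s'; lra.
have [b|b] := ltrP s s2; first by have := @ramp_lt s1 s2 s s'; lra.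
have [c|c] := ltrP s s3; first by have := @ramp_lt s2 s3 s s'; lra.
by have := @ramp_lt s3 L s s'; lra.
Qed.

Lemma angle_inj s s' : 0 <= s <= L -> 0 <= s' <= L -> angle s = angle s' -> s = s'.
Proof.
move=> /andP[s0 sL] /andP[s0' sL'] e.
case: (ltrgtP s s') => // ss.
  by have := angle_lt s0 sL' ss; rewrite e ltxx.
by have := angle_lt s0' sL ss; rewrite e ltxx.
Qed.

Lemma circle_fan : fan L (cos \o angle) (sin \o angle).
Proof.
have L0 : 0 < L by have [q1 q2 q3 q4] := ord; lra.
split.
- by move=> s; apply: tendscos; exact: angle_cts.
- by move=> s; apply: tendssin; exact: angle_cts.
- by rewrite /= angle0 angleL mulr_natl cos2pi sin2pi cos0 sin0.
- move=> s s' r r' sI s'I r0 r'0 /= E0 E1.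
  have c1 := cos2Dsin2 (angle s); have c1' := cos2Dsin2 (angle s').
  have r2 : r ^+ 2 = r' ^+ 2.
    have : (r * cos (angle s)) ^+ 2 + (r * sin (angle s)) ^+ 2 =
      (r' * cos (angle s')) ^+ 2 + (r' * sin (angle s')) ^+ 2 by rewrite E0 E1.
    by rewrite !exprMn -!mulrDr c1 c1' !mulr1.
  have rr : r = r'.
    by apply/eqP; rewrite -(@eqrXn2 _ 2)// ?ltW// r2.
  split => //; move: E0 E1; rewrite rr => /(mulfI (lt0r_neq0 r'0)) E0 /(mulfI (lt0r_neq0 r'0)) E1.
  wlog ss : s s' sI s'I E0 E1 c1 c1' / angle s' <= angle s => [h|].
    have [ss|/ltW ss] := lerP (angle s') (angle s); first exact: h.
    by case: (h s' s s'I sI (esym E0) (esym E1) c1' c1 ss) => [->|[[-> ->]|[-> ->]]]; tauto.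
  have /andP[a0 a1] := angle_itv s; have /andP[b0 b1] := angle_itv s'.
  have [|||e] := @cos_eq1 (angle s - angle s'); first by lra.
  + by rewrite cosB E0 E1 -!expr2 c1'.
  + by move=> e; left; apply: angle_inj => //; lra.
  + have LI : 0 <= L <= L by rewrite lexx ltW.
    have OI : 0 <= (0 : R) <= L by apply/andP; split => //; exact: ltW.
    by right; right; split; apply: angle_inj => //; rewrite ?angleL ?angle0; lra.
- split.
    by exists 1 => // s _ /=; rewrite cos2Dsin2.
  move=> u v; pose r := Num.sqrt (u ^+ 2 + v ^+ 2).
  have r2 : r ^+ 2 = u ^+ 2 + v ^+ 2 by rewrite sqr_sqrtr// addr_ge0 ?sqr_ge0.
  have r0 : 0 <= r by exact: sqrtr_ge0.
  have [z|nz] := eqVneq r 0.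
    exists 0, 0; rewrite lexx ltW//; split => //; rewrite mul0r;
     by apply/eqP; rewrite -sqrf_eq0 eq_le sqr_ge0 andbT;
        have := sqr_ge0 u; have := sqr_ge0 v; move: r2; rewrite z expr0n /=; lra.
  have [|t [tI uE vE]] := @polar R (u / r) (v / r).
    by rewrite !exprMn -mulrDl -r2 exprVn divff// expf_neq0.
  have [||s sI sE] := @IVT R angle 0 L t (ltW L0).
  + exact/continuous_subspaceT/angle_cts.
  + by rewrite angle0 angleL ge_min le_max; case/andP: tI => -> ->; rewrite orbT.
  + exists r, s; rewrite in_itv /= in sI; split => //=; rewrite sE -?uE -?vE mulrC divfK//.
Qed.

Let phase (s : R) : R := 3 / 2 * angle s.

Let phaseE s : phase s = pi / 2 * (ramp 0 s1 s + 2 * ramp s1 s2 s +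
  2 * ramp s2 s3 s + ramp s3 L s).
Proof. by rewrite /phase /angle; field. Qed.

Let phase_cts : continuous phase.
Proof. by apply: ctsI => s; apply: tendsM; [exact: cvg_cst|exact: angle_cts]. Qed.

Let cos_neg (x : R) : pi / 2 < x < pi / 2 + pi -> cos x < 0.
Proof.
move=> /andP[a b]; have := @cos_gt0_pihalf R (x - pi); rewrite cosB cospi sinpi.
by move=> h; have {}h : 0 < cos x * -1 + sin x * 0 by [apply: h; lra]; lra.
Qed.

Let cos_pos2 (x : R) : pi / 2 + pi < x < pi / 2 + pi + pi -> 0 < cos x.
Proof.
move=> /andP[a b]; have := @cos_neg (x - pi); rewrite cosB cospi sinpi.
by move=> h; have {}h : cos x * -1 + sin x * 0 < 0 by [apply: h; lra]; lra.
Qed.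

Let cos_neg3 (x : R) : pi / 2 + pi + pi < x < pi / 2 + pi + pi + pi -> cos x < 0.
Proof.
move=> /andP[a b]; have := @cos_pos2 (x - pi); rewrite cosB cospi sinpi.
by move=> h; have {}h : 0 < cos x * -1 + sin x * 0 by [apply: h; lra]; lra.
Qed.

Let phase_signs s :
  [/\ s < s1 -> 0 < cos (phase s), s1 < s < s2 -> cos (phase s) < 0,
      s2 < s < s3 -> 0 < cos (phase s) & s3 < s -> cos (phase s) < 0].
Proof.
have [q1 q2 q3 q4] := ord; have p0 := @pi_gt0 R; rewrite phaseE; split.
- move=> a; rewrite (@ramp_l s1 s2) ?(@ramp_l s2 s3) ?(@ramp_l s3 L)//; try lra.
  have := ramp_itv 0 s1 s; have : ramp 0 s1 s < 1.
    by rewrite -(@ramp_r 0 s1 s1)//; apply: ramp_lt.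
  by move: (ramp _ _ _) => r r1 /andP[r0 _]; apply: cos_gt0_pihalf; nra.
- move=> /andP[a b]; rewrite (@ramp_r 0 s1) ?(@ramp_l s2 s3) ?(@ramp_l s3 L)//; try lra.
  have : 0 < ramp s1 s2 s by rewrite -(@ramp_l s1 s2 s1)//; apply: ramp_lt => //; lra.
  have : ramp s1 s2 s < 1 by rewrite -(@ramp_r s1 s2 s2)//; apply: ramp_lt => //; lra.
  by move: (ramp _ _ _) => r r1 r0; apply: cos_neg; nra.
- move=> /andP[a b]; rewrite (@ramp_r 0 s1) ?(@ramp_r s1 s2) ?(@ramp_l s3 L)//; try lra.
  have : 0 < ramp s2 s3 s by rewrite -(@ramp_l s2 s3 s2)//; apply: ramp_lt => //; lra.
  have : ramp s2 s3 s < 1 by rewrite -(@ramp_r s2 s3 s3)//; apply: ramp_lt => //; lra.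
  by move: (ramp _ _ _) => r r1 r0; apply: cos_pos2; nra.
- move=> a; rewrite (@ramp_r 0 s1) ?(@ramp_r s1 s2) ?(@ramp_r s2 s3)//; try lra.
  have := ramp_itv s3 L s; have : 0 < ramp s3 L s.
    have [b|b] := ltrP s L; last by rewrite ramp_r.
    by rewrite -(@ramp_l s3 L s3)//; apply: ramp_lt.
  by move: (ramp _ _ _) => r r0 /andP[_ r1]; apply: cos_neg3; nra.
Qed.

Let phase1 : phase s1 = pi / 2.
Proof. by have [q1 q2 q3 q4] := ord; rewrite phaseE (@ramp_r 0 s1) ?(@ramp_l s1 s2) ?(@ramp_l s2 s3) ?(@ramp_l s3 L)//; lra. Qed.
Let phase2 : phase s2 = pi / 2 + pi.
Proof. by have [q1 q2 q3 q4] := ord; rewrite phaseE (@ramp_r 0 s1) ?(@ramp_r s1 s2) ?(@ramp_l s2 s3) ?(@ramp_l s3 L)//; lra. Qed.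
Let phase3 : phase s3 = pi / 2 + pi + pi.
Proof. by have [q1 q2 q3 q4] := ord; rewrite phaseE (@ramp_r 0 s1) ?(@ramp_r s1 s2) ?(@ramp_r s2 s3) ?(@ramp_l s3 L)//; lra. Qed.

Let trig1 : cos (phase s1) = 0 /\ sin (phase s1) = 1.
Proof. by rewrite phase1 cos_pihalf sin_pihalf. Qed.
Let trig2 : cos (phase s2) = 0 /\ sin (phase s2) = -1.
Proof. by rewrite phase2 cosDpi sinDpi cos_pihalf sin_pihalf oppr0. Qed.
Let trig3 : cos (phase s3) = 0 /\ sin (phase s3) = 1.
Proof. by rewrite phase3 !cosDpi !sinDpi cos_pihalf sin_pihalf !oppr0 opprK. Qed.

Variables (e0 e1 r1 r2 h1 h2 : R -> R).
Hypotheses (eF : fan L e0 e1).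
Hypothesis r1c : continuous r1.
Hypothesis r2c : continuous r2.
Hypothesis h1c : continuous h1.
Hypothesis h2c : continuous h2.
Hypothesis r_gt0 : forall s, 0 < r1 s /\ 0 < r2 s.
Hypothesis swap : [/\ r1 L = r2 0, r2 L = r1 0, h1 L = h2 0 & h2 L = h1 0].
Hypothesis above : forall s, s < s1 \/ s2 < s < s3 -> r2 s < r1 s.
Hypothesis below : forall s, s3 < s \/ s1 < s < s2 -> r1 s < r2 s.
Hypothesis cross1 : r1 s1 = r2 s1 /\ h2 s1 < h1 s1.
Hypothesis cross2 : r1 s2 = r2 s2 /\ h1 s2 < h2 s2.
Hypothesis cross3 : r1 s3 = r2 s3 /\ h2 s3 < h1 s3.

(** Over the angle 2 t lie the points with parameters t and t + pi. With phase 3 t their radii are 2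
    + cos and 2 - cos of the phase, their heights sin and - sin. *)
Let trefoil_strands :
  fan_pt (cos \o angle) (sin \o angle) @` strands L (fun s => 2 + cos (phase s))
    (fun s => 2 - cos (phase s)) (sin \o phase) (fun s => - sin (phase s)) =
  @standard_trefoil R.
Proof.
have p0 := @pi_gt0 R; have [q1 q2 q3 q4] := ord.
have cosP (x : R) : cos (x + pi *+ 2) = cos x by rewrite cosD cos2pi sin2pi mulr1 mulr0 subr0.
have sinP (x : R) : sin (x + pi *+ 2) = sin x by rewrite sinD cos2pi sin2pi mulr1 mulr0 addr0.
apply/seteqP; split => [_ [p [sL pE] <-]|_ [t tI <-]].
  have /andP[a0 a1] := angle_itv (p 0 1); set s := p 0 1 in sL pE a0 a1.
  have pE' : phase s = 3 * (angle s / 2) by rewrite /phase; field.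
  have aE : angle s = 2 * (angle s / 2) by field.
  case: pE => pE.
    exists (angle s / 2); first by rewrite /= in_itv /=; lra.
    by apply: vec3_ext; rewrite /fan_pt pE !vec3E /= -?pE' -?aE.
  exists (angle s / 2 + pi); first by rewrite /= in_itv /=; lra.
  have e3 : 3 * (angle s / 2 + pi) = phase s + pi + pi *+ 2 by rewrite pE' -mulr_natl; ring.
  have e2 : 2 * (angle s / 2 + pi) = angle s + pi *+ 2 by rewrite -mulr_natl; field.
  apply: vec3_ext; rewrite /fan_pt pE !vec3E /= ?e3 ?e2;
    rewrite ?cosP ?sinP ?cosDpi ?sinDpi; ring.
rewrite /= in_itv /= in tI; have /andP[t0 t2] := tI.
have [tp|tp] := lerP t pi.
  have [|||s sI sE] := @IVT R angle 0 L (2 * t).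
  - by lra.
  - exact/continuous_subspaceT/angle_cts.
  - by rewrite angle0 angleL ge_min le_max; apply/andP; split; apply/orP; [left|right]; lra.
  have pE : phase s = 3 * t by rewrite /phase sE; field.
  exists (vec3 (2 + cos (phase s)) s (sin (phase s))).
    by split; rewrite !vec3E; [rewrite in_itv in sI|left].
  by apply: vec3_ext; rewrite /fan_pt !vec3E /= ?pE ?sE.
have [|||s sI sE] := @IVT R angle 0 L (2 * t - 2 * pi).
- by lra.
- exact/continuous_subspaceT/angle_cts.
- by rewrite angle0 angleL ge_min le_max; apply/andP; split; apply/orP; [left|right]; lra.
have pE : 3 * t = phase s + pi + pi *+ 2 by rewrite /phase sE -mulr_natl; field.
have sE' : 2 * t = angle s + pi *+ 2 by rewrite sE -mulr_natl; ring.
exists (vec3 (2 - cos (phase s)) s (- sin (phase s))).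
  by split; rewrite !vec3E; [rewrite in_itv in sI|right].
by apply: vec3_ext; rewrite /fan_pt !vec3E /= ?pE ?sE';
  rewrite ?cosP ?sinP ?cosDpi ?sinDpi; ring.
Qed.

(** The order of the radii is the sign of the cosine of the phase, and at the three crossings its
    sine is 1, -1, 1, which matches the prescribed order of the heights. *)
Theorem trefoil_of_strands :
  pair_homeo [set: V3] (fan_pt e0 e1 @` strands L r1 r2 h1 h2)
             [set: V3] (@standard_trefoil R).
Proof.
have [q1 q2 q3 q4] := ord.
have cc : continuous (fun s => cos (phase s)).
  by apply: ctsI => s; apply: tendscos; exact: phase_cts.
have sc : continuous (fun s => sin (phase s)).
  by apply: ctsI => s; apply: tendssin; exact: phase_cts.
have sgn s : (r1 s < r2 s) = (2 + cos (phase s) < 2 - cos (phase s)) /\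
             (r2 s < r1 s) = (2 - cos (phase s) < 2 + cos (phase s)).
  have [a b c d] := phase_signs s.
  case: (ltrgtP s s1) => [h|h|->]; last first.
  - by case: cross1 => -> _; rewrite (proj1 trig1) addr0 subr0 !ltxx.
  - case: (ltrgtP s s2) => [h'|h'|->]; last first.
    + by case: cross2 => -> _; rewrite (proj1 trig2) addr0 subr0 !ltxx.
    + case: (ltrgtP s s3) => [h''|h''|->]; last first.
      * by case: cross3 => -> _; rewrite (proj1 trig3) addr0 subr0 !ltxx.
      * by have := d h''; have := @below s (or_introl h''); split; lra.
      * have hh : s2 < s < s3 by rewrite h' h''.
        by have := c hh; have := @above s (or_intror hh); split; lra.
    + have hh : s1 < s < s2 by rewrite h' h.
      by have := b hh; have := @below s (or_intror hh); split; lra.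
  - by have := a h; have := @above s (or_introl h); split; lra.
rewrite -trefoil_strands; apply: two_strand_homeo => //.
- by lra.
- exact: circle_fan.
- by apply: ctsI => s; apply: tendsD; [exact: cvg_cst|exact: cc].
- by apply: ctsI => s; apply: tendsB; [exact: cvg_cst|exact: cc].
- by apply: ctsI => s; apply: tendsN; exact: sc.
- rewrite /phase /= angleL angle0 mulr0 cos0 sin0.
  have -> : 3 / 2 * (2 * pi) = pi + pi *+ 2 :> R by rewrite -mulr_natl; field.
  rewrite cosD sinD cospi sinpi cos2pi sin2pi; split; ring.
- by move=> s; have [] := sgn s.
- by move=> s; have [] := sgn s.
- move=> s e /=.
  have [] := sgn s; rewrite e ltxx => /esym/negbT + /esym/negbT; rewrite -!leNgt => a b.
  have c0 : cos (phase s) = 0 by lra.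
  have [p1 p2 p3 p4] := phase_signs s.
  case: (ltrgtP s s1) => [h|h|->]; last first.
  - by rewrite (proj2 trig1); case: cross1; nra.
  - case: (ltrgtP s s2) => [h'|h'|->]; last first.
    + by rewrite (proj2 trig2); case: cross2; nra.
    + case: (ltrgtP s s3) => [h''|h''|->]; last first.
      * by rewrite (proj2 trig3); case: cross3; nra.
      * by have := p4 h''; rewrite c0 ltxx.
      * by have := p3; rewrite h' h'' c0 ltxx => /(_ isT).
    + by have := p2; rewrite h' h c0 ltxx => /(_ isT).
  - by have := p1 h; rewrite c0 ltxx.
Qed.

End CircleFan.

(** * Strands given by finitely many nodes *)

Section Nodes.
Variable R : realType.
Local Notation V3 := 'rV[R]_3.

Definition pl (N : nat) (f : nat -> R) (s : R) : R :=
  f 0%N + \sum_(i < N) (f i.+1 - f i) * ramp01 (s - i%:R).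

Lemma pl_cts N f : continuous (pl N f).
Proof.
apply: ctsI => s; apply: tendsD; first exact: cvg_cst.
apply: tendssum => i; apply: tendsM; first exact: cvg_cst.
by apply: tends_ramp01; tends.
Qed.

Lemma pl_seg N f i t : (i < N)%N -> 0 <= t <= 1 ->
  pl N f (i%:R + t) = f i + t * (f i.+1 - f i).
Proof.
move=> iN t01; have /andP[t0 t1] := t01.
have step n : (n <= N)%N -> pl N f (i%:R + t) = f 0%N +
    \sum_(j < i) (f j.+1 - f j) + (f i.+1 - f i) * t.
  move=> _; rewrite /pl -addrA; congr (_ + _).
  rewrite -(subnKC iN) big_split_ord /= big_ord_recr /=.
  rewrite [X in _ + X]big1 ?addr0; last first.
    move=> j _; rewrite ramp01_0 ?mulr0// -addrA.
    have -> : (i.+1 + j)%:R = i%:R + 1 + j%:R :> R by rewrite natrD -natr1.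
    by have := ler0n R j; lra.
  congr (_ + _); last by rewrite addrAC subrr add0r ramp01_id// mulrC.
  apply: eq_bigr => j _; rewrite ramp01_1 ?mulr1//.
  have : (j.+1%:R : R) <= i%:R by rewrite ler_nat.
  by rewrite -natr1; lra.
rewrite (step 0%N)// (_ : \sum_(j < i) (f j.+1 - f j) = f i - f 0%N).
  by ring.
elim: i {iN step} => [|i IH]; first by rewrite big_ord0 subrr.
by rewrite big_ord_recr /= IH; ring.
Qed.

Lemma pl_nat N f i : (i <= N)%N -> pl N f i%:R = f i.
Proof.
case: N => [|N]; first by rewrite leqn0 => /eqP ->; rewrite /pl big_ord0 addr0.
rewrite leq_eqVlt => /predU1P[->|iN].
  by rewrite -natr1 pl_seg// ?lexx ?ler01// mul1r addrC subrK.
by rewrite -[i%:R]addr0 pl_seg// ?lexx ?ler01// mul0r addr0.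
Qed.

Lemma locate N (s : R) : 0 <= s <= N%:R -> (0 < N)%N ->
  exists i t, [/\ (i < N)%N, 0 <= t <= 1 & s = i%:R + t].
Proof.
elim: N => // N IH /andP[s0 sN] _; have [sN'|sN'] := lerP s N%:R.
  case: N IH sN sN' => [|N] IH sN sN'.
    by exists 0%N, 0; rewrite lexx ler01 addr0; split => //; apply/le_anti/andP.
  by have [||i [t [iN tI sE]]] := IH; rewrite ?s0//; exists i, t; split => //; apply: ltnW.
by exists N, (s - N%:R); split => //; move: sN; rewrite -natr1; lra.
Qed.

Lemma pl_le0 N f s : s <= 0 -> pl N f s = f 0%N.
Proof.
move=> s0; rewrite /pl big1 ?addr0// => i _; rewrite ramp01_0 ?mulr0//.
by have := ler0n R i; lra.
Qed.

Lemma pl_geN N f s : N%:R <= s -> pl N f s = f N.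
Proof.
move=> sN; rewrite -(@pl_nat N f N)//; congr (_ + _); apply: eq_bigr => i _.
have : (i.+1%:R : R) <= N%:R by rewrite ler_nat.
by rewrite -natr1 => h; rewrite !ramp01_1//; lra.
Qed.

(** The last hypothesis concerns an interval without interior node, where positivity has to come
    from one of its ends. *)
Lemma pl_gt0 N f p q s : (p <= q <= N)%N ->
  (forall i, (p <= i <= q)%N -> 0 <= f i) -> (forall i, (p < i < q)%N -> 0 < f i) ->
  p%:R < s < q%:R -> ((q - p)%N = 1%N -> 0 < f p \/ 0 < f q) -> 0 < pl N f s.
Proof.
move=> /andP[pq qN] f0 fp /andP[ps sq] one.
have sI : 0 <= s <= N%:R.
  have := ler0n R p; have : (q%:R : R) <= N%:R by rewrite ler_nat.
  by lra.
have N0 : (0 < N)%N by rewrite lt0n; apply/eqP => N0; move: sI ps; rewrite N0; have := ler0n R p; lra.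
have [i [t [iN tI sE]]] := locate sI N0.
rewrite sE pl_seg//; have /andP[t0 t1] := tI.
have -> : f i + t * (f i.+1 - f i) = (1 - t) * f i + t * f i.+1 by ring.
have pi : (p <= i)%N.
  rewrite leqNgt; apply/negP => ip.
  have : (i.+1%:R : R) <= p%:R by rewrite ler_nat.
  by rewrite -natr1; lra.
have iq : (i < q)%N.
  rewrite ltnNge; apply/negP => qi.
  have : (q%:R : R) <= i%:R by rewrite ler_nat.
  by lra.
have fi : 0 <= f i by apply: f0; rewrite pi ltnW.
have fi1 : 0 <= f i.+1 by apply: f0; rewrite iq (leq_trans pi).
have [ep|np] := eqVneq p i.
  have t0' : 0 < t by move: ps; rewrite sE ep; lra.
  have [eq|nq] := eqVneq q i.+1.
    have t1' : t < 1 by move: sq; rewrite sE eq -natr1; lra.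
    have [|h|h] := one; first by rewrite eq ep subSnn.
      by rewrite ep in h; nra.
    by rewrite eq in h; nra.
  have h : 0 < f i.+1 by apply: fp; rewrite ltnS pi ltn_neqAle eq_sym nq.
  by nra.
have h : 0 < f i by apply: fp; rewrite iq ltn_neqAle np pi.
have [t1'|t1'] := eqVneq t 1; last by have : t < 1 by [rewrite lt_def eq_sym t1' t1]; nra.
rewrite t1' subrr mul0r add0r mul1r.
have [eq|nq] := eqVneq q i.+1.
  by exfalso; move: sq; rewrite sE eq t1' -natr1 ltxx.
by apply: fp; rewrite ltnS pi /= ltn_neqAle eq_sym nq iq.
Qed.

Lemma pl_pos N f s : (0 < N)%N -> (forall i, (i <= N)%N -> 0 < f i) -> 0 < pl N f s.
Proof.
move=> N0 fp; have [s0|s0] := lerP s 0; first by rewrite pl_le0//; exact: fp.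
have [sN|sN] := lerP N%:R s; first by rewrite pl_geN//; exact: fp.
apply: (@pl_gt0 N f 0 N) => //.
- by rewrite leqnn.
- by move=> i /andP[_ iN]; exact/ltW/fp.
- by move=> i /andP[_ iN]; exact/fp/ltnW.
- by rewrite s0.
- by left; exact: fp.
Qed.

Lemma plN N f s : pl N (fun i => - f i) s = - pl N f s.
Proof.
rewrite /pl opprD -sumrN; congr (_ + _); apply: eq_bigr => i _.
by rewrite -mulNr opprB opprK addrC.
Qed.

Lemma plB N f g s : pl N (fun i => f i - g i) s = pl N f s - pl N g s.
Proof.
rewrite /pl (eq_bigr (fun i : 'I_N => (f i.+1 - f i) * ramp01 (s - i%:R) -
  (g i.+1 - g i) * ramp01 (s - i%:R))); first by rewrite sumrB; ring.
by move=> i _; ring.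
Qed.

Variables (N n1 : nat) (a b : nat -> R).
Hypotheses (n1_gt0 : (0 < n1)%N) (n1N : (n1 < N)%N).
Hypotheses (a0 : 0 < a 0%N) (b0 : b 0%N = 0) (an1 : a n1 < 0) (bn1 : b n1 = 0)
  (aN : a N = a 0%N) (bN : b N = 0).
Hypothesis b_pos : forall i, (0 < i < n1)%N -> 0 < b i.
Hypothesis b_neg : forall i, (n1 < i < N)%N -> b i < 0.
(** Consecutive node directions turn counterclockwise. With the signs of [b], the nodes go once
    round the origin: through the upper half-plane up to node [n1], then through the lower one. *)
Hypothesis det_pos : forall i, (i < N)%N -> 0 < a i * b i.+1 - a i.+1 * b i.

Let A := pl N a.
Let B := pl N b.

Let N0 : (0 < N)%N. Proof. exact: leq_ltn_trans n1N. Qed.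

Let one_upper : (1 < n1)%N.
Proof.
rewrite ltn_neqAle n1_gt0 andbT; apply/eqP => e.
by have := det_pos N0; rewrite b0 {1}e bn1 !mulr0 subrr ltxx.
Qed.

Let one_lower : (n1.+1 < N)%N.
Proof.
rewrite ltn_neqAle n1N andbT; apply/eqP => e.
by have := det_pos n1N; rewrite bn1 e bN !mulr0 subrr ltxx.
Qed.

Let B_pos s : 0 < s < n1%:R -> 0 < B s.
Proof.
move=> sI; apply: (@pl_gt0 N b 0 n1) => //; first exact: ltnW.
  move=> i /andP[_]; case: i => [|i]; first by rewrite b0.
  rewrite leq_eqVlt => /predU1P[->|h]; first by rewrite bn1.
  exact/ltW/b_pos.
by rewrite subn0 => e; move: one_upper; rewrite e.
Qed.

Let B_neg s : n1%:R < s < N%:R -> B s < 0.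
Proof.
move=> sI; rewrite -oppr_gt0 -plN; apply: (@pl_gt0 N _ n1 N) => //.
- by rewrite leqnn ltnW.
- move=> i /andP[]; rewrite leq_eqVlt => /predU1P[<-|h]; first by rewrite bn1 oppr0.
  rewrite leq_eqVlt => /predU1P[->|h']; first by rewrite bN oppr0.
  by rewrite oppr_ge0 ltW// b_neg// h.
- by move=> i h; rewrite oppr_gt0 b_neg.
- by move=> e; move: one_lower; rewrite -(subnKC (ltnW n1N)) e addn1 ltnn.
Qed.

Let piece i s s' : (i < N)%N -> i%:R <= s -> s' <= i.+1%:R -> s < s' ->
  0 < A s * B s' - A s' * B s.
Proof.
move=> iN is0; rewrite -natr1 => si ss.
have [sE tI] : s = i%:R + (s - i%:R) /\ 0 <= s - i%:R <= 1 by split; [ring|lra].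
have [sE' tI'] : s' = i%:R + (s' - i%:R) /\ 0 <= s' - i%:R <= 1 by split; [ring|lra].
rewrite sE sE' /A /B !pl_seg//.
set t := s - i%:R; set t' := s' - i%:R.
have -> : (a i + t * (a i.+1 - a i)) * (b i + t' * (b i.+1 - b i)) -
  (a i + t' * (a i.+1 - a i)) * (b i + t * (b i.+1 - b i)) =
  (t' - t) * (a i * b i.+1 - a i.+1 * b i) by ring.
by rewrite mulr_gt0 ?det_pos// /t /t'; lra.
Qed.

(** Positivity of the determinant is known along each edge and is carried across the nodes by the
    transitivity [Dt], available among vectors of one open half-plane. *)
Let glue (D : R -> Prop) : (forall s, D s -> 0 <= s <= N%:R) ->
  (forall s s' r, D s -> D s' -> s < r -> r < s' -> D r) ->
  (forall s r s', D s -> D r -> D s' -> 0 < A s * B r - A r * B s ->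
     0 < A r * B s' - A s' * B r -> 0 < A s * B s' - A s' * B s) ->
  forall s s', D s -> D s' -> s < s' -> 0 < A s * B s' - A s' * B s.
Proof.
move=> DN Dc Dt s s' Ds Ds' ss.
suff h n : (n <= N)%N -> forall s s', D s -> D s' -> s < s' -> s' <= n%:R ->
    0 < A s * B s' - A s' * B s.
  by apply: (h N) => //; case/andP: (DN _ Ds').
move=> {s s' ss Ds Ds'}; elim: n => [_|n IH nN] s s' Ds Ds' ss sn.
  by have := DN _ Ds; lra.
have [sn'|sn'] := lerP s' n%:R; first by apply: IH => //; exact: ltnW.
have [ns|ns] := lerP n%:R s; first exact: (@piece n).
apply: (Dt s n%:R) => //; first exact: (Dc s s').
  by apply: IH => //; [exact: ltnW|exact: (Dc s s')].
exact: (@piece n).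
Qed.

Let trans_pos s r s' : 0 < B s -> 0 < B r -> 0 < B s' ->
  0 < A s * B r - A r * B s -> 0 < A r * B s' - A s' * B r ->
  0 < A s * B s' - A s' * B s.
Proof.
move: (A s) (A r) (A s') (B s) (B r) (B s') => x y z u v w u0 v0 w0 h1 h2.
rewrite -(pmulr_rgt0 _ v0).
have -> : v * (x * w - z * u) = w * (x * v - y * u) + u * (y * w - z * v) by ring.
by rewrite addr_gt0// mulr_gt0.
Qed.

Let inj_upper s s' : 0 < s < n1%:R -> 0 < s' < n1%:R -> s < s' ->
  0 < A s * B s' - A s' * B s.
Proof.
have nN : (n1%:R : R) < N%:R by rewrite ltr_nat.
apply: (@glue (fun s => 0 < s < n1%:R)) => [r|x y r|x r y].
- by move=> /andP[/ltW -> /ltW /le_trans -> //]; exact: ltW.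
- by move=> /andP[? ?] /andP[? ?] ? ?; lra.
- by move=> *; apply: (trans_pos (r := r)) => //; exact: B_pos.
Qed.

Let trans_neg s r s' : B s < 0 -> B r < 0 -> B s' < 0 ->
  0 < A s * B r - A r * B s -> 0 < A r * B s' - A s' * B r ->
  0 < A s * B s' - A s' * B s.
Proof.
move: (A s) (A r) (A s') (B s) (B r) (B s') => x y z u v w u0 v0 w0 h1 h2.
have nv0 : 0 < - v by rewrite oppr_gt0.
rewrite -(pmulr_rgt0 _ nv0).
have -> : - v * (x * w - z * u) = - w * (x * v - y * u) + - u * (y * w - z * v) by ring.
by rewrite addr_gt0// mulr_gt0// oppr_gt0.
Qed.

Let inj_lower s s' : n1%:R < s < N%:R -> n1%:R < s' < N%:R -> s < s' ->
  0 < A s * B s' - A s' * B s.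
Proof.
have n0 := ler0n R n1.
apply: (@glue (fun s => n1%:R < s < N%:R)) => [r|x y r|x r y].
- by move=> /andP[? /ltW ->]; rewrite andbT; lra.
- by move=> /andP[? ?] /andP[? ?] ? ?; lra.
- by move=> *; apply: (trans_neg (r := r)) => //; exact: B_neg.
Qed.

Let inj_of (P : R -> Prop) r r' s s' :
  (forall s s', P s -> P s' -> s < s' -> 0 < A s * B s' - A s' * B s) ->
  P s -> P s' -> 0 < r -> 0 < r' -> r * A s = r' * A s' -> r * B s = r' * B s' -> s = s'.
Proof.
move=> h Ps Ps' r0 r'0 EA EB.
have z : r * (A s * B s' - A s' * B s) = 0.
  by have -> : r * (A s * B s' - A s' * B s) = (r * A s) * B s' - A s' * (r * B s)
    by [ring]; rewrite EA EB; ring.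
have {}z : A s * B s' - A s' * B s = 0.
  by move/eqP: z; rewrite mulf_eq0 gt_eqF//= => /eqP.
case: (ltrgtP s s') => // ss.
  by have := h _ _ Ps Ps' ss; rewrite z ltxx.
by have := h _ _ Ps' Ps ss; rewrite (_ : A s' * B s - A s * B s' = 0) ?ltxx//; lra.
Qed.

Let B_cases s : 0 <= s <= N%:R ->
  [\/ 0 < s < n1%:R /\ 0 < B s, n1%:R < s < N%:R /\ B s < 0, s = 0 |
     s = n1%:R \/ s = N%:R].
Proof.
move=> /andP[]; rewrite le_eqVlt => /predU1P[<-|s0]; first by constructor 3.
rewrite le_eqVlt => /predU1P[->|sN]; first by constructor 4; right.
case: (ltrgtP s n1%:R) => h; last by constructor 4; left.
  by constructor 1; rewrite s0; split => //; apply: B_pos; rewrite s0 h.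
by constructor 2; rewrite sN; split => //; apply: B_neg; rewrite h sN.
Qed.

Let AB_ends : [/\ A 0 = a 0%N, A n1%:R = a n1, A N%:R = a 0%N, B 0 = 0 & B n1%:R = 0 /\ B N%:R = 0].
Proof.
have nN := ltnW n1N.
by rewrite /A /B !(pl_le0 N _ (lexx 0)) !(pl_nat _ nN) !(pl_nat _ (leqnn N)) aN bN b0 bn1.
Qed.

(** Positively proportional points of the curve lie in the same open half-plane or on the same
    half-axis, and within a half-plane the determinants are positive, which separates them. A given
    ray is met by the intermediate value theorem, applied to the determinant with its direction. *)
Lemma fan_of_nodes : fan N%:R (pl N a) (pl N b).
Proof.
have [A0 An AN B0 [Bn BN]] := AB_ends; rewrite -/A -/B.
have N0' : 0 < N%:R :> R by rewrite ltr0n.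
have nN' : n1%:R <= N%:R :> R by rewrite ler_nat ltnW.
split.
- exact: pl_cts.
- exact: pl_cts.
- by rewrite A0 AN B0 BN.
- move=> s s' r r' sI s'I r0 r'0 EA EB.
  have same : s = s' -> r = r'.
    move=> e; rewrite -e in EA EB; have [|bs] := eqVneq (B s) 0.
      have [[_]|[_]|z|[z|z]] := B_cases sI.
      + by move=> + z; rewrite z ltxx.
      + by move=> + z; rewrite z ltxx.
      + by move=> _; move: EA; rewrite z A0 => /mulIf -> //; rewrite lt0r_neq0.
      + by move=> _; move: EA; rewrite z An => /mulIf -> //; rewrite ltr0_neq0.
      + by move=> _; move: EA; rewrite z AN => /mulIf -> //; rewrite lt0r_neq0.
    by apply: (mulIf bs).
  have signs x y : r * x = r' * y -> (0 < x) = (0 < y) /\ (x < 0) = (y < 0).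
    move=> e; split; first by rewrite -(pmulr_rgt0 x r0) e pmulr_rgt0.
    by rewrite -(pmulr_rlt0 x r0) e pmulr_rlt0.
  have [Bp Bm] := signs _ _ EB; have [Ap Am] := signs _ _ EA.
  have inj : s = s' -> r = r' /\ (s = s' \/ s = 0 /\ s' = N%:R \/ s = N%:R /\ s' = 0).
    by move=> e; split; [exact: same|left].
  have rr : A s = A s' -> A s != 0 -> r = r'.
    by move=> e n; move: EA; rewrite -e => /(mulIf n).
  have a0n : a 0%N != 0 by rewrite lt0r_neq0.
  have [[sD sB]|[sD sB]|sE|[sE|sE]] := B_cases sI;
  have [[sD' sB']|[sD' sB']|sE'|[sE'|sE']] := B_cases s'I;
  try (by move: Bp Bm; rewrite ?sE ?sE' ?B0 ?Bn ?BN ?sB ?sB' ?ltxx);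
  try (by move: Bp; rewrite sB ltNge ltW);
  try (by move: Bp; rewrite sB' ltNge ltW);
  try (by move: Am; rewrite sE sE' ?A0 ?An ?AN an1 ltNge (ltW a0));
  try (by apply: inj; rewrite sE sE').
  + by apply: inj; apply: (inj_of inj_upper sD sD' r0 r'0).
  + by apply: inj; apply: (inj_of inj_lower sD sD' r0 r'0).
  + by split; [apply: rr; rewrite sE ?sE' A0 ?AN|right; left].
  + by split; [apply: rr; rewrite sE ?sE' AN ?A0|right; right].
- split.
    have [||m mI mP] := @EVT_min R (fun s => A s ^+ 2 + B s ^+ 2) 0 N%:R.
    + exact: ltW.
    + by apply: continuous_subspaceT; apply: ctsI => s; apply: tendsD; apply: tendsX; exact: pl_cts.
    exists (A m ^+ 2 + B m ^+ 2); last by move=> s sI; apply: mP; rewrite in_itv.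
    have sq x : x != 0 -> 0 < x ^+ 2 :> R by move=> h; rewrite lt_def sqr_ge0 sqrf_eq0 h.
    rewrite in_itv /= in mI.
    have [[_ h]|[_ h]|->|[->|->]] := B_cases mI.
    + by rewrite ltr_wpDl ?sqr_ge0// sq// lt0r_neq0.
    + by rewrite ltr_wpDl ?sqr_ge0// sq// ltr0_neq0.
    + by rewrite A0 ltr_wpDr ?sqr_ge0// sq// lt0r_neq0.
    + by rewrite An ltr_wpDr ?sqr_ge0// sq// ltr0_neq0.
    + by rewrite AN ltr_wpDr ?sqr_ge0// sq// lt0r_neq0.
  move=> u v; case: (ltrgtP v 0) => v0.
  + have [|||s sI sE] := @IVT R (fun s => A s * v - B s * u) n1%:R N%:R 0 => //.
    * apply: continuous_subspaceT; apply: ctsI => s; apply: tendsB;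
        by apply: tendsM; [exact: pl_cts|exact: cvg_cst].
    * rewrite An AN Bn BN !mul0r !subr0 ge_min le_max.
      by rewrite (mulr_ge0_le0 (ltW a0) (ltW v0)) (mulr_le0 (ltW an1) (ltW v0)) orbT.
    rewrite in_itv /= in sI; have /andP[sI1 sI2] := sI.
    have sI' : 0 <= s <= N%:R by rewrite sI2 andbT (le_trans _ sI1).
    have Bs : B s < 0.
      have [[/andP[_ h] _]|[_ //]|h|[h|h]] := B_cases sI'.
      - by move: h; rewrite ltNge sI1.
      - by move: sE; rewrite h A0 B0 mul0r subr0 => /eqP; rewrite mulf_eq0 (gt_eqF a0) (lt_eqF v0).
      - by move: sE; rewrite h An Bn mul0r subr0 => /eqP; rewrite mulf_eq0 (lt_eqF an1) (lt_eqF v0).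
      - by move: sE; rewrite h AN BN mul0r subr0 => /eqP; rewrite mulf_eq0 (gt_eqF a0) (lt_eqF v0).
    exists (v / B s), s; split => //.
    * by rewrite -mulrNN -invrN mulr_ge0 ?invr_ge0 ?oppr_ge0 ?ltW.
    * have Bne : B s != 0 by rewrite ltr0_neq0.
      by apply: (mulIf Bne); rewrite mulrAC divfK//; lra.
    * by rewrite divfK// ltr0_neq0.
  + have [|||s sI sE] := @IVT R (fun s => A s * v - B s * u) 0 n1%:R 0 => //.
    * apply: continuous_subspaceT; apply: ctsI => s; apply: tendsB;
        by apply: tendsM; [exact: pl_cts|exact: cvg_cst].
    * rewrite An A0 Bn B0 !mul0r !subr0 ge_min le_max.
      by rewrite (mulr_ge0 (ltW a0) (ltW v0)) (mulr_le0_ge0 (ltW an1) (ltW v0)) orbT.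
    rewrite in_itv /= in sI; have /andP[sI1 sI2] := sI.
    have sI' : 0 <= s <= N%:R by rewrite sI1 (le_trans sI2).
    have Bs : 0 < B s.
      have [[_ //]|[/andP[h _] _]|h|[h|h]] := B_cases sI'.
      - by move: h; rewrite ltNge sI2.
      - by move: sE; rewrite h A0 B0 mul0r subr0 => /eqP; rewrite mulf_eq0 (gt_eqF a0) (gt_eqF v0).
      - by move: sE; rewrite h An Bn mul0r subr0 => /eqP; rewrite mulf_eq0 (lt_eqF an1) (gt_eqF v0).
      - by move: sE; rewrite h AN BN mul0r subr0 => /eqP; rewrite mulf_eq0 (gt_eqF a0) (gt_eqF v0).
    exists (v / B s), s; split => //.
    * by rewrite divr_ge0// ltW.
    * have Bne : B s != 0 by rewrite lt0r_neq0.
      by apply: (mulIf Bne); rewrite mulrAC divfK//; lra.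
    * by rewrite divfK// lt0r_neq0.
  + have [u0|u0] := lerP 0 u.
      exists (u / a 0%N), 0; rewrite A0 B0 mulr0 divfK ?lt0r_neq0// lexx.
      by split => //=; rewrite divr_ge0// ltW.
    exists (u / a n1), n1%:R; rewrite An Bn mulr0 divfK ?ltr0_neq0// ler0n nN'.
    by split => //; rewrite -mulrNN -invrN mulr_ge0 ?invr_ge0 ?oppr_ge0 ?ltW.
Qed.

Definition segm n (p q : 'rV[R]_n) : set 'rV[R]_n :=
  [set p + t *: (q - p) | t in [set t | 0 <= t <= 1]].

Definition polyline n (s : nat -> 'rV[R]_n) (N : nat) : set 'rV[R]_n :=
  [set p | exists2 i, (i < N)%N & segm (s i) (s i.+1) p].

Variables (k1 m1 k2 m2 : nat -> R) (c1 c2 c3 : nat).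
Hypothesis k1_gt0 : forall i, (i <= N)%N -> 0 < k1 i.
Hypothesis k2_gt0 : forall i, (i <= N)%N -> 0 < k2 i.
Hypotheses (c1_gt0 : (0 < c1)%N) (c12' : (c1.+1 < c2)%N) (c23' : (c2.+1 < c3)%N) (c3N : (c3 < N)%N).
Hypothesis swap : [/\ k1 N = k2 0%N, k2 N = k1 0%N, m1 N = m2 0%N & m2 N = m1 0%N].
Hypothesis above : forall i, (i < c1)%N \/ (c2 < i < c3)%N -> k1 i < k2 i.
Hypothesis below : forall i, (c3 < i <= N)%N \/ (c1 < i < c2)%N -> k2 i < k1 i.
Hypothesis cross1 : k1 c1 = k2 c1 /\ m2 c1 < m1 c1.
Hypothesis cross2 : k1 c2 = k2 c2 /\ m1 c2 < m2 c2.
Hypothesis cross3 : k1 c3 = k2 c3 /\ m2 c3 < m1 c3.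

(** Homogeneous coordinates of weight [k]: over the ray through (a, b) the strand has radial factor
    1/k and height m/k. *)
Definition node (k m : nat -> R) (i : nat) : V3 := vec3 (a i / k i) (b i / k i) (m i / k i).

Let K1 := pl N k1.
Let K2 := pl N k2.

(** Interpolating all four homogeneous coordinates linearly traces a straight segment, so the strand
    is a true polygon although its radius and height are not piecewise linear in [s]. The affine
    parameter on an edge with weights k and k' is t k' / ((1 - t) k + t k'). *)
Let strand_eq (k m : nat -> R) : (forall i, (i <= N)%N -> 0 < k i) ->
  fan_pt (pl N a) (pl N b) @` [set p : V3 | 0 <= p 0 1 <= N%:R /\
    p = vec3 ((pl N k (p 0 1))^-1) (p 0 1) (pl N m (p 0 1) / pl N k (p 0 1))] =
  polyline (node k m) N.
Proof.
move=> k0.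
have seg i t : (i < N)%N -> 0 <= t <= 1 ->
    fan_pt (pl N a) (pl N b) (vec3 ((pl N k (i%:R + t))^-1) (i%:R + t)
      (pl N m (i%:R + t) / pl N k (i%:R + t))) =
    node k m i + (t * k i.+1 / ((1 - t) * k i + t * k i.+1)) *: (node k m i.+1 - node k m i).
  move=> iN tI; have /andP[t0 t1] := tI.
  have ki := k0 _ (ltnW iN); have ki1 := k0 _ iN.
  have d0 : 0 < (1 - t) * k i + t * k i.+1.
    have [->|nt] := eqVneq t 0; first by rewrite subr0 mul1r mul0r addr0.
    by have : 0 < t by [rewrite lt_def nt t0]; nra.
  have H x x' : (x + t * (x' - x)) / (k i + t * (k i.+1 - k i)) =
      x / k i + t * k i.+1 / ((1 - t) * k i + t * k i.+1) * (x' / k i.+1 - x / k i).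
    field; rewrite ?lt0r_neq0//.
  by apply: vec3_ext; rewrite /node /fan_pt !mxE /= !pl_seg// -H// mulrC.
apply/seteqP; split => [_ [p [pI pE] <-]|p [i iN [l lI <-]]].
  have [i [t [iN tI sE]]] := locate pI N0.
  exists i => //; rewrite pE sE seg//; have /andP[t0 t1] := tI.
  have ki := k0 _ (ltnW iN); have ki1 := k0 _ iN.
  have d0 : 0 < (1 - t) * k i + t * k i.+1.
    have [->|nt] := eqVneq t 0; first by rewrite subr0 mul1r mul0r addr0.
    by have : 0 < t by [rewrite lt_def nt t0]; nra.
  exists (t * k i.+1 / ((1 - t) * k i + t * k i.+1)) => //=.
  by rewrite divr_ge0 ?(ltW d0) ?mulr_ge0 ?(ltW ki1)//= ler_pdivrMr//; nra.
have ki := k0 _ (ltnW iN); have ki1 := k0 _ iN.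
rewrite /= in lI; have /andP[l0 l1] := lI.
pose t := l * k i / (l * k i + (1 - l) * k i.+1).
have d0 : 0 < l * k i + (1 - l) * k i.+1.
  have [->|nl] := eqVneq l 0; first by rewrite subr0 mul1r mul0r add0r.
  by have : 0 < l by [rewrite lt_def nl l0]; nra.
have tI : 0 <= t <= 1.
  by rewrite /t divr_ge0 ?(ltW d0) ?mulr_ge0 ?(ltW ki)//= ler_pdivrMr//; nra.
exists (vec3 ((pl N k (i%:R + t))^-1) (i%:R + t) (pl N m (i%:R + t) / pl N k (i%:R + t))).
  have : (i.+1%:R : R) <= N%:R by rewrite ler_nat.
  rewrite -natr1 => h; split; rewrite !vec3E//.
  by have := ler0n R i; lra.
rewrite seg//; congr (_ + _ *: _); rewrite /t; field.
rewrite lt0r_neq0//= (_ : _ + _ = k i * k i.+1) ?mulf_neq0 ?lt0r_neq0//; ring.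
Qed.

(** Radii are reciprocals of weights, so the strand with the smaller weight is the outer one; at a
    crossing the weights agree and the numerators [m1], [m2] compare the heights. *)
Theorem trefoil_of_nodes :
  pair_homeo [set: V3] (polyline (node k1 m1) N `|` polyline (node k2 m2) N)
             [set: V3] (@standard_trefoil R).
Proof.
have -> : polyline (node k1 m1) N `|` polyline (node k2 m2) N =
  fan_pt (pl N a) (pl N b) @` strands N%:R (fun s => (K1 s)^-1) (fun s => (K2 s)^-1)
    (fun s => pl N m1 s / K1 s) (fun s => pl N m2 s / K2 s).
  rewrite -!strand_eq// -image_setU; congr (_ @` _).
  apply/seteqP; split => p /=; first by move=> [[pI pE]|[pI pE]]; split => //; [left|right].
  by move=> [pI [pE|pE]]; [left|right].
have K1p s : 0 < K1 s by exact: pl_pos.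
have K2p s : 0 < K2 s by exact: pl_pos.
have Kc1 : continuous (fun s => (K1 s)^-1).
  by apply: ctsI => s; apply: tendsV; [exact: lt0r_neq0|exact: pl_cts].
have Kc2 : continuous (fun s => (K2 s)^-1).
  by apply: ctsI => s; apply: tendsV; [exact: lt0r_neq0|exact: pl_cts].
have c12 := ltnW c12'; have c23 := ltnW c23'.
have c2N : (c2 < N)%N by exact: ltn_trans c3N.
have c1N : (c1 < N)%N by exact: ltn_trans c2N.
have dif s : pl N (fun i => k2 i - k1 i) s = K2 s - K1 s by exact: plB.
have dif' s : pl N (fun i => k1 i - k2 i) s = K1 s - K2 s by exact: plB.
have lt2 s : K1 s < K2 s -> (K2 s)^-1 < (K1 s)^-1 by move=> h; rewrite ltf_pV2 ?posrE.
have lt1 s : K2 s < K1 s -> (K1 s)^-1 < (K2 s)^-1 by move=> h; rewrite ltf_pV2 ?posrE.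
have crossing c (m m' : nat -> R) : (c < N)%N -> k1 c = k2 c -> m c < m' c ->
    (K1 c%:R)^-1 = (K2 c%:R)^-1 /\ pl N m c%:R / K1 c%:R < pl N m' c%:R / K2 c%:R /\
    pl N m c%:R / K2 c%:R < pl N m' c%:R / K1 c%:R.
  move=> cN e h; rewrite /K1 /K2 !pl_nat ?(ltnW cN)// e; split => //.
  by rewrite ltr_pM2r ?invr_gt0 ?k2_gt0// ltnW.
have [x1 y1] := cross1; have [x2 y2] := cross2; have [x3 y3] := cross3.
have [kN kN' mN mN'] := swap.
apply: (@trefoil_of_strands R N%:R c1%:R c2%:R c3%:R) => //.
- by rewrite ltr0n.
- by rewrite ltr_nat.
- by rewrite ltr_nat.
- by rewrite ltr_nat.
- exact: fan_of_nodes.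
- by apply: ctsI => s; apply: tendsM; [exact: pl_cts|exact: Kc1].
- by apply: ctsI => s; apply: tendsM; [exact: pl_cts|exact: Kc2].
- by move=> s; rewrite !invr_gt0.
- rewrite /K1 /K2 !(pl_le0 N _ (lexx 0)) !(pl_nat _ (leqnn N)) kN kN' mN mN'; by split.
- move=> s h; apply: lt2; rewrite -subr_gt0 -dif.
  case: h => [h|h].
    have [s0|s0] := lerP s 0; first by rewrite pl_le0// subr_gt0; apply: above; left.
    apply: (@pl_gt0 N _ 0 c1) => //.
    + exact: ltnW.
    + move=> i /andP[_]; rewrite leq_eqVlt => /predU1P[->|ic]; first by rewrite x1 subrr.
      by rewrite subr_ge0 ltW//; apply: above; left.
    + by move=> i /andP[_ ic]; rewrite subr_gt0; apply: above; left.
    + by rewrite s0.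
    + by move=> _; left; rewrite subr_gt0; apply: above; left.
  apply: (@pl_gt0 N _ c2 c3) => //.
  + by rewrite (ltnW c23) (ltnW c3N).
  + move=> i /andP[]; rewrite leq_eqVlt => /predU1P[<-|ci]; first by rewrite x2 subrr.
    rewrite leq_eqVlt => /predU1P[->|ic]; first by rewrite x3 subrr.
    by rewrite subr_ge0 ltW//; apply: above; right; rewrite ci.
  + by move=> i ic; rewrite subr_gt0; apply: above; right.
  + by move=> e; have : (1 < c3 - c2)%N by [rewrite ltn_subRL addn1]; rewrite e.
- move=> s h; apply: lt1; rewrite -subr_gt0 -dif'.
  case: h => [h|h].
    have [sN|sN] := lerP N%:R s.
      by rewrite pl_geN// subr_gt0; apply: below; left; rewrite c3N leqnn.
    apply: (@pl_gt0 N _ c3 N) => //.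
    + by rewrite leqnn ltnW.
    + move=> i /andP[]; rewrite leq_eqVlt => /predU1P[<-|ci iN]; first by rewrite x3 subrr.
      by rewrite subr_ge0 ltW//; apply: below; left; rewrite ci.
    + by move=> i /andP[ic iN]; rewrite subr_gt0; apply: below; left; rewrite ic ltnW.
    + by rewrite h.
    + by move=> _; right; rewrite subr_gt0; apply: below; left; rewrite c3N leqnn.
  apply: (@pl_gt0 N _ c1 c2) => //.
  + by rewrite (ltnW c12) (ltnW c2N).
  + move=> i /andP[]; rewrite leq_eqVlt => /predU1P[<-|ci]; first by rewrite x1 subrr.
    rewrite leq_eqVlt => /predU1P[->|ic]; first by rewrite x2 subrr.
    by rewrite subr_ge0 ltW//; apply: below; right; rewrite ci.
  + by move=> i ic; rewrite subr_gt0; apply: below; right.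
  + by move=> e; have : (1 < c2 - c1)%N by [rewrite ltn_subRL addn1]; rewrite e.
- by have [? []] := crossing _ _ _ c1N x1 y1.
- by have [? []] := crossing _ _ _ c2N x2 y2.
- by have [? []] := crossing _ _ _ c3N x3 y3.
Qed.
End Nodes.

(** * Polygons with integer data *)

Section Integers.
Variable R : realType.

(** The data are binary integers, so that boolean tests on them run in [vm_compute]; [zr] carries
    the verdicts to [R]. *)
Definition zr (z : Z) : R := (int_of_Z z)%:~R.

Lemma zrD x y : zr (x + y)%Zb = zr x + zr y.
Proof. by rewrite /zr (rmorphD int_of_Z) rmorphD. Qed.

Lemma zrN x : zr (- x)%Zb = - zr x.
Proof. by rewrite /zr (rmorphN int_of_Z) rmorphN. Qed.

Lemma zrB x y : zr (x - y)%Zb = zr x - zr y.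
Proof. by rewrite -zrN -zrD. Qed.

Lemma zrM x y : zr (x * y)%Zb = zr x * zr y.
Proof. by rewrite /zr (rmorphM int_of_Z) rmorphM. Qed.

Lemma zr0 : zr 0%Zb = 0. Proof. by []. Qed.
Lemma zr1 : zr 1%Zb = 1. Proof. by []. Qed.

Lemma zr_gt0 x : (0 <? x)%Zb -> 0 < zr x.
Proof. by case: x => // p _; rewrite /zr -pmulrn ltr0n; apply/ssrnat.ltP/Pos2Nat.is_pos. Qed.

Lemma zr_ge0 x : (0 <=? x)%Zb -> 0 <= zr x.
Proof. by case: x => // p _; rewrite /zr -pmulrn ler0n. Qed.

Lemma zr_lt x y : (x <? y)%Zb -> zr x < zr y.
Proof.
move=> h; rewrite -subr_gt0 -zrB; apply: zr_gt0; apply/Z.ltb_lt.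
by apply/Z.lt_0_sub/Z.ltb_lt.
Qed.

Lemma zr_le x y : (x <=? y)%Zb -> zr x <= zr y.
Proof.
move=> h; rewrite -subr_ge0 -zrB; apply: zr_ge0; apply/Z.leb_le.
by apply/Z.le_0_sub/Z.leb_le.
Qed.

Lemma zr_eq x y : (x =? y)%Zb -> zr x = zr y.
Proof. by move=> /Z.eqb_eq ->. Qed.

Definition zrE := (zrD, zrN, zrB, zrM, zr0, zr1).

End Integers.

(** * Polygonal paths *)

Section Paths.
Variables (R : realType) (n : nat).
Local Notation V := 'rV[R]_n.

Fixpoint path_set (u : V) (s : seq V) : set V :=
  if s is v :: s' then segm u v `|` path_set v s' else set0.

Lemma path_set_cat u s t : path_set u (s ++ t) = path_set u s `|` path_set (last u s) t.
Proof. by elim: s u => [|v s IH] u /=; rewrite ?set0U// IH setUA. Qed.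

Lemma segm_split (u v x : V) : segm u v x -> segm u v = segm u x `|` segm x v.
Proof.
move=> [l /= /andP[l0 l1] <-]; apply/seteqP; split => p.
  move=> [t /= /andP[t0 t1] <-]; have [tl|lt] := lerP t l.
    left; exists (t / l).
      rewrite /= divr_ge0//=; have [->|nl] := eqVneq l 0; first by rewrite invr0 mulr0.
      by rewrite ler_pdivrMr ?mul1r// lt_def nl.
    rewrite [_ + l *: _ - _]addrAC subrr add0r scalerA; congr (_ + _ *: _).
    have [l0'|nl] := eqVneq l 0; last by rewrite divfK.
    by rewrite l0' mulr0; move: tl; rewrite l0'; lra.
  right; exists ((t - l) / (1 - l)).
    have d0 : 0 < 1 - l by lra.
    by rewrite /= divr_ge0 ?subr_ge0 ?(ltW lt)//= ler_pdivrMr// mul1r; lra.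
  have d0 : 1 - l != 0 by rewrite gt_eqF//; lra.
  by apply/rowP => i; rewrite !mxE; field.
move=> [[t /= /andP[t0 t1] <-]|[t /= /andP[t0 t1] <-]].
  exists (t * l); first by rewrite /= mulr_ge0//= mulr_ile1.
  have E (a b l' t' : R) : a + t' * l' * (b - a) = a + t' * (a + l' * (b - a) - a) by ring.
  by apply/rowP => i; rewrite !mxE; exact: E.
exists (l + t * (1 - l)); first by rewrite /=; nra.
have E (a b l' t' : R) : a + (l' + t' * (1 - l')) * (b - a) =
  a + l' * (b - a) + t' * (b - (a + l' * (b - a))) by ring.
by apply/rowP => i; rewrite !mxE; exact: E.
Qed.

Lemma polyline_path (s : nat -> V) N :
  polyline s N = path_set (s 0%N) [seq s i | i <- iota 1 N].
Proof.
elim: N => [|N IH]; first by apply/seteqP; split => p // -[].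
rewrite -[X in iota 1 X]addn1 iotaD map_cat path_set_cat -IH /= setU0.
have -> : last (s 0%N) [seq s i | i <- iota 1 N] = s N.
  by rewrite last_map; case: N {IH} => // N; rewrite -[X in iota 1 X]addn1 iotaD last_cat /= add1n.
rewrite add1n; apply/seteqP; split => p.
  move=> [j]; rewrite ltnS leq_eqVlt => /predU1P[->|iN]; first by right.
  by left; exists j.
by move=> [[i iN h]|h]; [exists i => //; exact: ltnW|exists N].
Qed.

End Paths.

(** * Certificates of subdivision *)

Section Homogeneous.
Variable R : realType.
Local Notation V3 := 'rV[R]_3.
Local Notation zr := (@zr R).

Definition hpt : Type := (Z * Z * Z * Z)%type.
Definition hx (p : hpt) := p.1.1.1.
Definition hy (p : hpt) := p.1.1.2.
Definition hz (p : hpt) := p.1.2.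
Definition hw (p : hpt) := p.2.

Definition pt (p : hpt) : V3 :=
  vec3 (zr (hx p) / zr (hw p)) (zr (hy p) / zr (hw p)) (zr (hz p) / zr (hw p)).

Definition hdet (p q : hpt) : Z := (hx p * hy q - hx q * hy p)%Zb.

Definition hpos (p : hpt) : bool := (0 <? hw p)%Zb.

Definition heq (p q : hpt) : bool :=
  [&& (hx p * hw q =? hx q * hw p)%Zb, (hy p * hw q =? hy q * hw p)%Zb &
      (hz p * hw q =? hz q * hw p)%Zb].

(* Since p det(u,v) = u det(p,v) + v det(u,p) in the plane, only the two other
   homogeneous coordinates have to be compared. *)
Definition hbetween (u p v : hpt) : bool :=
  let g := hdet u v in let s := hdet p v in let t := hdet u p in
  [&& (0 <? g)%Zb, (0 <=? s)%Zb, (0 <=? t)%Zb,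
      (g * hz p =? s * hz u + t * hz v)%Zb & (g * hw p =? s * hw u + t * hw v)%Zb].

(** Decides that the path through [fs] subdivides the one through [cs]: each fine vertex must lie on
    what remains of the current coarse edge, from [u] to [v], and reaching [v] opens the next coarse
    edge. The positive determinant in [hbetween] means that the path turns counterclockwise about
    the axis. *)
Fixpoint refines (u v : hpt) (cs fs : seq hpt) : bool :=
  if fs is p :: fs' then
    [&& hpos p, hbetween u p v & if heq p v then
       (if cs is v' :: cs' then hpos v' && refines p v' cs' fs' else nilp fs')
     else refines p v cs fs']
  else false.

Lemma heqP p q : hpos p -> hpos q -> heq p q -> pt p = pt q.
Proof.
move=> /(zr_gt0 R) /lt0r_neq0 p0 /(zr_gt0 R) /lt0r_neq0 q0 /and3P[].
move=> /(zr_eq R) + /(zr_eq R) + /(zr_eq R); rewrite !zrM => hX hY hZ.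
by apply: vec3_ext; rewrite !vec3E; apply/eqP; rewrite eqr_div//; apply/eqP.
Qed.

Lemma hbetweenP u p v : hpos u -> hpos p -> hpos v -> hbetween u p v ->
  segm (pt u) (pt v) (pt p).
Proof.
move=> /(zr_gt0 R) + /(zr_gt0 R) + /(zr_gt0 R) + /and5P[].
move=> u0 p0 v0 /(zr_gt0 R) + /(zr_ge0 R) + /(zr_ge0 R) + /(zr_eq R) + /(zr_eq R).
rewrite /hdet !zrE => g0 s0 t0 hZ hW.
have X (a b c d e f : R) : (a * b - c * d) * e = (e * b - c * f) * a + (a * f - e * d) * c by ring.
have Y (a b c d e f : R) : (a * b - c * d) * f = (e * b - c * f) * d + (a * f - e * d) * b by ring.
have hX := X (zr (hx u)) (zr (hy v)) (zr (hx v)) (zr (hy u)) (zr (hx p)) (zr (hy p)).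
have hY := Y (zr (hx u)) (zr (hy v)) (zr (hx v)) (zr (hy u)) (zr (hx p)) (zr (hy p)).
move: g0 s0 t0 hZ hW hX hY.
move: (zr (hx u) * zr (hy v) - zr (hx v) * zr (hy u)) => g.
move: (zr (hx p) * zr (hy v) - zr (hx v) * zr (hy p)) => s.
move: (zr (hx u) * zr (hy p) - zr (hx p) * zr (hy u)) => t.
move=> g0 s0 t0 hZ hW hX hY.
have gw0 : 0 < g * zr (hw p) by rewrite mulr_gt0.
have coord c cu cv : g * c = s * cu + t * cv -> c / zr (hw p) =
    cu / zr (hw u) + t * zr (hw v) / (g * zr (hw p)) * (cv / zr (hw v) - cu / zr (hw u)).
  move=> h; rewrite -[c](mulKf (lt0r_neq0 g0)) h -[zr (hw p)](mulKf (lt0r_neq0 g0)) hW.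
  have n0 : s * zr (hw u) + t * zr (hw v) != 0 by rewrite -hW lt0r_neq0.
  by field; rewrite n0 !lt0r_neq0.
exists (t * zr (hw v) / (g * zr (hw p))).
  rewrite /= divr_ge0 ?(ltW gw0) ?mulr_ge0 ?(ltW v0)//= ler_pdivrMr// hW mul1r.
  by rewrite lerDr mulr_ge0// ltW.
by apply: vec3_ext; rewrite /pt !mxE /=; apply/esym/coord.
Qed.

Lemma refinesP u v cs fs : hpos u -> hpos v -> refines u v cs fs ->
  path_set (pt u) (pt v :: map pt cs) = path_set (pt u) (map pt fs).
Proof.
elim: fs u v cs => // p fs IH u v cs u0 v0 /= /and3P[p0 /(hbetweenP u0 p0 v0) upv].
case: ifP => [/(heqP p0 v0) pv|_ h]; last first.
  by rewrite -(IH p v cs)//= setUA -segm_split.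
case: cs => [|v' cs]; first by move/nilP => ->; rewrite pv.
by case/andP => v'0 h; rewrite /= -(IH p v' cs)// pv.
Qed.

(* The third coordinate of a centre is also sqrt 2 times the radius of its bead. *)
Definition beads : seq (Z * Z * Z) := ([::
  (85, 0, 55); (137, 39, 135); (29, 120, 405); (-106, 120, 135); (-171, 120, 55);
  (-226, 120, 55); (-281, 120, 55); (-336, 120, 55); (-391, 120, 55); (-446, 120, 55);
  (-490, 87, 55); (-523, 43, 55); (-523, -12, 55); (-523, -67, 55); (-523, -122, 55);
  (-523, -177, 55); (-523, -232, 55); (-523, -287, 55); (-479, -320, 55);
  (-424, -320, 55); (-369, -320, 55); (-314, -320, 55); (-259, -320, 55);
  (-204, -320, 55); (-149, -320, 55); (-94, -320, 55); (-39, -320, 55); (5, -287, 55);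
  (5, -232, 55); (5, -177, 55); (5, -122, 55); (5, -67, 55); (5, -12, 55); (5, 43, 55);
  (5, 98, 55); (5, 153, 55); (5, 208, 55); (-39, 241, 55); (-94, 241, 55);
  (-149, 241, 55); (-204, 241, 55); (-259, 241, 55); (-314, 241, 55); (-369, 241, 55);
  (-424, 241, 55); (-479, 241, 55); (-534, 241, 55); (-589, 241, 55); (-644, 241, 55);
  (-699, 241, 55); (-754, 241, 55); (-787, 197, 55); (-820, 153, 55); (-820, 98, 55);
  (-820, 43, 55); (-820, -12, 55); (-787, -56, 55); (-743, -89, 55); (-678, -89, 135);
  (-543, -89, 405); (-408, -89, 135); (-343, -89, 55); (-288, -89, 55); (-233, -89, 55);
  (-168, -89, 135); (-103, -89, 55)
  ])%Zb.

(* Entries (a, b, k1, m1, k2, m2): on the ray spanned by (a, b) from the axis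
   (-200, 0), the two strands of the knot meet the points (a, b, m1) / k1 and
   (a, b, m2) / k2. *)
Definition nodes : seq (Z * Z * Z * Z * Z * Z) := ([::
  (11685, 0, 41, 2255, 57, 3135); (69085, 7995, 205, 27675, 337, 18535);
  (239235, 50181, 787, 171205, 1167, 64185); (239235, 114366, 1007, 386255, 1167, 64185);
  (46945, 24600, 205, 83025, 229, 12595); (205, 120, 1, 357, 1, 55);
  (8200, 6120, 51, 13697, 40, 2200); (3075, 3120, 26, 4772, 15, 825);
  (136018, 173640, 1447, 195345, 762, 41910); (251160, 375960, 3133, 369611, 1560, 85800);
  (165360, 375960, 3133, 264011, 1560, 85800); (6989, 28920, 241, 13255, 120, 6600);
  (6120, 28920, 241, 13255, 120, 6600); (-480, 28920, 241, 13255, 120, 6600);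
  (-6266, 28920, 241, 13255, 120, 6600); (-7080, 28920, 241, 13255, 120, 6600);
  (-13680, 28920, 241, 13255, 120, 6600); (-19521, 28920, 241, 13255, 120, 6600);
  (-20280, 28920, 241, 13255, 120, 6600); (-26880, 28920, 241, 13255, 120, 6600);
  (-32776, 28920, 241, 13255, 120, 6600); (-33480, 28920, 241, 13255, 120, 6600);
  (-40080, 28920, 241, 13255, 120, 6600); (-46031, 28920, 241, 13255, 120, 6600);
  (-46680, 28920, 241, 13255, 120, 6600); (-53280, 28920, 241, 13255, 120, 6600);
  (-59286, 28920, 241, 13255, 120, 6600); (-607782, 293538, 2461, 135355, 1218, 66990);
  (-337386, 146769, 1313, 72215, 609, 33495);
  (-714966, 239946, 2549, 140195, 1218, 66990);
  (-852310, 255693, 2939, 161645, 1421, 78155);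
  (-881020, 217413, 2939, 161645, 1421, 78155);
  (-881020, 139258, 2774, 152570, 1421, 78155); (-200260, 26660, 620, 34100, 323, 17765);
  (-200260, 13889, 620, 34100, 323, 17765); (-200260, 0, 620, 34100, 323, 17765);
  (-200260, -3876, 620, 34100, 323, 17765); (-203167, -7548, 629, 34595, 332, 18260);
  (-189601, -18088, 587, 32285, 323, 17765); (-175389, -28747, 543, 29865, 323, 17765);
  (-154394, -28747, 478, 26290, 323, 43605); (-28747, -5963, 89, 4895, 67, 15603);
  (-110789, -28747, 343, 18865, 323, 130815); (-323, -89, 1, 55, 1, 365);
  (-28747, -10858, 89, 4895, 122, 23212); (-67184, -28747, 208, 11440, 323, 43605);
  (-373711, -204789, 1157, 63635, 2301, 181531); (-46189, -28747, 143, 7865, 323, 17765);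
  (-28747, -20648, 89, 4895, 232, 12760); (-28747, -25543, 89, 4895, 287, 15785);
  (-186296, -188413, 620, 34100, 2117, 116435); (-24831, -28480, 89, 4895, 320, 17600);
  (-19936, -28480, 89, 4895, 320, 17600); (-15041, -28480, 89, 4895, 320, 17600);
  (-10560, -28480, 89, 4895, 320, 17600); (-131898, -370240, 1157, 63635, 4160, 235424);
  (-68263, -370240, 1157, 63635, 4160, 313744);
  (-4628, -370240, 1157, 63635, 4160, 392064);
  (59007, -370240, 1157, 63635, 4160, 470384); (9434, -28480, 89, 4895, 320, 42208);
  (10240, -28480, 89, 4895, 320, 43200); (186277, -370240, 1157, 63635, 4160, 496176);
  (18245, -25543, 89, 4895, 287, 27593); (237185, -268424, 1157, 63635, 3016, 234024);
  (19885, -18245, 97, 5335, 205, 11275);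
  (5199825, -4489605, 25365, 1395075, 51521, 2596935);
  (1733275, -1031510, 8455, 465025, 13727, 284845); (118080, -54735, 576, 31680, 820, 0);
  (5199825, -1699455, 25365, 1395075, 30841, 0); (9635, -1780, 47, 2585, 47, 0);
  (195160, -18245, 952, 52360, 820, 0); (273675, -16020, 1335, 73425, 1079, 19745);
  (11685, 0, 57, 3135, 41, 2255)
  ])%Zb.

Definition bead k : Z * Z * Z := nth (0, 0, 0)%Zb beads k.

(** The shift by 200 moves the axis of the decomposition to the origin. *)
Definition hbead (b : Z * Z * Z) : hpt := (b.1.1 + 200, b.1.2, b.2, 1)%Zb.

(** The closed polygon with its two vertical edges made oblique, since the determinant of a vertical
    edge is zero. The feet are replaced by the points at one quarter and three quarters of the
    segment joining them; the denominator 4 turns the shift by 200 into 800. *)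
Definition tilted : seq hpt :=
  let p := bead 0 in let q := bead 65 in
  [seq hbead b | b <- behead beads] ++
  [:: (p.1.1 + 3 * q.1.1 + 800, p.1.2 + 3 * q.1.2, 0, 4)%Zb;
      (3 * p.1.1 + q.1.1 + 800, 3 * p.1.2 + q.1.2, 0, 4)%Zb; hbead p].

Definition node1 (v : Z * Z * Z * Z * Z * Z) : hpt :=
  let: (a, b, k1, m1, _, _) := v in (a, b, m1, k1).
Definition node2 (v : Z * Z * Z * Z * Z * Z) : hpt :=
  let: (a, b, _, _, k2, m2) := v in (a, b, m2, k2).

(** Two turns about the axis, along the first strand and then along the second. *)
Definition nodes_chain : seq hpt :=
  [seq node1 v | v <- behead nodes] ++ [seq node2 v | v <- behead nodes].

Lemma nodes_refine :
  refines (hbead (bead 0)) (head (hbead (bead 0)) tilted) (behead tilted) nodes_chain.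
Proof. by vm_compute. Qed.

End Homogeneous.

(** * The bead polygon is a trefoil *)

Section NodeData.
Variable R : realType.
Local Notation V3 := 'rV[R]_3.
Local Notation zr := (@zr R).

Let nd i := nth (0, 0, 0, 0, 0, 0)%Zb nodes i.
Let za i := (nd i).1.1.1.1.1.
Let zb i := (nd i).1.1.1.1.2.
Let zk1 i := (nd i).1.1.1.2.
Let zm1 i := (nd i).1.1.2.
Let zk2 i := (nd i).1.2.
Let zm2 i := (nd i).2.

Lemma all_range (P : nat -> bool) p q : all P (iota p (q - p)) ->
  forall i, (p <= i < q)%N -> P i.
Proof.
move=> /allP h i /andP[pi iq]; apply: h; rewrite mem_iota pi subnKC//.
by rewrite ltnW// (leq_ltn_trans pi).
Qed.

Let a i := zr (za i).
Let b i := zr (zb i).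
Let k1 i := zr (zk1 i).
Let m1 i := zr (zm1 i).
Let k2 i := zr (zk2 i).
Let m2 i := zr (zm2 i).

Let node1E i : node a b k1 m1 i = pt R (node1 (nd i)).
Proof. by rewrite /node /pt /node1 /a /b /k1 /m1 /za /zb /zk1 /zm1; case: (nd i) => [[[[[]]]]]. Qed.

Let node2E i : node a b k2 m2 i = pt R (node2 (nd i)).
Proof. by rewrite /node /pt /node2 /a /b /k2 /m2 /za /zb /zk2 /zm2; case: (nd i) => [[[[[]]]]]. Qed.

Let behead_nodes : [seq nd i | i <- iota 1 72] = behead nodes.
Proof. by vm_compute. Qed.

Lemma tilted_trefoil :
  pair_homeo [set: V3] (path_set (pt R (hbead (bead 0))) [seq pt R v | v <- tilted])
             [set: V3] (@standard_trefoil R).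
Proof.
have tE : tilted = head (hbead (bead 0)) tilted :: behead tilted by [].
have -> : path_set (pt R (hbead (bead 0))) [seq pt R v | v <- tilted] =
    path_set (pt R (hbead (bead 0))) [seq pt R v | v <- nodes_chain].
  by rewrite tE map_cons; apply: refinesP nodes_refine.
have : path_set (pt R (hbead (bead 0))) [seq pt R v | v <- nodes_chain] =
    polyline (node a b k1 m1) 72 `|` polyline (node a b k2 m2) 72.
  rewrite !polyline_path (eq_map node1E) (eq_map node2E) node1E node2E.
  rewrite (map_comp (pt R) (node1 \o nd)) (map_comp (pt R) (node2 \o nd)).
  rewrite (map_comp node1) (map_comp node2) behead_nodes.
  rewrite /nodes_chain map_cat path_set_cat.
  have -> : pt R (node1 (nd 0)) = pt R (hbead (bead 0)) by apply: heqP.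
  by congr (_ `|` path_set _ _); rewrite last_map; congr (pt R _); vm_compute.
move=> ->.
have range (P : nat -> bool) p q (Q : nat -> Prop) :
    all P (iota p (q - p)) -> (forall i, P i -> Q i) -> forall i, (p <= i < q)%N -> Q i.
  by move=> /all_range h PQ i /h /PQ.
have lt_b i j : (i < j)%N -> (0 <= i < j)%N by [].
(* Node 35 is on the ray opposite to the first one. The crossings are at nodes 5, 43 and 69: height
   357 over 55, height 365 over 55, and height 55 over the closing segment at height 0. *)
apply: (@trefoil_of_nodes R 72 35 a b _ _ _ _ _ _ _ _ _ _ _ k1 m1 k2 m2 5 43 69) => //.
- by rewrite -oppr_gt0 -zrN; exact: zr_gt0.
- move=> i; apply: (range (fun i => 0 <? zb i)%Zb 1%N 35%N (fun i => 0 < b i)); first by vm_compute.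
  by move=> j; exact: zr_gt0.
- move=> i; apply: (range (fun i => zb i <? 0)%Zb 36%N 72%N (fun i => b i < 0)); first by vm_compute.
  by move=> j /(zr_lt R).
- move=> i /lt_b; apply: (range (fun i => 0 <? za i * zb i.+1 - za i.+1 * zb i)%Zb 0%N 72%N (fun i => 0 < a i * b i.+1 - a i.+1 * b i)).
    by vm_compute.
  by move=> j /(zr_gt0 R); rewrite !zrE.
- move=> i; rewrite -ltnS => /lt_b; apply: (range (fun i => 0 <? zk1 i)%Zb 0%N 73%N (fun i => 0 < k1 i)).
    by vm_compute.
  by move=> j; exact: zr_gt0.
- move=> i; rewrite -ltnS => /lt_b; apply: (range (fun i => 0 <? zk2 i)%Zb 0%N 73%N (fun i => 0 < k2 i)).
    by vm_compute.
  by move=> j; exact: zr_gt0.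
- move=> i [/lt_b|]; [apply: (range (fun i => zk1 i <? zk2 i)%Zb 0%N 5%N (fun i => k1 i < k2 i))|
                      apply: (range (fun i => zk1 i <? zk2 i)%Zb 44%N 69%N (fun i => k1 i < k2 i))];
    by [vm_compute|move=> j; exact: zr_lt].
- move=> i []; rewrite -?[(i <= 72)%N]ltnS; [apply: (range (fun i => zk2 i <? zk1 i)%Zb 70%N 73%N (fun i => k2 i < k1 i))|
                      apply: (range (fun i => zk2 i <? zk1 i)%Zb 6%N 43%N (fun i => k2 i < k1 i))];
    by [vm_compute|move=> j; exact: zr_lt].
- by split; [apply: zr_eq|apply: zr_lt].
- by split; [apply: zr_eq|apply: zr_lt].
Qed.

End NodeData.

(** * Smooth corners *)

Section Smooth.
Variable R : realType.

Lemma is_derive_cvg n (f : R -> 'rV[R]_n) (a : R) (df : 'rV[R]_n) :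
  (fun h => h^-1 *: ((f \o shift a) (h *: 1) - f a)) @ 0^' --> df -> is_derive a 1 f df.
Proof.
by move=> h; apply: DeriveDef; [exact: (cvgP _ h)|exact: (cvg_lim (@norm_hausdorff _ _) h)].
Qed.

Lemma is_derive_cvgR (f : R -> R) (a df : R) :
  (fun h => h^-1 *: ((f \o shift a) (h *: 1) - f a)) @ 0^' --> df -> is_derive a 1 f df.
Proof.
by move=> h; apply: DeriveDef; [exact: (cvgP _ h)|exact: (cvg_lim (@norm_hausdorff _ _) h)].
Qed.

Lemma is_derive_row n (f df : 'I_n -> R -> R) (a : R) :
  (forall i, is_derive a 1 (f i) (df i a)) ->
  is_derive a 1 (fun t => \row_i f i t) (\row_i df i a).
Proof.
move=> fd; apply: is_derive_cvg; apply: cvg_row => i.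
have [d dE] := fd i; rewrite mxE -dE.
rewrite (_ : (fun t => _) = (fun h => h^-1 *: ((f i \o shift a) (h *: 1) - f i a))) //.
by apply/funext => h; rewrite !mxE.
Qed.

(* The derivatives of a flat function are combinations of flat functions, so
   closing under the ring operations yields a class stable by derivation. *)
Definition flat (k : nat) (s : R) : R :=
  if 0 < s then expR (- s^-1) * s^-1 ^+ k else 0.

Lemma flat_ge0 k s : 0 <= flat k s.
Proof.
by rewrite /flat; case: ifP => // s0; rewrite mulr_ge0 ?expR_ge0// exprn_ge0// invr_ge0 ltW.
Qed.

(** This is exp (1/s) >= (1/s)^(k+2) / (k+2)!. The two spare powers of s make the difference
    quotient at 0 tend to 0. *)
Lemma flat_bound k s : flat k s <= (k.+2)`!%:R * s ^+ 2.
Proof.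
rewrite /flat; case: ifP => [s0|_]; last by rewrite mulr_ge0 ?sqr_ge0.
have i0 : 0 <= s^-1 by rewrite invr_ge0 ltW.
have := @expR_ge1Dxn R s^-1 k.+1 i0 => h.
rewrite expRN mulrC ler_pdivrMr ?expR_gt0//.
have f0 : 0 < (k.+2)`!%:R :> R by rewrite ltr0n fact_gt0.
have h2 : s^-1 ^+ k.+2 <= (k.+2)`!%:R * expR s^-1.
  by rewrite mulrC -ler_pdivrMr//; lra.
rewrite mulrAC; apply: le_trans (ler_wpM2r (sqr_ge0 s) h2).
by rewrite -addn2 exprD -mulrA -exprMn mulVf ?gt_eqF// expr1n mulr1.
Qed.

Lemma is_derive_flat (k : nat) (s : R) : is_derive s 1 (flat k) (flat k.+2 s - k%:R * flat k.+1 s).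
Proof.
case: (ltrgtP s 0) => s0.
- rewrite /flat ltNge (ltW s0) /= mulr0 subr0.
  apply: (@near_eq_is_derive _ _ _ (cst 0)).
  near=> t; rewrite /flat ltNge (_ : t <= 0)//.
  by apply: ltW; near: t; exact: lt_nbhsl.
- apply: (@near_eq_is_derive R R R (fun t : R => expR (- t^-1) * t^-1 ^+ k)).
    near=> t; rewrite /flat (_ : 0 < t)//.
    by near: t; exact: lt_nbhsr.
  rewrite /flat s0.
  have sn : s != 0 by rewrite gt_eqF.
  have dV : is_derive s 1 (fun t : R => t^-1) (- s ^- 2).
    have := @is_deriveV R id s 1 1 sn (is_derive_id s 1).
    by rewrite [_ *: 1]mulr1.
  have dE : is_derive s 1 (fun t => expR (- t^-1)) (expR (- s^-1) * s ^- 2).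
    have dN : is_derive s 1 (fun t : R => - t^-1) (- - s ^- 2) by exact: is_deriveN.
    by have := @is_derive1_comp R expR _ s _ _ (is_derive_expR _) dN; rewrite opprK.
  have dX : is_derive s 1 (fun t : R => t^-1 ^+ k) ((k%:R * s^-1 ^+ k.-1) * - s ^- 2).
    rewrite (_ : (fun t : R => t^-1 ^+ k) = (fun t : R => t^-1) ^+ k).
      exact: is_deriveX.
    by apply/funext => t; elim: k => //= m IH; rewrite exprS IH [in RHS]exprS.
  have dM := @is_deriveM R R (fun t : R => expR (- t^-1)) (fun t : R => t^-1 ^+ k) s 1 _ _ dE dX.
  suff -> : expR (- s^-1) * s^-1 ^+ k.+2 - k%:R * (expR (- s^-1) * s^-1 ^+ k.+1) =
      expR (- s^-1) * (k%:R * s^-1 ^+ k.-1 * - s ^- 2) +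
      s^-1 ^+ k * (expR (- s^-1) / s ^+ 2) by exact: dM.
  rewrite -exprVn; case: k {dX dM} => [|k].
    by rewrite !expr0 !mul0r mulr0 add0r subr0 mul1r.
  by rewrite /= !exprS; ring.
- have f0 j : flat j 0 = 0 by rewrite /flat ltxx.
  rewrite s0 !f0 mulr0 subr0; apply: is_derive_cvgR.
  apply: norm_cvg0.
  apply: (@squeeze_cvgr _ _ _ _ (cst 0) (fun h => (k.+2)`!%:R * `|h|)).
  + near=> h; rewrite normr_ge0 /=.
    have h0 : h != 0 by near: h; exact: nbhs_dnbhs_neq.
    rewrite /shift /= [h *: 1]mulr1 addr0 f0 subr0 [_ *: _]mulrC.
    rewrite normrM normfV ler_pdivrMr ?normr_gt0// -mulrA -expr2 -normrX.
    rewrite [`|h ^+ 2|]ger0_norm ?sqr_ge0// ger0_norm; last exact: flat_ge0.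
    exact: flat_bound.
  + exact: cvg_cst.
  + have : (fun h : R => (k.+2)`!%:R * `|h|) @ 0^' --> (k.+2)`!%:R * `|0 : R|.
      by apply: tendsM; [exact: cvg_cst|apply: tendsnorm; exact: cvg_within].
    by rewrite normr0 mulr0.
Unshelve. all: by end_near. Qed.

Inductive sm : (R -> R) -> Prop :=
  | sm_cst c : sm (fun=> c)
  | sm_id : sm (fun t => t)
  | sm_flat k a b : sm (fun t => flat k (a * t + b))
  | sm_add f g : sm f -> sm g -> sm (fun t => f t + g t)
  | sm_mul f g : sm f -> sm g -> sm (fun t => f t * g t)
  | sm_inv f : sm f -> (forall t, f t != 0) -> sm (fun t => (f t)^-1).

Lemma sm_opp f : sm f -> sm (fun t => - f t).
Proof.
move=> sf; rewrite (_ : (fun t => _) = (fun t => -1 * f t)).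
  by apply: sm_mul => //; exact: sm_cst.
by apply/funext => t; rewrite mulN1r.
Qed.

Lemma sm_derive f : sm f -> exists2 f', sm f' & forall t : R, is_derive t 1 f (f' t).
Proof.
elim=> {f}.
- by move=> c; exists (fun=> 0); [exact: sm_cst|move=> t; exact: is_derive_cst].
- by exists (fun=> 1); [exact: sm_cst|move=> t; exact: is_derive_id].
- move=> k a b; exists (fun t => (flat k.+2 (a * t + b) + - (k%:R * flat k.+1 (a * t + b))) * a).
    apply: sm_mul; last exact: sm_cst.
    apply: sm_add; first exact: sm_flat.
    by apply: sm_opp; apply: sm_mul; [exact: sm_cst|exact: sm_flat].
  move=> t; have h : is_derive t 1 (fun t : R => a * t + b) a.
    have := @is_deriveD _ _ _ (fun t : R => a * t) (cst b) t 1 _ _ (is_deriveZ a (is_derive_id t 1)) (is_derive_cst b t 1).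
    by rewrite addr0 [a *: 1]mulr1.
  exact: (is_derive1_comp (is_derive_flat k _) h).
- move=> f g _ [f' sf' fd] _ [g' sg' gd]; exists (fun t => f' t + g' t).
    exact: sm_add.
  by move=> t; exact: is_deriveD.
- move=> f g sf [f' sf' fd] sg [g' sg' gd].
  exists (fun t => f t * g' t + g t * f' t).
    by apply: sm_add; exact: sm_mul.
  by move=> t; exact: is_deriveM.
- move=> f sf [f' sf' fd] f0; exists (fun t => - ((f t)^-1 * (f t)^-1) * f' t).
    by apply: sm_mul => //; apply: sm_opp; apply: sm_mul; exact: sm_inv.
  move=> t; have := @is_deriveV R f t (f' t) 1 (f0 t) (fd t).
  by rewrite -exprVn expr2.
Qed.

Lemma sm_row_smooth n (f : 'I_n -> R -> R) : (forall i, sm (f i)) ->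
  forall m (t : R), derivable (derive1n m (fun t => \row_i f i t)) t 1.
Proof.
move=> sf m.
suff [h sh ->] : exists2 h : 'I_n -> R -> R, forall i, sm (h i) &
    derive1n m (fun t => \row_i f i t) = (fun t => \row_i h i t).
  have /choice [h' hP] : forall i, exists h', sm h' /\ forall t : R, is_derive t 1 (h i) (h' t).
    by move=> i; have [h'] := sm_derive (sh i); exists h'.
  by move=> t; have [] := @is_derive_row n h h' t (fun i => (hP i).2 t).
elim: m => [|m [h sh hE]]; first by exists f.
have /choice [h' hP] : forall i, exists h', sm h' /\ forall t : R, is_derive t 1 (h i) (h' t).
  by move=> i; have [h'] := sm_derive (sh i); exists h'.
exists h'; first by move=> i; have [] := hP i.
rewrite derive1nS hE; apply/funext => t; rewrite derive1E.
by have [] := @is_derive_row n h h' t (fun i => (hP i).2 t).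
Qed.

Section SmoothRamp.
Variable eps : R.
Hypothesis eps_gt0 : 0 < eps.

Let den s : R := flat 0 s + flat 0 (eps - s).

Lemma flat_gt0 k s : 0 < s -> 0 < flat k s.
Proof. by move=> s0; rewrite /flat s0 mulr_gt0 ?expR_gt0// exprn_gt0// invr_gt0. Qed.

Lemma flat_eq0 k s : s <= 0 -> flat k s = 0.
Proof. by rewrite /flat ltNge => ->. Qed.

Let den_gt0 s : 0 < den s.
Proof.
rewrite /den; have [s0|s0] := ltrP 0 s.
  by rewrite ltr_wpDr ?flat_ge0 ?flat_gt0.
by rewrite ltr_wpDl ?flat_ge0 ?flat_gt0//; have := eps_gt0; lra.
Qed.

(** The quotient passes from 0 to 1 between 0 and [eps], so this is a smooth substitute for max 0 s,
    different from it only between 0 and [eps]. *)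
Definition smooth_ramp (s : R) : R := s * (flat 0 s * (den s)^-1).

Lemma sm_smooth_ramp a b : sm (fun t => smooth_ramp (a * t + b)).
Proof.
have aff c d : sm (fun t => c * t + d).
  by apply: sm_add; [apply: sm_mul; [exact: sm_cst|exact: sm_id]|exact: sm_cst].
apply: sm_mul => //; apply: sm_mul; first exact: sm_flat.
apply: sm_inv; last by move=> t; exact: lt0r_neq0.
apply: sm_add; first exact: sm_flat.
rewrite (_ : (fun t => _) = (fun t => flat 0 (- a * t + (eps - b)))); first exact: sm_flat.
by apply/funext => t; congr flat; ring.
Qed.

Lemma smooth_ramp_le0 s : s <= 0 -> smooth_ramp s = 0.
Proof. by move=> s0; rewrite /smooth_ramp flat_eq0// mul0r mulr0. Qed.

Lemma smooth_ramp_ge s : eps <= s -> smooth_ramp s = s.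
Proof.
move=> s0; rewrite /smooth_ramp /den (@flat_eq0 0 (eps - s)); last by lra.
by rewrite addr0 divff ?mulr1// gt_eqF// flat_gt0//; have := eps_gt0; lra.
Qed.

Lemma smooth_ramp_itv s : 0 <= Num.max 0 s - smooth_ramp s <= eps.
Proof.
have [s0|s0] := lerP s 0.
  by rewrite smooth_ramp_le0// subrr lexx ltW.
have q0 : 0 <= flat 0 s / den s <= 1.
  rewrite ler_pdivrMr// mul1r divr_ge0 ?flat_ge0//; last exact/ltW/den_gt0.
  by rewrite /den lerDl flat_ge0.
have [se|se] := lerP eps s; first by rewrite smooth_ramp_ge// subrr lexx ltW.
by rewrite /smooth_ramp; nra.
Qed.

Lemma smooth_ramp_cts : continuous smooth_ramp.
Proof.
have [f' _ fd] := sm_derive (sm_smooth_ramp 1 0).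
move=> s; have [d _] := fd s.
have : {for s, continuous (fun t : R => smooth_ramp (1 * t + 0))}.
  exact/differentiable_continuous/derivable1_diffP.
by rewrite (_ : (fun t => _) = smooth_ramp)//; apply/funext => t; rewrite mul1r addr0.
Qed.

End SmoothRamp.

End Smooth.

(** * Straightening one smooth corner *)

Section Corner.
Variables (R : realType) (n : nat).
Local Notation V := 'rV[R]_n.
Implicit Types x y : V.

Definition dot x y : R := \sum_(i < n) x 0 i * y 0 i.

Lemma dotC x y : dot x y = dot y x.
Proof. by apply: eq_bigr => i _; rewrite mulrC. Qed.

Lemma dotDl x y z : dot (x + y) z = dot x z + dot y z.
Proof. by rewrite -big_split; apply: eq_bigr => i _; rewrite mxE mulrDl. Qed.

Lemma dotZl a x y : dot (a *: x) y = a * dot x y.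
Proof. by rewrite mulr_sumr; apply: eq_bigr => i _; rewrite mxE mulrA. Qed.

Lemma dotNl x y : dot (- x) y = - dot x y.
Proof. by rewrite -scaleN1r dotZl mulN1r. Qed.

Lemma dotBl x y z : dot (x - y) z = dot x z - dot y z.
Proof. by rewrite dotDl dotNl. Qed.

Lemma dotDr x y z : dot x (y + z) = dot x y + dot x z.
Proof. by rewrite ![dot x _]dotC dotDl. Qed.

Lemma dotZr a x y : dot x (a *: y) = a * dot x y.
Proof. by rewrite ![dot x _]dotC dotZl. Qed.

Lemma dotNr x y : dot x (- y) = - dot x y.
Proof. by rewrite ![dot x _]dotC dotNl. Qed.

Lemma dotBr x y z : dot x (y - z) = dot x y - dot x z.
Proof. by rewrite ![dot x _]dotC dotBl. Qed.

Lemma dot0l x : dot 0 x = 0.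
Proof. by rewrite -(scale0r 0) dotZl mul0r. Qed.

Definition dotE := (dotDl, dotDr, dotBl, dotBr, dotZl, dotZr, dotNl, dotNr).

Lemma dot_ge0 x : 0 <= dot x x.
Proof. by apply: sumr_ge0 => i _; rewrite -expr2 sqr_ge0. Qed.

Lemma sqdist_dot x y : sqdist x y = dot (x - y) (x - y).
Proof. by apply: eq_bigr => i _; rewrite !mxE expr2. Qed.

Lemma dot_cts y : continuous (dot ^~ y).
Proof.
apply: ctsI => x; apply: tendssum => i.
by apply: tendsM; [exact: tends_id|exact: cvg_cst].
Qed.

Lemma norm_tends (T : Type) (F : set_system T) {FF : Filter F} (f : T -> V) x :
  f @ F --> x -> (fun t => `|f t|) @ F --> `|x|.
Proof. exact: cvg_norm. Qed.

(** A map that moves points by at most 1 is proper, so its inverse is continuous. *)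
Lemma inverse_cts (Psi : V -> V) : continuous Psi -> injective Psi ->
  (forall y, exists x, Psi x = y) -> (forall x, `|Psi x - x| <= 1) ->
  exists Phi, [/\ continuous Phi, cancel Psi Phi & cancel Phi Psi].
Proof.
move=> Pc Pi Ps Pb; have /choice [Phi PhiK] := Ps.
have PsiK : cancel Psi Phi by move=> x; apply: Pi; rewrite PhiK.
exists Phi; split => // y.
pose K : set V := [set x | `|x| <= `|y| + 2].
have Kc : compact K.
  apply: bounded_closed_compact; last first.
    rewrite (_ : K = (fun x : V => `|x|) @^-1` [set t | t <= `|y| + 2])//.
    by apply: preimage_closed; [move=> x _; exact: norm_continuous|exact: closed_le].
  exists (`|y| + 2); split; first exact: num_real.
  by move=> M yM x /= xK; apply: le_trans xK (ltW yM).
have near_y : \forall y' \near nbhs y, exists2 x, K x & Psi x = y'.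
  have : \forall y' \near nbhs y, `|y'| < `|y| + 1.
    by apply: (@cvgr_norm_lt _ _ _ (nbhs y) _ id y); [exact: cvg_id|rewrite ltrDl].
  apply: filterS => y' y'lt; exists (Phi y'); last exact: PhiK.
  rewrite /K /= -[Phi y'](subrK (Psi (Phi y'))) (le_trans (ler_normD _ _))//.
  by have := Pb (Phi y'); rewrite distrC PhiK; lra.
have Pw x : setT x -> Psi @ within setT (nbhs x) --> Psi x.
  by move=> _; apply: cvg_within_filter; exact: Pc.
have idw x : setT x -> id @ within setT (nbhs x) --> x.
  by move=> _; apply: cvg_within_filter; exact: cvg_id.
exact: (quotient_tends (N := nbhs y) (@cvg_id _ _) (@hausdorff_row _ _) Kc (@subsetT _ _)
  Pw idw (fun x _ => PsiK x) near_y).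
Qed.

Lemma contraction (D eps F L X : R) : 0 <= D -> D <= eps -> L <= X ->
  eps * F <= 1 / 2 -> 0 <= L -> 0 <= F -> D * L * F <= X * (1 / 2).
Proof.
move=> D0 De LX eF L0 F0; apply: (@le_trans _ _ (eps * F * X)).
  rewrite mulrAC ler_pM ?mulr_ge0//; exact: ler_wpM2r.
by rewrite mulrC ler_wpM2l// (le_trans L0).
Qed.

Section CornerMap.
Variables (c v0 f : V) (eps : R).
Hypothesis eps_gt0 : 0 < eps.
Hypothesis f_small : eps * `|f| <= 1 / 2.
Hypothesis v0_small : eps * `|v0| <= 1 / 2.
Let gram := dot f f * dot v0 v0 - dot v0 f ^+ 2.
Hypothesis indep : 0 < gram.

Let e := gram^-1 *: (dot f f *: v0 - dot v0 f *: f).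

Let ev0 : dot v0 e = 1.
Proof.
by rewrite /e !dotE mulrC (_ : _ - _ = gram) ?divff ?gt_eqF.
Qed.

Let ef : dot f e = 0.
Proof. by rewrite /e !dotE [dot f v0]dotC; ring. Qed.

Let P := smooth_ramp eps.
Let s x := dot (x - c) e.
Let g t := c + t *: v0 + P t *: f.
Let d t := Num.max 0 t - P t.
Let l x := Num.max 0 (1 - `|x - g (s x)|).

(** Points slide along [f] only. The form [e], which is 1 on [v0] and 0 on [f], defines a time [s x]
    that sliding preserves. At time t the curve [g] is pushed by the defect [d t] between max 0 t
    and the smooth ramp, and other points by this defect damped by their distance to [g (s x)]. As
    eps |f| is at most 1/2 the damped push is contracting, which gives injectivity; surjectivity is
    the intermediate value theorem on lines parallel to [f]. *)
Definition corner_map x := x + (d (s x) * l x) *: f.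

Let sM x a : s (x + a *: f) = s x.
Proof. by rewrite /s addrAC [LHS]dotDl dotZl ef mulr0 addr0. Qed.

Let s_g t : s (g t) = t.
Proof.
by rewrite /g sM /s addrC addrA addNr add0r dotZl ev0 mulr1.
Qed.

Let d_itv t : 0 <= d t <= eps. Proof. exact: smooth_ramp_itv. Qed.

Let d0 t : ~ (0 < t < eps) -> d t = 0.
Proof.
move=> h; rewrite /d; have [t0|t0] := lerP t 0.
  by rewrite /P smooth_ramp_le0 ?subrr.
rewrite /P smooth_ramp_ge ?subrr// leNgt; apply/negP => te; apply: h.
by rewrite t0.
Qed.

Let l_itv x : 0 <= l x <= 1.
Proof. by rewrite /l le_max lexx ge_max ler01 lerBlDr lerDl normr_ge0. Qed.

Let l_lip x y : s x = s y -> `|l x - l y| <= `|x - y|.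
Proof.
move=> e'; rewrite /l e'.
have h : `| `|x - g (s y)| - `|y - g (s y)| | <= `|x - y|.
  by rewrite (le_trans (ler_dist_dist _ _))// opprB addrA subrK.
apply: le_trans h; move: (`|x - _|) (`|y - _|) => a b.
have := ler_norm (a - b); have := ler_norm (b - a); rewrite [`|b - a|]distrC.
by case: (lerP 0 (1 - a)) => ha; case: (lerP 0 (1 - b)) => hb h1 h2;
  rewrite ler_norml; lra.
Qed.

Let corner_cts : continuous corner_map.
Proof.
have sc : continuous s.
  apply: ctsI => x; apply: (cvg_comp (fun x => x - c) (dot ^~ e) _ (@dot_cts e _)).
  by apply: cvgB; [exact: cvg_id|exact: cvg_cst].
have Pc : continuous P by exact: smooth_ramp_cts.
apply: ctsI => x; apply: cvgD; first exact: cvg_id.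
apply: cvgZ; last exact: cvg_cst.
have Ps : (fun y => P (s y)) @ nbhs x --> P (s x) by apply: tends_comp; [exact: Pc|exact: sc].
apply: tendsM; first by apply: tendsB => //; apply: tendsmax; [exact: cvg_cst|exact: sc].
apply: tendsmax; first exact: cvg_cst.
apply: tendsB; first exact: cvg_cst.
apply: norm_tends; apply: cvgB; first exact: cvg_id.
apply: cvgD.
  by apply: cvgD; [exact: cvg_cst|apply: cvgZ; [exact: sc|exact: cvg_cst]].
by apply: cvgZ; [exact: Ps|exact: cvg_cst].
Qed.

Let corner_move x : `|corner_map x - x| <= 1.
Proof.
rewrite /corner_map addrC addrA addNr add0r normrZ normrM.
have /andP[a0 a1] := d_itv (s x); have /andP[b0 b1] := l_itv x.
rewrite (ger0_norm a0) (ger0_norm b0) (@le_trans _ _ (eps * 1 * `|f|))//; last first.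
  by have := f_small; lra.
by rewrite ler_wpM2r// ler_pM.
Qed.

Let corner_inj : injective corner_map.
Proof.
move=> x y h; have sxy : s x = s y.
  have sP z : s (corner_map z) = s z by exact: sM.
  by rewrite -sP h sP.
have E : x - y = (d (s y) * (l y - l x)) *: f.
  apply/eqP; rewrite mulrBr scalerBl subr_eq addrAC eq_sym subr_eq; apply/eqP.
  by move: h; rewrite /corner_map sxy => ->; rewrite addrC.
have : `|x - y| <= `|x - y| * (1 / 2).
  rewrite {1}E normrZ normrM; have /andP[a0 a1] := d_itv (s y).
  rewrite (ger0_norm a0); move: (d (s y)) a0 a1 => D a0 a1; have := l_lip (esym sxy); rewrite [`|y - x|]distrC => L.
  by apply: (contraction a0 a1 L f_small); exact: normr_ge0.
have := normr_ge0 (x - y) => h0 h1.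
have : `|x - y| = 0 by lra.
by move/eqP; rewrite normr_eq0 subr_eq0 => /eqP.
Qed.

Let corner_surj y : exists x, corner_map x = y.
Proof.
have lc : continuous (fun t : R => l (y - t *: f)).
  apply: ctsI => t; apply: tendsmax; first exact: cvg_cst.
  apply: tendsB; first exact: cvg_cst.
  apply: norm_tends; apply: cvgB.
    by apply: cvgB; [exact: cvg_cst|apply: cvgZ; [exact: cvg_id|exact: cvg_cst]].
  have E u : g (s (y - u *: f)) = g (s y) by rewrite -scaleNr sM.
  by under eq_fun do rewrite E; rewrite E; exact: cvg_cst.
have /andP[a0 a1] := d_itv (s y).
have [|||t tI tE] := @IVT R (fun t => t - d (s y) * l (y - t *: f)) 0 eps 0.
- exact: ltW.
- apply: continuous_subspaceT; apply: ctsI => t; apply: tendsB; first exact: cvg_id.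
  by apply: tendsM; [exact: cvg_cst|exact: lc].
- have /andP[b0 b1] := l_itv (y - 0 *: f); have /andP[c0 c1] := l_itv (y - eps *: f).
  move: (d (s y)) a0 a1 (l (y - 0 *: f)) b0 b1 (l (y - eps *: f)) c0 c1.
  move=> D a0 a1 l0 b0 b1 l1 c0 c1.
  rewrite ge_min le_max; apply/andP; split; apply/orP; [left|right].
    by rewrite sub0r oppr_le0 mulr_ge0.
  by rewrite subr_ge0 -[leRHS]mulr1 ler_pM.
exists (y - t *: f); rewrite /corner_map -scaleNr sM scaleNr.
by rewrite (_ : d (s y) * _ = t) ?subrK//; lra.
Qed.

Let corner_far x : 2 < `|x - c| -> corner_map x = x.
Proof.
move=> far; rewrite /corner_map; have [/andP[s0 se]|h] := pselect (0 < s x < eps); last first.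
  by rewrite d0// mul0r scale0r addr0.
suff -> : l x = 0 by rewrite mulr0 scale0r addr0.
apply/max_idPl; rewrite subr_le0.
have gc : `|g (s x) - c| <= 1.
  rewrite /g addrC !addrA addNr add0r (le_trans (ler_normD _ _))// (normrZ (s x) v0) (normrZ (P (s x)) f).
  have P_le : `|P (s x)| <= eps.
    have := d_itv (s x); rewrite /d (max_idPr (ltW s0)) ler_norml; lra.
  rewrite (gtr0_norm s0).
  apply: (@le_trans _ _ (eps * `|v0| + eps * `|f|)).
    by rewrite lerD// ler_wpM2r// ltW.
  by have := f_small; have := v0_small; lra.
have -> : x - g (s x) = (x - c) - (g (s x) - c) by rewrite opprB addrA subrK.
have := lerB_dist (x - c) (g (s x) - c); lra.
Qed.

Lemma corner_mapP : exists Psi Phi : V -> V,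
  [/\ continuous Psi, continuous Phi, cancel Psi Phi & cancel Phi Psi] /\
  [/\ forall t, Psi (c + t *: v0 + smooth_ramp eps t *: f) = c + t *: v0 + Num.max 0 t *: f,
      forall x, 2 < `|x - c| -> Psi x = x &
      forall x i, f 0 i = 0 -> Psi x 0 i = x 0 i].
Proof.
have [Phi [Phic PK KP]] := inverse_cts corner_cts corner_inj corner_surj corner_move.
exists corner_map, Phi; split => //; split => //.
- move=> t; rewrite -/(g t) /corner_map s_g /l s_g subrr normr0 subr0 (max_idPr ler01) mulr1.
  by rewrite /g -addrA -scalerDl /d [P t + _]addrC subrK.
- by move=> x i fi; rewrite /corner_map !mxE; rewrite fi mulr0 addr0.
Qed.

End CornerMap.

Lemma corner_homeo (c v0 v1 : V) (eps : R) : 0 < eps ->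
  eps * `|v1 - v0| <= 1 / 2 -> eps * `|v0| <= 1 / 2 ->
  v0 = v1 \/ 0 < dot (v1 - v0) (v1 - v0) * dot v0 v0 - dot v0 (v1 - v0) ^+ 2 ->
  exists Psi Phi : V -> V,
  [/\ continuous Psi, continuous Phi, cancel Psi Phi & cancel Phi Psi] /\
  [/\ forall t, Psi (c + t *: v0 + smooth_ramp eps t *: (v1 - v0)) =
        c + t *: v0 + Num.max 0 t *: (v1 - v0),
      forall x, 2 < `|x - c| -> Psi x = x &
      forall x i, (v1 - v0) 0 i = 0 -> Psi x 0 i = x 0 i].
Proof.
move=> e0 f_small v0_small [->|indep]; last exact: corner_mapP.
exists id, id; split; last by split => // t; rewrite subrr !scaler0.
by split => // x; exact: cvg_id.
Qed.

End Corner.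

(** * Chains of beads *)

Section Distances.
Variables (R : realType) (n : nat).
Local Notation V := 'rV[R]_n.
Implicit Types x y : V.

Lemma dot_cauchy x y : dot x y ^+ 2 <= dot x x * dot y y.
Proof.
have [y0|y0] := eqVneq (dot y y) 0.
  have h t : 0 <= dot x x - 2 * t * dot x y.
    have := dot_ge0 (x - t *: y); rewrite !dotE y0 [dot y x]dotC; lra.
  have := h ((dot x x + 1) / (2 * dot x y)).
  have [->|xy] := eqVneq (dot x y) 0; first by move=> _; rewrite y0 mulr0 expr0n.
  have -> : 2 * ((dot x x + 1) / (2 * dot x y)) * dot x y = dot x x + 1 by field.
  lra.
have yp : 0 < dot y y by rewrite lt_def y0 dot_ge0.
have := dot_ge0 (dot y y *: x - dot x y *: y); rewrite !dotE [dot y x]dotC => h.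
rewrite -(ler_pM2l yp); nra.
Qed.

Definition enorm x : R := Num.sqrt (dot x x).

Lemma enorm_ge0 x : 0 <= enorm x. Proof. exact: sqrtr_ge0. Qed.

Lemma enorm_sq x : enorm x ^+ 2 = dot x x.
Proof. by rewrite sqr_sqrtr// dot_ge0. Qed.

Lemma dot_le x y : dot x y <= enorm x * enorm y.
Proof.
have h : dot x y ^+ 2 <= (enorm x * enorm y) ^+ 2.
  by rewrite exprMn !enorm_sq dot_cauchy.
have h0 : 0 <= enorm x * enorm y by rewrite mulr_ge0 ?enorm_ge0.
have [n0|p] := lerP (dot x y) 0; first exact: le_trans n0 h0.
by move: h; rewrite ler_pXn2r// nnegrE ltW.
Qed.

Lemma enormD x y : enorm (x + y) <= enorm x + enorm y.
Proof.
have h0 : 0 <= enorm x + enorm y by rewrite addr_ge0 ?enorm_ge0.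
rewrite -(@ler_pXn2r _ 2)// ?nnegrE ?enorm_ge0//.
rewrite enorm_sq !dotE sqrrD !enorm_sq [dot y x]dotC.
by have := dot_le x y; lra.
Qed.

Lemma sqdistC x y : sqdist x y = sqdist y x.
Proof. by rewrite !sqdist_dot -[y - x]opprB dotNl dotNr opprK. Qed.

Lemma sqdist_enorm x y : sqdist x y = enorm (x - y) ^+ 2.
Proof. by rewrite enorm_sq sqdist_dot. Qed.

Lemma coord_le_norm x i : `|x 0 i| <= `|x|.
Proof.
rewrite [leRHS]/Num.norm /= mx_normrE.
exact: (le_bigmax _ (fun ij : 'I_1 * 'I_n => `|x ij.1 ij.2|) (0, i)).
Qed.

Lemma sqdist_le_norm x y d : `|x - y| <= d -> sqdist x y <= n%:R * d ^+ 2.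
Proof.
move=> xyd; have -> : n%:R * d ^+ 2 = \sum_(i < n) d ^+ 2 by rewrite sumr_const card_ord mulr_natl.
apply: ler_sum => i _.
rewrite -[leLHS]real_normK ?num_real// lerXn2r ?nnegrE ?normr_ge0//.
  exact: le_trans (normr_ge0 _) xyd.
by have := coord_le_norm (x - y) i; rewrite !mxE => /le_trans; exact.
Qed.

End Distances.

Lemma ord4 (i : 'I_4) : [\/ i = 0, i = 1, i = 2 | i = 3].
Proof.
case: i => -[|[|[|[|//]]]] h; [constructor 1|constructor 2|constructor 3|constructor 4];
  exact/val_inj.
Qed.

Lemma sm_sum (R : realType) m (F : nat -> R -> R) : (forall k, sm (F k)) ->
  sm (fun t => \sum_(k < m) F k t).
Proof.
move=> sF; elim: m => [|m IH].
  by rewrite (_ : (fun t => _) = (fun=> 0)); [exact: sm_cst|apply/funext => t; rewrite big_ord0].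
rewrite (_ : (fun t => _) = (fun t => \sum_(k < m) F k t + F m t)); first exact: sm_add.
by apply/funext => t; rewrite big_ord_recr.
Qed.

(* A vector having the same positive scalar product with two velocities shows
   that the arc keeps a non-zero speed while it turns from one to the other. *)
Lemma dual_vector (R : realType) n (x y : 'rV[R]_n) : x != 0 -> 0 < dot x x ->
  x = y \/ 0 < dot (y - x) (y - x) * dot x x - dot x (y - x) ^+ 2 ->
  exists e, dot x e = 1 /\ dot y e = 1.
Proof.
move=> x0 xp [<-|].
  by exists ((dot x x)^-1 *: x); rewrite dotZr mulVf ?gt_eqF.
have -> : y = x + (y - x) by rewrite addrC subrK.
rewrite [x + _]addrC addrK; move: (y - x) => f g0.
exists ((dot f f * dot x x - dot x f ^+ 2)^-1 *: (dot f f *: x - dot x f *: f)).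
set g := _ - _ in g0 *; rewrite !dotE [dot f x]dotC -/g.
rewrite mulVf ?gt_eqF//; split => //.
by rewrite [dot x f * _]mulrC subrr mulr0 add0r.
Qed.

Lemma dot_derive (R : realType) n (f f' : 'I_n -> R -> R) (e : 'rV[R]_n) (t : R) :
  (forall i, is_derive t 1 (f i) (f' i t)) ->
  is_derive t 1 (fun t => dot (\row_i f i t) e) (dot (\row_i f' i t) e).
Proof.
move=> fd.
have h := @is_derive_sum _ _ _ n (fun i => e 0 i *: f i) t 1 (fun i => e 0 i *: f' i t) _.
have {}h := h (fun i => is_deriveZ (e 0 i) (fd i)).
have -> : dot (\row_i f' i t) e = \sum_(i < n) e 0 i *: f' i t.
  by apply: eq_bigr => i _; rewrite mxE mulrC.
rewrite (_ : (fun t => _) = \sum_(i < n) e 0 i *: f i)//.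
by apply/funext => u; rewrite fct_sumE; apply: eq_bigr => i _; rewrite mxE mulrC.
Qed.

(** * Polygons through orthogonal beads *)

Section Chain.
Variables (R : realType) (m : nat).
Local Notation V := 'rV[R]_4.
Variables (C : nat -> V) (w : nat -> R) (eps : R).
Let v k : V := C k.+1 - C k.
Hypothesis eps_gt0 : 0 < eps.
Hypothesis eps_lt1 : eps < 1.
Hypothesis w_ge : forall k, (k <= m.+1)%N -> 55 <= w k.
Hypothesis orth : forall k, (k <= m)%N -> 2 * sqdist (C k) (C k.+1) = w k ^+ 2 + w k.+1 ^+ 2.
Hypothesis disj : forall i j, (i.+1 < j)%N -> (j <= m.+1)%N ->
  (w i + w j) ^+ 2 < 2 * sqdist (C i) (C j).
(** A point within sup distance 2 of [C k] is within Euclidean distance 4. If it were in bead j, at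
    distance a from the centre, then 2 a^2 <= w_j^2 and 2 (4 + a)^2 <= w_j^2 + 16 w_j + 32, too
    small for the distance of the two centres. *)
Hypothesis margin : forall k j, (0 < k <= m)%N -> (j <= m.+1)%N -> k != j ->
  w j ^+ 2 + 16 * w j + 32 < 2 * sqdist (C k) (C j).
Hypothesis slow : forall k, (k <= m)%N -> eps * `|v k| <= 1 / 4.
Hypothesis turn : forall k, (k < m)%N -> v k = v k.+1 \/
  0 < dot (v k.+1 - v k) (v k.+1 - v k) * dot (v k) (v k) - dot (v k) (v k.+1 - v k) ^+ 2.
Hypothesis flat3 : forall k, C k 0 3 = 0.

Let eps1 : eps <= 1. Proof. exact: ltW. Qed.
Let P := smooth_ramp eps.
Let relu (s : R) := Num.max 0 s.

(* The corners 1, ..., K are sharp and the later ones smooth. *)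
Definition hybrid (K : nat) (t : R) : V := C 0%N + t *: v 0%N +
  \sum_(k < m) (if (k < K)%N then relu (t - k.+1%:R) else P (t - k.+1%:R)) *: (v k.+1 - v k).

Definition polygon (t : R) : V := hybrid m t.

Let prefix j t : C 0%N + t *: v 0%N + \sum_(k < j) (t - k.+1%:R) *: (v k.+1 - v k) =
  C j + (t - j%:R) *: v j.
Proof.
elim: j => [|j IH]; first by rewrite big_ord0 addr0 subr0.
rewrite big_ord_recr /= addrA IH; apply/rowP => i; rewrite !mxE -natr1.
by ring.
Qed.

Lemma hybrid_edge0 K s : 0 <= s <= 1 -> hybrid K s = C 0%N + s *: v 0%N.
Proof.
move=> /andP[s0 s1]; rewrite /hybrid big1 ?addr0// => k _.
have k0 : s - k.+1%:R <= 0 by rewrite -natr1; have := ler0n R k; lra.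
by rewrite /relu /P (max_idPl k0) smooth_ramp_le0// if_same scale0r.
Qed.

(** Earlier ramps are past [eps < 1] and act as the identity, later ones have not started, and the
    terms before the current corner telescope by [prefix]. *)
Lemma hybrid_edge K j s : (j < m)%N -> 0 <= s <= 1 ->
  hybrid K (j.+1%:R + s) = C j.+1 + s *: v j +
    (if (j < K)%N then relu s else P s) *: (v j.+1 - v j).
Proof.
move=> jm /andP[s0 s1]; set t := _ + s.
have tj : t - j.+1%:R = s by rewrite /t addrAC subrr add0r.
have -> : hybrid K t = C 0%N + t *: v 0%N + \sum_(k < j) (t - k.+1%:R) *: (v k.+1 - v k) +
    (if (j < K)%N then relu s else P s) *: (v j.+1 - v j).
  rewrite /hybrid -[RHS]addrA; congr (_ + _).
  rewrite -(subnKC jm) big_split_ord /= big_ord_recr /= tj [X in _ + _ + X]big1 ?addr0; last first.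
    move=> k _; have k0 : t - (j.+1 + k).+1%:R <= 0.
      by rewrite -natr1 natrD /t; have := ler0n R k; lra.
    by rewrite /relu /P (max_idPl k0) smooth_ramp_le0// if_same scale0r.
  congr (_ + _); apply: eq_bigr => k _.
  have k1 : 1 <= t - k.+1%:R.
    have : (k.+2%:R : R) <= j.+1%:R by rewrite ler_nat ltnS.
    by rewrite -[X in X <= _]natr1 /t; lra.
  have k0 : 0 <= t - k.+1%:R by lra.
  by rewrite /relu /P (max_idPr k0) smooth_ramp_ge// ?if_same// (le_trans eps1).
rewrite prefix; congr (_ + _); apply/rowP => i; rewrite !mxE /t -natr1; ring.
Qed.

Lemma polygon_edge j s : (j <= m)%N -> 0 <= s <= 1 ->
  polygon (j%:R + s) = C j + s *: v j.
Proof.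
case: j => [|j] jm sI; first by rewrite add0r; exact: hybrid_edge0.
rewrite /polygon hybrid_edge// jm /relu (max_idPr _); last by case/andP: sI.
by rewrite -addrA -scalerDr [v j + _]addrC subrK.
Qed.

(* Along an edge, the squared distance to a third centre is an affine function
   minus l (1 - l) times the squared length, which orthogonality evaluates. *)
Lemma edge_avoid j k l : (j <= m)%N -> (k <= m.+1)%N -> k != j -> k != j.+1 ->
  0 <= l <= 1 -> w k ^+ 2 < 2 * sqdist (C j + l *: v j) (C k).
Proof.
move=> jm km kj kj1 /andP[l0 l1].
have sep i : (i <= m.+1)%N -> k != i -> w k ^+ 2 + w i ^+ 2 <= 2 * sqdist (C i) (C k).
  have pos p q : (p <= m.+1)%N -> (q <= m.+1)%N -> 0 <= w p * w q.
    by move=> /w_ge wp /w_ge wq; rewrite mulr_ge0//; lra.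
  move=> im ki; case: (ltngtP k i) => [ki'|ik'|e]; last by rewrite e eqxx in ki.
  - have [e|ne] := eqVneq i k.+1.
      by rewrite e sqdistC orth// -ltnS -e.
    have lt2 : (k.+1 < i)%N by rewrite ltn_neqAle eq_sym ne.
    by have := disj lt2 im; have := pos k i km im; rewrite sqdistC; nra.
  - have [e|ne] := eqVneq k i.+1.
      have im' : (i <= m)%N by rewrite -ltnS -e.
      by rewrite e (orth im') addrC.
    have lt2 : (i.+1 < k)%N by rewrite ltn_neqAle eq_sym ne.
    by have := disj lt2 km; have := pos i k im km; nra.
have h1 := sep j (leqW jm) kj; have h2 := sep j.+1 jm kj1; have h3 := orth jm.
have wj := w_ge (leqW jm); have wj1 := w_ge (k := j.+1) jm.
have -> : sqdist (C j + l *: v j) (C k) = (1 - l) * sqdist (C j) (C k) +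
    l * sqdist (C j.+1) (C k) - l * (1 - l) * sqdist (C j) (C j.+1).
  rewrite !sqdist_dot /v; set a := C j; set b := C j.+1; set c := C k.
  have -> : a + l *: (b - a) - c = (1 - l) *: (a - c) + l *: (b - c).
    by apply/rowP => i; rewrite !mxE; ring.
  have -> : a - b = (a - c) - (b - c) by apply/rowP => i; rewrite !mxE; ring.
  move: (a - c) (b - c) => x y; rewrite !dotE [dot y x]dotC; ring.
move: (sqdist (C j) (C k)) (sqdist (C j.+1) (C k)) (sqdist (C j) (C j.+1)) h1 h2 h3.
move=> A B D h1 h2 h3.
have : 0 < (1 - l) ^+ 2 * w j ^+ 2 + l ^+ 2 * w j.+1 ^+ 2.
  have [->|nl] := eqVneq l 0; first by rewrite subr0 expr1n mul1r expr0n mul0r addr0 exprn_gt0//; lra.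
  have lp : 0 < l by rewrite lt_def nl l0.
  apply: ltr_wpDl; first by rewrite mulr_ge0 ?sqr_ge0.
  by rewrite mulr_gt0 ?exprn_gt0//; lra.
have e1 : (1 - l) * (w k ^+ 2 + w j ^+ 2) <= (1 - l) * (2 * A) by rewrite ler_wpM2l//; lra.
have e2 : l * (w k ^+ 2 + w j.+1 ^+ 2) <= l * (2 * B) by rewrite ler_wpM2l//.
have e3 : l * (1 - l) * (2 * D) = l * (1 - l) * (w j ^+ 2 + w j.+1 ^+ 2) by rewrite h3.
lra.
Qed.

(** 19 is the largest integer d with 2 (4 d^2) < 55^2, where the factor 4 compares the squared
    Euclidean and sup norms in R^4. *)
Let far_of_sq x k : (k <= m.+1)%N -> w k ^+ 2 < 2 * sqdist x (C k) -> 19 < `|x - C k|.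
Proof.
move=> /w_ge wk h; rewrite ltNge; apply/negP => /sqdist_le_norm.
have : 3025 <= w k ^+ 2 by nra.
lra.
Qed.

Let hybrid_done K j s : (j <= K)%N -> (j <= m)%N -> 0 <= s <= 1 ->
  hybrid K (j%:R + s) = C j + s *: v j.
Proof.
case: j => [|j] jK jm sI; first by rewrite add0r; exact: hybrid_edge0.
rewrite hybrid_edge// jK /relu (max_idPr _); last by case/andP: sI.
by rewrite -addrA -scalerDr [v j + _]addrC subrK.
Qed.

Let turn_small j : (j < m)%N -> eps * `|v j.+1 - v j| <= 1 / 2.
Proof.
move=> jm; have h1 := slow (ltnW jm); have h2 := slow jm.
have := ler_wpM2l (ltW eps_gt0) (ler_normB (v j.+1) (v j)); rewrite mulrDr; lra.
Qed.

Let hybrid_close K j s : (j <= m)%N -> 0 <= s <= 1 ->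
  `|hybrid K (j%:R + s) - (C j + s *: v j)| <= 1 / 2.
Proof.
case: j => [|j] jm sI.
  by rewrite add0r hybrid_edge0// subrr normr0; lra.
have /andP[s0 s1] := sI.
rewrite hybrid_edge//; set q := if _ then _ else _.
have -> : C j.+1 + s *: v j + q *: (v j.+1 - v j) - (C j.+1 + s *: v j.+1) =
   (q - s) *: (v j.+1 - v j) by apply/rowP => i; rewrite !mxE; ring.
rewrite normrZ (le_trans _ (turn_small jm))// ler_wpM2r// distrC ler_norml.
have := smooth_ramp_itv eps_gt0 s; rewrite /q /relu /P (max_idPr s0).
by case: ifP => _; have := eps_gt0; lra.
Qed.

Let hybrid_far K j s k : (j <= m)%N -> 0 <= s <= 1 -> (k <= m.+1)%N -> k != j -> k != j.+1 ->
  2 < `|hybrid K (j%:R + s) - C k|.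
Proof.
move=> jm sI km kj kj1; have := far_of_sq km (edge_avoid jm km kj kj1 sI).
have := hybrid_close K jm sI; move: (hybrid _ _) (C j + s *: v j) (C k) => x y z h1 h2.
have := ler_distD x y z; rewrite distrC in h1; lra.
Qed.

Let hybrid_same K j s : (K.+1 < j)%N -> (j <= m)%N -> 0 <= s <= 1 ->
  hybrid K.+1 (j%:R + s) = hybrid K (j%:R + s).
Proof.
case: j => // j Kj jm sI; rewrite !hybrid_edge//.
have Kj' : (K <= j)%N by exact: ltnW.
have n1 : (j < K.+1)%N = false by apply/negbTE; rewrite -leqNgt.
have n2 : (j < K)%N = false by apply/negbTE; rewrite -leqNgt.
by rewrite n1 n2.
Qed.

Let centers_far k j : (k <= m.+1)%N -> (j <= m.+1)%N -> (0 < k <= m)%N -> k != j ->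
  19 < `|C k - C j|.
Proof.
move=> km jm kI kj; apply: far_of_sq => //; have := margin kI jm kj.
have := w_ge jm; lra.
Qed.

(** One corner is straightened at a time, by a homeomorphism supported in the sup ball of radius 2
    about its centre. This ball is far from all edges except the two at that centre, so the other
    corners are left as they are. *)
Lemma untwist K : (K <= m)%N -> exists Psi Phi : V -> V,
  [/\ continuous Psi, continuous Phi, cancel Psi Phi & cancel Phi Psi] /\
  [/\ forall t, 0 <= t <= m.+1%:R -> Psi (hybrid 0 t) = hybrid K t,
      forall x, Psi x = x \/ exists2 k, (0 < k <= K)%N & `|x - C k| <= 2 /\ `|Psi x - C k| <= 2 &
      forall x, Psi x 0 3 = x 0 3].
Proof.
elim: K => [_|K IH Km].
  exists id, id; split; first by split => // x; exact: cvg_id.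
  by split => // x; left.
have [Psi [Phi [[Pc Fc PF FP] [Ph Pm P3]]]] := IH (ltnW Km).
have [Q [Q' [[Qc Qc' QQ QQ'] [Qh Qm Q3]]]] := corner_homeo (C K.+1) eps_gt0 (turn_small Km)
  (le_trans (slow (ltnW Km)) (ltac:(lra) : 1 / 4 <= 1 / 2 :> R)) (turn Km).
exists (Q \o Psi), (Phi \o Q'); split.
  split; [|  |exact: can_comp|exact: can_comp].
    by move=> x; apply: continuous_comp; [exact: Pc|exact: Qc].
  by move=> x; apply: continuous_comp; [exact: Qc'|exact: Fc].
have Kd : (K.+1 <= m.+1)%N by exact: ltnW.
have in2 x : `|Q x - C K.+1| <= 2 \/ Q x = x.
  have [h|h] := lerP `|x - C K.+1| 2; last by right; exact: Qm.
  left; rewrite leNgt; apply/negP => far; have := Qm _ far => /(can_inj QQ) e.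
  by move: far; rewrite e ltNge h.
split.
- move=> t tI; rewrite /= Ph//; have [j [s [jm sI ->]]] := locate tI (ltn0Sn m).
  rewrite ltnS in jm; case: (ltngtP j K.+1) => jK.
  + have jK' : (j <= K)%N by [].
    rewrite !hybrid_done// ?(leq_trans jK')//; move: jK'; rewrite leq_eqVlt => /predU1P[->|jK'].
      (* The edge before the corner is the corner curve at the time s - 1 <= 0, where both ramps
         vanish. *)
      have -> : C K + s *: v K = C K.+1 + (s - 1) *: v K + P (s - 1) *: (v K.+1 - v K).
        have /andP[_ s1] := sI.
        rewrite /P smooth_ramp_le0; last by lra.
        by apply/rowP => i; rewrite /v !mxE; ring.
      have /andP[_ s1] := sI.
      by rewrite Qh /P smooth_ramp_le0 ?(max_idPl _)//; lra.
    have kj : K.+1 != j by rewrite gtn_eqF.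
    have kj1 : K.+1 != j.+1 by rewrite gtn_eqF.
    by rewrite Qm//; have := far_of_sq Kd (edge_avoid jm Kd kj kj1 sI); lra.
  + have kj : K.+1 != j by rewrite ltn_eqF.
    have kj1 : K.+1 != j.+1 by rewrite ltn_eqF// ltnW.
    by rewrite hybrid_same// Qm// hybrid_far.
  + rewrite jK !hybrid_edge// ltnn ltnSn; exact: Qh.
- move=> x /=; have [->|[k kI [h1 h2]]] := Pm x.
    have [h|h] := lerP `|x - C K.+1| 2; last by left; exact: Qm.
    have [h'|->] := in2 x; last by left.
    by right; exists K.+1; rewrite ?leqnn.
  right; exists k; first by case/andP: kI => -> /leqW ->.
  split => //; rewrite Qm//.
  have kI' : (0 < k <= m)%N by case/andP: kI => -> kK; rewrite (leq_trans kK)// ltnW.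
  have kn : k != K.+1 by rewrite ltn_eqF// ltnS; case/andP: kI.
  have := centers_far (leqW (proj2 (andP kI'))) Kd kI' kn.
  have := ler_distD (Psi x) (C k) (C K.+1); rewrite [`|C k - Psi x|]distrC; lra.
- by move=> x /=; rewrite Q3 ?P3// /v !mxE !flat3 !subr0.
Qed.

(** With D the squared length of the edge, 2 D = w j ^ 2 + w j.+1 ^ 2 and s^2 + (1 - s)^2 <= 1, so
    the two bounds cannot both fail. *)
Let edge_cover j s : (j <= m)%N -> 0 <= s <= 1 ->
  2 * sqdist (C j + s *: v j) (C j) <= w j ^+ 2 \/
  2 * sqdist (C j + s *: v j) (C j.+1) <= w j.+1 ^+ 2.
Proof.
move=> jm /andP[s0 s1]; have := orth jm.
have -> : sqdist (C j) (C j.+1) = dot (v j) (v j).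
  by rewrite sqdistC sqdist_dot.
have -> : sqdist (C j + s *: v j) (C j) = s ^+ 2 * dot (v j) (v j).
  by rewrite sqdist_dot addrC addKr !dotE; ring.
have -> : sqdist (C j + s *: v j) (C j.+1) = (1 - s) ^+ 2 * dot (v j) (v j).
  rewrite sqdist_dot (_ : _ - _ = (s - 1) *: v j); first by rewrite !dotE; ring.
  by apply/rowP => i; rewrite !mxE; ring.
move=> h; have := dot_ge0 (v j); move: (dot _ _) h => D h D0.
have [a|a] := lerP (2 * (s ^+ 2 * D)) (w j ^+ 2); first by left.
have [b|b] := lerP (2 * ((1 - s) ^+ 2 * D)) (w j.+1 ^+ 2); first by right.
have : (s ^+ 2 + (1 - s) ^+ 2) * (2 * D) <= 1 * (2 * D).
  by rewrite ler_wpM2r//; nra.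
lra.
Qed.

Let v_pos j : (j <= m)%N -> 0 < dot (v j) (v j).
Proof.
move=> jm; have := orth jm; rewrite sqdistC sqdist_dot -/(v j).
have := w_ge (leqW jm); have := w_ge (k := j.+1) jm; nra.
Qed.

Let v_neq0 j : (j <= m)%N -> v j != 0.
Proof. by move=> /v_pos; apply: contraTneq => ->; rewrite dot0l ltxx. Qed.

Let no_return j a b : (j < m)%N -> 0 <= a -> 0 <= b -> a *: v j + b *: v j.+1 = 0 ->
  a = 0 /\ b = 0.
Proof.
move=> jm a0 b0 e; suff : a + b = 0 by lra.
apply/eqP; apply: contraT => ab.
case: (turn jm) => [h|].
  move: e; rewrite -h -scalerDl => /eqP; rewrite scaler_eq0 (negPf ab) /=.
  by rewrite (negPf (v_neq0 (ltnW jm))).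
have {e} : v j = - (b / (a + b)) *: (v j.+1 - v j).
  apply/(scalerI ab); rewrite scalerA mulrN mulrC divfK// scaleNr.
  move: (v j) (v j.+1) e => x y /rowP h; apply/rowP => i; have := h i; rewrite !mxE; lra.
move: (v j.+1 - v j) => f ->; rewrite !dotE => h.
by exfalso; move: h; rewrite (_ : _ - _ = 0) ?ltxx//; ring.
Qed.

(** Of two edges without common vertex, one is covered by the beads at its ends, which the other
    avoids by [edge_avoid]. Adjacent edges do not fold back, by [no_return]. *)
Lemma polygon_inj t t' : 0 <= t <= m.+1%:R -> 0 <= t' <= m.+1%:R ->
  polygon t = polygon t' -> t = t'.
Proof.
move=> tI t'I; have [j [s [jm sI ->]]] := locate tI (ltn0Sn m).
have [j' [s' [jm' sI' ->]]] := locate t'I (ltn0Sn m).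
move: jm jm'; rewrite !ltnS => {tI t'I t t'} jm jm'.
rewrite !polygon_edge//.
wlog jj : j j' s s' jm jm' sI sI' / (j <= j')%N.
  move=> W e; case/orP: (leq_total j j') => jj; first exact: W.
  by apply/esym; apply: W.
move: jj; rewrite leq_eqVlt => /predU1P[jj|]; last rewrite leq_eqVlt => /predU1P[jj|].
- by rewrite -jj => /addrI /eqP; rewrite -subr_eq0 -scalerBl scaler_eq0 (negPf (v_neq0 jm)) orbF subr_eq0 => /eqP ->.
- rewrite -jj in jm' *.
  move=> e; have /andP[s0 s1] := sI; have /andP[s0' s1'] := sI'.
  have s1n : 0 <= 1 - s by rewrite subr_ge0.
  have z : (1 - s) *: v j + s' *: v j.+1 = 0.
    have -> : (1 - s) *: v j + s' *: v j.+1 = (C j.+1 + s' *: v j.+1) - (C j + s *: v j).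
      by apply/rowP => i; rewrite !mxE; ring.
    by rewrite e subrr.
  by have [a b] := no_return jm' s1n s0' z; rewrite -natr1; lra.
- move=> jj e.
  have far k : (k <= m.+1)%N -> k != j -> k != j.+1 ->
      ~ 2 * sqdist (C j' + s' *: v j') (C k) <= w k ^+ 2.
    by move=> km kj kj1; rewrite -e; apply/negP; rewrite -ltNge; exact: edge_avoid.
  exfalso; case: (edge_cover jm' sI'); apply: far => //.
  + exact: leqW.
  + by rewrite gtn_eqF// ltnW.
  + by rewrite gtn_eqF.
  + by rewrite gtn_eqF// ltnW// ltnW.
  + by rewrite gtn_eqF// ltnW.
Qed.

Lemma polygon_path : polygon @` [set t | 0 <= t <= m.+1%:R] =
  path_set (C 0%N) [seq C i | i <- iota 1 m.+1].
Proof.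
rewrite -polyline_path; apply/seteqP; split => [_ [t tI <-]|p [j jm [s sI <-]]].
  have [j [s [jm sI ->]]] := locate tI (ltn0Sn m).
  by exists j => //; exists s => //; rewrite polygon_edge.
rewrite ltnS in jm; exists (j%:R + s); last by rewrite polygon_edge.
move: sI => /= /andP[s0 s1]; have : (j.+1%:R : R) <= m.+1%:R by rewrite ler_nat ltnS.
by rewrite -natr1; have := ler0n R j; lra.
Qed.

Lemma bead_near x k j : (0 < k <= m)%N -> (j <= m.+1)%N -> `|x - C k| <= 2 ->
  if j == k then 2 * sqdist x (C j) < w j ^+ 2 else w j ^+ 2 < 2 * sqdist x (C j).
Proof.
move=> kI jm xk; have wj := w_ge jm; have h := sqdist_le_norm xk.
case: eqVneq => [->|jk]; first by have := w_ge (leqW (proj2 (andP kI))); nra.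
have := margin kI jm; rewrite eq_sym => /(_ jk); rewrite !sqdist_enorm in h *.
have := enorm_ge0 (x - C j); have := enorm_ge0 (x - C k); have := enorm_ge0 (C k - C j).
have : enorm (C k - C j) <= enorm (x - C k) + enorm (x - C j).
  have -> : C k - C j = (C k - x) + (x - C j) by rewrite addrA subrK.
  rewrite (le_trans (enormD _ _))// lerD2r /enorm -opprB dotNl dotNr opprK //.
have : enorm (x - C k) <= 4.
  have : enorm (x - C k) ^+ 2 <= 4 ^+ 2 by lra.
  by rewrite ler_pXn2r ?nnegrE ?enorm_ge0.
move: (enorm (x - C j)) (enorm (x - C k)) (enorm (C k - C j)) => a b c h1 h2 c0 b0 a0 h3.
rewrite ltNge; apply/negP => h4.
have : a <= w j by nra.
have : c ^+ 2 <= (4 + a) ^+ 2 by rewrite ler_pXn2r ?nnegrE//; lra.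
nra.
Qed.

Definition bead_radius k := w k / Num.sqrt 2.
Definition outgoing k : V := (enorm (v k))^-1 *: v k.
Definition incoming k : V := - (enorm (v k.-1))^-1 *: v k.-1.

Lemma bead_radius_sq k : 2 * bead_radius k ^+ 2 = w k ^+ 2.
Proof. by rewrite /bead_radius expr_div_n sqr_sqrtr// mulrC divfK. Qed.

Let w_gt0 k : (k <= m.+1)%N -> 0 < w k.
Proof. by move=> /w_ge; lra. Qed.

Lemma bead_radius_gt0 k : (k <= m.+1)%N -> 0 < bead_radius k.
Proof. by move=> km; rewrite divr_gt0// w_gt0. Qed.

Let enorm_pos k : (k <= m)%N -> 0 < enorm (v k).
Proof. by move=> km; rewrite sqrtr_gt0 v_pos. Qed.

Lemma outgoing_unit k : (k <= m)%N -> dot (outgoing k) (outgoing k) = 1.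
Proof.
move=> km; have h := enorm_pos km; rewrite /outgoing dotZl dotZr -enorm_sq.
by field; rewrite gt_eqF.
Qed.

Lemma incoming_unit k : (0 < k <= m.+1)%N -> dot (incoming k) (incoming k) = 1.
Proof.
case: k => // k /andP[_ km]; have h := enorm_pos km; rewrite /incoming dotZl dotZr -enorm_sq /=.
by field; rewrite gt_eqF.
Qed.

Let radius_lt k : (k <= m)%N -> bead_radius k < enorm (v k) /\ bead_radius k.+1 < enorm (v k).
Proof.
move=> km; have := orth km; rewrite sqdistC sqdist_enorm -/(v k).
have r0 := bead_radius_gt0 (leqW km); have r1 := bead_radius_gt0 (k := k.+1) km.
have n0 := enorm_pos km; rewrite -!bead_radius_sq => h.
by split; rewrite ltNge; apply/negP => h'; nra.
Qed.

(** Only the edges at its centre enter a bead, by [edge_avoid], and each is longer than the radius,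
    so that a full radius is covered. *)
Lemma polygon_bead j p : (j <= m.+1)%N ->
  (polygon @` [set t | 0 <= t <= m.+1%:R]) p /\ 2 * sqdist p (C j) <= w j ^+ 2 <->
  exists2 r, 0 <= r <= bead_radius j &
    (j <= m)%N /\ p = C j + r *: outgoing j \/ (0 < j)%N /\ p = C j + r *: incoming j.
Proof.
move=> jm; split.
  move=> [[t tI <-]]; have [i [s [im sI ->]]] := locate tI (ltn0Sn m).
  rewrite ltnS in im; rewrite polygon_edge// => near.
  have [ij|ij] := eqVneq j i; last have [ij1|ij1] := eqVneq j i.+1; last first.
  - by move: near; rewrite leNgt edge_avoid.
  - have n0 := enorm_pos im; have /andP[s0 s1] := sI.
    exists ((1 - s) * enorm (v i)).
      rewrite mulr_ge0 ?subr_ge0 ?(ltW n0)//=.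
      rewrite -(@ler_pXn2r _ 2)// ?nnegrE ?(ltW (bead_radius_gt0 jm))//; last first.
        by rewrite mulr_ge0 ?subr_ge0 ?(ltW n0).
      move: near; rewrite -bead_radius_sq ij1 sqdist_dot.
      have -> : C i + s *: v i - C i.+1 = (s - 1) *: v i by apply/rowP => k; rewrite !mxE; ring.
      rewrite dotZl dotZr [((1 - s) * _) ^+ 2]exprMn enorm_sq; lra.
    right; rewrite ij1; split => //; rewrite /incoming /= scalerA.
    have -> : (1 - s) * enorm (v i) * - (enorm (v i))^-1 = s - 1 by field; rewrite gt_eqF.
    by apply/rowP => k; rewrite !mxE; ring.
  - have n0 := enorm_pos im; have /andP[s0 s1] := sI.
    exists (s * enorm (v i)).
      rewrite mulr_ge0 ?(ltW n0)//=.
      rewrite -(@ler_pXn2r _ 2)// ?nnegrE ?(ltW (bead_radius_gt0 jm))//; last first.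
        by rewrite mulr_ge0 ?(ltW n0).
      move: near; rewrite -bead_radius_sq ij sqdist_dot addrC addKr dotZl dotZr [(s * _) ^+ 2]exprMn enorm_sq; lra.
    left; rewrite ij; split => //; rewrite /outgoing scalerA mulfK// gt_eqF//.
move=> [r /andP[r0 rr]] [[jm' ->]|[j0 ->]].
  have n0 := enorm_pos jm'; have [rn _] := radius_lt jm'; split; last first.
    by rewrite sqdist_dot addrC addKr dotZl dotZr outgoing_unit// -bead_radius_sq; nra.
  have sI : 0 <= r / enorm (v j) <= 1.
    by rewrite divr_ge0 ?(ltW n0)//= ler_pdivrMr// mul1r (le_trans rr)// ltW.
  exists (j%:R + r / enorm (v j)).
    have /andP[s0 s1] := sI; have : (j.+1%:R : R) <= m.+1%:R by rewrite ler_nat ltnS.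
    by rewrite /= -natr1; have := ler0n R j; lra.
  by rewrite polygon_edge// /outgoing scalerA.
case: j jm j0 rr => // j jm _ rr; have jm' : (j <= m)%N by [].
have n0 := enorm_pos jm'; have [_ rn] := radius_lt jm'; split; last first.
  by rewrite sqdist_dot addrC addKr dotZl dotZr incoming_unit// -bead_radius_sq; nra.
have sI : 0 <= 1 - r / enorm (v j) <= 1.
  have h1 : 0 <= r / enorm (v j) by rewrite divr_ge0 ?(ltW n0).
  have h2 : r / enorm (v j) <= 1 by rewrite ler_pdivrMr// mul1r (le_trans rr)// ltW.
  lra.
exists (j%:R + (1 - r / enorm (v j))).
  have /andP[s0 s1] := sI; have : (j.+1%:R : R) <= m.+1%:R by rewrite ler_nat ltnS.
  by rewrite /= -natr1; have := ler0n R j; lra.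
rewrite polygon_edge// /incoming scalerA /=.
by apply/rowP => k; rewrite !mxE; ring.
Qed.

Hypothesis m_gt0 : (0 < m)%N.
Hypothesis bottom : C 0%N 0 2 = 0 /\ C m.+1 0 2 = 0.
Hypothesis high : forall k, (0 < k <= m)%N -> 55 <= C k 0 2.
Hypothesis upright : v 0%N = C 1%N 0 2 *: delta_mx 0 2 /\ v m = - C m 0 2 *: delta_mx 0 2.

Let polygon_height t : 0 < t < m.+1%:R -> 0 < polygon t 0 2.
Proof.
move=> /andP[t0 t1]; have tI : 0 <= t <= m.+1%:R by rewrite !ltW.
have [j [s [jm sI tE]]] := locate tI (ltn0Sn m).
rewrite ltnS in jm; rewrite tE polygon_edge// !mxE.
have /andP[s0 s1] := sI.
have -> : C j 0 2 + s * (C j.+1 0 2 - C j 0 2) = (1 - s) * C j 0 2 + s * C j.+1 0 2 by ring.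
have [j0|j0] := posnP j.
  have sp : 0 < s by move: t0; rewrite tE j0 add0r.
  rewrite j0 (proj1 bottom); have := high (k := 1%N) m_gt0; nra.
have hj : 55 <= C j 0 2 by apply: high; rewrite j0.
have [je|je] := eqVneq j m.
  have sp : s < 1 by move: t1; rewrite tE je -natr1; lra.
  by rewrite je (proj2 bottom) -je; nra.
have hj1 : 55 <= C j.+1 0 2 by apply: high; rewrite /= ltn_neqAle je.
nra.
Qed.

Lemma hybrid_ends : hybrid 0 0 = C 0%N /\ hybrid 0 m.+1%:R = C m.+1.
Proof.
split; first by rewrite hybrid_edge0 ?lexx ?ler01// scale0r addr0.
have km : (m.-1 < m)%N by rewrite prednK.
rewrite -natr1 -{1}(prednK m_gt0) hybrid_edge ?lexx ?ler01// (prednK m_gt0) /=.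
rewrite leqNgt m_gt0 /P smooth_ramp_ge// !scale1r.
have -> : C m + v m.-1 + (v m - v m.-1) = C m + v m by apply/rowP => i; rewrite !mxE; ring.
by rewrite /v addrC subrK.
Qed.

(** Where the arc differs from the polygon it is within 2 of a centre of height at least 55. *)
Lemma hybrid_height t : 0 < t < m.+1%:R -> 0 < hybrid 0 t 0 2.
Proof.
move=> tI; have tI' : 0 <= t <= m.+1%:R by case/andP: tI => /ltW -> /ltW.
have [Psi [Phi [_ [Ph Pm _]]]] := untwist (leqnn m).
have := Ph t tI'; case: (Pm (hybrid 0 t)) => [-> ->|[k kI [near _]] _].
  exact: polygon_height.
have := coord_le_norm (hybrid 0 t - C k) 2; rewrite !mxE ler_norml => /andP[h _].
by have := high kI; lra.
Qed.

Lemma hybrid_flat K t : hybrid K t 0 3 = 0.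
Proof.
rewrite /hybrid !mxE !flat3 subrr mulr0 addr0 add0r summxE big1// => k _.
by rewrite !mxE !flat3; ring.
Qed.

Lemma hybrid_inj t t' : 0 <= t <= m.+1%:R -> 0 <= t' <= m.+1%:R ->
  hybrid 0 t = hybrid 0 t' -> t = t'.
Proof.
move=> tI tI' e; have [Psi [Phi [_ [Ph _ _]]]] := untwist (leqnn m).
by apply: polygon_inj => //; rewrite /polygon -!Ph// e.
Qed.

(* Off the corners the arc is the polygon, and near an end-point the polygon is
   the vertical segment. *)
Let near_end x : (hybrid 0 @` [set t | 0 <= t <= m.+1%:R]) x ->
  (`|x - C 0%N| < 1 -> exists s, x = C 0%N + s *: v 0%N) /\
  (`|x - C m.+1| < 1 -> exists s, x = C m.+1 + s *: v m).
Proof.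
move=> [t tI tx]; have [Psi [Phi [_ [Ph Pm _]]]] := untwist (leqnn m).
have moved k : (k <= m.+1)%N -> ~~ (0 < k <= m)%N -> `|x - C k| < 1 -> x = polygon t.
  move=> km kn xk; rewrite /polygon -Ph// tx; case: (Pm x) => // -[i iI [xi _]].
  have ik : i != k by apply: contraNneq kn => <-.
  exfalso; have := centers_far (leqW (proj2 (andP iI))) km iI ik.
  have := ler_distD x (C i) (C k); rewrite [`|C i - x|]distrC; lra.
have [j [s [jm sI tE]]] := locate tI (ltn0Sn m).
rewrite ltnS in jm; have pE : polygon t = C j + s *: v j by rewrite tE polygon_edge.
split => xC.
  exists s; rewrite (moved 0%N)// pE; case: (posnP j) => [->//|j0].
  have j0' : 0%N != j by rewrite eq_sym -lt0n.
  have h := far_of_sq (leq0n _) (edge_avoid jm (leq0n _) j0' isT sI).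
  rewrite -pE -(moved 0%N (leq0n _) isT xC) in h.
  by exfalso; have := lt_trans h xC; rewrite ltNge ler1n.
exists (s - 1); rewrite (moved m.+1)// ?ltnn ?andbF// pE.
have [je|jn] := eqVneq j m; first by rewrite je; apply/rowP => i; rewrite /v !mxE; ring.
have jm' : (j < m)%N by rewrite ltn_neqAle jn.
have k0 : ~~ (0 < m.+1 <= m)%N by rewrite ltnn andbF.
have k1 : m.+1 != j by rewrite gtn_eqF// ltnS.
have k2 : m.+1 != j.+1 by rewrite gtn_eqF.
have h := far_of_sq (leqnn _) (edge_avoid jm (leqnn _) k1 k2 sI).
rewrite -pE -(moved _ (leqnn _) k0 xC) in h.
by exfalso; have := lt_trans h xC; rewrite ltNge ler1n.
Qed.

Lemma hybrid_contact : infinite_contact (hybrid 0 @` [set t | 0 <= t <= m.+1%:R]) (C 0%N) /\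
  infinite_contact (hybrid 0 @` [set t | 0 <= t <= m.+1%:R]) (C m.+1).
Proof.
have contact k (h : R) u : u = h *: delta_mx 0 2 -> (forall x,
    (hybrid 0 @` [set t | 0 <= t <= m.+1%:R]) x -> `|x - C k| < 1 ->
    exists s : R, x = C k + s *: u) ->
    infinite_contact (hybrid 0 @` [set t | 0 <= t <= m.+1%:R]) (C k).
  move=> uE E n.
  have : \forall x \near nbhs (C k), `|C k - x| < 1.
    by apply/nbhs_ballP; exists 1 => //= x; rewrite -ball_normE.
  rewrite near_withinE; apply: filterS => x xC Ax.
  (* The point is itself on the normal line, so the distance is 0, below every power. *)
  exists x; last by rewrite /Defs.edist sqdist_dot subrr dot0l sqrtr0 exprn_ge0// sqrtr_ge0.
  have [|s ->] := E x Ax; first by rewrite distrC.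
  by exists (s * h) => //; rewrite uE scalerA.
have [u0 u1] := upright.
split; [apply: contact u0 _ => x Ax|apply: contact u1 _ => x Ax];
  by have [] := near_end Ax.
Qed.

Let hybrid_local j t : (j < m)%N -> j%:R + eps <= t -> t <= j.+2%:R \/ j.+1 = m ->
  hybrid 0 t = C j.+1 + (t - j.+1%:R) *: v j + P (t - j.+1%:R) *: (v j.+1 - v j).
Proof.
move=> jm tj tj2.
have -> : hybrid 0 t = C 0%N + t *: v 0%N + \sum_(k < j) (t - k.+1%:R) *: (v k.+1 - v k) +
    P (t - j.+1%:R) *: (v j.+1 - v j).
  rewrite /hybrid -[RHS]addrA; congr (_ + _).
  rewrite -(subnKC jm) big_split_ord /= big_ord_recr /= [X in _ + _ + X]big1 ?addr0; last first.
    move=> k _; rewrite /P smooth_ramp_le0 ?scale0r//.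
    case: tj2 => [tj2|jm']; last first.
      have z : (m - j.+1 = 0)%N by rewrite jm' subnn.
      by move: (nat_of_ord k) (ltn_ord k) => k' kk; rewrite z in kk.
    rewrite -natr1 natrD; have := ler0n R k; move: tj2; rewrite -natr1; lra.
  congr (_ + _); apply: eq_bigr => k _; congr (_ *: _).
  rewrite /P smooth_ramp_ge//; have : (k.+1%:R : R) <= j%:R by rewrite ler_nat.
  lra.
by rewrite prefix; congr (_ + _); apply/rowP => i; rewrite !mxE -natr1; ring.
Qed.

(** A linear form along which the arc advances at unit speed near [t]; its velocity is therefore
    non-zero. From j + eps to j + 2 only the corner j + 1 is turning, and a form with value 1 on
    both adjacent velocities kills the ramp term. *)
Let locally_affine (t : R) : 0 <= t <= m.+1%:R -> exists e c,
  \forall u \near nbhs t, dot (hybrid 0 u) e = c + u.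
Proof.
move=> tI; have [t1|t1] := ltrP t 1.
  exists ((dot (v 0%N) (v 0%N))^-1 *: v 0%N), (dot (C 0%N) ((dot (v 0%N) (v 0%N))^-1 *: v 0%N)).
  apply: filterS (lt_nbhsl t1) => u u1.
  have -> : hybrid 0 u = C 0%N + u *: v 0%N.
    rewrite /hybrid big1 ?addr0// => k _.
    by rewrite /P smooth_ramp_le0 ?scale0r// -natr1; have := ler0n R k; lra.
  by rewrite dotDl [dot (u *: _) _]dotZl [dot (v 0%N) (_ *: _)]dotZr mulVf ?mulr1 ?gt_eqF ?v_pos.
suff [j [jm tj tj2]] : exists j, [/\ (j < m)%N, j%:R + eps < t & t < j.+2%:R \/ j.+1 = m].
  have [e [e0 e1]] := dual_vector (v_neq0 (ltnW jm)) (v_pos (ltnW jm)) (turn jm).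
  exists e, (dot (C j.+1) e - j.+1%:R).
  have near2 : \forall u \near nbhs t, u <= j.+2%:R \/ j.+1 = m.
    case: tj2 => [tj2|->]; last by apply: nearW => u; right.
    by apply: filterS (lt_nbhsl tj2) => u /ltW; left.
  apply: filterS2 (lt_nbhsr tj) near2 => u /ltW uj uj2.
  rewrite (hybrid_local jm uj uj2) [dot (_ + _ + _) e]dotDl [dot (C j.+1 + _) e]dotDl.
  rewrite (dotZl (u - j.+1%:R) (v j) e) (dotZl _ (v j.+1 - v j) e) [dot (v j.+1 - v j) e]dotBl.
  by rewrite e0 e1 subrr mulr0 addr0 mulr1; ring.
have [i [s [im sI tE]]] := locate tI (ltn0Sn m); rewrite ltnS in im.
have /andP[s0 s1] := sI; have e1 := eps_lt1.
have [s1'|s1'] := eqVneq s 1; last first.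
  have sl : s < 1 by rewrite lt_def eq_sym s1'.
  case: i im tE => [|i] im tE; first by move: t1; rewrite tE; lra.
  by exists i; split => //; rewrite tE -?natr1; [lra|left; lra].
have [ie|im'] := eqVneq i m; last by (exists i; split;
  [rewrite ltn_neqAle im'|rewrite tE s1'; lra|left; rewrite tE s1' -!natr1; lra]).
exists m.-1; rewrite prednK//; split => //; last by right.
rewrite tE s1' ie; have : (m.-1%:R : R) <= m%:R by rewrite ler_nat leq_pred.
lra.
Qed.

Lemma arc_smooth : exists g : R -> V,
  [/\ forall t, g t = hybrid 0 (m.+1%:R * t),
      forall n (t : R), derivable (derive1n n g) t 1 &
      forall t, 0 <= t <= 1 -> derive1 g t != 0].
Proof.
pose f i t : R := C 0%N 0 i + (m.+1%:R * t) * v 0%N 0 i +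
  \sum_(k < m) P (m.+1%:R * t + - k.+1%:R) * (v k.+1 - v k) 0 i.
have gE t : \row_i f i t = hybrid 0 (m.+1%:R * t).
  apply/rowP => i; rewrite /hybrid !mxE summxE; congr (_ + _); first by rewrite /v !mxE.
  by apply: eq_bigr => k _; rewrite !mxE.
have sf i : sm (f i).
  apply: sm_add; last first.
    apply: (@sm_sum R m (fun k t => P (m.+1%:R * t + - k.+1%:R) * (v k.+1 - v k) 0 i)) => k.
    by apply: sm_mul; [exact: sm_smooth_ramp|exact: sm_cst].
  apply: sm_add; first exact: sm_cst.
  apply: sm_mul; last exact: sm_cst.
  by apply: sm_mul; [exact: sm_cst|exact: sm_id].
exists (fun t => \row_i f i t); split => //; first exact: sm_row_smooth.
move=> t tI.
have /choice [f' fP] : forall i, exists h, forall t : R, is_derive t 1 (f i) (h t).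
  by move=> i; have [h _ hP] := sm_derive (sf i); exists h.
rewrite derive1E (@derive_val _ _ _ _ _ _ _ (is_derive_row (fun i => fP i t))).
apply/eqP => z.
have TI : 0 <= m.+1%:R * t <= m.+1%:R.
  have /andP[t0 t1] := tI; have m0 := ler0n R m.+1.
  by rewrite mulr_ge0//= -[leRHS]mulr1 ler_wpM2l.
have [e [c near_e]] := locally_affine TI.
have d1 := dot_derive e (fun i => fP i t).
have d2 : is_derive t 1 (fun u => dot (\row_i f i u) e) m.+1%:R.
  apply: (@near_eq_is_derive R R R (fun u : R => c + m.+1%:R * u)).
    have : (fun u : R => m.+1%:R * u) @ nbhs t --> m.+1%:R * t by tends.
    move=> mc; have h : \forall u \near nbhs t, dot (hybrid 0 (m.+1%:R * u)) e = c + m.+1%:R * u.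
      exact: mc _ near_e.
    by apply: filterS h => u uE; rewrite gE uE.
  have := @is_deriveD _ _ _ (cst c) (fun u : R => m.+1%:R * u) t 1 _ _ (is_derive_cst c t 1) (is_deriveZ m.+1%:R (is_derive_id t 1)).
  by rewrite add0r [_ *: 1]mulr1.
have := @derive_val _ _ _ _ _ _ _ d1; rewrite (@derive_val _ _ _ _ _ _ _ d2) z dot0l.
by move/eqP; rewrite pnatr_eq0.
Qed.

End Chain.

(** * Charts of the beads *)

Section BallMaps.
Variables (R : realType) (n : nat).
Local Notation V := 'rV[R]_n.
Implicit Types x y : V.

Lemma enormZ a x : enorm (a *: x) = `|a| * enorm x.
Proof.
by rewrite /enorm dotZl dotZr mulrA -expr2 sqrtrM ?sqr_ge0// sqrtr_sqr.
Qed.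

Lemma enorm0 : enorm (0 : V) = 0.
Proof. by rewrite /enorm dot0l sqrtr0. Qed.

Lemma dot_eq0 x : (dot x x == 0) = (x == 0).
Proof.
apply/eqP/eqP => [|->]; last exact: dot0l.
move=> h; apply/rowP => i; rewrite mxE.
have h0 : x 0 i ^+ 2 <= 0.
  rewrite -h /dot (bigD1 i)//= -expr2 lerDl.
  by apply: sumr_ge0 => j _; rewrite -expr2 sqr_ge0.
by apply/eqP; rewrite -sqrf_eq0 eq_le h0 sqr_ge0.
Qed.

Lemma enorm_eq0 x : (enorm x == 0) = (x == 0).
Proof. by rewrite sqrtr_eq0 -dot_eq0 eq_le dot_ge0 andbT. Qed.

Lemma enorm_gt0 x : (0 < enorm x) = (x != 0).
Proof. by rewrite lt_def enorm_eq0 enorm_ge0 andbT. Qed.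

Lemma coord_le_enorm x i : `|x 0 i| <= enorm x.
Proof.
rewrite -sqrtr_sqr ler_wsqrtr// /dot (bigD1 i)//= -expr2 lerDl.
by apply: sumr_ge0 => j _; rewrite -expr2 sqr_ge0.
Qed.

Lemma enorm_cts : continuous (@enorm R n).
Proof.
apply: ctsI => x; apply: tendssqrt; apply: tendssum => i.
by apply: tendsM; exact: tends_id.
Qed.

Section Straighten.
Variable m : V.
Hypothesis m_lt1 : dot m m < 1.

(* Radially extended to the ball, this sends two radii whose unit vectors have
   midpoint m onto a diameter. *)
Definition unbend y : V :=
  (enorm y / enorm (y - enorm y *: m)) *: (y - enorm y *: m).

Let offset_neq0 y : y != 0 -> y - enorm y *: m != 0.
Proof.
move=> y0; rewrite subr_eq0; apply/eqP => /(congr1 (fun z => dot z z)).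
rewrite dotZl dotZr mulrA -expr2 enorm_sq => h.
have := enorm_gt0 y; rewrite y0 => h0; have : 0 < dot y y by rewrite -enorm_sq exprn_gt0.
move: h; have := m_lt1; move: (dot y y) (dot m m) => d mm; nra.
Qed.

Lemma unbend0 : unbend 0 = 0.
Proof. by rewrite /unbend enorm0 mul0r scale0r. Qed.

Lemma unbend_norm y : enorm (unbend y) = enorm y.
Proof.
have [->|y0] := eqVneq y 0; first by rewrite unbend0.
have h := offset_neq0 y0; rewrite enormZ ger0_norm ?divr_ge0 ?enorm_ge0//.
by rewrite divfK// enorm_eq0.
Qed.

(** At 0, where the direction has no limit, continuity comes from the preservation of the norm. *)
Lemma unbend_cts : continuous unbend.
Proof.
apply: ctsI => y; have [->|y0] := eqVneq y 0.
  rewrite unbend0; apply: cvg_row => i; rewrite mxE; apply: norm_cvg0.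
  apply: (@squeeze_cvgr _ _ _ _ (cst 0) (@enorm R n)).
  - by apply: nearW => z /=; rewrite normr_ge0 -(unbend_norm z) coord_le_enorm.
  - exact: cvg_cst.
  - by rewrite -[X in _ --> X]enorm0; exact: enorm_cts.
have oc : (fun z => z - enorm z *: m) @ nbhs y --> y - enorm y *: m.
  by apply: cvgB; [exact: cvg_id|apply: cvgZr_tmp; exact: enorm_cts].
apply: cvgZ => //; apply: tendsdiv; first by rewrite enorm_eq0 offset_neq0.
  exact: enorm_cts.
by apply: (cvg_comp _ _ oc); exact: enorm_cts.
Qed.

(** On the sphere of radius t, [unbend] is the central projection from t m, an interior point
    because |m| < 1; a ray from an interior point meets the sphere only once. *)
Lemma unbend_inj : injective unbend.
Proof.
move=> y z e; have t_eq : enorm y = enorm z by rewrite -unbend_norm e unbend_norm.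
have [y0|y0] := eqVneq y 0.
  by apply/esym/eqP; rewrite y0 -enorm_eq0 -t_eq y0 enorm0.
have z0 : z != 0 by rewrite -enorm_eq0 -t_eq enorm_eq0.
have oy := offset_neq0 y0; have oz := offset_neq0 z0.
move: e; rewrite /unbend -t_eq in oz *; set t := enorm y in oy oz *.
have t0 : 0 < t by rewrite enorm_gt0.
set a := y - t *: m in oy *; set b := z - t *: m in oz * => e.
have na : 0 < enorm a by rewrite enorm_gt0.
have nb : 0 < enorm b by rewrite enorm_gt0.
have ab : a = (enorm a / enorm b) *: b.
  have : (enorm a / t) *: ((t / enorm a) *: a) = (enorm a / t) *: ((t / enorm b) *: b) by rewrite e.
  have nz p : 0 < p -> t / p * (p / t) = 1 by move=> p0; rewrite mulrA divfK ?divff ?gt_eqF.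
  rewrite !scalerA [enorm a / t * _]mulrC nz// scale1r => e1; rewrite [LHS]e1; congr (_ *: _).
  by rewrite mulrA divfK ?gt_eqF.
set l := enorm a / enorm b in ab.
have l0 : 0 < l by rewrite divr_gt0.
have ya : y = t *: m + a by rewrite /a addrC subrK.
have zb : z = t *: m + b by rewrite /b addrC subrK.
have hy : dot y y = t ^+ 2 by rewrite -enorm_sq.
have hz : dot z z = t ^+ 2 by rewrite -enorm_sq -t_eq.
suff l1 : l = 1 by rewrite ya zb ab l1 scale1r.
clear e; clearbody l a b t; clear oy oz na.
move: hy hz; rewrite ya zb ab !dotE [dot b m]dotC.
have bb : 0 < dot b b by rewrite -enorm_sq exprn_gt0.
move: (dot m m) (dot m b) (dot b b) m_lt1 bb => mm mb B h1 B0 e1 e2.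
apply/eqP; rewrite -subr_eq0; apply/eqP.
have : (l - 1) * ((l + 1) * B + 2 * t * mb) = 0 by nra.
move/eqP; rewrite mulf_eq0 => /orP[/eqP //|/eqP e3]; exfalso.
have t2 : 0 < t ^+ 2 by rewrite exprn_gt0.
have : l * B = - (t ^+ 2 * (1 - mm)) by nra.
have : 0 < l * B by rewrite mulr_gt0.
have : 0 < t ^+ 2 * (1 - mm) by rewrite mulr_gt0// subr_gt0.
lra.
Qed.

Lemma unbend_surj x : exists y, unbend y = x.
Proof.
have [->|x0] := eqVneq x 0; first by exists 0; exact: unbend0.
have t0 : 0 < enorm x by rewrite enorm_gt0.
set t := enorm x in t0; pose mu := dot m x / t.
(* The positive solution of |t m + l x| = t: the place where the ray from t m in the direction of x
   leaves the sphere. *)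
pose l := - mu + Num.sqrt (mu ^+ 2 + (1 - dot m m)).
have d0 : 0 < 1 - dot m m by rewrite subr_gt0.
have q0 : 0 <= mu ^+ 2 + (1 - dot m m) by rewrite addr_ge0 ?sqr_ge0 ?ltW.
have lq : l ^+ 2 + 2 * l * mu = 1 - dot m m.
  have := sqr_sqrtr q0; rewrite /l; move: (Num.sqrt _) => s h; nra.
have l0 : 0 < l.
  have : `|mu| < Num.sqrt (mu ^+ 2 + (1 - dot m m)).
    by rewrite -sqrtr_sqr ltr_sqrt ?ltrDl// ltr_wpDl ?sqr_ge0.
  rewrite /l; have := ler_norm mu; lra.
pose y := t *: m + l *: x.
have yn : enorm y = t.
  have : dot y y = t ^+ 2.
    rewrite /y !dotE [dot x m]dotC -(enorm_sq x) -/t.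
    have -> : dot m x = mu * t by rewrite /mu divfK// gt_eqF.
    rewrite (_ : _ + _ = t ^+ 2 * (dot m m + (l ^+ 2 + 2 * l * mu))); first by rewrite lq; ring.
    by ring.
  by move=> h; rewrite /enorm h sqrtr_sqr gtr0_norm.
exists y; rewrite /unbend yn /y addrAC subrr add0r enormZ (gtr0_norm l0) -/t scalerA.
by rewrite (_ : t / (l * t) * l = 1) ?scale1r//; field; rewrite !gt_eqF.
Qed.

Lemma unbend_radius u s : dot u u = 1 -> 0 <= s ->
  unbend (s *: u) = (s / enorm (u - m)) *: (u - m).
Proof.
move=> u1 s0; have eu : enorm u = 1 by rewrite /enorm u1 sqrtr1.
have [->|sn] := eqVneq s 0; first by rewrite !scale0r unbend0 mul0r scale0r.
rewrite /unbend enormZ eu mulr1 (ger0_norm s0) -scalerBr enormZ (ger0_norm s0) scalerA.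
congr (_ *: _); have [->|nz] := eqVneq (enorm (u - m)) 0; first by rewrite mulr0 invr0 !mulr0 mul0r.
by field; rewrite sn nz.
Qed.

End Straighten.

(** The reflection in the hyperplane orthogonal to [w], and the identity when [w = 0]; so two
    vectors of equal length are exchanged even if they coincide. *)
Definition householder w x : V := x - (2 * dot x w / dot w w) *: w.

Lemma householder_norm w x : dot (householder w x) (householder w x) = dot x x.
Proof.
rewrite /householder; have [->|w0] := eqVneq w 0; first by rewrite scaler0 subr0.
by rewrite !dotE [dot w x]dotC; field; rewrite dot_eq0.
Qed.

Lemma householderK w : involutive (householder w).
Proof.
move=> x; rewrite /householder; have [->|w0] := eqVneq w 0; first by rewrite !scaler0 !subr0.
rewrite dotBl dotZl divfK ?dot_eq0//.
have -> : 2 * (dot x w - 2 * dot x w) / dot w w = - (2 * dot x w / dot w w) by ring.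
by rewrite scaleNr opprK subrK.
Qed.

Lemma householder_cts w : continuous (householder w).
Proof.
apply: ctsI => x; apply: cvgB; first exact: cvg_id.
apply: cvgZr_tmp; apply: tendsM; last exact: cvg_cst.
by apply: tendsM; [exact: cvg_cst|exact: dot_cts].
Qed.

Lemma householderZ w a x : householder w (a *: x) = a *: householder w x.
Proof. by rewrite /householder dotZl scalerBr scalerA; congr (_ - _ *: _); ring. Qed.

Lemma householder_swap x y : dot x x = dot y y -> householder (x - y) x = y.
Proof.
move=> xy; rewrite /householder; have [e|w0] := eqVneq (x - y) 0.
  by rewrite e scaler0 subr0; apply/eqP; rewrite -subr_eq0 e.
have -> : dot (x - y) (x - y) = 2 * dot x (x - y).
  by rewrite !dotE [dot y x]dotC -xy; ring.
rewrite divff; first by rewrite scale1r opprB addrC subrK.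
rewrite mulf_neq0 ?pnatr_eq0//.
apply: contraNneq w0 => z; rewrite -dot_eq0.
have -> : dot (x - y) (x - y) = 2 * dot x (x - y).
  by rewrite !dotE [dot y x]dotC -xy; ring.
by rewrite z mulr0.
Qed.

End BallMaps.

(** * Coordinates in R^4 and spun sets *)

Section Rows.
Variable R : realType.
Local Notation V3 := 'rV[R]_3.
Local Notation E4 := 'rV[R]_4.

Lemma sqr_le0 (x : R) : x ^+ 2 <= 0 -> x = 0.
Proof. by move=> h; apply/eqP; rewrite -sqrf_eq0 eq_le h sqr_ge0. Qed.

Definition vec4 (a b c d : R) : E4 := \row_(j < 4) [:: a; b; c; d]`_j.

Lemma vec4E a b c d : ((vec4 a b c d) 0 0 = a) * ((vec4 a b c d) 0 1 = b) *
  ((vec4 a b c d) 0 2 = c) * ((vec4 a b c d) 0 3 = d).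
Proof. by rewrite !mxE. Qed.

Lemma vec4_ext (p q : E4) : p 0 0 = q 0 0 -> p 0 1 = q 0 1 -> p 0 2 = q 0 2 ->
  p 0 3 = q 0 3 -> p = q.
Proof. by move=> h0 h1 h2 h3; apply/rowP => i; case: (ord4 i) => ->. Qed.

Lemma vec4_inj a b c d a' b' c' d' : vec4 a b c d = vec4 a' b' c' d' ->
  [/\ a = a', b = b', c = c' & d = d'].
Proof.
by move=> e; split; [move: e => /rowP/(_ 0)|move: e => /rowP/(_ 1)|move: e => /rowP/(_ 2)|
  move: e => /rowP/(_ 3)]; rewrite !vec4E.
Qed.

Lemma tends_vec4 (T : Type) (F : set_system T) {FF : Filter F}
    (f g h k : T -> R) a b c d :
  f @ F --> a -> g @ F --> b -> h @ F --> c -> k @ F --> d ->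
  (fun t => vec4 (f t) (g t) (h t) (k t)) @ F --> vec4 a b c d.
Proof.
move=> fa gb hc kd; apply: cvg_row => i; case: (ord4 i) => ->; rewrite vec4E.
- by rewrite (_ : (fun _ => _) = f) //; apply/funext => t; rewrite vec4E.
- by rewrite (_ : (fun _ => _) = g) //; apply/funext => t; rewrite vec4E.
- by rewrite (_ : (fun _ => _) = h) //; apply/funext => t; rewrite vec4E.
- by rewrite (_ : (fun _ => _) = k) //; apply/funext => t; rewrite vec4E.
Qed.

Lemma sum4 (f : 'I_4 -> R) : \sum_i f i = f 0 + f 1 + f 2 + f 3.
Proof.
rewrite !big_ord_recl big_ord0 addr0 !addrA; congr (f _ + f _ + f _ + f _); exact/val_inj.
Qed.

Lemma sum3 (f : 'I_3 -> R) : \sum_i f i = f 0 + f 1 + f 2.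
Proof.
rewrite !big_ord_recl big_ord0 addr0 !addrA; congr (f _ + f _ + f _); exact/val_inj.
Qed.

Lemma sqdist4 (x y : E4) : sqdist x y = (x 0 0 - y 0 0) ^+ 2 + (x 0 1 - y 0 1) ^+ 2 +
  (x 0 2 - y 0 2) ^+ 2 + (x 0 3 - y 0 3) ^+ 2.
Proof. exact: sum4. Qed.

Lemma dot4 (x y : E4) : dot x y = x 0 0 * y 0 0 + x 0 1 * y 0 1 + x 0 2 * y 0 2 + x 0 3 * y 0 3.
Proof. exact: sum4. Qed.

Lemma dot3 (x y : V3) : dot x y = x 0 0 * y 0 0 + x 0 1 * y 0 1 + x 0 2 * y 0 2.
Proof. exact: sum3. Qed.

Definition drop3 (x : E4) : V3 := vec3 (x 0 0) (x 0 1) (x 0 2).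
Definition lift3 (x : V3) : E4 := vec4 (x 0 0) (x 0 1) (x 0 2) 0.

Lemma lift3K : cancel lift3 drop3.
Proof. by move=> x; apply: vec3_ext; rewrite !vec3E !vec4E. Qed.

Lemma drop3K (x : E4) : x 0 3 = 0 -> lift3 (drop3 x) = x.
Proof. by move=> x3; apply: vec4_ext; rewrite !vec4E ?vec3E. Qed.

Lemma drop3_cts : continuous drop3.
Proof. by apply: ctsI => x; apply: tends_vec3; exact: tends_id. Qed.

Lemma drop3D (x y : E4) : drop3 (x + y) = drop3 x + drop3 y.
Proof. by apply: vec3_ext; rewrite !mxE. Qed.

Lemma drop3Z a (x : E4) : drop3 (a *: x) = a *: drop3 x.
Proof. by apply: vec3_ext; rewrite !mxE. Qed.

Lemma dot_drop3 (x y : E4) : x 0 3 = 0 -> dot (drop3 x) (drop3 y) = dot x y.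
Proof. by move=> x3; rewrite dot3 dot4 !vec3E x3 mul0r addr0. Qed.

Lemma sqdist_cts n (c : 'rV[R]_n) : continuous (@sqdist R n ^~ c).
Proof.
apply: ctsI => x; apply: tendssum => i; apply: tendsX.
by apply: tendsB; [exact: tends_id|exact: cvg_cst].
Qed.

Lemma closed_rball (B : round R) : closed (rball B).
Proof.
rewrite (_ : rball B = @sqdist R 4 ^~ (center B) @^-1` [set x | x <= radius B ^+ 2])//.
by apply: closed_comp; [move=> x _; exact: sqdist_cts|exact: closed_le].
Qed.

Lemma compact_rball (B : round R) : compact (rball B).
Proof.
apply: (@compact_of_bounded _ _ _ (enorm (center B) + radius B)); first exact: closed_rball.
move=> x; rewrite /rball /= sqdist_enorm ler_pXn2r ?nnegrE ?enorm_ge0 ?(ltW (radius_gt0 B))// => h i.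
have -> : x = center B + (x - center B) by rewrite addrC subrK.
by rewrite (le_trans (coord_le_enorm _ _))// (le_trans (enormD _ _))// lerD2l.
Qed.

(** Rotations preserve the distance to the fixed plane, so an orbit meets the half-space in the
    single point where this distance is the third coordinate. *)
Lemma spinE (A : set E4) (y : E4) : A `<=` @half_space3 R ->
  spin A y <-> A (vec4 (y 0 0) (y 0 1) (Num.sqrt (y 0 2 ^+ 2 + y 0 3 ^+ 2)) 0).
Proof.
move=> Ah; set s := Num.sqrt _; split => [[t [x [tI Ax yE]]]|As].
  have [x2 x3] := Ah x Ax.
  have s2 : s = x 0 2.
    rewrite /s yE !mxE /= x3 !mulr0 subr0 addr0 !exprMn -mulrDl cos2Dsin2 mul1r.
    by rewrite sqrtr_sqr ger0_norm.
  rewrite s2 (_ : vec4 _ _ _ _ = x)//.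
  by apply: vec4_ext; rewrite vec4E ?yE ?mxE//= x3.
have q0 : 0 <= y 0 2 ^+ 2 + y 0 3 ^+ 2 by rewrite addr_ge0 ?sqr_ge0.
have ss : s ^+ 2 = y 0 2 ^+ 2 + y 0 3 ^+ 2 by rewrite sqr_sqrtr.
have [s0|s0] := eqVneq s 0.
  move: (ss); rewrite s0 expr0n /= => /esym/eqP.
  rewrite paddr_eq0 ?sqr_ge0// !sqrf_eq0 => /andP[/eqP y2 /eqP y3].
  exists 0, (vec4 (y 0 0) (y 0 1) s 0); split => //; first by rewrite lexx mulr_ge0// pi_ge0.
  by apply: vec4_ext; rewrite [RHS]mxE ?vec4E /= ?s0 ?y2 ?y3 ?mulr0 ?subr0 ?addr0.
have [t [tI ct st]] : exists t, [/\ 0 <= t <= 2 * pi, y 0 2 / s = cos t & y 0 3 / s = sin t].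
  by apply: polar; rewrite !expr_div_n -mulrDl -ss divff// sqrf_eq0.
exists t; eexists; split; [exact: tI|exact: As|].
by apply: vec4_ext; rewrite [RHS]mxE ?vec4E /= -?ct -?st ?mulr0 ?subr0 ?addr0// divfK.
Qed.

Lemma interior_rball (B : round R) x : sqdist x (center B) < radius B ^+ 2 ->
  interior (rball B) x.
Proof.
move=> h; have : \forall y \near x, sqdist y (center B) < radius B ^+ 2.
  exact: (@sqdist_cts 4 (center B) x _ (lt_nbhsl h)).
by apply: filterS => y /ltW.
Qed.

End Rows.

(** * Trivial ball pairs in an interior bead *)

Section Bead.
Variable R : realType.
Local Notation V3 := 'rV[R]_3.
Local Notation E4 := 'rV[R]_4.
Variables (A Gamma : set E4) (Psi Phi : E4 -> E4) (B : round R) (u1 u2 : E4).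
Let c := center B.
Let r := radius B.
Hypothesis (Psi_cts : continuous Psi) (Phi_cts : continuous Phi).
Hypothesis (PsiK : cancel Psi Phi) (PhiK : cancel Phi Psi).
Hypothesis Psi_flat : forall x, Psi x 0 3 = x 0 3.
Hypothesis A_Gamma : forall x, A x <-> Gamma (Psi x).
Hypothesis A_half : A `<=` @half_space3 R.
Hypothesis A_compact : compact A.
Hypothesis c_flat : c 0 3 = 0.
(** Points moved by [Psi] stay strictly on the same side of the bounding sphere, which is fixed
    pointwise. *)
Hypothesis Psi_local : forall x, [\/ Psi x = x,
  sqdist x c < r ^+ 2 /\ sqdist (Psi x) c < r ^+ 2 |
  r ^+ 2 < sqdist x c /\ r ^+ 2 < sqdist (Psi x) c].
Hypothesis Gamma_bead : forall p, sqdist p c <= r ^+ 2 ->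
  (Gamma p <-> exists2 s, 0 <= s <= r & p = c + s *: u1 \/ p = c + s *: u2).
Hypothesis unit1 : dot u1 u1 = 1.
Hypothesis unit2 : dot u2 u2 = 1.
Hypothesis flat1 : u1 0 3 = 0.
Hypothesis flat2 : u2 0 3 = 0.
Let r0 : 0 < r := radius_gt0 B.

Let r2 : 0 < r ^+ 2. Proof. by rewrite exprn_gt0. Qed.

Let Psi_inside x : (sqdist (Psi x) c <= r ^+ 2) = (sqdist x c <= r ^+ 2).
Proof.
by case: (Psi_local x) => [->//|[/ltW-> /ltW->]//|[]]; rewrite !ltNge => /negPf-> /negPf->.
Qed.

Let Psi_strict x : (sqdist (Psi x) c < r ^+ 2) = (sqdist x c < r ^+ 2).
Proof.
by case: (Psi_local x) => [->//|[-> ->]//|[]] /ltW; rewrite leNgt => /negPf-> /ltW; rewrite leNgt => /negPf->.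
Qed.

(** A point of the arc on the sphere is fixed by [Psi] and ends a radius, so it is a limit of
    [Phi]-images of interior points of that radius. *)
Lemma bead_closure : closure (A `&` interior (rball B)) = A `&` rball B.
Proof.
have Ac : closed A by apply: compact_closed => //; exact: hausdorff_row.
apply/seteqP; split => x.
  move=> h; have cl : closed (A `&` rball B) by apply: closedI => //; exact: closed_rball.
  apply: cl; apply: closureS h => y [Ay /interior_subset By]; by split.
move=> [Ax]; rewrite /rball /= -/c -/r le_eqVlt => /orP[/eqP xr|xr]; last first.
  by apply: subset_closure; split => //; exact: interior_rball.
have xE : Psi x = x by case: (Psi_local x) => // -[]; rewrite xr ltxx.
have /Gamma_bead : sqdist (Psi x) c <= r ^+ 2 by rewrite Psi_inside xr.
move=> [] /(_ (proj1 (A_Gamma x) Ax)) [s /andP[s0 sr]]; rewrite xE => xs _.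
have [u [uu xu Gu]] : exists u, [/\ dot u u = 1, x = c + s *: u &
    forall t, 0 <= t <= r -> Gamma (c + t *: u)].
  have dd u t : dot u u = 1 -> sqdist (c + t *: u) c = t ^+ 2.
    by move=> uu; rewrite sqdist_dot addrAC subrr add0r dotZl dotZr uu mulr1.
  have tr t : 0 <= t <= r -> t ^+ 2 <= r ^+ 2.
    by move=> /andP[t0 t1]; rewrite ler_pXn2r// nnegrE// ltW.
  by case: xs => xs; [exists u1|exists u2]; split => // t tI;
    apply/Gamma_bead; rewrite ?dd// ?tr//; exists t => //; [left|right].
have dd t : sqdist (c + t *: u) c = t ^+ 2.
  by rewrite sqdist_dot addrAC subrr add0r dotZl dotZr uu mulr1.
have {}sr : s = r.
  by apply/eqP; rewrite -(@eqrXn2 _ 2)// ?(ltW r0)// -dd -xu xr.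
rewrite {}sr in xu s0 *.
have lim : Phi (c + t *: u) @[t --> r^'-] --> x.
  rewrite -[in X in _ --> X](PsiK x) xE xu; apply: (cvg_comp (fun t => c + t *: u) Phi _ (@Phi_cts _)).
  apply: cvgD; first exact: cvg_cst.
  by apply: cvgZl; apply: cvg_at_left_filter; exact: cvg_id.
move=> N /lim Nlim.
have : \forall t \near r^'-, 0 < t < r /\ N (Phi (c + t *: u)).
  near=> t; split; last by near: t.
  by apply/andP; split; near: t; [exact: nbhs_left_gt|exact: nbhs_left_lt].
move=> /filter_ex [t [/andP[t0 tr] Nt]].
exists (Phi (c + t *: u)); split => //; split.
  by apply/A_Gamma; rewrite PhiK; apply: Gu; rewrite (ltW t0) (ltW tr).
apply: interior_rball; rewrite -/c -/r -Psi_strict PhiK dd ltrXn2r//; exact: ltW.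
Unshelve. all: by end_near. Qed.

(** For unit vectors this says that they differ: the arc does not leave the centre the way it
    came. *)
Hypothesis not_antiparallel : dot (2^-1 *: (u1 + u2)) (2^-1 *: (u1 + u2)) < 1.

Let m : V3 := 2^-1 *: (drop3 u1 + drop3 u2).
Let k : R := enorm (drop3 u1 - m).
Let e0 : V3 := vec3 1 0 0.
(** The reflection exchanging the direction of the straightened diameter with the first axis. *)
Let turn0 : V3 -> V3 := householder (drop3 u1 - m - k *: e0).

Definition bead_chart (x : E4) : V3 := turn0 (unbend m (r^-1 *: drop3 (Psi x - c))).

Let m_lt1 : dot m m < 1.
Proof.
rewrite /m -drop3D -drop3Z dot_drop3// !mxE flat1 flat2 addr0 mulr0 //.
Qed.

Let turn0_norm x : dot (turn0 x) (turn0 x) = dot x x. Proof. exact: householder_norm. Qed.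

Lemma bead_chart_cts : continuous bead_chart.
Proof.
have h (x : E4) : (fun y : E4 => r^-1 *: drop3 (Psi y - c)) @ nbhs x --> r^-1 *: drop3 (Psi x - c).
  apply: cvgZl_tmp.
  have d : (fun y : E4 => Psi y - c) @ nbhs x --> Psi x - c.
    by apply: cvgB; [exact: Psi_cts|exact: cvg_cst].
  exact: (cvg_comp _ _ d (@drop3_cts _ _)).
apply: ctsI => x; apply: (cvg_comp (fun y : E4 => unbend m (r^-1 *: drop3 (Psi y - c))) turn0 _
  (@householder_cts _ _ _ _)).
exact: (cvg_comp _ _ (h x) (@unbend_cts _ _ _ m_lt1 _)).
Qed.

Lemma bead_chart_inj (x y : E4) : x 0 3 = 0 -> y 0 3 = 0 -> bead_chart x = bead_chart y -> x = y.
Proof.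
move=> x3 y3 /(inv_inj (@householderK _ _ _)) /(unbend_inj m_lt1).
have ri : r^-1 != 0 by rewrite invr_eq0 gt_eqF.
move=> /(scalerI ri) /(congr1 (@lift3 R)).
rewrite !drop3K ?mxE ?Psi_flat ?x3 ?y3 ?c_flat ?subr0// => /addIr.
exact: (can_inj PsiK).
Qed.

Lemma bead_chart_surj z : exists2 x : E4, x 0 3 = 0 & bead_chart x = z.
Proof.
have [y yz] := unbend_surj m_lt1 (turn0 z).
exists (Phi (c + r *: lift3 y)).
  by rewrite -Psi_flat PhiK !mxE c_flat /= mulr0 addr0.
rewrite /bead_chart PhiK addrAC subrr add0r drop3Z lift3K scalerA mulVf ?gt_eqF// scale1r yz.
exact: householderK.
Qed.

Lemma bead_chart_norm (x : E4) : x 0 3 = 0 ->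
  dot (bead_chart x) (bead_chart x) = sqdist (Psi x) c / r ^+ 2.
Proof.
move=> x3; rewrite /bead_chart turn0_norm -enorm_sq (unbend_norm m_lt1) enorm_sq.
rewrite dotZl dotZr dot_drop3 ?mxE ?Psi_flat ?x3 ?c_flat ?subr0// sqdist_dot mulrA -exprVn.
by rewrite mulrC expr2.
Qed.

Lemma bead_chart_ball (x : E4) : x 0 3 = 0 ->
  (dot (bead_chart x) (bead_chart x) <= 1) = (sqdist x c <= r ^+ 2).
Proof. by move=> x3; rewrite bead_chart_norm// ler_pdivrMr// mul1r Psi_inside. Qed.

Lemma bead_chart_ball_lt (x : E4) : x 0 3 = 0 ->
  (dot (bead_chart x) (bead_chart x) < 1) = (sqdist x c < r ^+ 2).
Proof. by move=> x3; rewrite bead_chart_norm// ltr_pdivrMr// mul1r Psi_strict. Qed.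

Let k0 : 0 < k.
Proof.
rewrite enorm_gt0; apply/eqP => /eqP; rewrite subr_eq0 => /eqP h.
by have := m_lt1; rewrite -h dot_drop3// unit1 ltxx.
Qed.

Let radius1 s : 0 <= s -> turn0 (unbend m (s *: drop3 u1)) = s *: e0.
Proof.
move=> s0; rewrite unbend_radius ?dot_drop3// -/k /turn0 householderZ householder_swap.
  by rewrite scalerA divfK// gt_eqF.
by rewrite -enorm_sq -/k dotZl dotZr dot3 !vec3E; ring.
Qed.

Let opposite : drop3 u2 - m = - (drop3 u1 - m).
Proof. by apply: vec3_ext; rewrite !mxE /=; field. Qed.

Let radius2 s : 0 <= s -> turn0 (unbend m (s *: drop3 u2)) = - s *: e0.
Proof.
move=> s0; rewrite unbend_radius ?dot_drop3// opposite /enorm dotNl dotNr opprK -/(enorm _) -/k.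
rewrite scalerN -scaleNr /turn0 householderZ householder_swap.
  by rewrite scalerA mulNr divfK// gt_eqF.
by rewrite -enorm_sq -/k dotZl dotZr dot3 !vec3E; ring.
Qed.

Lemma bead_chart_axis (x : E4) : x 0 3 = 0 -> sqdist x c <= r ^+ 2 ->
  (A x <-> bead_chart x 0 1 = 0 /\ bead_chart x 0 2 = 0).
Proof.
move=> x3 xr; rewrite A_Gamma Gamma_bead ?Psi_inside//; split.
  move=> [s /andP[s0 sr] h].
  have s1 : 0 <= r^-1 * s by rewrite mulr_ge0// invr_ge0 ltW.
  case: h => h; rewrite /bead_chart h addrAC subrr add0r drop3Z scalerA.
    by rewrite radius1// !mxE /= mulr0.
  by rewrite radius2// !mxE /= mulr0.
move=> [x1 x2]; have := bead_chart_ball x3; rewrite xr dot3 x1 x2 mulr0 !addr0 => h1.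
set t := bead_chart x 0 0 in h1.
have te : bead_chart x = t *: e0 by apply: vec3_ext; rewrite [RHS]mxE /e0 vec3E ?x1 ?x2 ?mulr0 ?mulr1.
have [tn tp] : -1 <= t /\ t <= 1 by split; nra.
have rK s : r * (r^-1 * s) = s by rewrite mulrA divff ?gt_eqF// mul1r.
have back (u : E4) s : u 0 3 = 0 -> bead_chart x = turn0 (unbend m (s *: drop3 u)) ->
    Psi x = c + (r * s) *: u.
  move=> u3 /(inv_inj (@householderK _ _ _)) /(unbend_inj m_lt1) e.
  have : r *: (r^-1 *: drop3 (Psi x - c)) = r *: (s *: drop3 u) by rewrite e.
  rewrite !scalerA divff ?gt_eqF// scale1r -drop3Z => /(congr1 (@lift3 R)).
  rewrite !drop3K ?mxE ?u3 ?mulr0 ?Psi_flat ?x3 ?c_flat ?subr0// => <-.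
  by rewrite addrC subrK.
have [t0|/ltW t0] := leP 0 t.
  exists (r * t); first by rewrite mulr_ge0 ?(ltW r0)//= ler_piMr// ltW.
  by left; apply: (back u1 t flat1); rewrite te (radius1 t0).
exists (r * - t); first by rewrite mulr_ge0 ?(ltW r0) ?oppr_ge0//= ler_piMr ?(ltW r0)//; lra.
have t1 : 0 <= - t by rewrite oppr_ge0.
by right; apply: (back u2 (- t) flat2); rewrite te (radius2 t1) opprK.
Qed.

(** As the radius is at most the height of the centre, the half-space cuts out a whole round 3-ball,
    on which [bead_chart] is a chart of the pair. *)
Lemma bead_unknotted3 : r <= c 0 2 ->
  unknotted_in R 3 1 (rball B `&` @half_space3 R) (closure (A `&` interior (rball B))).
Proof.
move=> rc; rewrite bead_closure.
have flat (x : E4) : (rball B `&` @half_space3 R) x -> x 0 3 = 0 /\ sqdist x c <= r ^+ 2.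
  by case=> h [].
have sq z : sqdist z 0 = dot z z :> R by rewrite sqdist_dot subr0.
apply: (@unknotted_compact _ _ _ _ _ _ bead_chart).
- apply: (subclosed_compact _ (@compact_rball R B)); last by move=> x [].
  apply: closedI; first exact: closed_rball.
  apply: closedI; first exact: (closed_comp (fun x _ => @tends_id _ _ x 2) (@closed_ge R 0)).
  exact: (closed_comp (fun x _ => @tends_id _ _ x 3) (@closed_eq R 0)).
- by move=> x _; apply: cvg_within_filter; exact: bead_chart_cts.
- move=> x y /set_mem /flat[x3 _] /set_mem /flat[y3 _]; exact: bead_chart_inj.
- by move=> x /flat[x3 xr]; rewrite /unit_ball /= sq bead_chart_ball.
- move=> z; rewrite /unit_ball /= sq; have [x x3 <-] := bead_chart_surj z.
  rewrite bead_chart_ball// => xr; exists x => //; split => //; split => //.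
  have h : (x 0 2 - c 0 2) ^+ 2 <= r ^+ 2.
    by apply: le_trans xr; rewrite sqdist4; have := (sqr_ge0 (x 0 0 - c 0 0), sqr_ge0 (x 0 1 - c 0 1), sqr_ge0 (x 0 3 - c 0 3)); move=> [[]]; lra.
  rewrite leNgt; apply/negP => x2; move: h; have := r0; nra.
- by move=> x [Ax Bx]; split => //; exact: A_half.
- move=> x Xx; have [x3 xr] := flat x Xx; have [Bx _] := Xx.
  have h := bead_chart_axis x3 xr; split.
    move=> [/h[x1 x2] _]; split; first by rewrite /unit_ball /= sq bead_chart_ball.
    by move=> i; case: (ord3 i) => ->.
  by move=> [_ x12]; split => //; apply/h; split; apply: x12.
Qed.

#[local] Opaque bead_chart.

Hypothesis r_height : 2 * r ^+ 2 = c 0 2 ^+ 2.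
Hypothesis c_high : 0 < c 0 2.

Let rho (y : E4) : R := Num.sqrt (y 0 2 ^+ 2 + y 0 3 ^+ 2).
Let pr (y : E4) : E4 := vec4 (y 0 0) (y 0 1) (rho y) 0.
(** Since 2 r^2 is the square of the height of the centre, a point at distance [rho] from the plane
    lies in the ball exactly when its third coordinate is at least [low]; the fourth then ranges
    over an interval of half-length [wid]. *)
Let low (y : E4) : R := ((y 0 0 - c 0 0) ^+ 2 + (y 0 1 - c 0 1) ^+ 2 + rho y ^+ 2 + r ^+ 2) / (2 * c 0 2).
Let wid (y : E4) : R := Num.sqrt (rho y ^+ 2 - low y ^+ 2).
Let cap (y : E4) : R := Num.sqrt (1 - dot (bead_chart (pr y)) (bead_chart (pr y))).
Let eta (y : E4) : R := y 0 3 * cap y / wid y.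

(* Over the point (y_0, y_1, rho) of the 3-ball the 4-ball is the segment
   |y_3| <= wid, which is rescaled to the segment |eta| <= cap of the unit ball. *)
Definition spin_chart (y : E4) : E4 :=
  vec4 (bead_chart (pr y) 0 0) (eta y) (bead_chart (pr y) 0 1) (bead_chart (pr y) 0 2).

Let rho2 (y : E4) : rho y ^+ 2 = y 0 2 ^+ 2 + y 0 3 ^+ 2.
Proof. by rewrite sqr_sqrtr// addr_ge0 ?sqr_ge0. Qed.

Let low_gt0 (y : E4) : 0 < low y.
Proof.
rewrite divr_gt0 ?mulr_gt0//; apply: ltr_wpDl => //.
by rewrite !addr_ge0 ?sqr_ge0.
Qed.

Let lowE (y : E4) : 2 * c 0 2 * low y = (y 0 0 - c 0 0) ^+ 2 + (y 0 1 - c 0 1) ^+ 2 + rho y ^+ 2 + r ^+ 2.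
Proof. by rewrite /low mulrC divfK// gt_eqF// mulr_gt0. Qed.

Let in_ball (y : E4) : rball B y <-> low y <= y 0 2.
Proof.
rewrite /rball /= -/c -/r sqdist4 c_flat subr0.
have := lowE y; rewrite rho2; have := r_height; have := c_high; move: (low y) => L h0 h1 h2.
split => h; last by nra.
have : 2 * c 0 2 * (y 0 2 - L) >= 0 by nra.
by rewrite pmulr_rge0 ?mulr_gt0// subr_ge0.
Qed.

Let pr_ball (y : E4) : (sqdist (pr y) c <= r ^+ 2) = (low y <= rho y).
Proof.
rewrite sqdist4 !vec4E c_flat subr0.
have := lowE y; have := r_height; have := c_high; move: (low y) (rho y) => L s h0 h1 h2.
apply/idP/idP => h; last by nra.
have : 2 * c 0 2 * (s - L) >= 0 by nra.
by rewrite pmulr_rge0 ?mulr_gt0// subr_ge0.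
Qed.

Let pr_ball_lt (y : E4) : (sqdist (pr y) c < r ^+ 2) = (low y < rho y).
Proof.
rewrite sqdist4 !vec4E c_flat subr0.
have := lowE y; have := r_height; have := c_high; move: (low y) (rho y) => L s h0 h1 h2.
apply/idP/idP => h; last by nra.
have : 2 * c 0 2 * (s - L) > 0 by nra.
by rewrite pmulr_rgt0 ?mulr_gt0// subr_gt0.
Qed.

Let pr3 (y : E4) : pr y 0 3 = 0. Proof. by rewrite vec4E. Qed.

Let rho_ge0 (y : E4) : 0 <= rho y. Proof. exact: sqrtr_ge0. Qed.

Let y2_le_rho (y : E4) : y 0 2 <= rho y.
Proof.
by rewrite (le_trans (ler_norm _))// -sqrtr_sqr ler_wsqrtr// lerDl sqr_ge0.
Qed.

Let cap_gt0 (y : E4) : (0 < cap y) = (low y < rho y).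
Proof. by rewrite sqrtr_gt0 subr_gt0 bead_chart_ball_lt// pr_ball_lt. Qed.

Let wid_gt0 (y : E4) : (0 < wid y) = (low y < rho y).
Proof. by rewrite sqrtr_gt0 subr_gt0 ltr_pXn2r ?nnegrE ?(ltW (low_gt0 y)). Qed.

Let wid2 (y : E4) : rball B y -> wid y ^+ 2 = rho y ^+ 2 - low y ^+ 2.
Proof.
move=> /in_ball h; rewrite sqr_sqrtr// subr_ge0 ler_pXn2r ?nnegrE ?(ltW (low_gt0 y))//.
exact: le_trans h _.
Qed.

Let y3_le (y : E4) : rball B y -> y 0 3 ^+ 2 <= wid y ^+ 2.
Proof.
move=> By; rewrite wid2// rho2; have /in_ball := By; have := low_gt0 y.
move: (low y) => L L0 h; nra.
Qed.

Let cap2 (y : E4) : rball B y -> cap y ^+ 2 = 1 - dot (bead_chart (pr y)) (bead_chart (pr y)).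
Proof.
move=> /in_ball h; rewrite sqr_sqrtr// subr_ge0 bead_chart_ball// pr_ball.
exact: le_trans h _.
Qed.

Let eta_le (y : E4) : rball B y -> eta y ^+ 2 <= cap y ^+ 2.
Proof.
move=> By; rewrite /eta; have [->|w0] := eqVneq (wid y) 0.
  by rewrite invr0 mulr0 expr0n sqr_ge0.
have w2 : 0 < wid y ^+ 2 by rewrite exprn_even_gt0.
by rewrite expr_div_n exprMn ler_pdivrMr// mulrC ler_wpM2l ?sqr_ge0// y3_le.
Qed.

Let rho_cts : continuous rho.
Proof.
by apply: ctsI => y; apply: tendssqrt; apply: tendsD; apply: tendsX; exact: tends_id.
Qed.

Let pr_cts : continuous pr.
Proof.
apply: ctsI => y; apply: tends_vec4; [exact: tends_id|exact: tends_id|exact: rho_cts|exact: cvg_cst].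
Qed.

Let chart_pr_cts (i : 'I_3) : continuous (fun y => bead_chart (pr y) 0 i).
Proof.
apply: ctsI => y; have h := cvg_comp _ _ (@pr_cts y) (@bead_chart_cts (pr y)).
exact: (cvg_comp _ _ h (@tends_id _ _ _ i)).
Qed.

Let cap_cts : continuous cap.
Proof.
apply: ctsI => y; apply: tendssqrt; apply: tendsB; first exact: cvg_cst.
by apply: tendssum => i; apply: tendsM; exact: chart_pr_cts.
Qed.

Let low_cts : continuous low.
Proof.
have sq (i : 'I_4) (y : E4) : (fun y : E4 => (y 0 i - c 0 i) ^+ 2) @ nbhs y --> (y 0 i - c 0 i) ^+ 2.
  by apply: tendsX; apply: tendsB; [exact: tends_id|exact: cvg_cst].
apply: ctsI => y; apply: tendsM; last exact: cvg_cst.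
apply: tendsD; last exact: cvg_cst.
by apply: tendsD; [apply: tendsD; exact: sq|apply: tendsX; exact: rho_cts].
Qed.

Let wid_cts : continuous wid.
Proof.
by apply: ctsI => y; apply: tendssqrt; apply: tendsB; apply: tendsX; [exact: rho_cts|exact: low_cts].
Qed.

(** Where [wid] vanishes so does [cap], and the bound |eta| <= cap on the ball gives continuity
    despite the quotient. *)
Let eta_cts (y : E4) : rball B y -> eta @ within (rball B) (nbhs y) --> eta y.
Proof.
move=> By; have [w0|w0] := eqVneq (wid y) 0.
  have c0 : cap y = 0.
    by apply/eqP; have := sqrtr_ge0 (1 - dot (bead_chart (pr y)) (bead_chart (pr y)));
      rewrite -/(cap y) le_eqVlt cap_gt0 -wid_gt0 w0 ltxx orbF eq_sym.
  have z0 : eta y = 0 by rewrite /eta c0 mulr0 mul0r.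
  rewrite z0; apply: norm_cvg0.
  apply: (@squeeze_cvgr _ _ _ _ (cst 0) cap).
  - near=> z; rewrite /= normr_ge0 /= -(@ger0_norm _ (cap z)) ?sqrtr_ge0//.
    have Bz : rball B z by near: z; exact: withinT.
    by rewrite -ler_sqr ?nnegrE ?normr_ge0// !real_normK ?num_real// eta_le.
  - exact: cvg_cst.
  - by rewrite -c0; apply: cvg_within_filter; exact: cap_cts.
apply: cvg_within_filter; apply: tendsM; last by apply: tendsV => //; exact: wid_cts.
by apply: tendsM; [exact: tends_id|exact: cap_cts].
Unshelve. all: by end_near. Qed.

(** Membership in the spun arc is read on [pr y], hence on the last two coordinates of [spin_chart];
    the free coordinate [eta] gives the disk its second dimension. *)
Lemma bead_unknotted4 : unknotted_in R 4 2 (rball B) (rball B `&` spin A).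
Proof.
have sq z : sqdist z 0 = dot z z :> R by rewrite sqdist_dot subr0.
apply: (@unknotted_compact _ _ _ _ _ _ spin_chart).
- exact: compact_rball.
- move=> y By; apply: tends_vec4; last 1 first.
  + by apply: cvg_within_filter; exact: chart_pr_cts.
  + by apply: cvg_within_filter; exact: chart_pr_cts.
  + exact: eta_cts.
  + by apply: cvg_within_filter; exact: chart_pr_cts.
- move=> y z /set_mem By /set_mem Bz e.
  have [X0 e3' X1 X2] := vec4_inj e.
  have pe : pr y = pr z by apply: (bead_chart_inj (pr3 y) (pr3 z)); apply: vec3_ext.
  have [e00 e01 er _] := vec4_inj pe.
  have el : low y = low z by rewrite /low e00 e01 er.
  have ew : wid y = wid z by rewrite /wid el er.
  have ec : cap y = cap z by rewrite /cap pe.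
  clear e X0 X1 X2 pe.
  have e3 : y 0 3 = z 0 3.
    have [w0|w0] := eqVneq (wid y) 0.
      have := y3_le By; have := y3_le Bz; rewrite -ew w0 expr0n /=.
      by move=> /sqr_le0 -> /sqr_le0 ->.
    have w1 : 0 < wid y by rewrite lt_def w0 sqrtr_ge0.
    have c1 : 0 < cap y by rewrite cap_gt0 -wid_gt0.
    move: e3'; rewrite /eta -ec -ew -!mulrA => /mulIf; apply.
    exact: (mulf_neq0 (lt0r_neq0 c1) (invr_neq0 (lt0r_neq0 w1))).
  apply: (vec4_ext e00 e01 _ e3); clear e3' el ew ec.
  (* In the ball the third coordinate is at least [low], which is positive, so it is determined with
     its sign by [rho] and the fourth. *)
  have y0 : 0 < y 0 2 by have /in_ball := By; exact: lt_le_trans.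
  have z0 : 0 < z 0 2 by have /in_ball := Bz; exact: lt_le_trans.
  have := congr1 (fun x => x ^+ 2) er; rewrite !rho2 e3 => /addIr h; clear er.
  by apply/eqP; rewrite -(@eqrXn2 _ 2)// ?h// ltW.
- move=> y By; rewrite /unit_ball /= sq dot4 !vec4E.
  have := eta_le By; rewrite cap2// dot3; lra.
- move=> z; rewrite /unit_ball /= sq dot4 => z1.
  have [x x3 xz] := bead_chart_surj (vec3 (z 0 0) (z 0 2) (z 0 3)).
  have z2 : z 0 1 ^+ 2 <= 1 - dot (bead_chart x) (bead_chart x).
    by rewrite xz dot3 !vec3E; lra.
  have xr : sqdist x c <= r ^+ 2.
    by rewrite -bead_chart_ball//; have := sqr_ge0 (z 0 1); lra.
  have Bx : rball B x by [].
  have x2 : 0 < x 0 2 by have /in_ball := Bx; exact: lt_le_trans.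
  have rx : rho x = x 0 2 by rewrite /rho x3 expr0n addr0 sqrtr_sqr gtr0_norm.
  have px : pr x = x by apply: vec4_ext; rewrite vec4E ?rx ?x3.
  pose y3 := z 0 1 * wid x / cap x.
  have cz : z 0 1 ^+ 2 <= cap x ^+ 2 by rewrite (cap2 Bx) px; exact: z2.
  have y3w : y3 ^+ 2 <= wid x ^+ 2.
    rewrite /y3; have [->|w0] := eqVneq (cap x) 0.
      by rewrite invr0 mulr0 expr0n sqr_ge0.
    have w2 : 0 < cap x ^+ 2 by rewrite exprn_even_gt0.
    by rewrite expr_div_n exprMn (ler_pdivrMr _ _ w2) mulrC; exact: (ler_wpM2l (sqr_ge0 _) cz).
  have L2 : low x ^+ 2 <= x 0 2 ^+ 2 - y3 ^+ 2 by rewrite lerBrDr addrC -lerBrDr -rx -(wid2 Bx); exact: y3w.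
  have q0 : 0 <= x 0 2 ^+ 2 - y3 ^+ 2 by apply: le_trans L2; exact: sqr_ge0.
  pose y := vec4 (x 0 0) (x 0 1) (Num.sqrt (x 0 2 ^+ 2 - y3 ^+ 2)) y3.
  have ry : rho y = rho x.
    by rewrite {1}/rho !vec4E sqr_sqrtr// subrK sqrtr_sqr gtr0_norm.
  have py : pr y = x by rewrite -[RHS]px /pr ry !vec4E.
  have ly : low y = low x by rewrite /low ry !vec4E.
  have wy : wid y = wid x by rewrite /wid ly ry.
  have cy : cap y = cap x by rewrite /cap py px.
  exists y.
    apply/in_ball; rewrite ly vec4E -(ger0_norm (ltW (low_gt0 x))) -sqrtr_sqr.
    exact: (ler_wsqrtr L2).
  have ez : eta y = z 0 1.
    rewrite /eta wy cy vec4E /y3.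
    have [c0|c0] := eqVneq (cap x) 0.
      move: cz; rewrite c0 invr0 !mulr0 mul0r (expr0n _ 2) => /sqr_le0 ->; exact: erefl.
    have c1 : 0 < cap x by rewrite lt_def c0; exact: sqrtr_ge0.
    have w1 : wid x != 0 by apply: lt0r_neq0; rewrite wid_gt0 -cap_gt0; exact: c1.
    by rewrite (divfK c0) (mulfK w1).
  by rewrite /spin_chart ez py xz; apply: vec4_ext; rewrite !(vec4E, vec3E).
- by move=> x [].
- move=> y By; have pB : sqdist (pr y) c <= r ^+ 2.
    by rewrite pr_ball; have /in_ball := By => /le_trans; exact.
  have h := bead_chart_axis (pr3 y) pB; split.
    move=> [_ /(spinE _ A_half) /h [h1 h2]]; split.
      rewrite /unit_ball /= sq dot4 !vec4E; have := eta_le By; rewrite cap2// dot3; lra.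
    by move=> i; case: (ord4 i) => ->//; rewrite !vec4E.
  move=> [_ f2]; split => //; apply/(spinE _ A_half)/h.
  by have := f2 2; have := f2 3; rewrite !vec4E => -> // ->.
Qed.

End Bead.

(** * Trivial ball pairs at the end-points *)

Section EndBead.
Variable R : realType.
Local Notation V3 := 'rV[R]_3.
Local Notation E4 := 'rV[R]_4.
Variables (A : set E4) (B : round R).
Let c := center B.
Let r := radius B.
Let up : E4 := delta_mx 0 2.
Hypothesis A_half : A `<=` @half_space3 R.
Hypothesis A_compact : compact A.
Hypothesis c_flat : plane2 c.
Hypothesis A_bead : forall x, sqdist x c <= r ^+ 2 ->
  (A x <-> exists2 s, 0 <= s <= r & x = c + s *: up).
Let r0 : 0 < r := radius_gt0 B.

Let upE : (up 0 0 = 0) * (up 0 1 = 0) * (up 0 2 = 1) * (up 0 3 = 0).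
Proof. by rewrite !mxE. Qed.

Let up_unit : dot up up = 1.
Proof. by rewrite dot4 !upE; ring. Qed.

Lemma end_closure : closure (A `&` interior (rball B)) = A `&` rball B.
Proof.
apply: (@bead_closure _ A A id id B up up) => //.
- by move=> x; exact: cvg_id.
- by move=> x; constructor 1.
- move=> p pr; rewrite A_bead//; split; move=> [s sI h]; exists s => //; first by left.
  by case: h.
Qed.

(** Over each point of the equatorial disk the vertical chord [0, l] of the half ball is stretched
    to [-l, l], so that the vertical radius becomes a diameter. *)
Let chart (x : E4) : V3 :=
  let w0 := (x 0 0 - c 0 0) / r in let w1 := (x 0 1 - c 0 1) / r in
  vec3 (2 * (x 0 2 / r) - Num.sqrt (1 - w0 ^+ 2 - w1 ^+ 2)) w0 w1.

Let chart_cts : continuous chart.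
Proof.
have h (i : 'I_4) (x : E4) : (fun y : E4 => (y 0 i - c 0 i) / r) @ nbhs x --> (x 0 i - c 0 i) / r.
  by apply: tendsM; [apply: tendsB; [exact: tends_id|exact: cvg_cst]|exact: cvg_cst].
apply: ctsI => x; apply: tends_vec3; [|exact: h|exact: h].
apply: tendsB.
  by apply: tendsM; [exact: cvg_cst|apply: tendsM; [exact: tends_id|exact: cvg_cst]].
by apply: tendssqrt; apply: tendsB; [apply: tendsB; [exact: cvg_cst|]|]; apply: tendsX; exact: h.
Qed.

Let half_ball (x : E4) : (rball B `&` @half_space3 R) x <->
  [/\ x 0 3 = 0, 0 <= x 0 2 &
    ((x 0 0 - c 0 0) / r) ^+ 2 + ((x 0 1 - c 0 1) / r) ^+ 2 + (x 0 2 / r) ^+ 2 <= 1].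
Proof.
have [c2 c3] := c_flat.
have e : x 0 3 = 0 -> (sqdist x c <= r ^+ 2) =
    (((x 0 0 - c 0 0) / r) ^+ 2 + ((x 0 1 - c 0 1) / r) ^+ 2 + (x 0 2 / r) ^+ 2 <= 1).
  move=> x3; rewrite sqdist4 x3 c2 c3 !subr0 expr0n addr0 !expr_div_n -!mulrDl.
  by rewrite ler_pdivrMr ?mul1r// exprn_gt0.
split; first by case=> h [x2 x3]; split => //; rewrite -e.
by case=> x3 x2; rewrite -e.
Qed.

Lemma end_unknotted3 :
  unknotted_in R 3 1 (rball B `&` @half_space3 R) (closure (A `&` interior (rball B))).
Proof.
rewrite end_closure; have [c2 c3] := c_flat.
have sq (z : V3) : sqdist z 0 = z 0 0 ^+ 2 + z 0 1 ^+ 2 + z 0 2 ^+ 2 by rewrite sqdist_dot subr0 dot3 !expr2.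
have rK x : x / r * r = x by rewrite divfK// gt_eqF.
have Kr x : x * r / r = x by rewrite mulfK// gt_eqF.
have inj_r x y : x / r = y / r -> x = y by move=> h; rewrite -[x]rK h rK.
have in_disk (x : E4) : (rball B `&` @half_space3 R) x ->
    let w0 := (x 0 0 - c 0 0) / r in let w1 := (x 0 1 - c 0 1) / r in
    let l := Num.sqrt (1 - w0 ^+ 2 - w1 ^+ 2) in
    [/\ l ^+ 2 = 1 - w0 ^+ 2 - w1 ^+ 2, 0 <= l, 0 <= x 0 2 / r & x 0 2 / r <= l].
  move=> /half_ball [x3 x2 h] w0 w1 l.
  have w20 : 0 <= x 0 2 / r by rewrite divr_ge0// ltW.
  have q0 : (x 0 2 / r) ^+ 2 <= 1 - w0 ^+ 2 - w1 ^+ 2 by move: h; rewrite -/w0 -/w1; lra.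
  split => //; first by rewrite sqr_sqrtr// (le_trans _ q0)// sqr_ge0.
    exact: sqrtr_ge0.
  by rewrite -(ger0_norm w20) -sqrtr_sqr; exact: ler_wsqrtr.
apply: (@unknotted_compact _ _ _ _ _ _ chart).
- apply: (subclosed_compact _ (@compact_rball R B)); last by move=> x [].
  apply: closedI; first exact: closed_rball.
  apply: closedI; first exact: (closed_comp (fun x _ => @tends_id _ _ x 2) (@closed_ge R 0)).
  exact: (closed_comp (fun x _ => @tends_id _ _ x 3) (@closed_eq R 0)).
- by move=> x _; apply: cvg_within_filter; exact: chart_cts.
- move=> x y /set_mem /half_ball[x3 _ _] /set_mem /half_ball[y3 _ _] e.
  have e1 : (x 0 0 - c 0 0) / r = (y 0 0 - c 0 0) / r by move/rowP: e => /(_ 1); rewrite !vec3E.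
  have e2 : (x 0 1 - c 0 1) / r = (y 0 1 - c 0 1) / r by move/rowP: e => /(_ 2); rewrite !vec3E.
  move/rowP: e => /(_ 0); rewrite !vec3E e1 e2 => /addIr e0.
  apply: vec4_ext; rewrite ?x3 ?y3//; [exact: addIr (inj_r _ _ e1)|exact: addIr (inj_r _ _ e2)|].
  by apply: inj_r; move: e0; move: (x 0 2 / r) (y 0 2 / r) => p q; lra.
- move=> x /in_disk /=; rewrite /unit_ball /= sq !vec3E.
  by move: (Num.sqrt _) => l [l2 l0 w0 wl]; nra.
- move=> z; rewrite /unit_ball /= sq => z1.
  pose l := Num.sqrt (1 - z 0 1 ^+ 2 - z 0 2 ^+ 2).
  have l0 : 0 <= l by exact: sqrtr_ge0.
  have l2 : l ^+ 2 = 1 - z 0 1 ^+ 2 - z 0 2 ^+ 2.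
    by rewrite sqr_sqrtr//; have := sqr_ge0 (z 0 0); lra.
  have zl : - l <= z 0 0 <= l.
    by rewrite -ler_norml -sqrtr_sqr; apply: ler_wsqrtr; lra.
  exists (vec4 (z 0 1 * r + c 0 0) (z 0 2 * r + c 0 1) ((z 0 0 + l) / 2 * r) 0).
    apply/half_ball; rewrite !vec4E !addrK !Kr; split => //.
      by rewrite mulr_ge0 ?(ltW r0)// divr_ge0//; lra.
    nra.
  rewrite /chart !vec4E !addrK !Kr -/l; apply: vec3_ext; rewrite !vec3E//.
  by rewrite [2 * _]mulrC divfK// addrK.
- by move=> x [Ax Bx]; split => //; exact: A_half.
- move=> x Xx; have [Bx _] := Xx; have [x3 x2 xr] := (half_ball x).1 Xx; split.
    move=> [/A_bead -/(_ Bx) [s sI xE] _]; split.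
      have := in_disk x Xx; rewrite /unit_ball /= sq !vec3E /=.
      by move: (Num.sqrt _) => l [l2 l0 w0 wl]; nra.
    by move=> i; case: (ord3 i) => ->//; rewrite vec3E xE !mxE /= mulr0 addr0 subrr mul0r.
  move=> [_ f]; split => //; apply/A_bead => //.
  have := f 1; have := f 2; rewrite !vec3E => /(_ isT) f2 /(_ isT) f1.
  exists (x 0 2).
    move: xr; rewrite f1 f2 !expr0n !add0r x2 /= -[X in _ -> is_true (_ <= X)]mul1r -(ler_pdivrMr _ _ r0).
    by have : 0 <= x 0 2 / r by [rewrite divr_ge0// ltW]; move: (x 0 2 / r) => q; nra.
  apply: vec4_ext; rewrite !mxE /= ?mulr0 ?mulr1 ?addr0 ?c2 ?c3 ?add0r//.
    by apply/eqP; rewrite -subr_eq0 -[_ - _]rK f1 mul0r.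
  by apply/eqP; rewrite -subr_eq0 -[_ - _]rK f2 mul0r.
Qed.

End EndBead.

(** * Corner pearls *)

Section Sixfold.
Variable R : realType.
Local Notation E4 := 'rV[R]_4.
Local Notation s3 := (Num.sqrt 3 : R).

Lemma sqrt3_sq : s3 ^+ 2 = 3.
Proof. by rewrite sqr_sqrtr. Qed.

Lemma sqrt3_gt0 : 0 < s3.
Proof. by rewrite sqrtr_gt0. Qed.

Lemma rotE t (x : E4) : ((rot t x 0 0 = x 0 0) * (rot t x 0 1 = x 0 1) *
  (rot t x 0 2 = cos t * x 0 2 - sin t * x 0 3) *
  (rot t x 0 3 = sin t * x 0 2 + cos t * x 0 3)).
Proof. by rewrite !mxE. Qed.

Lemma rot_cts t : continuous (@rot R t).
Proof.
have h (i : 'I_4) a (x : E4) : (fun y : E4 => a * y 0 i) @ nbhs x --> a * x 0 i.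
  by apply: tendsM; [exact: cvg_cst|exact: tends_id].
apply: ctsI => x; rewrite (_ : rot t = fun y => vec4 (y 0 0) (y 0 1)
  (cos t * y 0 2 - sin t * y 0 3) (sin t * y 0 2 + cos t * y 0 3))//.
by apply: tends_vec4; [exact: tends_id|exact: tends_id|apply: tendsB|apply: tendsD]; exact: h.
Qed.

Lemma rot_angleD s t (x : E4) : rot (s + t) x = rot s (rot t x).
Proof. by apply: vec4_ext; rewrite !rotE// ?sinD ?cosD; ring. Qed.

Lemma rot_angle0 (x : E4) : rot 0 x = x.
Proof. by apply: vec4_ext; rewrite !rotE// sin0 cos0; ring. Qed.

Lemma rot2pi n (x : E4) : rot (2 * pi * n%:R) x = x.
Proof.
elim: n => [|n IH]; first by rewrite mulr0 rot_angle0.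
rewrite -[n.+1%:R]natr1 mulrDr mulr1 rot_angleD -[RHS]IH; congr (rot _ _).
by apply: vec4_ext; rewrite !rotE// mulr_natl sin2pi cos2pi; ring.
Qed.

(** Addition modulo 6 drops whole turns, which act trivially. *)
Lemma rot_angle6D (i j : 'Z_6) (x : E4) : rot (angle6 R (i + j)) x = rot (angle6 R i) (rot (angle6 R j) x).
Proof.
rewrite -rot_angleD (_ : angle6 R i + angle6 R j = 2 * pi * ((i + j) %/ 6)%:R + angle6 R (i + j)).
  by rewrite rot_angleD rot2pi.
rewrite /angle6 /= -mulrDl -mulrDr -natrD {1}(divn_eq (i + j) 6) natrD natrM.
by field.
Qed.

Lemma rot_angle6_0 (x : E4) : rot (angle6 R 0) x = x.
Proof. by rewrite /angle6 mulr0 mul0r rot_angle0. Qed.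

(** With a = pi/3, sin (3 a) = 0 and sin a > 0 give 4 cos^2 a = 1. *)
Lemma cos_sin_pi3 : cos (pi / 3) = 1 / 2 :> R /\ sin (pi / 3) = s3 / 2.
Proof.
have p0 := @pi_gt0 R; set a := pi / 3.
have cs : sin a ^+ 2 = 1 - cos a ^+ 2 by rewrite -(cos2Dsin2 a) addrAC subrr add0r.
have c0 : 0 < cos a by apply: cos_gt0_pihalf; rewrite /a; apply/andP; split; lra.
have s0 : 0 < sin a by apply: sin_gt0_pi; rewrite /a; apply/andP; split; lra.
have : sin (a + (a + a)) = 0 by rewrite (_ : a + _ = pi) ?sinpi// /a; field.
rewrite !sinD !cosD; move: cs c0 s0; move: (cos a) (sin a) => c s cs c0 s0 h.
have c2 : c ^+ 2 = 1 / 4.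
  have : s * (4 * c ^+ 2 - 1) = 0 by rewrite -h; ring: cs.
  move/eqP; rewrite mulf_eq0 gt_eqF//= => /eqP; lra.
have ch : c = 1 / 2 by nra.
split => //; have := sqrt3_sq; have := sqrt3_gt0; move: s3 => q q0 q2.
by apply/eqP; rewrite -(@eqrXn2 _ 2) ?ltW ?divr_gt0//; apply/eqP; lra.
Qed.

(** The left side of the inequality is 2 cos (theta - pi/6). Among the six directions it reaches its
    maximum sqrt 3 at j = 0 and j = 1, the two neighbours of the half-space at angle pi/6. *)
Lemma hexagon (j : 'Z_6) : [\/ j = 0 /\ (cos (angle6 R j) = 1 /\ sin (angle6 R j) = 0),
  j = 1 /\ (cos (angle6 R j) = 1 / 2 /\ sin (angle6 R j) = s3 / 2) |
  (j != 0) && (j != 1) /\ s3 * cos (angle6 R j) + sin (angle6 R j) < s3].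
Proof.
have [c1 s1] := cos_sin_pi3; have q0 := sqrt3_gt0.
have e : angle6 R j = (j : nat)%:R * (pi / 3) by rewrite /angle6; field.
case: j e => -[|[|[|[|[|[|//]]]]]] h; rewrite /= => ->.
- by constructor 1; split; [exact/val_inj|rewrite mul0r cos0 sin0].
- constructor 2; split; first by apply/val_inj.
  by rewrite (mul1r (pi / 3)).
- constructor 3; split => //; rewrite (_ : 2%:R * _ = pi / 3 + pi / 3); last by field.
  by rewrite cosD sinD c1 s1; have := sqrt3_sq; nra.
- constructor 3; split => //; rewrite (_ : 3%:R * _ = pi); last by field.
  by rewrite cospi sinpi; lra.
- constructor 3; split => //; rewrite (_ : 4%:R * _ = pi / 3 + pi); last by field.
  by rewrite cosDpi sinDpi c1 s1; lra.
- constructor 3; split => //; rewrite (_ : 5%:R * _ = pi / 3 + pi / 3 + pi); last by field.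
  by rewrite cosDpi sinDpi cosD sinD c1 s1; have := sqrt3_sq; nra.
Qed.

Section Turns.
Variables (A : set E4).

Lemma spin_rot t (y : E4) : A `<=` @half_space3 R -> spin A (rot t y) <-> spin A y.
Proof.
move=> Ah; rewrite !spinE// !rotE.
have h : cos t ^+ 2 = 1 - sin t ^+ 2 by rewrite -(cos2Dsin2 t) addrK.
set u := (X in Num.sqrt X); set v := (X in _ <-> A (vec4 _ _ (Num.sqrt X) _)).
have -> : u = v by rewrite /u /v; move: h; move: (cos t) (sin t) => c s h; ring: h.
by [].
Qed.

Lemma unknotted_rot t (B : round R) : A `<=` @half_space3 R ->
  unknotted_in R 4 2 (rball B) (rball B `&` spin A) ->
  unknotted_in R 4 2 (rball (rot_round t B)) (rball (rot_round t B) `&` spin A).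
Proof.
move=> Ah; apply: pair_homeo_trans.
have rK y : rot t (rot (- t) y) = y :> E4 by rewrite -rot_angleD subrr rot_angle0.
have Kr y : rot (- t) (rot t y) = y :> E4 by rewrite -rot_angleD addNr rot_angle0.
exists (@rot R (- t)), (@rot R t); split.
- by apply: continuous_subspaceT => x; exact: rot_cts.
- by apply: continuous_subspaceT => x; exact: rot_cts.
- rewrite rball_rot; apply/seteqP; split => [_ [_ [x Bx <-] <-]|x Bx]; first by rewrite Kr.
  by exists (rot t x) => //; exists x.
- by move=> x _.
- rewrite rball_rot; apply/seteqP; split => [_ [_ [[x Bx <-] sx] <-]|x [Bx sx]].
    by rewrite Kr; split => //; apply/(spin_rot t).
  by exists (rot t x) => //; split; [exists x|apply/spin_rot].
Qed.

End Turns.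

Lemma sqdist_rot_r t (p c : E4) : c 0 3 = 0 ->
  sqdist p (rot t c) = sqdist p c + 2 * c 0 2 * (p 0 2 - cos t * p 0 2 - sin t * p 0 3).
Proof.
move=> c3; rewrite !sqdist4 !rotE c3.
have : cos t ^+ 2 = 1 - sin t ^+ 2 by rewrite -(cos2Dsin2 t) addrK.
move: (cos t) (sin t) => a b h; ring: h.
Qed.

Lemma angle6_1 : cos (angle6 R 1) = 1 / 2 /\ sin (angle6 R 1) = s3 / 2.
Proof. rewrite (_ : angle6 R 1 = pi / 3); first exact: cos_sin_pi3.
by rewrite /angle6 (_ : nat_of_ord 1 = 1%N)//; field. Qed.

(** * The corner point and its pearl *)

Section Corner.
Variables (c c' : E4).
Let h := c 0 2.
Let h' := c' 0 2.
Hypotheses (c3 : c 0 3 = 0) (c3' : c' 0 3 = 0) (h0 : 0 < h) (h0' : 0 < h').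
Hypothesis orth : 2 * sqdist c c' = h ^+ 2 + h' ^+ 2.
Let n := h + h'.
Let dx := c' 0 0 - c 0 0.
Let dy := c' 0 1 - c 0 1.

(** The contact point divides the segment between the centres of the two tangent balls in the ratio
    h : h'. Its distance sqrt 3 h h' / n to the plane is split by the cosine and sine of pi/6 into
    the last two coordinates. *)
Definition corner : E4 := vec4 ((h' * c 0 0 + h * c' 0 0) / n) ((h' * c 0 1 + h * c' 0 1) / n)
  (3 * h * h' / (2 * n)) (s3 * h * h' / (2 * n)).

Let n0 : 0 < n. Proof. exact: addr_gt0. Qed.

Let flat_dist : 2 * (dx ^+ 2 + dy ^+ 2) = h ^+ 2 + h' ^+ 2 - 2 * (h - h') ^+ 2.
Proof. by rewrite -orth sqdist4 c3 c3' /dx /dy /h /h'; ring. Qed.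

Lemma corner_on : [/\ 2 * sqdist corner c = h ^+ 2, 2 * sqdist corner c' = h' ^+ 2 &
  corner 0 2 = s3 * corner 0 3].
Proof.
have nz := lt0r_neq0 n0; have fd := flat_dist; have q := sqrt3_sq.
have e : corner 0 0 = c 0 0 + h / n * dx /\ corner 0 1 = c 0 1 + h / n * dy.
  by rewrite !vec4E /dx /dy /n; split; field.
have e' : corner 0 0 = c' 0 0 - h' / n * dx /\ corner 0 1 = c' 0 1 - h' / n * dy.
  by rewrite !vec4E /dx /dy /n; split; field.
have u2 : corner 0 2 = 3 * (h * h' / (2 * n)) by rewrite vec4E; ring.
have u3 : corner 0 3 = s3 * (h * h' / (2 * n)) by rewrite vec4E; ring.
split; last by rewrite u2 u3 [RHS]mulrA -expr2 q.
- rewrite sqdist4 (e.1) (e.2) u2 u3 c3 -/h; move: fd q nz; move: (s3) dx dy => q dx' dy' fd q2 nz.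
  have -> : 2 * ((c 0 0 + h / n * dx' - c 0 0) ^+ 2 + (c 0 1 + h / n * dy' - c 0 1) ^+ 2 +
    (3 * (h * h' / (2 * n)) - h) ^+ 2 + (q * (h * h' / (2 * n)) - 0) ^+ 2) =
    (h / n) ^+ 2 * (2 * (dx' ^+ 2 + dy' ^+ 2)) + 2 * ((3 * (h * h' / (2 * n)) - h) ^+ 2 +
    q ^+ 2 * (h * h' / (2 * n)) ^+ 2) by ring.
  by rewrite fd q2; move: nz; rewrite /n => nz; field.
- rewrite sqdist4 (e'.1) (e'.2) u2 u3 c3' -/h'; move: fd q nz; move: (s3) dx dy => q dx' dy' fd q2 nz.
  have -> : 2 * ((c' 0 0 - h' / n * dx' - c' 0 0) ^+ 2 + (c' 0 1 - h' / n * dy' - c' 0 1) ^+ 2 +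
    (3 * (h * h' / (2 * n)) - h') ^+ 2 + (q * (h * h' / (2 * n)) - 0) ^+ 2) =
    (h' / n) ^+ 2 * (2 * (dx' ^+ 2 + dy' ^+ 2)) + 2 * ((3 * (h * h' / (2 * n)) - h') ^+ 2 +
    q ^+ 2 * (h * h' / (2 * n)) ^+ 2) by ring.
  by rewrite fd q2; move: nz; rewrite /n => nz; field.
Qed.

Lemma on_turned (p d : E4) : d 0 3 = 0 -> p 0 2 = s3 * p 0 3 ->
  sqdist p (rot (angle6 R 1) d) = sqdist p d.
Proof.
move=> d3 p2; rewrite sqdist_rot_r//; have [-> ->] := angle6_1; by rewrite p2; field.
Qed.

Lemma corner_unique (p : E4) : 2 * sqdist p c = h ^+ 2 -> 2 * sqdist p c' = h' ^+ 2 ->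
  2 * sqdist p (rot (angle6 R 1) c) = h ^+ 2 -> p = corner.
Proof.
move=> e1 e2 e3.
have p2 : p 0 2 = s3 * p 0 3.
  move: e3; rewrite sqdist_rot_r//; have [-> ->] := angle6_1.
  rewrite -/h; have q := sqrt3_sq; have := h0; move: (s3) q => q q2 h1 e3.
  have : h * (p 0 2 - q * p 0 3) = 0 by lra.
  by move/eqP; rewrite mulf_eq0 gt_eqF//= subr_eq0 => /eqP.
(* The two sphere equations, weighted by h' n and h n, add up to a vanishing sum of three squares:
   this is the tangency. *)
have sum0 : (n * p 0 0 - (h' * c 0 0 + h * c' 0 0)) ^+ 2 +
    (n * p 0 1 - (h' * c 0 1 + h * c' 0 1)) ^+ 2 + (2 * n * p 0 3 - s3 * h * h') ^+ 2 = 0.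
  move: e1 e2; rewrite !sqdist4 c3 c3' p2 -/h -/h' !subr0.
  have fd := flat_dist; move: fd; rewrite /dx /dy; have q := sqrt3_sq.
  move: (s3) (c 0 0) (c 0 1) (c' 0 0) (c' 0 1) (p 0 0) (p 0 1) (p 0 3) q => q x y x' y' a b t q2 fd e1 e2.
  have f1 : 2 * (h' * n) * ((a - x) ^+ 2 + (b - y) ^+ 2 + (q * t - h) ^+ 2 + t ^+ 2) = h' * n * h ^+ 2.
    by rewrite -e1; ring.
  have f2 : 2 * (h * n) * ((a - x') ^+ 2 + (b - y') ^+ 2 + (q * t - h') ^+ 2 + t ^+ 2) = h * n * h' ^+ 2.
    by rewrite -e2; ring.
  have f3 : h * h' * (2 * ((x' - x) ^+ 2 + (y' - y) ^+ 2)) = h * h' * (h ^+ 2 + h' ^+ 2 - 2 * (h - h') ^+ 2).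
    by rewrite fd.
  have f4 := congr1 (fun z => n ^+ 2 * t ^+ 2 * z) q2.
  have f5 := congr1 (fun z => (h * h') ^+ 2 * z) q2.
  have f6 := congr1 (fun z => n * n * t ^+ 2 * z) q2.
  move: f1 f2 f3 f4 f5 f6; rewrite /= /n; clear; move: (h) (h') => g g'; lra.
have [z0 z1 z3] : [/\ n * p 0 0 = h' * c 0 0 + h * c' 0 0, n * p 0 1 = h' * c 0 1 + h * c' 0 1 &
    2 * n * p 0 3 = s3 * h * h'].
  by split; apply/eqP; rewrite -subr_eq0; apply/eqP/sqr_le0; move: sum0;
    move: (n * p 0 0 - _) (n * p 0 1 - _) (2 * n * p 0 3 - _) => a b d;
    have := (sqr_ge0 a, sqr_ge0 b, sqr_ge0 d); case=> [[]]; lra.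
have nz := lt0r_neq0 n0.
apply: vec4_ext; rewrite ?vec4E.
- by rewrite -z0 mulrC mulKf.
- by rewrite -z1 mulrC mulKf.
- by rewrite p2; have -> : 3 * h * h' = s3 * (s3 * h * h') by [rewrite !mulrA -expr2 sqrt3_sq]; rewrite -z3; field.
- by rewrite -z3; field.
Qed.

Hypothesis spread : 0 < dx ^+ 2 + dy ^+ 2.

(** Horizontal and orthogonal to the line of centres, hence invariant under the rotations and
    orthogonal to the radii from all four centres to the corner. By Pythagoras a sphere through the
    corner with centre displaced along it is orthogonal to the four pearls. *)
Definition normal : E4 := vec4 (- dy) dx 0 0.

Lemma normal_gt0 : 0 < enorm normal.
Proof. by rewrite sqrtr_gt0 dot4 !vec4E; move: spread; rewrite -/dx -/dy; lra. Qed.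

Lemma normal_orth d : d = c \/ d = c' -> dot normal (corner - d) = 0.
Proof.
have nz := lt0r_neq0 n0.
by rewrite dot4 !mxE /=; case=> ->; rewrite /dx /dy; move: nz; rewrite /n => nz; field.
Qed.

Definition corner_pearl eps (eps0 : 0 < eps) : round R :=
  Round (corner + eps *: normal) (mulr_gt0 eps0 normal_gt0).

Lemma corner_pearl_through eps (eps0 : 0 < eps) : rsphere (corner_pearl eps0) corner.
Proof.
rewrite /rsphere /= sqdist_dot opprD addrA subrr add0r dotNl dotNr opprK dotZl dotZr.
by rewrite exprMn enorm_sq; ring.
Qed.

Lemma corner_pearl_orth eps (eps0 : 0 < eps) (B : round R) d :
  d = c \/ d = c' -> 2 * radius B ^+ 2 = d 0 2 ^+ 2 ->
  center B = d \/ center B = rot (angle6 R 1) d -> orthogonal (corner_pearl eps0) B.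
Proof.
move=> dc rB cB; have [e1 e2 e3] := corner_on.
have d3 : d 0 3 = 0 by case: dc => ->.
have cd : 2 * sqdist corner d = d 0 2 ^+ 2 by case: dc => ->.
have hB : sqdist corner (center B) = radius B ^+ 2.
  by case: cB => ->; rewrite ?on_turned//; lra.
have o : dot normal (corner - center B) = 0.
  have := normal_orth dc; rewrite !dot4 !mxE /=; case: cB => ->; rewrite ?mxE /=; lra.
have pyth (u v : E4) : dot v u = 0 ->
    dot (u + eps *: v) (u + eps *: v) = eps ^+ 2 * dot v v + dot u u.
  by move=> uv; rewrite !dotE [dot u v]dotC uv; ring.
by rewrite /orthogonal /= exprMn enorm_sq -hB !sqdist_dot addrAC pyth.
Qed.

Lemma corner_pearl_far eps (eps0 : 0 < eps) (B : round R) :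
  radius B + 2 * (eps * enorm normal) < enorm (corner - center B) ->
  rsphere (corner_pearl eps0) `&` rsphere B = set0.
Proof.
move=> far; apply/seteqP; split => // z [].
have rB := radius_gt0 B; have rP : 0 < eps * enorm normal by rewrite mulr_gt0// normal_gt0.
rewrite /rsphere /= !sqdist_enorm => zP zB.
have {}zP : enorm (z - (corner + eps *: normal)) = eps * enorm normal.
  by apply/eqP; rewrite -(@eqrXn2 _ 2)// ?enorm_ge0 ?(ltW rP)// zP.
have {}zB : enorm (z - center B) = radius B.
  by apply/eqP; rewrite -(@eqrXn2 _ 2)// ?enorm_ge0 ?(ltW rB)// zB.
have : enorm (corner - center B) <= enorm (corner - (corner + eps *: normal)) +
    (enorm (- (z - (corner + eps *: normal))) + enorm (z - center B)).
  rewrite (_ : corner - center B = (corner - (corner + eps *: normal)) +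
    (- (z - (corner + eps *: normal)) + (z - center B))); last by apply/rowP => i; rewrite !mxE; ring.
  by rewrite (le_trans (enormD _ _))// lerD2l enormD.
have eN (x : E4) : enorm (- x) = enorm x by rewrite /enorm dotNl dotNr opprK.
rewrite eN zP zB (_ : corner - (_ + _) = - (eps *: normal)); last by rewrite opprD addrA subrr add0r.
rewrite eN enormZ gtr0_norm//; lra.
Qed.

End Corner.

Lemma uniform_margin (T : finType) (Q : pred T) (f : T -> R) : (forall t, Q t -> 0 < f t) ->
  exists2 d, 0 < d & forall t, Q t -> d < f t.
Proof.
move=> f0; suff [d d0 h] : exists2 d, 0 < d & forall t, t \in enum T -> Q t -> d < f t.
  by exists d => // t; apply: h; rewrite mem_enum.
elim: (enum T) => [|t l [d d0 IH]]; first by exists 1.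
have [Qt|Qt] := boolP (Q t); last first.
  by exists d => // u; rewrite inE => /orP[/eqP->|/IH//]; rewrite (negPf Qt).
have ft := f0 t Qt; exists (Num.min d (f t / 2)); first by rewrite lt_min d0 divr_gt0.
move=> u; rewrite inE => /orP[/eqP-> _|ul Qu]; rewrite gt_min; last by rewrite IH.
by apply/orP; right; lra.
Qed.

(** * Pearls at all corners between two copies *)

Section Pearls.
Variables (m : nat) (C : nat -> E4) (S : nat -> round R).
Let h k := C k 0 2.
Hypothesis S_center : forall k, center (S k) = C k.
Hypothesis S_radius : forall k, (0 < k <= m)%N -> 2 * radius (S k) ^+ 2 = h k ^+ 2.
Hypothesis flat3 : forall k, C k 0 3 = 0.
Hypothesis height : forall k, 0 <= h k.
Hypothesis high : forall k, (0 < k <= m)%N -> 0 < h k.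
Hypothesis orth : forall k, (k <= m)%N -> orthogonal (S k) (S k.+1).
Hypothesis disj : forall i j, (i.+1 < j)%N -> (j <= m.+1)%N ->
  radius (S i) + radius (S j) < enorm (C i - C j).
Hypothesis spread : forall k, (0 < k < m)%N ->
  0 < (C k.+1 0 0 - C k 0 0) ^+ 2 + (C k.+1 0 1 - C k 0 1) ^+ 2.
Let B (j : 'Z_6) k := rot_round (angle6 R j) (S k).

Let orth_heights k : (0 < k < m)%N -> 2 * sqdist (C k) (C k.+1) = h k ^+ 2 + h k.+1 ^+ 2.
Proof.
move=> /andP[k0 km]; have := orth (ltnW km); rewrite /orthogonal !S_center => ->.
by rewrite mulrDr !S_radius//= ?k0 ?km ?(ltnW km).
Qed.

(** Copies with index other than 0 and 1 are further away by [hexagon]. For r different from k and k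
    + 1, one of beads k, k + 1 is not consecutive to bead r, hence disjoint from it, and the corner
    lies on that bead. *)
Let corner_outside k j r : (0 < k < m)%N -> (r <= m.+1)%N ->
  ~ ((r = k \/ r = k.+1) /\ (j = 0 \/ j = 1)) ->
  radius (S r) < enorm (corner (C k) (C k.+1) - center (B j r)).
Proof.
move=> kI rm out; have /andP[k0 km] := kI; rewrite /= S_center.
have kI1 : (0 < k <= m)%N by rewrite k0 ltnW.
have kI2 : (0 < k.+1 <= m)%N by [].
have [e1 e2 e3] := corner_on (flat3 k) (flat3 k.+1) (high kI1) (high kI2) (orth_heights kI).
set p := corner _ _ in e1 e2 e3 *.
have on r' : r' = k \/ r' = k.+1 -> enorm (p - C r') = radius (S r').
  move=> rr; apply/eqP; rewrite -(@eqrXn2 _ 2) ?enorm_ge0 ?(ltW (radius_gt0 _))//.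
  by rewrite -sqdist_enorm; case: rr => ->; apply/eqP; have := S_radius kI1; have := S_radius kI2;
    rewrite /h; lra.
have p3 : 0 < p 0 3.
  by rewrite vec4E divr_gt0 ?mulr_gt0 ?sqrt3_gt0 ?addr_gt0// ?high.
have turned : enorm (p - C r) <= enorm (p - rot (angle6 R j) (C r)).
  rewrite -(@ler_pXn2r _ 2) ?nnegrE ?enorm_ge0// -!sqdist_enorm sqdist_rot_r ?flat3// lerDl.
  rewrite mulr_ge0 ?mulr_ge0 ?height// e3.
  have q0 := sqrt3_gt0; have q2 := sqrt3_sq.
  case: (hexagon j) => [[_ [-> ->]]|[_ [-> ->]]|[_ hj]]; [lra|lra|].
  have -> : s3 * p 0 3 - cos (angle6 R j) * (s3 * p 0 3) - sin (angle6 R j) * p 0 3 =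
    (s3 - (s3 * cos (angle6 R j) + sin (angle6 R j))) * p 0 3 by ring.
  by rewrite mulr_ge0 ?(ltW p3)// subr_ge0 ltW.
have [rr|rr] := pselect (r = k \/ r = k.+1).
  have hr : 0 < h r by case: rr => ->; exact: high.
  rewrite -(@ltr_pXn2r _ 2) ?nnegrE ?enorm_ge0 ?(ltW (radius_gt0 _))// -sqdist_enorm.
  rewrite sqdist_rot_r ?flat3// sqdist_enorm on// ltrDl mulr_gt0 ?mulr_gt0// e3.
  case: (hexagon j) => [[j0 _]|[j1 _]|[_ hj]]; [by case: out; split=> //; left|by case: out; split=> //; right|].
  have -> : s3 * p 0 3 - cos (angle6 R j) * (s3 * p 0 3) - sin (angle6 R j) * p 0 3 =
    (s3 - (s3 * cos (angle6 R j) + sin (angle6 R j))) * p 0 3 by ring.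
  by rewrite mulr_gt0// subr_gt0.
apply: lt_le_trans turned.
have eN (x y : E4) : enorm (x - y) = enorm (y - x).
  by rewrite -opprB /enorm dotNl dotNr opprK.
have far r' : r' = k \/ r' = k.+1 -> radius (S r') + radius (S r) < enorm (C r' - C r) ->
    radius (S r) < enorm (p - C r).
  move=> /on <-; have : enorm (C r' - C r) <= enorm (p - C r') + enorm (p - C r).
    have -> : C r' - C r = (C r' - p) + (p - C r) by rewrite addrA subrK.
    by rewrite [enorm (p - C r')]eN enormD.
  lra.
have [rk|rk] := ltnP r k.
  by apply: (far k.+1); [right|rewrite addrC eN; apply: disj => //; exact: ltnW].
apply: (far k); [by left|apply: disj => //].
rewrite ltn_neqAle; apply/andP; split; first by apply/eqP => e; apply: rr; right.
by rewrite ltn_neqAle rk andbT; apply/eqP => e; apply: rr; left.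
Qed.

Lemma corner_pearls k : (0 < k < m)%N -> exists Q : round R,
  [/\ exists2 p, rsphere (B 0 k) `&` rsphere (B 0 k.+1) `&` rsphere (B 1 k) `&`
         rsphere (B 1 k.+1) = [set p] & rsphere Q p,
     forall r (s : 'Z_6), r = k \/ r = k.+1 -> s = 0 \/ s = 1 -> orthogonal Q (B s r) &
     forall r (s : 'Z_6), (r <= m.+1)%N -> ~ ((r = k \/ r = k.+1) /\ (s = 0 \/ s = 1)) ->
       rsphere Q `&` rsphere (B s r) = set0].
Proof.
move=> kI; have /andP[k0 km] := kI.
have kI1 : (0 < k <= m)%N by rewrite k0 ltnW.
have kI2 : (0 < k.+1 <= m)%N by [].
have ho := orth_heights kI.
have [e1 e2 e3] := corner_on (flat3 k) (flat3 k.+1) (high kI1) (high kI2) ho.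
set p := corner (C k) (C k.+1) in e1 e2 e3.
have [d d0 dP] := @uniform_margin ('I_m.+2 * 'Z_6)%type
  (fun t => `[< ~ ((t.1 = k :> nat \/ t.1 = k.+1 :> nat) /\ (t.2 = 0 \/ t.2 = 1)) >])
  (fun t => enorm (p - center (B t.2 t.1)) - radius (S t.1)) (ltac:(
    by case=> r s /asboolP out; rewrite subr_gt0; apply: corner_outside => //; rewrite -ltnS)).
have n0 := normal_gt0 (spread kI); set n := enorm _ in n0.
(* Makes the diameter of the pearl, 2 eps times the norm of [normal], equal to the margin [d]. *)
have eps0 : 0 < d / (2 * n) by rewrite divr_gt0 ?mulr_gt0.
have b0 r : B 0 r = S r.
  by rewrite /B; case: (S r) => c q q0; rewrite /rot_round /= rot_angle6_0; congr Round; exact: Prop_irrelevance.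
exists (corner_pearl (spread kI) eps0); split.
- exists p; last exact: corner_pearl_through.
  have sph r c : center (S r) = c -> (0 < r <= m)%N ->
      forall z, rsphere (S r) z <-> 2 * sqdist z c = h r ^+ 2.
    move=> <- rI z; rewrite /rsphere /= -(S_radius rI); split=> [->//|]; lra.
  have sph1 r : (0 < r <= m)%N ->
      forall z, rsphere (B 1 r) z <-> 2 * sqdist z (rot (angle6 R 1) (C r)) = h r ^+ 2.
    move=> rI z; rewrite /rsphere /= S_center -(S_radius rI); split=> [->//|]; lra.
  rewrite !b0; apply/seteqP; split=> z.
    move=> [[[/(sph _ _ (S_center k) kI1) z1 /(sph _ _ (S_center k.+1) kI2) z2] /(sph1 _ kI1) z3] _].
    exact: (corner_unique (flat3 k) (flat3 k.+1) (high kI1) (high kI2) ho).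
  move=> ->; split; first split; first split.
  + by apply/(sph _ _ (S_center k) kI1).
  + by apply/(sph _ _ (S_center k.+1) kI2).
  + by apply/(sph1 _ kI1); rewrite on_turned.
  + by apply/(sph1 _ kI2); rewrite on_turned.
- move=> r s rr ss; have rI : (0 < r <= m)%N by case: rr => ->.
  apply: (corner_pearl_orth (flat3 k) (flat3 k.+1) (high kI1) (high kI2) ho _ _ (d := C r)).
  + by case: rr => ->; [left|right].
  + by rewrite /= S_radius.
  + by case: ss => ->; [left; rewrite b0 S_center|right; rewrite /= S_center].
- move=> r s rm out; apply: corner_pearl_far.
  have := dP (Ordinal (rm : (r < m.+2)%N), s); rewrite /= => /(_ (asboolT out)).
  have -> : 2 * (d / (2 * n) * n) = d by field; rewrite gt_eqF.
  by rewrite /= ltrBrDr addrC.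
Qed.

End Pearls.

End Sixfold.

(** * The necklace *)

Section Necklace.
Variables (R : realType) (m : nat).
Local Notation V := 'rV[R]_4.
Variables (C : nat -> V) (w : nat -> R) (eps : R).
Let v k : V := C k.+1 - C k.
Hypothesis eps_gt0 : 0 < eps.
Hypothesis eps_lt1 : eps < 1.
Hypothesis w_gt0 : forall k, 0 < w k.
Hypothesis w_ge : forall k, (k <= m.+1)%N -> 55 <= w k.
Hypothesis orth : forall k, (k <= m)%N -> 2 * sqdist (C k) (C k.+1) = w k ^+ 2 + w k.+1 ^+ 2.
Hypothesis disj : forall i j, (i.+1 < j)%N -> (j <= m.+1)%N ->
  (w i + w j) ^+ 2 < 2 * sqdist (C i) (C j).
Hypothesis margin : forall k j, (0 < k <= m)%N -> (j <= m.+1)%N -> k != j ->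
  w j ^+ 2 + 16 * w j + 32 < 2 * sqdist (C k) (C j).
Hypothesis slow : forall k, (k <= m)%N -> eps * `|v k| <= 1 / 4.
Hypothesis turn : forall k, (k < m)%N -> v k = v k.+1 \/
  0 < dot (v k.+1 - v k) (v k.+1 - v k) * dot (v k) (v k) - dot (v k) (v k.+1 - v k) ^+ 2.
Hypothesis flat3 : forall k, C k 0 3 = 0.
Hypothesis m_gt0 : (0 < m)%N.
Hypothesis bottom : C 0%N 0 2 = 0 /\ C m.+1 0 2 = 0.
Hypothesis upright : v 0%N = C 1%N 0 2 *: delta_mx 0 2 /\ v m = - C m 0 2 *: delta_mx 0 2.
Hypothesis height_w : forall k, (0 < k <= m)%N -> C k 0 2 = w k.
Hypothesis height : forall k, 0 <= C k 0 2.
Hypothesis ends_w : w 0%N = w 1%N /\ w m.+1 = w m.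
Hypothesis spread : forall k, (0 < k < m)%N ->
  0 < (C k.+1 0 0 - C k 0 0) ^+ 2 + (C k.+1 0 1 - C k 0 1) ^+ 2.

Let high k : (0 < k <= m)%N -> 55 <= C k 0 2.
Proof. by move=> kI; rewrite height_w// w_ge// leqW//; case/andP: kI. Qed.

Definition chain_arc : set V := hybrid m C eps 0 @` [set t | 0 <= t <= m.+1%:R].
Let A := chain_arc.
Let arc t := hybrid m C eps 0 (m.+1%:R * t).

Let mS0 : 0 < m.+1%:R :> R. Proof. by rewrite ltr0n. Qed.

Let time_itv (t : R) : 0 <= t <= 1 -> 0 <= m.+1%:R * t <= m.+1%:R.
Proof. by move=> /andP[t0 t1]; rewrite mulr_ge0 ?(ltW mS0)//= ler_piMr// ltW. Qed.

Let arc_image : arc @` `[0, 1] = A.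
Proof.
apply/seteqP; split=> [_ [t /= tI <-]|_ [t /= /andP[t0 t1] <-]].
  by exists (m.+1%:R * t) => //; apply: time_itv; rewrite in_itv in tI.
exists (t / m.+1%:R); last by rewrite /arc mulrC divfK// gt_eqF.
by rewrite /= in_itv /= divr_ge0 ?(ltW mS0)//= ler_pdivrMr// mul1r.
Qed.

Let arc_inj : {in `[0, 1]%R &, injective arc}.
Proof.
move=> s t; rewrite !in_itv /= => /time_itv sI /time_itv tI.
move/(hybrid_inj eps_gt0 eps_lt1 w_ge orth disj margin slow turn flat3 sI tI).
by apply: mulfI; rewrite gt_eqF.
Qed.

Let arc_ends : arc 0 = C 0%N /\ arc 1 = C m.+1.
Proof. by rewrite /arc mulr0 mulr1; exact: (hybrid_ends C eps_gt0 eps_lt1 m_gt0). Qed.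

Let smooth : smooth_arc A (C 0%N) (C m.+1).
Proof.
have [g [gE gs gd]] := arc_smooth eps_gt0 eps_lt1 w_ge orth turn m_gt0.
have e : g = arc by apply/funext => t; rewrite gE.
rewrite e in gs gd *; by exists arc.
Qed.

Let arc_cts : continuous arc.
Proof.
have [g [gE gs _]] := arc_smooth eps_gt0 eps_lt1 w_ge orth turn m_gt0.
have e : g = arc by apply/funext => t; rewrite gE.
by rewrite -e => t; apply: differentiable_continuous; apply/derivable1_diffP; exact: (gs 0%N).
Qed.

Let A_half : A `<=` @half_space3 R.
Proof.
move=> _ [t /= tI <-]; split; last exact: hybrid_flat.
have [e0 e1] := hybrid_ends C eps_gt0 eps_lt1 m_gt0.
have [->|t0] := eqVneq t 0; first by rewrite e0 height.
have [->|t1] := eqVneq t m.+1%:R; first by rewrite e1 height.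
have /andP[a b] := tI; apply: ltW.
apply: (hybrid_height eps_gt0 eps_lt1 w_ge orth disj margin slow turn flat3 m_gt0 bottom high).
by rewrite !lt_neqAle a b eq_sym t0 t1.
Qed.

Let ends_neq : C 0%N <> C m.+1.
Proof.
move=> e; have := disj (m_gt0 : (1 < m.+1)%N) (leqnn _); rewrite e sqdist_dot subrr dot0l mulr0.
by rewrite ltNge sqr_ge0.
Qed.

Lemma chain_half_space_arc : half_space_arc A (C 0%N) (C m.+1).
Proof.
have [e0 e1] := arc_ends; have [b0 b1] := bottom; split.
  by exists arc; split => //; exact: continuous_subspaceT.
split => //; apply/seteqP; split=> [_ [[t /= tI <-] [x2 _]]|x].
  have [h0 h1] := hybrid_ends C eps_gt0 eps_lt1 m_gt0.
  have [->|t0] := eqVneq t 0; first by left; rewrite h0.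
  have [->|t1] := eqVneq t m.+1%:R; first by right; rewrite h1.
  have /andP[a b] := tI.
  have tI' : 0 < t < m.+1%:R by rewrite !lt_neqAle a b eq_sym t0 t1.
  have := hybrid_height eps_gt0 eps_lt1 w_ge orth disj margin slow turn flat3 m_gt0 bottom high tI'.
  by rewrite x2 ltxx.
by case=> ->; split => //; rewrite -arc_image; [exists 0|exists 1] => //; rewrite /= in_itv /= ?lexx ?ler01.
Qed.

Let A_compact : compact A.
Proof.
rewrite -arc_image; apply: continuous_compact; last exact: segment_compact.
exact: continuous_subspaceT.
Qed.

Let radius_pos k : 0 < bead_radius w k.
Proof. by rewrite divr_gt0// sqrtr_gt0. Qed.

Definition pearl k : round R := Round (C k) (radius_pos k).
Local Notation S := pearl.

Let S_radius k : 2 * radius (S k) ^+ 2 = w k ^+ 2. Proof. exact: bead_radius_sq. Qed.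

Let in_S k (x : V) : (sqdist x (C k) <= radius (S k) ^+ 2) = (2 * sqdist x (C k) <= w k ^+ 2).
Proof. by rewrite -S_radius ler_pM2l. Qed.

Let Gamma : set V := polygon m C eps @` [set t | 0 <= t <= m.+1%:R].

(** [untwist] in the form used by the charts: a moved point is within 2 of some centre, so it stays
    strictly inside that bead and strictly outside all others; the extreme beads contain no moved
    point. *)
Let straighten : exists Psi Phi : V -> V,
  [/\ continuous Psi, continuous Phi, cancel Psi Phi & cancel Phi Psi] /\
  [/\ forall x, Psi x 0 3 = x 0 3, forall x, A x <-> Gamma (Psi x),
    forall k, (k <= m.+1)%N -> forall x, [\/ Psi x = x,
      sqdist x (C k) < radius (S k) ^+ 2 /\ sqdist (Psi x) (C k) < radius (S k) ^+ 2 |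
      radius (S k) ^+ 2 < sqdist x (C k) /\ radius (S k) ^+ 2 < sqdist (Psi x) (C k)] &
    forall k, k = 0%N \/ k = m.+1 -> forall x, sqdist x (C k) <= radius (S k) ^+ 2 -> Psi x = x].
Proof.
have [Psi [Phi [[Pc Fc PF FP] [Ph Pm P3]]]] :=
  untwist eps_gt0 eps_lt1 w_ge orth disj margin slow turn flat3 (leqnn m).
exists Psi, Phi; split => //; split => //.
- move=> x; split=> [[t tI <-]|[t tI e]]; first by exists t => //; rewrite Ph.
  by exists t => //; apply: (can_inj PF); rewrite Ph.
- move=> k km x; have [->|[l lI [n1 n2]]] := Pm x; first by constructor 1.
  have := bead_near w_ge margin lI km n1; have := bead_near w_ge margin lI km n2.
  by rewrite -S_radius !ltr_pM2l//; case: ifP => _ h1 h2; [constructor 2|constructor 3].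
- move=> k kk x; have [->//|[l lI [n1 _]]] := Pm x.
  have km : (k <= m.+1)%N by case: kk => ->.
  have := bead_near w_ge margin lI km n1; rewrite in_S leNgt.
  case: eqP => [kl|_ ->//]; move: lI; rewrite -kl.
  by case: kk => ->; rewrite ?ltnn ?andbF.
Qed.

Let edge_cover x : Gamma x -> exists2 k, (k <= m.+1)%N & sqdist x (C k) <= radius (S k) ^+ 2.
Proof.
move=> [t tI <-]; have [j [s [jm sI ->]]] := locate tI (ltn0Sn m); rewrite ltnS in jm.
rewrite polygon_edge//; have /andP[s0 s1] := sI.
have e0 : sqdist (C j + s *: v j) (C j) = s ^+ 2 * dot (v j) (v j).
  by rewrite sqdist_dot addrAC subrr add0r dotZl dotZr mulrA expr2.
have e1 : sqdist (C j + s *: v j) (C j.+1) = (1 - s) ^+ 2 * dot (v j) (v j).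
  rewrite sqdist_dot (_ : _ - _ = (s - 1) *: v j); last by apply/rowP => i; rewrite !mxE; ring.
  by rewrite dotZl dotZr; ring.
have vv : dot (v j) (v j) = radius (S j) ^+ 2 + radius (S j.+1) ^+ 2.
  have := orth jm; rewrite sqdistC sqdist_dot -/(v j); have := S_radius j; have := S_radius j.+1; lra.
have [h|h] := leP (s ^+ 2 * dot (v j) (v j)) (radius (S j) ^+ 2).
  by exists j; [exact: leqW|rewrite e0].
exists j.+1; first by rewrite ltnS.
rewrite e1; move: h; rewrite vv; have := radius_gt0 (S j); have := radius_gt0 (S j.+1).
move: (radius (S j)) (radius (S j.+1)) => a b b0 a0 h.
rewrite leNgt; apply/negP => h'.
have : 0 <= s * (1 - s) * (a ^+ 2 + b ^+ 2).
  by rewrite !mulr_ge0 ?subr_ge0 ?addr_ge0 ?sqr_ge0.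
lra.
Qed.

Let cover : A `<=` \bigcup_(i in [set i | (i <= m.+1)%N]) rball (S i).
Proof.
have [Psi [Phi [_ [_ AG loc _]]]] := straighten.
move=> x /AG /edge_cover [k km h]; exists k => //.
case: (loc k km x) => [<-//|[/ltW]//|[_]]; by rewrite ltNge h.
Qed.

Let Gamma_bead k (p : V) : (k <= m.+1)%N -> sqdist p (C k) <= radius (S k) ^+ 2 ->
  (Gamma p <-> exists2 s, 0 <= s <= radius (S k) & (k <= m)%N /\ p = C k + s *: outgoing C k \/
    (0 < k)%N /\ p = C k + s *: incoming C k).
Proof.
move=> km pk; rewrite -(polygon_bead eps_gt0 eps_lt1 w_ge orth disj p km).
by split=> [Gp|[]//]; split => //; rewrite -in_S.
Qed.

Let unknotted_end k : k = 0%N \/ k = m.+1 ->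
  unknotted_in R 3 1 (rball (S k) `&` @half_space3 R) (closure (A `&` interior (rball (S k)))).
Proof.
move=> kk; have [Psi [Phi [_ [_ AG _ fixed]]]] := straighten.
have [b0 b1] := bottom; have [u0 u1] := upright.
have km : (k <= m.+1)%N by case: kk => ->.
apply: end_unknotted3 => //; first by case: kk => /= ->.
have unit (h : R) : 0 < h -> (enorm (h *: delta_mx 0 2 : V))^-1 *: (h *: delta_mx 0 2) = delta_mx 0 2 :> V.
  move=> h0; have e1 : enorm (delta_mx 0 2 : V) = 1.
    by rewrite /enorm dot4 !mxE /= !mulr0 mulr1 !add0r addr0 sqrtr1.
  by rewrite enormZ e1 mulr1 gtr0_norm// scalerA mulVf ?scale1r// gt_eqF.
have h1 : 0 < C 1%N 0 2 by have := high (m_gt0 : (0 < 1 <= m)%N); lra.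
have hm : 0 < C m 0 2 by have := @high m; rewrite m_gt0 leqnn => /(_ isT); lra.
have out0 : outgoing C 0 = delta_mx 0 2 by rewrite /outgoing -/(v 0%N) u0 unit.
have inm : incoming C m.+1 = delta_mx 0 2.
  rewrite /incoming -/(v m) u1 scaleNr scaleNr -scalerN opprK.
  by rewrite (_ : enorm _ = enorm (C m 0 2 *: delta_mx 0 2 : V)) ?unit// /enorm dotNl dotNr opprK.
move=> x xk; rewrite AG (fixed k kk x xk) (Gamma_bead km xk); clear AG fixed xk km.
case: kk => ->; rewrite ?out0 ?inm; split=> -[s sI h]; exists s => //.
- by case: h => [[]//|[]//].
- by left.
- by case: h => [[]|[]//]; rewrite ltnn.
- by right.
Qed.

Let unknotted_mid k : (0 < k <= m)%N ->
  unknotted_in R 3 1 (rball (S k) `&` @half_space3 R) (closure (A `&` interior (rball (S k)))) /\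
  unknotted_in R 4 2 (rball (S k)) (rball (S k) `&` spin A).
Proof.
move=> kI; have /andP[k0 km] := kI; have km1 := leqW km.
have [Psi [Phi [[Pc Fc PF FP] [P3 AG loc _]]]] := straighten.
have Gb (p : V) : sqdist p (C k) <= radius (S k) ^+ 2 -> (Gamma p <-> exists2 s,
    0 <= s <= radius (S k) & p = C k + s *: outgoing C k \/ p = C k + s *: incoming C k).
  move=> pk; rewrite (Gamma_bead km1 pk); split=> -[s sI h]; exists s => //.
    by case: h => -[]; [left|right].
  by case: h; [left|right].
have kI1 : (0 < k <= m.+1)%N by rewrite k0.
have un1 := outgoing_unit w_ge orth km; have un2 := incoming_unit w_ge orth kI1.
have f1 : outgoing C k 0 3 = 0 by rewrite /outgoing !mxE !flat3 subrr mulr0.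
have f2 : incoming C k 0 3 = 0 by rewrite /incoming !mxE !flat3 subrr mulr0.
have mid : dot (2^-1 *: (outgoing C k + incoming C k)) (2^-1 *: (outgoing C k + incoming C k)) < 1.
  have o1 : dot (outgoing C k) (incoming C k) < 1.
    move: k0 km kI kI1 un1 un2 {km1 f1 f2 Gb}; case: k => // k _ km kI kI1 un1 un2.
    have [e|g] := turn km.
      have -> : incoming C k.+1 = - outgoing C k.+1.
        by rewrite /incoming /outgoing /= -/(v k) -/(v k.+1) e scaleNr.
      by rewrite dotNr un1; lra.
    (* The Gram determinant in [turn] makes the Cauchy-Schwarz inequality strict. *)
    have gram : dot (v k) (v k.+1) ^+ 2 < dot (v k) (v k) * dot (v k.+1) (v k.+1).
      move: g; clear; move: (v k) (v k.+1) => x y; rewrite !dotE [dot y x]dotC => g.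
      by rewrite -subr_gt0; apply: (lt_le_trans g); rewrite le_eqVlt; apply/orP; left; apply/eqP; ring.
    move: un1 un2 gram; rewrite /outgoing /incoming /= -/(v k) -/(v k.+1).
    have n0 := enorm_ge0 (v k); have n1 := enorm_ge0 (v k.+1); move: n0 n1.
    move: (v k) (v k.+1) => x y n0 n1; rewrite !dotE [dot y x]dotC -!enorm_sq => un1 un2 gram.
    move: un1 un2.
    move: (enorm x) (enorm y) (dot x y) n0 n1 gram => a b d a0 b0 gram e1 e2.
    have : (b^-1 * (- a^-1 * d)) ^+ 2 < 1.
      have -> : (b^-1 * (- a^-1 * d)) ^+ 2 = (b^-1 * a^-1) ^+ 2 * d ^+ 2 by ring.
      have q : 0 < (b^-1 * a^-1) ^+ 2.
        rewrite exprn_even_gt0//= mulf_neq0// invr_eq0.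
          by apply: contra_eq_neq e1 => ->; rewrite invr0 !mul0r eq_sym oner_eq0.
        by apply: contra_eq_neq e2 => ->; rewrite invr0 oppr0 !mul0r eq_sym oner_eq0.
      have -> : 1 = (b^-1 * a^-1) ^+ 2 * (a ^+ 2 * b ^+ 2).
        by rewrite -[1]mulr1 -{1}e1 -e2; ring.
      by rewrite ltr_pM2l.
    nra.
  move: un1 un2 o1; move: (outgoing C k) (incoming C k) => x y un1 un2 o1.
  by rewrite !dotE un1 un2 [dot y x]dotC; lra.
split.
  apply: (bead_unknotted3 (B := S k) Pc Fc PF FP P3 AG A_half A_compact (flat3 k) (loc k km1) Gb un1 un2 f1 f2 mid).
  rewrite /= height_w//; have := S_radius k; have := radius_pos k; have := w_gt0 k; rewrite /=.
  move: (bead_radius w k) (w k) => a b b0 a0 h; nra.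
apply: (bead_unknotted4 (B := S k) Pc PF FP P3 AG A_half (flat3 k) (loc k km1) Gb un1 un2 f1 f2 mid).
- by rewrite S_radius /= height_w.
- by rewrite /= height_w.
Qed.

Let S_orth k : (k <= m)%N -> orthogonal (S k) (S k.+1).
Proof. by move=> km; rewrite /orthogonal /=; have := orth km; have := S_radius k; have := S_radius k.+1; rewrite /=; lra. Qed.

Let S_disj i j : (i.+1 < j)%N -> (j <= m.+1)%N -> radius (S i) + radius (S j) < enorm (C i - C j).
Proof.
move=> ij jm; have ri := radius_gt0 (S i); have rj := radius_gt0 (S j).
rewrite -(@ltr_pXn2r _ 2) ?nnegrE ?enorm_ge0 ?addr_ge0 ?(ltW ri) ?(ltW rj)// -sqdist_enorm.
rewrite -(@ltr_pM2l _ 2)//; apply: le_lt_trans (disj ij jm).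
have s2 : Num.sqrt 2 ^+ 2 = 2 :> R by rewrite sqr_sqrtr.
have q0 : 0 < Num.sqrt 2 :> R by rewrite sqrtr_gt0.
rewrite /= /bead_radius -mulrDl expr_div_n s2 mulrC divfK//.
Qed.

Let semi : semi_pearl_necklace A (C 0%N) (C m.+1) m.+1 S.
Proof.
split; [by []|by []|exact: cover|exact: S_orth| |].
- move=> i j ij jm; apply/seteqP; split => // z [].
  rewrite /rball /= !sqdist_enorm.
  rewrite !ler_pXn2r ?nnegrE ?enorm_ge0 ?(ltW (radius_pos _))// => zi zj.
  have := S_disj ij jm; rewrite ltNge => /negP; apply.
  have -> : C i - C j = - (z - C i) + (z - C j) by apply/rowP => l; rewrite !mxE; ring.
  by rewrite (le_trans (enormD _ _))// lerD// /enorm dotNl dotNr opprK.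
- move=> i im; have [i0|i0] := eqVneq i 0%N; first by apply: unknotted_end; left.
  have [i1|i1] := eqVneq i m.+1; first by apply: unknotted_end; right.
  by case: (unknotted_mid (k := i)) => //; rewrite lt0n i0 -ltnS ltn_neqAle i1 im.
Qed.

Let contact : infinite_contact A (C 0%N) /\ infinite_contact A (C m.+1).
Proof.
exact: (hybrid_contact eps_gt0 eps_lt1 w_ge orth disj margin slow turn flat3 upright).
Qed.

Let rot_pole t k : k = 0%N \/ k = m.+1 -> rot t (C k) = C k.
Proof.
have [b0 b1] := bottom.
by case=> ->; apply: vec4_ext; rewrite !rotE// ?flat3 ?b0 ?b1; ring.
Qed.

Lemma pole_meeting (c c' : V) h : 0 <= h -> c 0 3 = 0 -> c 0 2 = 0 -> c' = c + h *: delta_mx 0 2 ->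
  exists q : V, [/\ 2 * sqdist q c = h ^+ 2, 2 * sqdist q c' = h ^+ 2 & q 0 2 = Num.sqrt 3 * q 0 3].
Proof.
move=> h0 c3 c2 ->.
(* h^2/6 + h^2/4 + h^2/12 = h^2/2 puts the point on both spheres, and its last two coordinates are
   in the direction pi/6. *)
exists (vec4 (c 0 0 + h / Num.sqrt 6) (c 0 1) (h / 2) (h / (2 * Num.sqrt 3))).
have q3 := @sqrt3_gt0 R; have s3 := @sqrt3_sq R.
have q6 : 0 < Num.sqrt 6 :> R by rewrite sqrtr_gt0.
have s6 : Num.sqrt 6 ^+ 2 = 6 :> R by rewrite sqr_sqrtr.
split; last by rewrite !vec4E; field; rewrite gt_eqF.
- rewrite sqdist4 !vec4E c3 c2 subrr !subr0 addrC.
  have -> : c 0 0 + h / Num.sqrt 6 - c 0 0 = h / Num.sqrt 6 by rewrite addrC addKr.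
  by rewrite !expr_div_n exprMn s6 s3; field.
- rewrite sqdist4 !vec4E !mxE /= c3 c2 !mulr0 !addr0 mulr1 add0r subrr subr0.
  have -> : c 0 0 + h / Num.sqrt 6 - c 0 0 = h / Num.sqrt 6 by rewrite addrC addKr.
  have -> : h / 2 - h = - (h / 2) by field.
  by rewrite sqrrN !expr_div_n exprMn s6 s3; field.
Qed.

Let shift i j (B : round R) (z : V) :
  rsphere (rot_round (angle6 R (i + j)) B) (rot (angle6 R i) z) <-> rsphere (rot_round (angle6 R j) B) z.
Proof. by rewrite /rsphere /= rot_angle6D sqdist_rot. Qed.

Let shift0 i (B : round R) (z : V) :
  rsphere (rot_round (angle6 R i) B) (rot (angle6 R i) z) <-> rsphere (rot_round (angle6 R 0) B) z.
Proof. by rewrite /rsphere /= rot_angle6_0 sqdist_rot. Qed.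

Let unrot i (z : V) : exists z', z = rot (angle6 R i) z'.
Proof. by exists (rot (- angle6 R i) z); rewrite -rot_angleD subrr rot_angle0. Qed.

Let meet k k' i : k = 0%N /\ k' = 1%N \/ k = m.+1 /\ k' = m ->
  rsphere (S k) `&` rsphere (rot_round (angle6 R i) (S k'))
      `&` rsphere (rot_round (angle6 R (i + 1)) (S k')) !=set0.
Proof.
move=> kk; have [b0 b1] := bottom; have [u0 u1] := upright; have [w0 w1] := ends_w.
have kI : (0 < k' <= m)%N by case: kk => -[_ ->]; rewrite ?m_gt0 ?leqnn.
have kE : C k' = C k + w k' *: delta_mx 0 2.
  rewrite -height_w//; case: kk => -[-> ->]; first by rewrite -u0 addrC subrK.
  by apply/eqP; rewrite addrC -subr_eq -opprB eqr_oppLR -scaleNr -u1.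
have wE : w k = w k' by case: kk => -[-> ->].
have k2 : C k 0 2 = 0 by case: kk => -[-> _].
have [q [qk qk' q3]] := pole_meeting (ltW (w_gt0 k')) (flat3 k) k2 kE.
exists (rot (angle6 R i) q); split; first split.
- rewrite /rsphere /= -(rot_pole (angle6 R i) (k := k)) ?sqdist_rot; last by case: kk => -[-> _]; [left|right].
  by have := S_radius k; rewrite wE /=; lra.
- by rewrite /rsphere /= sqdist_rot; have := S_radius k'; rewrite /=; lra.
- apply/shift; rewrite /rsphere /= (on_turned (flat3 k') q3).
  by have := S_radius k'; rewrite /=; lra.
Qed.

(** The corner pearls are constructed between copies 0 and 1, then turned to the other copies. The
    pearls at the poles are the extreme beads, which the rotations fix. *)
Theorem chain_necklace : knotted A (C 0%N) (C m.+1) ->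
  exists (S : nat -> round R) (S1 S2 : round R) (P : nat -> 'Z_6 -> round R),
    pearl_necklace A (C 0%N) (C m.+1) m S S1 S2 P.
Proof.
move=> kn; have [b0 b1] := bottom.
have high0 k : (0 < k <= m)%N -> 0 < C k 0 2 by move/high; lra.
have S_radius' k : (0 < k <= m)%N -> 2 * radius (S k) ^+ 2 = C k 0 2 ^+ 2.
  by move=> kI; rewrite S_radius height_w.
(* Outside the range [S 0] serves as default value, so that choice yields a total function. *)
have Qex k : exists Q, (0 < k < m)%N -> _ :=
  match boolP (0 < k < m)%N with
  | AltTrue h => let: ex_intro Q hQ := corner_pearls (fun k => erefl) S_radius' flat3 height high0 S_orth S_disj spread h in
     ex_intro _ Q (fun _ => hQ)
  | AltFalse h => ex_intro _ (S 0) (fun h' => False_ind _ (negP h h'))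
  end.
have /choice [Q QP] := Qex; clear Qex.
have out_shift k r (i s : 'Z_6) : ~ ((r = k \/ r = k.+1) /\ (s = i \/ s = i + 1)) ->
    ~ ((r = k \/ r = k.+1) /\ (s - i = 0 \/ s - i = 1)).
  move=> out [rr ss]; apply: out; split => //.
  by case: ss => /eqP; rewrite subr_eq => /eqP->; [left; rewrite add0r|right; rewrite addrC].
have disjoint k (i s : 'Z_6) r : (0 < k < m)%N -> (r <= m.+1)%N ->
    ~ ((r = k \/ r = k.+1) /\ (s = i \/ s = i + 1)) ->
    rsphere (rot_round (angle6 R i) (Q k)) `&` rsphere (rot_round (angle6 R s) (S r)) = set0.
  move=> kI rm /out_shift out; have [_ _ /(_ r _ rm out) h] := QP k kI.
  apply/seteqP; split => // z; have [z' ->] := unrot i z.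
  have -> : s = i + (s - i) by rewrite addrC subrK.
  move=> [/shift0 z1 /shift z2].
  have : set0 z' by rewrite -h; split => //; move: z1; rewrite /rsphere /= rot_angle6_0.
  by [].
exists S, (S 0), (S m.+1), (fun k i => rot_round (angle6 R i) (Q k)); split => //.
- exact: chain_half_space_arc.
- by case: contact.
- move=> k i kI; rewrite /orthogonal /= rot_angle6D sqdist_rot sqdist_rot_r ?flat3//.
  have [-> ->] := @angle6_1 R; rewrite sqdist_dot subrr dot0l height_w//.
  by have := S_radius k; rewrite /=; lra.
- move=> i; rewrite /orthogonal /= sqdist_rot_r ?flat3// b0.
  by have := S_orth (leq0n m); rewrite /orthogonal /= => <-; ring.
- move=> i; rewrite /orthogonal /= sqdist_rot_r ?flat3// b1 sqdistC.
  by have := S_orth (leqnn m); rewrite /orthogonal /= => ->; ring.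
- by move=> i; apply: meet; left.
- by move=> i; apply: meet; right.
- move=> k i kI; have [[p pE pQ] _ _] := QP k kI.
  exists (rot (angle6 R i) p); last by rewrite /rsphere /= sqdist_rot.
  apply/seteqP; split=> z; have [z' ->] := unrot i z.
    move=> [[[/shift0 z1 /shift0 z2] /shift z3] /shift z4].
    have zp : [set p] z' by rewrite -pE; split; [split; [split|]|].
    by rewrite zp.
  move=> /(congr1 (rot (- angle6 R i))); rewrite -!rot_angleD addNr !rot_angle0 => zp.
  have : [set p] z' by [].
  rewrite -pE => -[[[z1 z2] z3] z4].
  by split; [split; [split; apply/shift0|apply/shift]|apply/shift].
- move=> k i kI r s rr ss; have [_ o _] := QP k kI.
  have : orthogonal (Q k) (rot_round (angle6 R (s - i)) (S r)).
    by apply: o => //; case: ss => ->; [left; rewrite subrr|right; rewrite addrC addKr].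
  by rewrite /orthogonal /= -(sqdist_rot (angle6 R i)) -rot_angle6D [i + _]addrC subrK.
- by move=> k i kI r s /andP[_ rm] out; apply: disjoint => //; exact: leqW.
- move=> k i kI; have /andP[k0 km] := kI; split.
    have := @disjoint k i 0 0%N kI (leq0n _).
    rewrite {2}/rsphere /= rot_angle6_0; apply=> -[[e|e] _]; first by rewrite -e in k0.
    by [].
  have := @disjoint k i 0 m.+1 kI (leqnn _).
  rewrite {2}/rsphere /= rot_angle6_0; apply=> -[[e|e] _].
    by move: km; rewrite -e => /ltnW; rewrite ltnn.
  by case: e km => ->; rewrite ltnn.
- by move=> k i kI; apply: unknotted_rot => //; case: (unknotted_mid kI).
Qed.

End Necklace.

(** * The closed arc *)

Section Tilt.
Variables (R : realType) (mx my c : R).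
Local Notation V3 := 'rV[R]_3.
Local Notation E4 := 'rV[R]_4.

(** Equal to 1/2 up to height 0 and to 1 from height 55 on, affine in between; 55 is the height of
    the two vertical edges. *)
Definition taper (z : R) : R := 1 - Num.max 0 (Num.min 1 (1 - z / 55)) / 2.

Let taper_gt0 z : 0 < taper z.
Proof.
have : Num.max 0 (Num.min 1 (1 - z / 55)) <= 1 by rewrite ge_max ler01 ge_min lexx.
by rewrite /taper; lra.
Qed.

Let taper_low z : 0 <= z <= 55 -> taper z = (1 + z / 55) / 2.
Proof. by move=> /andP[z0 z1]; rewrite /taper min_r ?max_r; lra. Qed.

Let taper_high z : 55 <= z -> taper z = 1.
Proof. by move=> z1; rewrite /taper max_l ?mul0r ?subr0// ge_min; apply/orP; right; lra. Qed.

Let taper_cts : continuous taper.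
Proof.
apply: ctsI => z; apply: tendsB; first exact: cvg_cst.
apply: tendsM; last exact: cvg_cst.
apply: tendsmax; first exact: cvg_cst.
apply: tendsmin; first exact: cvg_cst.
by apply: tendsB; [exact: cvg_cst|apply: tendsM; [exact: cvg_id|exact: cvg_cst]].
Qed.

(* The levels below 55 contract towards a vertical axis, by the factor 1/2 at
   height 0, so that vertical segments become oblique. *)
Definition tilt (x : E4) : V3 :=
  vec3 (mx + (x 0 0 - mx) * taper (x 0 2) + c) (my + (x 0 1 - my) * taper (x 0 2)) (x 0 2).

Definition untilt (y : V3) : E4 :=
  vec4 (mx + (y 0 0 - c - mx) / taper (y 0 2)) (my + (y 0 1 - my) / taper (y 0 2)) (y 0 2) 0.

Lemma tilt_homeo (K : set E4) : pair_homeo (@space3 R) K [set: V3] (tilt @` K).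
Proof.
have tc n (i : 'I_n) (x : 'rV[R]_n) : (fun y : 'rV[R]_n => taper (y 0 i)) @ nbhs x --> taper (x 0 i).
  by apply: (cvg_comp (fun y : 'rV[R]_n => y 0 i) taper _ (@taper_cts _)); exact: tends_id.
exists tilt, untilt; split => //.
- apply: continuous_subspaceT; apply: ctsI => x; apply: tends_vec3; last exact: tends_id.
    apply: tendsD; last exact: cvg_cst.
    apply: tendsD; first exact: cvg_cst.
    by apply: tendsM; [apply: tendsB; [exact: tends_id|exact: cvg_cst]|exact: tc].
  apply: tendsD; first exact: cvg_cst.
  by apply: tendsM; [apply: tendsB; [exact: tends_id|exact: cvg_cst]|exact: tc].
- apply: continuous_subspaceT; apply: ctsI => y; apply: tends_vec4; [| |exact: tends_id|exact: cvg_cst].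
    apply: tendsD; first exact: cvg_cst.
    apply: tendsdiv; [by rewrite gt_eqF| |exact: tc].
    by apply: tendsB; [apply: tendsB; [exact: tends_id|exact: cvg_cst]|exact: cvg_cst].
  apply: tendsD; first exact: cvg_cst.
  apply: tendsdiv; [by rewrite gt_eqF| |exact: tc].
  by apply: tendsB; [exact: tends_id|exact: cvg_cst].
- apply/seteqP; split=> // y _; exists (untilt y); first by rewrite /space3 /= vec4E.
  have t0 := lt0r_neq0 (taper_gt0 (y 0 2)).
  apply: vec3_ext; rewrite !vec3E !vec4E//.
    by move: t0; move: (taper _) => t t0; field.
  by move: t0; move: (taper _) => t t0; field.
- move=> x x3; have t0 := lt0r_neq0 (taper_gt0 (x 0 2)).
  apply: vec4_ext; rewrite !vec4E ?vec3E//.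
    by move: t0; move: (taper _) => t t0; field.
  by move: t0; move: (taper _) => t t0; field.
Qed.

Lemma tilt_high (x : E4) : 55 <= x 0 2 -> tilt x = drop3 x + vec3 c 0 0.
Proof. by move=> h; apply: vec3_ext; rewrite !mxE /= ?taper_high//; ring. Qed.

Lemma tilt_upright (x : E4) (s : R) : x 0 2 = 0 -> 0 <= s <= 1 ->
  tilt (x + s *: (55 *: delta_mx 0 2)) =
  tilt x + s *: (drop3 (x + 55 *: delta_mx 0 2) + vec3 c 0 0 - tilt x).
Proof.
move=> x2 sI; have tx : taper (x 0 2) = 1 / 2 by rewrite x2 taper_low; [lra|rewrite lexx; lra].
have ts : taper (x 0 2 + s * 55) = (1 + s) / 2.
  by rewrite x2 add0r taper_low; [field|move: sI => /andP[]; lra].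
by apply: vec3_ext; rewrite !mxE /= ?mulr1 ?mulr0 ?addr0 ?ts ?tx ?x2; field.
Qed.

Lemma tilt_flat (x y : E4) (s : R) : x 0 2 = 0 -> y 0 2 = 0 ->
  tilt (x + s *: (y - x)) = tilt x + s *: (tilt y - tilt x).
Proof.
move=> x2 y2; have t0 : taper 0 = 1 / 2 by rewrite taper_low; [lra|rewrite lexx; lra].
by apply: vec3_ext; rewrite !mxE /= ?x2 ?y2 ?subr0 ?mulr0 ?addr0 ?t0; field.
Qed.

Lemma tilt_bottom (x : E4) : x 0 2 = 0 -> tilt x = vec3 ((x 0 0 + mx) / 2 + c) ((x 0 1 + my) / 2) 0.
Proof.
move=> x2; have t0 : taper 0 = 1 / 2 by rewrite taper_low; [lra|rewrite lexx; lra].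
by apply: vec3_ext; rewrite !vec3E ?x2 ?t0; field.
Qed.

End Tilt.

(** * The closed arc as a polygon *)

Section KnotType.
Variables (R : realType) (m : nat).
Local Notation V := 'rV[R]_4.
Local Notation V3 := 'rV[R]_3.

Lemma image_segm n k (f : 'rV[R]_n -> 'rV[R]_k) u v p q :
  (forall s, 0 <= s <= 1 -> f (u + s *: (v - u)) = p + s *: (q - p)) ->
  f @` segm u v = segm p q.
Proof.
move=> h; apply/seteqP; split=> [_ [_ [s sI <-] <-]|_ [s sI <-]].
  by exists s => //; rewrite h.
by exists (u + s *: (v - u)); [exists s|rewrite h].
Qed.

Lemma segm_sym n (u v : 'rV[R]_n) : segm u v = segm v u.
Proof.
suff h (x y : 'rV[R]_n) : segm x y `<=` segm y x by apply/seteqP; split; exact: h.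
move=> _ [s /andP[s0 s1] <-]; exists (1 - s); first by apply/andP; split; lra.
by apply/rowP => i; rewrite !mxE; ring.
Qed.

Variables (C : nat -> V) (w : nat -> R) (eps : R).
Let v k : V := C k.+1 - C k.
Hypothesis eps_gt0 : 0 < eps.
Hypothesis eps_lt1 : eps < 1.
Hypothesis w_ge : forall k, (k <= m.+1)%N -> 55 <= w k.
Hypothesis orth : forall k, (k <= m)%N -> 2 * sqdist (C k) (C k.+1) = w k ^+ 2 + w k.+1 ^+ 2.
Hypothesis disj : forall i j, (i.+1 < j)%N -> (j <= m.+1)%N ->
  (w i + w j) ^+ 2 < 2 * sqdist (C i) (C j).
Hypothesis margin : forall k j, (0 < k <= m)%N -> (j <= m.+1)%N -> k != j ->
  w j ^+ 2 + 16 * w j + 32 < 2 * sqdist (C k) (C j).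
Hypothesis slow : forall k, (k <= m)%N -> eps * `|v k| <= 1 / 4.
Hypothesis turn : forall k, (k < m)%N -> v k = v k.+1 \/
  0 < dot (v k.+1 - v k) (v k.+1 - v k) * dot (v k) (v k) - dot (v k) (v k.+1 - v k) ^+ 2.
Hypothesis flat3 : forall k, C k 0 3 = 0.
Hypothesis m_gt0 : (0 < m)%N.
Hypothesis bottom : C 0%N 0 2 = 0 /\ C m.+1 0 2 = 0.
Hypothesis high : forall k, (0 < k <= m)%N -> 55 <= C k 0 2.
Hypothesis upright : v 0%N = 55 *: delta_mx 0 2 /\ v m = - (55 *: delta_mx 0 2).
Variable c : R.
Let mx := (C 0%N 0 0 + C m.+1 0 0) / 2.
Let my := (C 0%N 0 1 + C m.+1 0 1) / 2.
Let T := tilt mx my c.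
Let tr (x : V) : V3 := drop3 x + vec3 c 0 0.

Let tilt_path (u : V) (s : seq V) : 55 <= u 0 2 -> (forall x : V, x \in s -> 55 <= x 0 2) ->
  T @` path_set u s = path_set (tr u) [seq tr x | x <- s].
Proof.
elim: s u => [|x s IH] u u55 s55 /=; first by rewrite image_set0.
have x55 : 55 <= x 0 2 by apply: s55; rewrite mem_head.
rewrite image_setU IH//; last by move=> y ys; apply: s55; rewrite inE ys orbT.
congr (_ `|` _); apply: image_segm => t /andP[t0 t1]; rewrite /T tilt_high.
  by apply: vec3_ext; rewrite !mxE /=; ring.
by rewrite !mxE; nra.
Qed.

(** [Psi] turns the arc into the polygon and fixes the closing segment, which is at height 0, far
    from the centres near which points move. [tilt] is affine along every edge: from height 55 on it
    is a translation, and on a vertical edge the horizontal position is constant while [taper] is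
    affine. *)
Lemma closed_chain_type : pair_homeo (@space3 R)
  (closed_up (chain_arc m C eps) (C 0%N) (C m.+1)) [set: V3]
  (path_set (tr (C 1%N)) ([seq tr (C i) | i <- iota 2 m.-1] ++
    [:: vec3 ((C 0%N 0 0 + 3 * C m.+1 0 0) / 4 + c) ((C 0%N 0 1 + 3 * C m.+1 0 1) / 4) 0;
        vec3 ((3 * C 0%N 0 0 + C m.+1 0 0) / 4 + c) ((3 * C 0%N 0 1 + C m.+1 0 1) / 4) 0;
        tr (C 1%N)])).
Proof.
have [Psi [Phi [[Pc Fc PF FP] [Ph Pm P3]]]] :=
  untwist eps_gt0 eps_lt1 w_ge orth disj margin slow turn flat3 (leqnn m).
have [b0 b1] := bottom; have [u0 u1] := upright.
apply: (pair_homeo_trans (Y := @space3 R) (B := Psi @` closed_up (chain_arc m C eps) (C 0%N) (C m.+1))).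
  exists Psi, Phi; split => //; [exact: continuous_subspaceT|exact: continuous_subspaceT|].
  apply/seteqP; split=> [_ [x x3 <-]|x x3]; first by rewrite /space3 /= P3.
  by exists (Phi x); rewrite ?FP// /space3 /= -P3 FP.
have -> : Psi @` closed_up (chain_arc m C eps) (C 0%N) (C m.+1) =
    (polygon m C eps @` [set t | 0 <= t <= m.+1%:R]) `|` segm (C m.+1) (C 0%N).
  rewrite /closed_up image_setU segm_sym; congr (_ `|` _).
    apply/seteqP; split=> [_ [_ [t tI <-] <-]|_ [t tI <-]].
      by exists t => //; rewrite Ph.
    by exists (hybrid m C eps 0 t); [exists t|rewrite Ph].
  have fixed x : segm (C 0%N) (C m.+1) x -> Psi x = x.
    move=> [t tI xE]; have [//|[k kI [xk _]]] := Pm x; exfalso.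
    have := le_trans (coord_le_norm (x - C k) 2) xk; rewrite -xE !mxE b0 b1 subrr mulr0 addr0 sub0r normrN.
    by move/(le_trans (ler_norm _)); have := high kI; lra.
  apply/seteqP; split=> [_ [x [t tI xE] <-]|x xs].
    by rewrite fixed; exists t => //; move: tI; rewrite /= in_itv.
  exists x; last exact: fixed.
  by case: xs => t tI xE; exists t => //; rewrite /= in_itv.
have := tilt_homeo mx my c ((polygon m C eps @` [set t | 0 <= t <= m.+1%:R]) `|` segm (C m.+1) (C 0%N)).
congr pair_homeo; rewrite -/T polygon_path// image_setU.
have h1 := @high 1%N; have hm := @high m; rewrite m_gt0 leqnn in hm h1; have {h1}h1 := h1 isT; have {hm}hm := hm isT.
have mE : m = m.-1.+1 by rewrite prednK.
have rc k : iota 2 k.+1 = iota 2 k ++ [:: k.+2] by rewrite -(addn1 k) iotaD addn1.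
have lastI : last 1%N (iota 2 m.-1) = m.
  by rewrite [RHS]mE; case: (m.-1) => // k; rewrite rc last_cat.
have lastE : last (C 1%N) [seq C i | i <- iota 2 m.-1] = C m by rewrite last_map lastI.
have -> : iota 1 m.+1 = 1%N :: (iota 2 m.-1 ++ [:: m.+1]).
  by rewrite [in LHS]mE -[iota 1 _]/(1%N :: iota 2 m.-1.+1) rc -mE.
rewrite map_cons map_cat /= path_set_cat lastE /= setU0 !image_setU tilt_path//; last first.
  by move=> x /mapP[k]; rewrite mem_iota => /andP[i2 im] ->; apply: high; rewrite (ltnW i2) /=;
    rewrite add2n -addn2 in im; move: im; rewrite {2}mE addn2 !ltnS.
have Tb : T (C 0%N) = vec3 ((3 * C 0%N 0 0 + C m.+1 0 0) / 4 + c) ((3 * C 0%N 0 1 + C m.+1 0 1) / 4) 0.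
  by rewrite /T tilt_bottom// /mx /my; congr vec3; field.
have Te : T (C m.+1) = vec3 ((C 0%N 0 0 + 3 * C m.+1 0 0) / 4 + c) ((C 0%N 0 1 + 3 * C m.+1 0 1) / 4) 0.
  by rewrite /T tilt_bottom// /mx /my; congr vec3; field.
have -> : T @` segm (C 0%N) (C 1%N) = segm (T (C 0%N)) (tr (C 1%N)).
  apply: image_segm => s sI; rewrite -/(v 0%N) u0 /T tilt_upright//.
  by rewrite -u0 /tr /v [C 0%N + _]addrC subrK.
have -> : T @` segm (C m) (C m.+1) = segm (tr (C m)) (T (C m.+1)).
  have e : C m = C m.+1 + 55 *: delta_mx 0 2 by rewrite -[_ *: _]opprK -u1 opprB addrC subrK.
  rewrite segm_sym [RHS]segm_sym; apply: image_segm => s sI.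
  by rewrite {1 2}e [_ + _ *: _ - _]addrC addKr /T tilt_upright// -e.
have -> : T @` segm (C m.+1) (C 0%N) = segm (T (C m.+1)) (T (C 0%N)).
  by apply: image_segm => s sI; rewrite /T tilt_flat.
rewrite path_set_cat -map_comp [last _ _](_ : _ = tr (C m)); last first.
  by rewrite (last_map (fun i => tr (C i))) lastI.
rewrite /= setU0 -Tb -Te /comp; apply/seteqP; split=> x /=; tauto.
Qed.

End KnotType.

(** * The integer data *)

Lemma norm_row_le (R : realType) n (x : 'rV[R]_n) d : 0 <= d ->
  (forall i, `|x 0 i| <= d) -> `|x| <= d.
Proof.
move=> d0 h; rewrite [leLHS]/Num.norm /= mx_normrE; apply: bigmax_le => // -[i j] _ /=.
by rewrite (ord1 i).
Qed.

Section Data.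
Variable R : realType.
Local Notation V := 'rV[R]_4.
Local Notation zr := (@zr R).

Definition chain_centers : seq (Z * Z * Z) :=
  (85, 0, 0)%Zb :: beads ++ [:: (-103, -89, 0)%Zb].
(** Weights are sqrt 2 times the radii. The two end beads have centres at height 0 but weight 55,
    which makes them orthogonal to their neighbours 55 above. *)
Definition chain_weights : seq Z := 55%Zb :: [seq b.2 | b <- beads] ++ [:: 55%Zb].

Let zc k : Z * Z * Z := nth (0, 0, 0)%Zb chain_centers k.
Let zx k : Z := (zc k).1.1.
Let zy k : Z := (zc k).1.2.
Let zz k : Z := (zc k).2.
(** The default 55 keeps every weight positive, as the radius of a bead must be. *)
Let zw k : Z := nth 55%Zb chain_weights k.
Let zd i j : Z := ((zx i - zx j) * (zx i - zx j) + (zy i - zy j) * (zy i - zy j) +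
  (zz i - zz j) * (zz i - zz j))%Zb.

Let C k : V := vec4 (zr (zx k)) (zr (zy k)) (zr (zz k)) 0.
Let w k : R := zr (zw k).
Let v k : V := C k.+1 - C k.
(** The coordinates of the edge vectors are at most 500 in absolute value, so [eps] times their sup
    norm is at most 1/4. *)
Let eps : R := 1 / 2000.

Let range (P : nat -> bool) p q : all P (iota p (q - p)) -> forall i, (p <= i < q)%N -> P i.
Proof. exact: all_range. Qed.

Let range2 (P : nat -> nat -> bool) (n : nat) : all (fun i => all (P i) (iota 0 n)) (iota 0 n) ->
  forall i j, (i < n)%N -> (j < n)%N -> P i j.
Proof.
move=> /allP h i j iN jN; have := h i; rewrite mem_iota iN => /(_ isT) /allP h2; apply: h2.
by rewrite mem_iota.
Qed.

Let distE i j : sqdist (C i) (C j) = zr (zd i j).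
Proof. by rewrite sqdist4 !vec4E subrr /zd !zrE; ring. Qed.

Let w_gt0 k : 0 < w k.
Proof.
have [k68|k68] := ltnP k 68; last by rewrite /w /zw nth_default//; exact: zr_gt0.
by apply: zr_gt0; apply: (@range (fun k => 0 <? zw k)%Zb 0%N 68%N)=> //; vm_compute.
Qed.

Let w_ge k : (k <= 67)%N -> 55 <= w k.
Proof.
move=> k67; have -> : 55 = zr 55 by [].
by apply: zr_le; apply: (@range (fun k => 55 <=? zw k)%Zb 0%N 68%N)=> //; vm_compute.
Qed.

Let orth k : (k <= 66)%N -> 2 * sqdist (C k) (C k.+1) = w k ^+ 2 + w k.+1 ^+ 2.
Proof.
move=> k66; rewrite distE (_ : 2 = zr 2)// /w !expr2 -!zrM -zrD; apply: zr_eq.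
by apply: (@range (fun k => 2 * zd k k.+1 =? zw k * zw k + zw k.+1 * zw k.+1)%Zb 0%N 67%N)=> //; vm_compute.
Qed.

Let disj i j : (i.+1 < j)%N -> (j <= 67)%N -> (w i + w j) ^+ 2 < 2 * sqdist (C i) (C j).
Proof.
move=> ij j67; have i68 : (i < 68)%N by rewrite (ltn_trans (ltnW ij)).
rewrite distE (_ : 2 = zr 2)// /w expr2 -!zrD -!zrM; apply: zr_lt.
have := @range2 (fun i j => (i.+1 < j)%N ==> ((zw i + zw j) * (zw i + zw j) <? 2 * zd i j)%Zb) 68.
by move=> /(_ (ltac:(by vm_compute)) i j i68 j67); rewrite ij.
Qed.

Let margin k j : (0 < k <= 66)%N -> (j <= 67)%N -> k != j ->
  w j ^+ 2 + 16 * w j + 32 < 2 * sqdist (C k) (C j).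
Proof.
move=> /andP[k0 k66] j67 kj; rewrite distE (_ : 2 = zr 2)// (_ : 16 = zr 16)// (_ : 32 = zr 32)//.
rewrite /w expr2 -!zrM -!zrD; apply: zr_lt.
have := @range2 (fun k j => ((0 < k)%N && (k != j)) ==> (zw j * zw j + 16 * zw j + 32 <? 2 * zd k j)%Zb) 68.
by move=> /(_ (ltac:(by vm_compute)) k j (leqW k66) j67); rewrite k0 kj.
Qed.

Let vE k : v k = vec4 (zr (zx k.+1 - zx k)) (zr (zy k.+1 - zy k)) (zr (zz k.+1 - zz k)) 0.
Proof. by apply: vec4_ext; rewrite mxE [X in _ + X]mxE !vec4E ?zrB// subrr. Qed.

Let slow k : (k <= 66)%N -> eps * `|v k| <= 1 / 4.
Proof.
move=> k66; suff : `|v k| <= 500 by rewrite /eps; lra.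
have bd (z : Z) : (- (500) <=? z)%Zb && (z <=? 500)%Zb -> `|zr z| <= 500.
  move=> /andP[z1 z2]; rewrite ler_norml; have := zr_le R z1; have := zr_le R z2.
  by rewrite (_ : zr 500 = 500)// (_ : zr (- (500)) = - 500)// => -> ->.
have h := @range (fun k => [&& (- (500) <=? zx k.+1 - zx k) && (zx k.+1 - zx k <=? 500),
  (- (500) <=? zy k.+1 - zy k) && (zy k.+1 - zy k <=? 500) &
  (- (500) <=? zz k.+1 - zz k) && (zz k.+1 - zz k <=? 500)])%Zb 0 67 (ltac:(by vm_compute)) k k66.
have /and3P[hx hy hz] := h.
have d0 : 0 <= 500 :> R := ler0n R 500.
apply: (norm_row_le d0) => j; rewrite vE; case: (ord4 j) => ->; rewrite vec4E.
- exact: bd hx.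
- exact: bd hy.
- exact: bd hz.
- by rewrite normr0.
Qed.

Let turn k : (k < 66)%N -> v k = v k.+1 \/
  0 < dot (v k.+1 - v k) (v k.+1 - v k) * dot (v k) (v k) - dot (v k) (v k.+1 - v k) ^+ 2.
Proof.
move=> k66.
pose a i := (zx i.+1 - zx i)%Zb; pose b i := (zy i.+1 - zy i)%Zb; pose c i := (zz i.+1 - zz i)%Zb.
pose da i := (a i.+1 - a i)%Zb; pose db i := (b i.+1 - b i)%Zb; pose dc i := (c i.+1 - c i)%Zb.
pose gram i := ((da i * da i + db i * db i + dc i * dc i) * (a i * a i + b i * b i + c i * c i) -
  (a i * da i + b i * db i + c i * dc i) * (a i * da i + b i * db i + c i * dc i))%Zb.
have : [&& a k =? a k.+1, b k =? b k.+1 & c k =? c k.+1]%Zb || (0 <? gram k)%Zb.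
  apply: (@range (fun k => [&& a k =? a k.+1, b k =? b k.+1 & c k =? c k.+1]%Zb || (0 <? gram k)%Zb) 0 66 _ k k66).
  by vm_compute.
case/orP=> [/and3P[/Z.eqb_eq ea /Z.eqb_eq eb /Z.eqb_eq ec]|/(zr_gt0 R) g].
  by left; rewrite !vE -/(a k) -/(a k.+1) -/(b k) -/(b k.+1) -/(c k) -/(c k.+1) ea eb ec.
right.
have fE : v k.+1 - v k = vec4 (zr (da k)) (zr (db k)) (zr (dc k)) 0.
  by apply: vec4_ext; rewrite mxE [X in _ + X]mxE !vE !vec4E ?(zrB R (_ - _)%Zb)// subrr.
rewrite fE !dot4 !vec4E vE !vec4E -/(a k) -/(b k) -/(c k) !mulr0 !addr0 expr2.
by rewrite -!zrM -!zrD -!zrM -zrB.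
Qed.

Let flat3 k : C k 0 3 = 0. Proof. by rewrite vec4E. Qed.

Let bottom : C 0%N 0 2 = 0 /\ C 67 0 2 = 0.
Proof. by rewrite !vec4E. Qed.

Let height_w k : (0 < k <= 66)%N -> C k 0 2 = w k.
Proof.
move=> kI; rewrite vec4E; apply: zr_eq.
by apply: (@range (fun k => zz k =? zw k)%Zb 1 67 (ltac:(by vm_compute)) k).
Qed.

Let height k : 0 <= C k 0 2.
Proof.
rewrite vec4E; apply: zr_ge0; have [k68|k68] := ltnP k 68; last by rewrite /zz /zc nth_default.
by apply: (@range (fun k => 0 <=? zz k)%Zb 0 68 (ltac:(by vm_compute)) k).
Qed.

Let upright : v 0%N = 55 *: delta_mx 0 2 /\ v 66 = - (55 *: delta_mx 0 2).
Proof.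
by split; rewrite vE; apply: vec4_ext; rewrite !vec4E !mxE /= ?mulr0 ?mulr1 ?oppr0.
Qed.

Let spread k : (0 < k < 66)%N ->
  0 < (C k.+1 0 0 - C k 0 0) ^+ 2 + (C k.+1 0 1 - C k 0 1) ^+ 2.
Proof.
move=> kI; rewrite !vec4E -!zrB !expr2 -!zrM -zrD; apply: zr_gt0.
by apply: (@range (fun k => 0 <? (zx k.+1 - zx k) * (zx k.+1 - zx k) +
  (zy k.+1 - zy k) * (zy k.+1 - zy k))%Zb 1 66 (ltac:(by vm_compute)) k).
Qed.

Let eps_gt0 : 0 < eps. Proof. by rewrite /eps; lra. Qed.
Let eps_lt1 : eps < 1. Proof. by rewrite /eps; lra. Qed.

Let high k : (0 < k <= 66)%N -> 55 <= C k 0 2.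
Proof. by move=> kI; rewrite height_w// w_ge//; case/andP: kI => _ /leqW. Qed.

Lemma data_knot_type : has_knot_type (closed_up (chain_arc 66 C eps) (C 0%N) (C 67)) (@standard_trefoil R).
Proof.
(* The translation by 200 is the one contained in [hbead]. *)
have := @closed_chain_type R 66 C w eps eps_gt0 eps_lt1 w_ge orth disj margin slow turn flat3 isT bottom high upright 200.
move/pair_homeo_trans; apply; have := tilted_trefoil R.
congr pair_homeo.
have trE k : (0 < k <= 66)%N -> drop3 (C k) + vec3 200 0 0 = pt R (hbead (bead k.-1)).
  case: k => // k kI; have e : zc k.+1 = bead k.
    by apply/eqP; apply: (@range (fun k => zc k.+1 == bead k) 0 66 (ltac:(by vm_compute)) k).
  rewrite /pt /hbead /hx /hy /hz /hw /C /zx /zy /zz e /= zr1 !divr1 zrD.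
  by apply: vec3_ext; rewrite !mxE /= ?addr0.
rewrite trE//; congr path_set; rewrite /tilted map_cat; congr (_ ++ _).
  have -> : behead beads = [seq bead i | i <- iota 1 65] by vm_compute.
  rewrite -!map_comp; rewrite (_ : iota 2 66.-1 = [seq i.+1 | i <- iota 1 65])// -map_comp.
  by apply/eq_in_map => i; rewrite mem_iota => /andP[i1 i2] /=; rewrite trE.
have z3 : zr 3 = 3 by []. have z4 : zr 4 = 4 by []. have z800 : zr 800 = 800 by [].
have x0 : zx 0 = (bead 0).1.1 by []. have x67 : zx 67 = (bead 65).1.1 by [].
have y0 : zy 0 = (bead 0).1.2 by []. have y67 : zy 67 = (bead 65).1.2 by [].
move: (bead 0) (bead 65) x0 x67 y0 y67 => b0 b65 x0 x67 y0 y67.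
congr [:: _; _; _]; rewrite /pt /hx /hy /hz /hw -![(_, _).1]/_ -![(_, _).2]/_.
- by apply: vec3_ext; rewrite !vec3E ?vec4E ?x0 ?x67 ?y0 ?y67 ?zrE ?z3 ?z4 ?z800; field.
- by apply: vec3_ext; rewrite !vec3E ?vec4E ?x0 ?x67 ?y0 ?y67 ?zrE ?z3 ?z4 ?z800; field.
Qed.

(** Two knot types for one set would compose to a homeomorphism of R^3 taking the trefoil to the
    round circle. *)
Lemma trefoil_type_knotted (K : set V) : K `<=` @space3 R ->
  has_knot_type K (@standard_trefoil R) -> ~ has_knot_type K (@round_circle R).
Proof.
move=> K3 /(pair_homeo_sym K3) h /(pair_homeo_trans h) [f [g [fc gc fT gf fK]]].
have cts (h' : 'rV[R]_3 -> 'rV[R]_3) : {within setT, continuous h'} -> continuous h'.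
  by move=> hc x; have := hc x; rewrite /continuous_at nbhs_subspaceT.
have {}gf : cancel f g by move=> x; exact: gf.
apply: (trefoil_nontrivial (cts _ fc) (cts _ gc) gf _ fK) => y.
have : setT y by []; rewrite -fT => -[x _ <-]; by rewrite gf.
Qed.

Lemma trefoil_pearl_necklace :
  exists (A : set 'rV[R]_4) (a b : 'rV[R]_4),
    trefoil_arc A a b /\
    exists (l : nat) (S : nat -> round R) (S1 S2 : round R)
           (P : nat -> 'Z_6 -> round R),
      pearl_necklace A a b l S S1 S2 P.
Proof.
have ends_w : w 0%N = w 1%N /\ w 67 = w 66 by [].
have h0 : C 1%N 0 2 = 55 by rewrite vec4E.
have h1 : C 66 0 2 = 55 by rewrite vec4E.
exists (chain_arc 66 C eps), (C 0%N), (C 67); split.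
  split; last exact: data_knot_type.
  exact: (chain_half_space_arc eps_gt0 eps_lt1 w_ge orth disj margin slow turn flat3 isT bottom height_w height).
exists 66.
apply: (chain_necklace eps_gt0 eps_lt1 w_gt0 w_ge orth disj margin slow turn flat3 isT bottom _ height_w height ends_w spread).
  by rewrite h0 h1 scaleNr; exact: upright.
apply: trefoil_type_knotted data_knot_type => x [].
  have [_ [_ _ _ Ah _]] := chain_half_space_arc eps_gt0 eps_lt1 w_ge orth disj margin slow turn flat3 isT bottom height_w height.
  by move=> /Ah[].
move=> [t _ <-]; move: (flat3 0) (flat3 67); move: (C 0%N) (C 67) => p q p3 q3.
by rewrite /space3 /= !mxE p3 q3 subrr mulr0 addr0.
Qed.

End Data.

Theorem theorem3p6 (R : realType) :
  exists (A : set 'rV[R]_4) (a b : 'rV[R]_4),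
    trefoil_arc A a b /\
    exists (l : nat) (S : nat -> round R) (S1 S2 : round R)
           (P : nat -> 'Z_6 -> round R),
      pearl_necklace A a b l S S1 S2 P.
Proof. exact: trefoil_pearl_necklace. Qed.
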